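(* Under the following setting and assumptions: $f_\oplus$ is a probability density on $\mathbb{R}$ with finite second moment, support $D_\oplus$ an interval, cdf $F_\oplus$, and tangent space $\mathcal{T}_{f_\oplus}$; $\beta_1,\dots,\beta_p\in\mathbb{R}$; $\epsilon_t\in\mathcal{T}_{f_\oplus}$ i.i.d. with covariance kernel $C_\epsilon$; (A1') $\phi(z)=1-\beta_1z-\dots-\beta_pz^p$ has no root in $\{|z|\le1\}$, $1/\phi(z)=\sum_{i\ge0}\psi_iz^i$, $\psi_i=0$ for $i<0$; (A2) $\mathbb{E}\epsilon_t(u)=0$ for $u\in D_\oplus$ and $\int C_\epsilon(u,u)f_\oplus(u)du<\infty$; (A3) $V_t=\sum_{i\ge0}\psi_i\epsilon_{t-i}$ is a.s. differentiable with $V_t'(u)>-1$ on $D_\oplus$; (A4) $\int\mathbb{E}[\epsilon_t^4(u)]f_\oplus(u)du<\infty$; $f_t$ is the density of $\operatorname{Exp}_{f_\oplus}(V_t)$ with quantile function $Q_t$, and $T_t=Q_t\circ F_\oplus$. Define $\eta_h(u)=\operatorname{Cov}(T_t(u),T_{t+h}(u))$, $\rho_h=\int\eta_h f_\oplus\,du/\int\eta_0f_\oplus\,du$, and from observations $f_1,\dots,f_n$: $\widehat F_\oplus=(n^{-1}\sum_{t=1}^nQ_t)^{-1}$, $\hat f_\oplus=\widehat F_\oplus'$, $\widehat T_t=Q_t\circ\widehat F_\oplus$, $\hat\eta_h(u)=n^{-1}\sum_{t=1}^{n-h}\{\widehat T_t(u)-u\}\{\widehat T_{t+h}(u)-u\}$,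 $\hat\rho_i=\int\hat\eta_i\hat f_\oplus\,du/\int\hat\eta_0\hat f_\oplus\,du$. Let $\boldsymbol\varrho_h=(\rho_1,\dots,\rho_h)^\top$, $\hat{\boldsymbol\varrho}_h=(\hat\rho_1,\dots,\hat\rho_h)^\top$. Then $$n^{1/2}(\hat{\boldsymbol\varrho}_h-\boldsymbol\varrho_h)\xrightarrow{D}N(0,\mathbf{D}\mathbf{V}\mathbf{D}^\top),$$ where $\mathbf{D}$ is the $h\times(h+1)$ matrix $\frac{1}{\int\eta_0(u)f_\oplus(u)du}\,[\,-\boldsymbol\varrho_h\ \ I_h\,]$ (first column $-(\rho_1,\dots,\rho_h)^\top$, followed by the $h\times h$ identity), and $\mathbf{V}=(v_{ij})_{i,j=0}^h$ with $$v_{ij}=\sum_{r=-\infty}^{\infty}\big(S_1(r)K_2+S_2(r)K_1+S_3(r)K_1\big),$$ $S_1(r)=\sum_k\psi_k\psi_{k+i}\psi_{k+r}\psi_{k+r+j}$, $S_2(r)=\sum_k\psi_k\psi_{k+r}\sum_l\psi_l\psi_{l+r+j-i}$, $S_3(r)=\sum_k\psi_k\psi_{k+r+j}\sum_l\psi_l\psi_{l+r-i}$, $K_1=\int_{\mathbb{R}^2}C_\epsilon^2(u,v)f_\oplus(u)f_\oplus(v)du\,dv$, $K_2=\int_{\mathbb{R}^2}\{\mathbb{E}[\epsilon_t^2(u)\epsilon_t^2(v)]-2C_\epsilon^2(u,v)-C_\epsilon(u,u)C_\epsilon(v,v)\}f_\oplus(u)f_\oplus(v)du\,dv$ (sums over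 all integers).
   Context: $C_\epsilon(u,v)=\operatorname{Cov}(\epsilon_t(u),\epsilon_t(v))$. $\mathcal{W}_2$: Borel probability measures on $\mathbb{R}$ with finite second moment; the tangent space $\mathcal{T}_\mu$ at $\mu\in\mathcal{W}_2$ is the closure in $L^2(\mathbb{R},d\mu)$ of $\{\lambda(T-\mathrm{id}):T$ the optimal transport map from $\mu$ to some $\nu\in\mathcal{W}_2,\lambda>0\}$. $\operatorname{Exp}_f(V)=(V+\mathrm{id})_\#\mu_f$, the pushforward of the measure with density $f$. $v_{ij}$ equals $\lim_{n\to\infty}n\operatorname{Cov}(\int_0^1\lambda_i^*(s)ds,\int_0^1\lambda_j^*(s)ds)$ with $\lambda_h^*(s)=n^{-1}\sum_{t=1}^n(Q_t(s)-Q_\oplus(s))(Q_{t+h}(s)-Q_\oplus(s))$, $Q_\oplus=F_\oplus^{-1}$. *)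

(* Defs.v *)
From HB Require Import structures.
From mathcomp Require Import all_boot all_order all_algebra.
From mathcomp Require Import all_classical all_reals all_analysis.
From mathcomp Require Import complex.

Set Implicit Arguments.
Unset Strict Implicit.
Unset Printing Implicit Defensive.

Import Order.TTheory GRing.Theory Num.Theory.
Import numFieldNormedType.Exports.
Local Open Scope classical_set_scope.
Local Open Scope ring_scope.

Section WassersteinAR.
Variable R : realType.

Local Notation leb := (@lebesgue_measure R).

Definition LInt (g : R -> R) : R := fine (\int[leb]_(u in setT) (g u)%:E)%E.

Definition Ex {d} {O : measurableType d} (P : probability O R) (X : O -> R) : R :=
  fine (\int[P]_w (X w)%:E)%E.

Definition Cov {d} {O : measurableType d} (P : probability O R) (X Y : O -> R) : R :=
  Ex P (fun w => X w * Y w) - Ex P X * Ex P Y.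

Definition is_density (f : R -> R) : Prop :=
  measurable_fun setT f /\ (forall u, 0 <= f u) /\
  (\int[leb]_(u in setT) (f u)%:E = 1)%E.

Definition finite_second_moment (f : R -> R) : Prop :=
  (\int[leb]_(u in setT) ((u ^+ 2 * f u)%:E) < +oo)%E.

Definition dens_support (f : R -> R) : set R := closure [set u | 0 < f u].

Definition cdf_of (f : R -> R) (x : R) : R :=
  fine (\int[leb]_(u in [set u : R | (u <= x)%R]) (f u)%:E)%E.

Definition quantile_of (f : R -> R) (s : R) : R :=
  inf [set x | s <= cdf_of f x].

Definition in_W2 (nu : probability R R) : Prop :=
  (\int[nu]_x ((x ^+ 2)%:E) < +oo)%E.

Definition pushes (f : R -> R) (T : R -> R) (nu : probability R R) : Prop :=
  measurable_fun setT T /\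
  forall A : set R, measurable A ->
    (\int[leb]_(u in T @^-1` A) (f u)%:E = nu A)%E.

Definition opt_map (f : R -> R) (T : R -> R) (nu : probability R R) : Prop :=
  pushes f T nu /\
  forall S : R -> R, pushes f S nu ->
    (\int[leb]_(u in setT) (((T u - u) ^+ 2 * f u)%:E)
      <= \int[leb]_(u in setT) (((S u - u) ^+ 2 * f u)%:E))%E.

(* v belongs to the tangent space T_{mu_f}: the L^2(f du)-closure of
   { lam (T - id) : T optimal map from mu_f to some nu in W2, lam > 0 } *)
Definition in_tangent (f : R -> R) (v : R -> R) : Prop :=
  measurable_fun setT v /\
  (\int[leb]_(u in setT) (((v u) ^+ 2 * f u)%:E) < +oo)%E /\
  forall e : R, 0 < e ->
    exists (nu : probability R R) (T : R -> R) (lam : R),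
      [/\ in_W2 nu, opt_map f T nu, 0 < lam &
        (\int[leb]_(u in setT) (((v u - lam * (T u - u)) ^+ 2 * f u)%:E)
          < e%:E)%E].

Definition exp_density (f V g : R -> R) : Prop :=
  is_density g /\
  forall A : set R, measurable A ->
    (\int[leb]_(u in A) (g u)%:E =
     \int[leb]_(u in (fun x => (V x + x)%R) @^-1` A) (f u)%:E)%E.

Definition ar_poly (p : nat) (beta : nat -> R) : {poly R[i]} :=
  \poly_(k < p.+1) (if k == 0%N then 1 else - ((beta k)%:C)%C).

Definition ar_coef (p : nat) (beta : nat -> R) (k : nat) : R :=
  if k == 0%N then 1 else if (k <= p)%N then - beta k else 0.

(* psi is the coefficient sequence of the power series 1/phi:
   (phi * sum_i psi_i z^i) = 1 as formal power series *)
Definition is_inv_series (p : nat) (beta : nat -> R) (psi : nat -> R) : Prop :=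
  forall n : nat,
    \sum_(k < n.+1) ar_coef p beta k * psi (n - k)%N = (n == 0%N)%:R.

Definition psiZ (psi : nat -> R) (i : int) : R :=
  match i with Posz n => psi n | Negz _ => 0 end.

Definition zsum (a : int -> R) : R :=
  limn (fun N : nat => \sum_(k < (2 * N).+1) a (k%:Z - N%:Z)).

Section Proc.
Context {d : measure_display} {O : measurableType d} (P : probability O R).

Definition fdd_event (X : O -> R -> R) (us : seq (R * set R)) : set O :=
  [set w | forall j, (j < size us)%N ->
     (nth (0, setT) us j).2 (X w (nth (0, setT) us j).1)].

Definition meas_list (us : seq (R * set R)) : Prop :=
  forall j, measurable (nth (0, setT) us j).2.

(* eps_t, t in Z, are i.i.d. random functions (independence and equality in
   law of all finite-dimensional distributions) *)
Definition iid_proc (eps : int -> O -> R -> R) : Prop :=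
  [/\ (forall t u, measurable_fun setT (fun w => eps t w u)),
      (forall (ts : seq int) (E : int -> seq (R * set R)),
         uniq ts -> (forall t, meas_list (E t)) ->
         fine (P [set w | forall t, t \in ts -> fdd_event (eps t) (E t) w]) =
         \prod_(t <- ts) fine (P (fdd_event (eps t) (E t))))
    & (forall (t s : int) (us : seq (R * set R)), meas_list us ->
         P (fdd_event (eps t) us) = P (fdd_event (eps s) us))].

End Proc.

(* Y ~ N(0, S) on R^h (possibly degenerate), via its characteristic function *)
Definition is_gauss_vec {d'} {O' : measurableType d'} (P' : probability O' R)
    (h : nat) (Y : O' -> 'cV[R]_h) (S : 'M[R]_h) : Prop :=
  (forall i, measurable_fun setT (fun w => Y w i 0)) /\
  forall a : 'cV[R]_h,
    Ex P' (fun w => cos ((a^T *m Y w) 0 0)) = expR (- ((a^T *m S *m a) 0 0 / 2)) /\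
    Ex P' (fun w => sin ((a^T *m Y w) 0 0)) = 0.

Definition conv_dist_gauss {d} {O : measurableType d} (P : probability O R)
    (h : nat) (X : nat -> O -> 'cV[R]_h) (S : 'M[R]_h) : Prop :=
  exists (d' : measure_display) (O' : measurableType d')
         (P' : probability O' R) (Y : O' -> 'cV[R]_h),
    is_gauss_vec P' Y S /\
    forall g : 'cV[R]_h -> R, continuous g -> (exists M : R, forall x, `|g x| <= M) ->
      (fun n => Ex P (fun w => g (X n w))) @ \oo --> Ex P' (fun w => g (Y w)).


Section Model.
Context {d : measure_display} {O : measurableType d} (P : probability O R).

Definition Ceps (eps0 : O -> R -> R) (u v : R) : R :=
  Cov P (fun w => eps0 w u) (fun w => eps0 w v).

Definition Tmap (f0 ft : R -> R) (u : R) : R := quantile_of ft (cdf_of f0 u).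

Definition etaC (f0 : R -> R) (f : int -> O -> R -> R) (h : nat) (u : R) : R :=
  Cov P (fun w => Tmap f0 (f 0 w) u) (fun w => Tmap f0 (f h%:Z w) u).

Definition rho (f0 : R -> R) (f : int -> O -> R -> R) (h : nat) : R :=
  LInt (fun u => etaC f0 f h u * f0 u) / LInt (fun u => etaC f0 f 0 u * f0 u).

Definition Qbar (f : int -> O -> R -> R) (n : nat) (w : O) (s : R) : R :=
  n%:R^-1 * \sum_(1 <= t < n.+1) quantile_of (f t%:Z w) s.

(* hat F_oplus = (Qbar)^{-1} (generalized inverse of the quantile function) *)
Definition Fhat (f : int -> O -> R -> R) (n : nat) (w : O) (x : R) : R :=
  sup [set s : R | (0 < s < 1) /\ Qbar f n w s <= x].

Definition fhat (f : int -> O -> R -> R) (n : nat) (w : O) : R -> R :=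
  derive1 (Fhat f n w).

Definition That (f : int -> O -> R -> R) (n : nat) (w : O) (t : nat) (u : R) : R :=
  quantile_of (f t%:Z w) (Fhat f n w u).

Definition etahat (f : int -> O -> R -> R) (n : nat) (w : O) (h : nat) (u : R) : R :=
  n%:R^-1 * \sum_(1 <= t < (n - h).+1)
     ((That f n w t u - u) * (That f n w (t + h) u - u)).

Definition rhohat (f : int -> O -> R -> R) (n : nat) (w : O) (i : nat) : R :=
  LInt (fun u => etahat f n w i u * fhat f n w u) /
  LInt (fun u => etahat f n w 0 u * fhat f n w u).


Definition weighted_moment (f0 : R -> R) (eps0 : O -> R -> R) (k : nat) : \bar R :=
  (\int[leb]_(u in setT)
      ((\int[P]_w ((eps0 w u) ^+ k)%:E) * (f0 u)%:E))%E.

Definition K1 (f0 : R -> R) (eps0 : O -> R -> R) : R :=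
  fine (\int[(leb \x leb)%E]_(z in setT)
          (((Ceps eps0 z.1 z.2) ^+ 2 * f0 z.1 * f0 z.2)%:E))%E.

Definition K2 (f0 : R -> R) (eps0 : O -> R -> R) : R :=
  fine (\int[(leb \x leb)%E]_(z in setT)
          (((Ex P (fun w => (eps0 w z.1) ^+ 2 * (eps0 w z.2) ^+ 2)
             - 2 * (Ceps eps0 z.1 z.2) ^+ 2
             - Ceps eps0 z.1 z.1 * Ceps eps0 z.2 z.2) * f0 z.1 * f0 z.2)%:E))%E.

End Model.

Section Vmat.
Variable psi : nat -> R.
Local Notation ps := (psiZ psi).

Definition S1 (i j : nat) (r : int) : R :=
  zsum (fun k => ps k * ps (k + i%:Z) * ps (k + r) * ps (k + r + j%:Z)).
Definition S2 (i j : nat) (r : int) : R :=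
  zsum (fun k => ps k * ps (k + r)) *
  zsum (fun l => ps l * ps (l + r + j%:Z - i%:Z)).
Definition S3 (i j : nat) (r : int) : R :=
  zsum (fun k => ps k * ps (k + r + j%:Z)) *
  zsum (fun l => ps l * ps (l + r - i%:Z)).

Definition Vmat (h : nat) (k1 k2 : R) : 'M[R]_(h.+1) :=
  \matrix_(i < h.+1, j < h.+1)
    zsum (fun r => S1 i j r * k2 + S2 i j r * k1 + S3 i j r * k1).
End Vmat.

(* D = (1 / int eta_0 f) [ -varrho_h  I_h ], with varrho_h = (rho_1,...,rho_h) *)
Definition Dmat (h : nat) (rh : nat -> R) (c : R) : 'M[R]_(h, h.+1) :=
  \matrix_(i < h, j < h.+1)
    ((if j == 0 :> nat then - rh i.+1
      else if j == i.+1 :> nat then 1 else 0) / c).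

End WassersteinAR.

(* Main.v *)
(* Let [mu] be the law with density [f0] and [Q0] its quantile function.  On a full event every [V_t + id] is increasing on the
   support, so [Q_t = (V_t + id) o Q0].  Since the increments of [Q_1] are at most [n] times those of the average quantile function
   [Qbar], the image of the uniform law under [Qbar] is absolutely continuous, [fhat] is its density, and the estimated
   autocovariance is [1/n sum_t int (V_t - Vbar) (V_(t+i) - Vbar) dmu].  Up to an L1 error small compared with [sqrt n], its
   deviation from [gam RZ i] ([gam = E int eps^2 dmu], [RZ] the autocorrelation of [psi]) is a linear combination of the products
   [Y_(s,r) = int eps_s eps_r dmu - (s == r) gam], which are uncorrelated.  Truncating [psi] leaves an m-dependent stationary sum,
   treated by blocks and characteristic functions; its variance tends to the quadratic form of [V].  A ratio argument then gives
   the limit of the autocorrelations.  When [gam = 0] everything vanishes almost surely, in accordance with [x / 0 = 0].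

   The [eps_t] are only assumed measurable at each fixed point, while the integrals above need joint measurability: [ecan] and
   [vcan] are jointly measurable versions, obtained as limits along a grid and identified with [phi(B) V_t] and [V_t] thanks to
   the differentiability of [V_t].  No measurability of [rhohat] is needed, because [Eint] only depends on almost everywhere
   equality. *)
Require Import Defs.
From HB Require Import structures.
From mathcomp Require Import all_boot all_order all_algebra.
From mathcomp Require Import all_classical all_reals all_analysis.
From mathcomp Require Import complex.
From mathcomp Require Import measurable_realfun ring lra zify.
Import Order.TTheory GRing.Theory Num.Theory.
Import numFieldNormedType.Exports.
Local Open Scope classical_set_scope.
Local Open Scope ring_scope.
Set Implicit Arguments.
Unset Strict Implicit.
Unset Printing Implicit Defensive.

(** * Expectations and square-integrable functions *)

(** All errors are measured in L1: sine and cosine are bounded and 1-Lipschitz, so an L1 error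
    passes to characteristic functions, while the autocorrelations, being ratios, may have no
    moments and are seen through such bounded functions only. The obstacle is the order of limits.
    Truncating each [V_t] separately costs [n] times the tail of [psi], too much after division by
    [sqrt n]; the affordable cost, [sqrt n] times the tail, comes from the orthogonality of the
    products [Y], whose variances are finite by (A4). So the sum is compared with a very long
    truncation, whose error is of order [n] but vanishes with its length for fixed [n], and the long
    truncation with the short one by orthogonality. Subtracting the sample mean costs a bounded
    amount after multiplication by [n], since sums of [V_t] have norm of order [sqrt n]. Convergence
    in law rests on trigonometric polynomials that are close to the test function on a box and obey
    its bound everywhere, so that tightness controls the rest. *)

Section RealIntegral.
Context {R : realType} {d : measure_display} {T : measurableType d}.
Implicit Types (m : {measure set T -> \bar R}) (f g : T -> R).

(** An infinite integral gets the default value 0, hence the [intg] hypotheses in the rules of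
    calculation below. *)
Definition Eint m (f : T -> R) : R := \int[m]_x f x.

Definition intg m (f : T -> R) : Prop := m.-integrable setT (EFin \o f).

Definition L2 m (f : T -> R) : Prop :=
  measurable_fun setT f /\ intg m (fun x => f x ^+ 2).

Lemma intgmf m f : intg m f -> measurable_fun setT f.
Proof. by move=> /measurable_int/measurable_EFinP. Qed.

Lemma intg_fin m f : intg m f -> (\int[m]_x (f x)%:E = (Eint m f)%:E)%E.
Proof.
by move=> fi; rewrite /Eint /Rintegral fineK//; exact: integrable_fin_num.
Qed.

Lemma intgD m f g : intg m f -> intg m g -> intg m (fun x => f x + g x).
Proof.
move=> fi gi; have := integrableD measurableT fi gi.
by apply: eq_integrable => // x _ /=; rewrite EFinD.
Qed.

Lemma intgZ m c f : intg m f -> intg m (fun x => c * f x).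
Proof.
move=> fi; have := integrableZl measurableT c fi.
by apply: eq_integrable => // x _ /=; rewrite EFinM.
Qed.

Lemma intgN m f : intg m f -> intg m (fun x => - f x).
Proof.
by move=> /(intgZ (-1)); rewrite /intg; apply: eq_integrable => // x _ /=; rewrite mulN1r.
Qed.

Lemma intgB m f g : intg m f -> intg m g -> intg m (fun x => f x - g x).
Proof. by move=> fi /intgN gi; exact: intgD. Qed.

Lemma intg0 m : intg m (fun=> 0).
Proof. exact: integrable0. Qed.

Lemma intg_sum m (I : Type) (s : seq I) (F : I -> T -> R) :
  (forall i, intg m (F i)) -> intg m (fun x => \sum_(i <- s) F i x).
Proof.
move=> Fi; elim: s => [|i s IH].
  by under eq_fun do rewrite big_nil; exact: intg0.
by under eq_fun do rewrite big_cons; exact: intgD.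
Qed.

Lemma intg_norm m f : intg m f -> intg m (fun x => `|f x|).
Proof. by move=> fi; exact: integrable_norm. Qed.

Lemma intg_le m f g : measurable_fun setT f -> (forall x, `|f x| <= g x) ->
  intg m g -> intg m f.
Proof.
move=> mf fg; apply: le_integrable => //; first exact/measurable_EFinP.
by move=> x _ /=; rewrite lee_fin (le_trans (fg x))// ler_norm.
Qed.

Lemma intg_eq m f g : f =1 g -> intg m f -> intg m g.
Proof. by move=> fg; rewrite /intg; apply: eq_integrable => // x _ /=; rewrite fg. Qed.

Lemma EintD m f g : intg m f -> intg m g ->
  Eint m (fun x => f x + g x) = Eint m f + Eint m g.
Proof. by move=> fi gi; rewrite /Eint RintegralD. Qed.

Lemma EintB m f g : intg m f -> intg m g ->
  Eint m (fun x => f x - g x) = Eint m f - Eint m g.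
Proof. by move=> fi gi; rewrite /Eint RintegralB. Qed.

Lemma EintZ m c f : intg m f -> Eint m (fun x => c * f x) = c * Eint m f.
Proof. by move=> fi; rewrite /Eint RintegralZl. Qed.

Lemma Eint_sum m (I : Type) (s : seq I) (F : I -> T -> R) :
  (forall i, intg m (F i)) ->
  Eint m (fun x => \sum_(i <- s) F i x) = \sum_(i <- s) Eint m (F i).
Proof.
move=> Fi; elim: s => [|i s IH].
  rewrite big_nil -[RHS](mul0r (Eint m (fun=> 0))) -EintZ; last exact: intg0.
  by congr Eint; apply/funext => x; rewrite big_nil mul0r.
rewrite big_cons -IH -EintD//; last exact: intg_sum.
by congr Eint; apply/funext => x; rewrite big_cons.
Qed.

Lemma Eint_le m f g : intg m f -> intg m g -> (forall x, f x <= g x) ->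
  Eint m f <= Eint m g.
Proof. by move=> fi gi fg; apply: le_Rintegral. Qed.

Lemma Eint_ge0 m f : (forall x, 0 <= f x) -> 0 <= Eint m f.
Proof. by move=> f0; apply: Rintegral_ge0. Qed.

Lemma Eint_norm m f : intg m f -> `|Eint m f| <= Eint m (fun x => `|f x|).
Proof. by move=> fi; apply: le_normr_Rintegral. Qed.

Lemma L2mf m f : L2 m f -> measurable_fun setT f. Proof. by case. Qed.

Lemma L2M m f g : L2 m f -> L2 m g -> intg m (fun x => f x * g x).
Proof.
move=> [mf fi] [mg gi]; apply: (@intg_le _ _ (fun x => f x ^+ 2 + g x ^+ 2)).
- exact: measurable_funM.
- move=> x; rewrite ler_norml; nra.
- exact: intgD.
Qed.

Lemma L2_eq m f g : f =1 g -> L2 m f -> L2 m g.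
Proof. by move=> /funext ->. Qed.

Lemma L20 m : L2 m (fun=> 0).
Proof. by split => //; under eq_fun do rewrite expr0n/=; exact: intg0. Qed.

Lemma L2D m f g : L2 m f -> L2 m g -> L2 m (fun x => f x + g x).
Proof.
move=> fl gl; split; first by apply: measurable_funD; apply: L2mf; eassumption.
apply: (@intg_eq _ (fun x => (f x ^+ 2 + g x ^+ 2) + 2 * (f x * g x))).
  by move=> x; ring.
by apply: intgD; [apply: intgD; [exact: fl.2|exact: gl.2]|exact/intgZ/L2M].
Qed.

Lemma L2Z m c f : L2 m f -> L2 m (fun x => c * f x).
Proof.
move=> [mf fi]; split; first exact: measurable_funM.
by apply: (intg_eq _ (intgZ (c ^+ 2) fi)) => x; ring.
Qed.

Lemma L2B m f g : L2 m f -> L2 m g -> L2 m (fun x => f x - g x).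
Proof.
move=> fl /(L2Z (-1)) gl; apply: (L2_eq _ (L2D fl gl)) => x; ring.
Qed.

Lemma L2_sum m (I : Type) (s : seq I) (F : I -> T -> R) :
  (forall i, L2 m (F i)) -> L2 m (fun x => \sum_(i <- s) F i x).
Proof.
move=> Fi; elim: s => [|i s IH].
  by under eq_fun do rewrite big_nil; exact: L20.
by under eq_fun do rewrite big_cons; exact: L2D.
Qed.

Definition nrm2 m (f : T -> R) : R := Eint m (fun x => f x ^+ 2).

Lemma nrm2_ge0 m f : 0 <= nrm2 m f.
Proof. by apply: Eint_ge0 => x; rewrite sqr_ge0. Qed.

Lemma nrm2Z m c f : L2 m f -> nrm2 m (fun x => c * f x) = c ^+ 2 * nrm2 m f.
Proof.
move=> [mf fi]; rewrite -EintZ//; congr Eint; apply/funext => x; ring.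
Qed.

Lemma nrm2D_le m f g : L2 m f -> L2 m g ->
  nrm2 m (fun x => f x + g x) <= 2 * nrm2 m f + 2 * nrm2 m g.
Proof.
move=> fl gl; rewrite -!EintZ ?fl.2 ?gl.2//; [|exact: gl.2|exact: fl.2].
rewrite -EintD; [|exact/intgZ/fl.2|exact/intgZ/gl.2].
apply: Eint_le; first exact: (L2D fl gl).2.
  by apply: intgD; apply: intgZ; [exact: fl.2|exact: gl.2].
move=> x; have := sqr_ge0 (f x - g x); lra.
Qed.

(** Cauchy-Schwarz with weights [|a i|], by induction: a new term creates a cross term, absorbed by
    the inequality [C ^+ 2 <= A * B] already known for the others. *)
Lemma sqr_wsum (I : Type) (s : seq I) (a : I -> R) (X : I -> R) :
  (\sum_(i <- s) a i * X i) ^+ 2 <=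
  (\sum_(i <- s) `|a i|) * \sum_(i <- s) `|a i| * X i ^+ 2.
Proof.
elim: s => [|i s IH]; first by rewrite !big_nil; lra.
rewrite !big_cons.
set A := \sum_(j <- s) `|a j| in IH *; set B := \sum_(j <- s) _ * _ ^+ 2 in IH *.
set C := \sum_(j <- s) _ in IH *.
have A0 : 0 <= A by apply: sumr_ge0.
have B0 : 0 <= B by apply: sumr_ge0 => j _; rewrite mulr_ge0// sqr_ge0.
have n2 : `|a i| ^+ 2 = a i ^+ 2 by rewrite -normrX ger0_norm// sqr_ge0.
(* After multiplication by [A]: [2 A X C <= A^2 X^2 + C^2 <= A (A X^2 + B)]. When [A = 0] the
   induction hypothesis forces [C = 0]. *)
have key : 2 * (a i * X i * C) <= `|a i| * (B + A * X i ^+ 2).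
  have h1 : 2 * (X i * C) <= B + A * X i ^+ 2 /\ - (2 * (X i * C)) <= B + A * X i ^+ 2.
    have [A00|Apos] : A = 0 \/ 0 < A by move: A0; rewrite le_eqVlt => /orP[/eqP<-|]; [left|right].
      have -> : C = 0 by apply/eqP; rewrite -sqrf_eq0 eq_le sqr_ge0 andbT (le_trans IH)// A00; lra.
      by rewrite A00; split; nra.
    split; rewrite -(ler_pM2l Apos); have := sqr_ge0 (A * X i - C); have := sqr_ge0 (A * X i + C); nra.
  have [ap|an] := lerP 0 (a i).
    by rewrite ger0_norm//; move: h1.1 => h1'; have := ler_wpM2l ap h1'; nra.
  rewrite ltr0_norm//; move: h1.2 => h1'.
  have an' : 0 <= - a i by lra.
  by have := ler_wpM2l an' h1'; nra.
nra.
Qed.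

Lemma nrm2_wsum m (I : Type) (s : seq I) (a : I -> R) (X : I -> T -> R) :
  (forall i, L2 m (X i)) ->
  nrm2 m (fun x => \sum_(i <- s) a i * X i x) <=
  (\sum_(i <- s) `|a i|) * \sum_(i <- s) `|a i| * nrm2 m (X i).
Proof.
move=> XL.
have h2 : intg m (fun x => \sum_(i <- s) `|a i| * X i x ^+ 2).
  by apply: intg_sum => i; exact/intgZ/(XL i).2.
apply: (@le_trans _ _ (Eint m (fun x => (\sum_(i <- s) `|a i|) *
    \sum_(i <- s) `|a i| * X i x ^+ 2))).
  apply: Eint_le; [|exact: intgZ|by move=> x; exact: sqr_wsum].
  by apply: (L2_sum _ _).2 => i; exact: L2Z.
rewrite EintZ// Eint_sum; last by move=> i; exact/intgZ/(XL i).2.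
rewrite [X in _ <= _ * X](eq_bigr (fun i => Eint m (fun x => `|a i| * X i x ^+ 2)))//.
by move=> i _; rewrite EintZ//; exact: (XL i).2.
Qed.

(** Only the l1 norm of the coefficients enters, whatever the dependence between the [X i]; applied
    to slices of [psi] it bounds partial sums and tails of the linear process. *)
Lemma nrm2_wsum_le m (I : Type) (s : seq I) (a : I -> R) (X : I -> T -> R) C :
  (forall i, L2 m (X i)) -> (forall i, nrm2 m (X i) <= C) ->
  nrm2 m (fun x => \sum_(i <- s) a i * X i x) <= (\sum_(i <- s) `|a i|) ^+ 2 * C.
Proof.
move=> XL XC; apply: le_trans (nrm2_wsum _ _ XL) _.
rewrite expr2 -mulrA; apply: ler_wpM2l; first exact: sumr_ge0.
by rewrite mulr_suml; apply: ler_sum => i _; exact: ler_wpM2l.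
Qed.

End RealIntegral.

Section ProbIntegral.
Context {R : realType} {d : measure_display} {T : measurableType d}.
Implicit Types (m : probability T R) (f g : T -> R).

Lemma intg_cst m c : intg m (fun=> c).
Proof. exact: finite_measure_integrable_cst. Qed.

Lemma Eint_cst m c : Eint m (fun=> c) = c.
Proof.
by rewrite /Eint Rintegral_cst// [X in fine X](_ : _ = 1%E) ?mulr1//; exact: probability_setT.
Qed.

Lemma L2_cst m c : L2 m (fun=> c).
Proof. by split => //; exact: intg_cst. Qed.

Lemma L2_intg m f : L2 m f -> intg m f.
Proof.
move=> fl; apply: (intg_eq _ (L2M fl (L2_cst m 1))) => x; exact: mulr1.
Qed.

Lemma intg_bounded m f C : measurable_fun setT f -> (forall x, `|f x| <= C) -> intg m f.
Proof. by move=> mf fC; apply: intg_le fC _ => //; exact: intg_cst. Qed.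

Lemma sqr_Eint_le m f : L2 m f -> (Eint m (fun x => `|f x|)) ^+ 2 <= nrm2 m f.
Proof.
move=> fl; set a := Eint m _.
have fi : intg m (fun x => `|f x|) by exact/intg_norm/L2_intg.
have : 0 <= Eint m (fun x => (f x ^+ 2 - (2 * a) * `|f x|) + a ^+ 2).
  apply: Eint_ge0 => x; have := sqr_ge0 (`|f x| - a).
  have : `|f x| ^+ 2 = f x ^+ 2 by rewrite -normrX ger0_norm// sqr_ge0.
  lra.
rewrite EintD; [|by apply: intgB; [exact: fl.2|exact: intgZ]|exact: intg_cst].
rewrite EintB; [|exact: fl.2|exact: intgZ].
by rewrite EintZ// Eint_cst -/a /nrm2; lra.
Qed.

Lemma Eabs_le m f C : L2 m f -> 0 <= C -> nrm2 m f <= C ^+ 2 ->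
  Eint m (fun x => `|f x|) <= C.
Proof.
move=> fl C0 fC; rewrite -(@ler_pXn2r _ 2)// ?nnegrE//.
  exact: le_trans (sqr_Eint_le fl) fC.
by apply: Eint_ge0.
Qed.

(** Integrating [(t |f| - s |g|)^2 >= 0] gives a quadratic inequality in [t, s >= 0], used at
    [t = E |f g|] and [s = nrm2 m f]. *)
Lemma sqr_Emul_le m f g : L2 m f -> L2 m g ->
  (Eint m (fun x => `|f x * g x|)) ^+ 2 <= nrm2 m f * nrm2 m g.
Proof.
move=> fl gl; set a := Eint m _.
have i : intg m (fun x => `|f x * g x|) by exact/intg_norm/L2M.
have a0 : 0 <= a by apply: Eint_ge0.
have key (t s : R) : 0 <= t -> 0 <= s -> 2 * (t * s * a) <= t ^+ 2 * nrm2 m f + s ^+ 2 * nrm2 m g.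
  move=> t0 s0; rewrite /nrm2 -(EintZ (t ^+ 2) fl.2) -(EintZ (s ^+ 2) gl.2).
  rewrite /a -(EintZ _ i) -(EintZ _ (intgZ (t * s) i)).
  rewrite -EintD; [|exact/intgZ/fl.2|exact/intgZ/gl.2].
  apply: Eint_le.
  - exact/intgZ/intgZ.
  - by apply: intgD; apply: intgZ; [exact: fl.2|exact: gl.2].
  move=> x; rewrite normrM; have := sqr_ge0 (t * `|f x| - s * `|g x|).
  have : `|f x| ^+ 2 = f x ^+ 2 by rewrite -normrX ger0_norm// sqr_ge0.
  have : `|g x| ^+ 2 = g x ^+ 2 by rewrite -normrX ger0_norm// sqr_ge0.
  nra.
have F0 := nrm2_ge0 m f; have G0 := nrm2_ge0 m g.
have [F00|Fp] := eqVneq (nrm2 m f) 0.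
  rewrite F00 mul0r.
  have [G00|Gp] := eqVneq (nrm2 m g) 0.
    by have := key 1 1 ler01 ler01; rewrite F00 G00; nra.
  have /(_ (nrm2 m g + 1) 1) := key; rewrite F00 => k1.
  have /(_ (nrm2 m g / 2 + (nrm2 m g)^-1 * 0) a) := key; rewrite F00 mulr0 addr0 mulr0 add0r => k2.
  have Gpos : 0 < nrm2 m g by rewrite lt_def Gp.
  have [//|apos] := eqVneq a 0; first by move=> ->; rewrite expr0n.
  have ap : 0 < a by rewrite lt_def apos.
  (* With [nrm2 m f = 0], this [t] turns the inequality into [2 nrm2 g <= nrm2 g], which excludes
     [a > 0]. *)
  have := key (nrm2 m g / a) 1 ltac:(by rewrite divr_ge0// ltW) ler01.
  rewrite F00 mulr0 add0r mulr1 mulfVK// expr1n mul1r; lra.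
have Fpos : 0 < nrm2 m f by rewrite lt_def Fp.
have := key a (nrm2 m f) a0 F0 => k.
have : nrm2 m f * a ^+ 2 <= nrm2 m f * (nrm2 m f * nrm2 m g) by nra.
by rewrite ler_pM2l.
Qed.

Lemma Emul_le m f g A B : L2 m f -> L2 m g -> 0 <= A -> 0 <= B ->
  nrm2 m f <= A ^+ 2 -> nrm2 m g <= B ^+ 2 ->
  Eint m (fun x => `|f x * g x|) <= A * B.
Proof.
move=> fl gl A0 B0 fA gB; rewrite -(@ler_pXn2r _ 2)// ?nnegrE ?mulr_ge0//; last first.
  exact: Eint_ge0.
apply: le_trans (sqr_Emul_le fl gl) _; rewrite exprMn.
by apply: ler_pM => //; exact: nrm2_ge0.
Qed.

End ProbIntegral.

(** * Integrals of functions known up to a null set *)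

Section RobustIntegral.
Import HBNNSimple.
Context {R : realType} {d : measure_display} {T : measurableType d}
  (m : {measure set T -> \bar R}).
Local Open Scope ereal_scope.

(** Valid for non-measurable functions too: a nonnegative integral is the supremum over the simple
    functions below, and cutting such a simple function down to the complement of [N] keeps its
    integral and puts it below [g]. *)
Lemma ge0_le_integral_null (f g : T -> \bar R) (N : set T) :
  measurable N -> m N = 0 -> (forall x, 0 <= f x) -> (forall x, 0 <= g x) ->
  (forall x, ~ N x -> f x <= g x) -> \int[m]_x f x <= \int[m]_x g x.
Proof.
move=> mN N0 f0 g0 fg; rewrite !ge0_integralTE//.
apply: ge_ereal_sup => _ [h hf <-].
have mNC : measurable (~` N) by exact: measurableC.
have -> : sintegral m h = sintegral m (proj_nnsfun h mNC).
  rewrite -!integralT_nnsfun.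
  have mh : measurable_fun setT (EFin \o h) by exact/measurable_EFinP.
  apply: (@ge0_ae_eq_integral _ _ _ m setT (EFin \o h) (EFin \o proj_nnsfun h mNC)) => //.
  - exact/measurable_EFinP/measurable_funPT.
  - by move=> x _; rewrite /= lee_fin.
  - by move=> x _; rewrite lee_fin; exact: fun_ge0.
  exists N; split => // x nx; apply: contrapT => Nx; apply: nx => _.
  by rewrite /comp -mrestrict patchE mem_set.
apply: ereal_sup_ubound; exists (proj_nnsfun h mNC) => // x.
rewrite -mrestrict patchE; have [Nx|Nx] := boolP (x \in ~` N); last by [].
by rewrite (le_trans (hf x))// fg//; exact: set_mem Nx.
Qed.

Lemma eq_integral_null (f g : T -> \bar R) (N : set T) :
  measurable N -> m N = 0 -> (forall x, ~ N x -> f x = g x) ->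
  \int[m]_x f x = \int[m]_x g x.
Proof.
move=> mN N0 fg; rewrite integralE [RHS]integralE; congr (_ - _);
  apply/eqP; rewrite eq_le; apply/andP; split;
  apply: (@ge0_le_integral_null _ _ N) => // x Nx; by rewrite ?funeposE ?funenegE fg.
Qed.

Lemma eq_integral_negligible (f g : T -> \bar R) :
  m.-negligible [set x | f x <> g x] -> \int[m]_x f x = \int[m]_x g x.
Proof.
move=> [N [mN N0 sub]]; apply: (eq_integral_null mN N0) => x Nx.
by apply: contra_notP Nx => /sub.
Qed.

Lemma eq_Eint_ae (f g : T -> R) : {ae m, forall x, f x = g x} -> Eint m f = Eint m g.
Proof.
move=> fg; rewrite /Eint /Rintegral; congr fine.
apply: eq_integral_negligible; apply: negligibleS fg => x /= h h2; apply: h.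
by rewrite h2.
Qed.

End RobustIntegral.

(** * Characteristic functions *)

Section TrigBounds.
Context {R : realType}.
Implicit Types x y : R.

Lemma MVT_dist (f df : R -> R) x y : (forall z : R, is_derive z (1:R) f (df z)) ->
  exists2 c, `|c - x| <= `|y - x| & f y - f x = df c * (y - x).
Proof.
move=> fd; have fc : continuous f.
  by move=> z; apply: differentiable_continuous; apply/derivable1_diffP; case: (fd z).
have [xy|yx|->] := ltgtP x y.
- have [c /itvP cxy ->] := @MVT R f df x y xy (fun z _ => fd z) (continuous_subspaceT fc).
  by exists c => //; rewrite !ger0_norm ?subr_ge0 ?lerD2r ?cxy// ltW.
- have [c /itvP cxy e] := @MVT R f df y x yx (fun z _ => fd z) (continuous_subspaceT fc).
  exists c; last by move: e; lra.
  by rewrite !ler0_norm ?subr_le0 ?lerN2 ?lerD2r ?cxy// ltW.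
- by exists y => //; lra.
Qed.

Lemma sin_lip x y : `|sin x - sin y| <= `|x - y|.
Proof.
have [c _ ->] := @MVT_dist sin cos y x (fun z => is_derive_sin z).
by rewrite normrM ler_piMl// cos_max.
Qed.

Lemma cos_lip x y : `|cos x - cos y| <= `|x - y|.
Proof.
have [c _ ->] := @MVT_dist cos (fun z => - sin z) y x (fun z => is_derive_cos z).
by rewrite normrM ler_piMl// normrN sin_max.
Qed.

Lemma onem_cos x : 1 - cos x = 2 * sin (x / 2) ^+ 2.
Proof.
have {1}-> : x = (x / 2) *+ 2 by rewrite -mulr_natr; field.
by rewrite cos_mulr2n sin2cos2 -mulr_natr; ring.
Qed.

Lemma norm_sin_le x : `|sin x| <= `|x|.
Proof. by have := sin_lip x 0; rewrite sin0 !subr0. Qed.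

Lemma sqr_le_norm x y : `|x| <= `|y| -> x ^+ 2 <= y ^+ 2.
Proof. by move=> xy; rewrite -ler_sqrt ?sqr_ge0// !sqrtr_sqr. Qed.

Lemma sqr_norm x : `|x| ^+ 2 = x ^+ 2.
Proof. exact: real_normK (num_real x). Qed.

Lemma onem_cos_le x : `|1 - cos x| <= x ^+ 2 / 2.
Proof.
rewrite onem_cos ger0_norm; last by rewrite mulr_ge0// sqr_ge0.
have := sqr_le_norm (norm_sin_le (x / 2)).
rewrite expr_div_n; lra.
Qed.

Lemma sin_sub_id x : exists2 c, `|c| <= `|x| & sin x - x = (cos c - 1) * x.
Proof.
have [c cx e] := @MVT_dist (fun z => sin z - z) (fun z => cos z - 1) 0 x
   (fun z => is_deriveB (is_derive_sin z) (is_derive_id z (1:R))).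
by exists c; [move: cx; rewrite !subr0|move: e; rewrite sin0 !subr0].
Qed.

Lemma sin_sub_le2 x : `|sin x - x| <= x ^+ 2.
Proof.
have [c cx ->] := sin_sub_id x; rewrite -sqr_norm expr2 normrM ler_wpM2r//.
by apply: le_trans cx; have := cos_lip c 0; rewrite cos0 subr0.
Qed.

Lemma sin_sub_le3 x : `|sin x - x| <= `|x| ^+ 3.
Proof.
have [c cx ->] := sin_sub_id x; rewrite normrM exprSr ler_wpM2r//.
rewrite distrC (le_trans (onem_cos_le c))//.
have := sqr_le_norm cx; rewrite sqr_norm.
have := sqr_ge0 c; lra.
Qed.

(** The left side is twice a difference of squares, of [sin (x / 2)] and [x / 2]; one factor is of
    order [x^2], the other of order [|x|]. *)
Lemma cos_quad_le x : `|1 - cos x - x ^+ 2 / 2| <= `|x| ^+ 3.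
Proof.
rewrite onem_cos (_ : _ - _ = 2 * (sin (x / 2) - x / 2) * (sin (x / 2) + x / 2)); last by field.
rewrite !normrM.
have h1 := sin_sub_le2 (x / 2).
have h2 : `|sin (x / 2) + x / 2| <= `|x|.
  rewrite (le_trans (ler_normD _ _))//; have := norm_sin_le (x / 2).
  have -> : `|x| = `|x / 2| + `|x / 2| by rewrite normrM (@ger0_norm _ 2^-1)//; field.
  lra.
rewrite (_ : `|2| = 2 :> R); last by rewrite ger0_norm.
rewrite exprSr ler_pM//.
rewrite sqr_norm; move: h1; rewrite expr_div_n; have := sqr_ge0 x; lra.
Qed.

(** Both bounds are [1 + x <= e^x], taken at [x = - a / n.+1] and at [x = a / n.+1]. *)
Lemma onem_expRN_bounds (a : R) (n : nat) : 0 <= a ->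
  a / (1 + a / n.+1%:R) <= n.+1%:R * (1 - expR (- (a / n.+1%:R))) <= a.
Proof.
move=> a0; set N := n.+1%:R : R; have N0 : 0 < N by rewrite ltr0n.
set b := a / N; have b0 : 0 <= b by rewrite divr_ge0// ltW.
have aE : a = N * b by rewrite /b mulrCA divff ?mulr1// gt_eqF.
have := expR_ge1Dx (- b) => h1; have := expR_ge1Dx b => h2.
have e0 := expR_gt0 b; have b1 : 0 < 1 + b by lra.
apply/andP; split; last by rewrite aE ler_pM2l//; lra.
rewrite {1}aE -mulrA ler_pM2l//= expRN.
have : (expR b)^-1 <= (1 + b)^-1 by rewrite lef_pV2 ?posrE.
have -> : b / (1 + b) = 1 - (1 + b)^-1 by field; rewrite gt_eqF.
lra.
Qed.

End TrigBounds.

Section Limits.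
Context {R : realType}.

(** The exchange of limits behind every truncation: the approximating sequence may depend on [e],
    and its own limit has to be only within [e] of [l]. *)
Lemma cvgn_approx (a : nat -> R) (l : R) :
  (forall e, 0 < e -> exists b l', [/\ b @ \oo --> l', `|l' - l| <= e &
     \forall n \near \oo, `|a n - b n| <= e]) -> a @ \oo --> l.
Proof.
move=> H; apply/cvgrPdist_le => e e0.
have e3 : 0 < e / 3 by rewrite divr_gt0.
have [b [l' [/cvgrPdist_le/(_ _ e3) bl ll ab]]] := H _ e3.
near=> n.
have h1 : `|l' - b n| <= e / 3 by near: n.
have h2 : `|a n - b n| <= e / 3 by near: n.
have -> : l - a n = - (l' - l) + (l' - b n) - (a n - b n) by ring.
rewrite (le_trans (ler_normB _ _))// (le_trans (lerD (ler_normD _ _) (lexx _)))//.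
rewrite normrN; lra.
Unshelve. all: by end_near. Qed.

Lemma cvg_invn : (fun n => n%:R^-1 : R) @ \oo --> (0 : R).
Proof. by rewrite -(cvg_shiftS (fun n => n%:R^-1 : R)); exact: cvg_harmonic. Qed.

Lemma near_invn (c e : R) : 0 < e -> \forall n \near \oo, c / n%:R <= e.
Proof.
move=> e0; have : (fun n => c * n%:R^-1 : R) @ \oo --> c * 0 by apply: cvgMr; exact: cvg_invn.
by rewrite mulr0 => /cvgrPdist_le/(_ _ e0); apply: filterS => n; rewrite sub0r normrN; apply/le_trans/ler_norm.
Qed.

End Limits.

Section CharFun.
Context {R : realType} {d : measure_display} {O : measurableType d} (P : probability O R).
Implicit Types X Y : O -> R.

Definition cosE X : R := Eint P (fun w => cos (X w)).
Definition sinE X : R := Eint P (fun w => sin (X w)).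
Definition chf X : R[i] := (cosE X +i* sinE X)%C.

Lemma measurable_cos' X : measurable_fun setT X -> measurable_fun setT (fun w => cos (X w)).
Proof. by move=> mX; apply: measurableT_comp mX; apply: continuous_measurable_fun; exact: continuous_cos. Qed.

Lemma measurable_sin' X : measurable_fun setT X -> measurable_fun setT (fun w => sin (X w)).
Proof. by move=> mX; apply: measurableT_comp mX; apply: continuous_measurable_fun; exact: continuous_sin. Qed.

Lemma intg_cos X : measurable_fun setT X -> intg P (fun w => cos (X w)).
Proof. by move=> /measurable_cos' mX; apply: intg_bounded mX (fun w => cos_max (X w)). Qed.

Lemma intg_sin X : measurable_fun setT X -> intg P (fun w => sin (X w)).
Proof. by move=> /measurable_sin' mX; apply: intg_bounded mX (fun w => sin_max (X w)). Qed.

Lemma Eint_lip (F : R -> R) (M : R) X Y : continuous F -> (forall x, `|F x| <= M) ->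
  (forall x y, `|F x - F y| <= `|x - y|) ->
  measurable_fun setT X -> measurable_fun setT Y -> intg P (fun w => X w - Y w) ->
  `|Eint P (fun w => F (X w)) - Eint P (fun w => F (Y w))| <= Eint P (fun w => `|X w - Y w|).
Proof.
move=> cF FM lF mX mY XY.
have iF Z : measurable_fun setT Z -> intg P (fun w => F (Z w)).
  move=> mZ; apply: (@intg_bounded _ _ _ P (fun w => F (Z w)) M) => //.
  by apply: measurableT_comp mZ; exact: continuous_measurable_fun.
rewrite -EintB; [|exact: iF|exact: iF].
apply: le_trans (Eint_norm _) _; first by apply: intgB; exact: iF.
apply: Eint_le => //; last exact: intg_norm.
by apply/intg_norm/intgB; exact: iF.
Qed.

Lemma cosE_near X Y : measurable_fun setT X -> measurable_fun setT Y ->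
  intg P (fun w => X w - Y w) -> `|cosE X - cosE Y| <= Eint P (fun w => `|X w - Y w|).
Proof. by move=> *; apply: (@Eint_lip _ 1) => //; [exact: continuous_cos|exact: cos_max|exact: cos_lip]. Qed.

Lemma sinE_near X Y : measurable_fun setT X -> measurable_fun setT Y ->
  intg P (fun w => X w - Y w) -> `|sinE X - sinE Y| <= Eint P (fun w => `|X w - Y w|).
Proof. by move=> *; apply: (@Eint_lip _ 1) => //; [exact: continuous_sin|exact: sin_max|exact: sin_lip]. Qed.

Lemma Eint_dom (F : nat -> O -> R) (G f : O -> R) :
  (forall n, measurable_fun setT (F n)) -> measurable_fun setT f -> intg P G ->
  (forall n x, `|F n x| <= G x) -> (forall x, F ^~ x @ \oo --> f x) ->
  (fun n => Eint P (F n)) @ \oo --> Eint P f.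
Proof.
move=> mF mf iG FG Ff.
have [h1 _ h2] := @dominated_convergence _ _ _ P setT measurableT (fun n x => (F n x)%:E)
  (EFin \o f) (EFin \o G) (fun n => (measurable_EFinP _ _).2 (mF n)) ((measurable_EFinP _ _).2 mf)
  ltac:(by apply: aeW => x _; apply: cvg_EFin; [exact: nearW|exact: Ff])
  iG ltac:(by apply: aeW => x n _; rewrite /= lee_fin FG).
by move: h2; rewrite (intg_fin h1) => /fine_cvg.
Qed.

Local Notation normc := (@Normc.normc R).

Lemma normc_nneg (z : R[i]) : 0 <= normc z.
Proof. by case: z => a b; exact: sqrtr_ge0. Qed.

(** Telescoping: in the unit disc each of the [q] factors contributes the difference of the bases
    once. *)
Lemma normc_le1_pow_sub (z w : R[i]) q : normc z <= 1 -> normc w <= 1 ->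
  normc (z ^+ q - w ^+ q) <= q%:R * normc (z - w).
Proof.
move=> z1 w1; have wq k : normc (w ^+ k) <= 1.
  elim: k => [|k IH]; first by rewrite expr0 Normc.normc1.
  by rewrite exprS Normc.normcM mulr_ile1 ?normc_nneg.
elim: q => [|q IH]; first by rewrite !expr0 subrr mul0r Normc.normc0.
have -> : z ^+ q.+1 - w ^+ q.+1 = z * (z ^+ q - w ^+ q) + (z - w) * w ^+ q by rewrite !exprS; ring.
apply: le_trans (le_normcD _ _) _; rewrite !Normc.normcM -natr1 mulrDl mul1r.
apply: lerD; last by rewrite ler_piMr ?normc_nneg.
by apply: le_trans IH; rewrite ler_piMl ?normc_nneg.
Qed.

Lemma normc_le_abs (a b : R) : normc (a +i* b)%C <= `|a| + `|b|.
Proof.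
rewrite /normc -(@ler_pXn2r _ 2)// ?nnegrE ?addr_ge0// ?sqrtr_ge0//.
rewrite sqr_sqrtr ?addr_ge0 ?sqr_ge0//.
have := sqr_norm a; have := sqr_norm b; have := normr_ge0 a; have := normr_ge0 b; nra.
Qed.

Lemma abs_le_normc (a b : R) : `|a| <= normc (a +i* b)%C /\ `|b| <= normc (a +i* b)%C.
Proof.
by split; rewrite /normc -sqrtr_sqr ler_sqrt ?addr_ge0 ?sqr_ge0// ?lerDl ?lerDr sqr_ge0.
Qed.

Lemma chf_le1 X : measurable_fun setT X -> normc (chf X) <= 1.
Proof.
move=> mX; rewrite /normc/= -[leRHS]sqrtr1 ler_sqrt//.
set a := cosE X; set b := sinE X.
have ic := intg_cos mX; have is_ := intg_sin mX.
(* The integrand is [(cos X - a)^2 + (sin X - b)^2], whose expectation is [1 - a^2 - b^2]. *)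
have : 0 <= Eint P (fun w => (1 - (2 * a) * cos (X w) - (2 * b) * sin (X w)) + (a ^+ 2 + b ^+ 2)).
  apply: Eint_ge0 => w; have := sqr_ge0 (cos (X w) - a); have := sqr_ge0 (sin (X w) - b).
  have := cos2Dsin2 (X w); nra.
rewrite EintD; [|apply: intgB; [apply: intgB|]|]; rewrite ?EintB; try exact: intgZ; try exact: intg_cst.
  by rewrite !EintZ// !Eint_cst -/a -/b -/(cosE X) -/(sinE X) -/a -/b; nra.
by apply: intgB; [exact: intg_cst|exact: intgZ].
Qed.

End CharFun.

(** * Central limit theorem for m-dependent sequences *)

Section IidCLT.
Context {R : realType} {d : measure_display} {O : measurableType d} (P : probability O R).
Local Notation normc := (@Normc.normc R).

Context (B : O -> R) (BL : L2 P B) (B0 : Eint P B = 0).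
Let t2 := nrm2 P B.
Let r (n : nat) : R := Num.sqrt n.+1%:R.

Let r_gt0 n : 0 < r n. Proof. by rewrite sqrtr_gt0 ltr0n. Qed.

Let r2 n : r n ^+ 2 = n.+1%:R. Proof. by rewrite sqr_sqrtr. Qed.

Let rV0 : (fun n => (r n)^-1) @ \oo --> (0 : R).
Proof.
have h : (fun n => (n.+1%:R : R)^-1) @ \oo --> (0 : R) by exact: cvg_harmonic.
have : (fun n => Num.sqrt ((n.+1%:R : R)^-1)) @ \oo --> Num.sqrt (0 : R).
  exact: (continuous_cvg _ (@sqrt_continuous R 0) h).
by rewrite sqrtr0; under eq_fun do rewrite sqrtrV//.
Qed.

(** Dominated convergence: [1 - cos x <= x^2 / 2] bounds the integrand by [B^2 / 2], and for each
    point the error is at most [|B|^3 / r n]. *)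
Lemma cf_cos_limit :
  (fun n => n.+1%:R * (1 - cosE P (fun w => B w / r n))) @ \oo --> t2 / 2.
Proof.
have mB := L2mf BL.
have e n : n.+1%:R * (1 - cosE P (fun w => B w / r n)) =
    Eint P (fun w => n.+1%:R * (1 - cos (B w / r n))).
  have ic : intg P (fun w => cos (B w / r n)) by apply: intg_cos; exact: measurable_funM.
  by rewrite EintZ; [rewrite EintB ?Eint_cst//; exact: intg_cst|apply: intgB => //; exact: intg_cst].
under eq_fun do rewrite e.
have -> : t2 / 2 = Eint P (fun w => B w ^+ 2 / 2).
  by rewrite /t2 /nrm2 mulrC -EintZ ?BL.2//; [congr Eint; apply/funext => w; rewrite mulrC|exact: BL.2].
apply: (@Eint_dom _ _ _ _ _ (fun w => 2^-1 * B w ^+ 2)).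
- move=> n; apply: measurable_funM => //; apply: measurable_funB => //.
  by apply: measurable_cos'; exact: measurable_funM.
- by apply: measurable_funM => //; exact: measurable_funX.
- exact/intgZ/BL.2.
- move=> n w; rewrite normrM ger0_norm ?ler0n//.
  have := onem_cos_le (B w / r n); rewrite expr_div_n r2 => h.
  have := ler_wpM2l (ler0n R n.+1) h.
  suff -> : n.+1%:R * (B w ^+ 2 / n.+1%:R / 2) = 2^-1 * B w ^+ 2 by [].
  have := pnatr_eq0 R n.+1; move: (n.+1%:R : R) => N /negbT N0; by field.
- move=> w; apply/cvgrPdist_le => e0 e0p.
  have : (fun n => `|B w| ^+ 3 * (r n)^-1) @ \oo --> (`|B w| ^+ 3 * 0 : R).
    by apply: cvgMr; exact: rV0.
  rewrite mulr0 => /cvgrPdist_le/(_ _ e0p); apply: filterS => n.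
  rewrite sub0r normrN => h; apply: le_trans h.
  rewrite [leRHS]ger0_norm ?mulr_ge0 ?exprn_ge0 ?invr_ge0 ?(ltW (r_gt0 n))//.
  have := ler_wpM2l (ler0n R n.+1) (cos_quad_le (B w / r n)).
  have rn0 : r n != 0 by rewrite gt_eqF.
  have -> : n.+1%:R * `|B w / r n| ^+ 3 = `|B w| ^+ 3 / r n.
    by rewrite normrM normfV (gtr0_norm (r_gt0 n)) -r2; field.
  apply: le_trans; rewrite -[X in X * `|_|](ger0_norm (ler0n R n.+1)) -normrM distrC -r2.
  by rewrite (_ : _ - B w ^+ 2 / 2 = r n ^+ 2 * (1 - cos (B w / r n) - (B w / r n) ^+ 2 / 2)) ?lexx//; field.
Qed.

(** As [B] is centred, [B / r n] can be subtracted from the sine; the rest is dominated by [B^2] and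
    tends to 0 pointwise by the cubic bound. *)
Lemma cf_sin_limit : (fun n => n.+1%:R * sinE P (fun w => B w / r n)) @ \oo --> (0 : R).
Proof.
have mB := L2mf BL; have iB := L2_intg BL.
have e n : n.+1%:R * sinE P (fun w => B w / r n) =
    Eint P (fun w => n.+1%:R * (sin (B w / r n) - B w / r n)).
  have is_ : intg P (fun w => sin (B w / r n)) by apply: intg_sin; exact: measurable_funM.
  have ib : intg P (fun w => B w / r n) by apply: (intg_eq _ (intgZ (r n)^-1 iB)) => w; rewrite mulrC.
  rewrite EintZ; last exact: intgB.
  rewrite EintB// [X in _ - X](_ : _ = 0) ?subr0//.
  under [X in Eint _ X]eq_fun do rewrite mulrC.
  by rewrite EintZ// B0 mulr0.
under eq_fun do rewrite e.
have -> : (0 : R) = Eint P (fun=> 0) by rewrite Eint_cst.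
apply: (@Eint_dom _ _ _ _ _ (fun w => B w ^+ 2)).
- move=> n; apply: measurable_funM => //; apply: measurable_funB => //.
    by apply: measurable_sin'; exact: measurable_funM.
  exact: measurable_funM.
- by [].
- exact: BL.2.
- move=> n w; rewrite normrM ger0_norm ?ler0n//.
  have := ler_wpM2l (ler0n R n.+1) (sin_sub_le2 (B w / r n)).
  rewrite expr_div_n r2; suff -> : n.+1%:R * (B w ^+ 2 / n.+1%:R) = B w ^+ 2 by [].
  have := pnatr_eq0 R n.+1; move: (n.+1%:R : R) => N /negbT N0; by field.
- move=> w; apply/cvgrPdist_le => e0 e0p.
  have : (fun n => `|B w| ^+ 3 * (r n)^-1) @ \oo --> (`|B w| ^+ 3 * 0 : R).
    by apply: cvgMr; exact: rV0.
  rewrite mulr0 => /cvgrPdist_le/(_ _ e0p); apply: filterS => n.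
  rewrite !sub0r !normrN => h; apply: le_trans h.
  rewrite [leRHS]ger0_norm ?mulr_ge0 ?exprn_ge0 ?invr_ge0 ?(ltW (r_gt0 n))//.
  have := ler_wpM2l (ler0n R n.+1) (sin_sub_le3 (B w / r n)).
  have rn0 : r n != 0 by rewrite gt_eqF.
  have -> : n.+1%:R * `|B w / r n| ^+ 3 = `|B w| ^+ 3 / r n.
    by rewrite normrM normfV (gtr0_norm (r_gt0 n)) -r2; field.
  by apply: le_trans; rewrite normrM ger0_norm.
Qed.

Lemma cf_exp_limit (a : R) : 0 <= a ->
  (fun n => n.+1%:R * (1 - expR (- (a / n.+1%:R)))) @ \oo --> a.
Proof.
move=> a0; apply: (@squeeze_cvgr _ _ _ _ (fun n => a / (1 + a / n.+1%:R)) (fun=> a)).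
- by apply: nearW => n; exact: onem_expRN_bounds.
- have : (fun n => a * (1 + a * (n.+1%:R)^-1)^-1) @ \oo --> a * (1 + a * 0)^-1.
    apply: cvgMr; apply: cvgV; first by rewrite mulr0 addr0.
    by apply: cvgD; [exact: cvg_cst|apply: cvgMr; exact: cvg_harmonic].
  by rewrite mulr0 addr0 invr1 mulr1.
- exact: cvg_cst.
Qed.

(* the error of replacing the characteristic function of B/sqrt n by the Gaussian one is o(1/n), so it survives n-th powers *)
Lemma cf_pow_near (e : R) : 0 < e -> \forall n \near \oo, forall q, (q <= n.+1)%N ->
  normc (chf P (fun w => B w / r n) ^+ q - (expR (- (q%:R * (t2 / 2) / n.+1%:R)))%:C%C) <= e.
Proof.
move=> e0; have t20 : 0 <= t2 / 2 by rewrite divr_ge0// nrm2_ge0.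
have e3 : 0 < e / 3 by rewrite divr_gt0.
have mB := L2mf BL.
near=> n => q qn.
have h1 : `|t2 / 2 - n.+1%:R * (1 - cosE P (fun w => B w / r n))| <= e / 3.
  by near: n; move/cvgrPdist_le: cf_cos_limit; exact.
have h2 : `|0 - n.+1%:R * sinE P (fun w => B w / r n)| <= e / 3.
  by near: n; move/cvgrPdist_le: cf_sin_limit; exact.
have h3 : `|t2 / 2 - n.+1%:R * (1 - expR (- (t2 / 2 / n.+1%:R)))| <= e / 3.
  by near: n; move/cvgrPdist_le: (cf_exp_limit t20); exact.
set z := chf P _; set w := expR (- (t2 / 2 / n.+1%:R)).
have -> : (expR (- (q%:R * (t2 / 2) / n.+1%:R)))%:C%C = (w%:C%C) ^+ q.
  rewrite -rmorphXn/= /w -expRM_natl; congr ((expR _)%:C)%C; ring.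
have w1 : normc (w%:C)%C <= 1.
  rewrite /Normc.normc /= expr0n/= addr0 sqrtr_sqr ger0_norm ?expR_ge0//.
  rewrite /w -[leRHS]expR0 ler_expR oppr_le0 divr_ge0//.
apply: le_trans (normc_le1_pow_sub q _ w1) _; first by apply: chf_le1; exact: measurable_funM.
(* All [q <= n.+1] are handled at once: the three limits above say that [n.+1] times the difference
   of the bases is small. *)
apply: (@le_trans _ _ (n.+1%:R * normc (z - (w%:C)%C))).
  by rewrite ler_wpM2r ?normc_nneg// ler_nat.
have -> : z - (w%:C)%C = ((cosE P (fun w => B w / r n) - w) +i* sinE P (fun w => B w / r n))%C.
  by rewrite /z /chf; apply/eqP; rewrite eq_complex /= subr0 !eqxx.
apply: le_trans (ler_wpM2l (ler0n R n.+1) (normc_le_abs _ _)) _.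
rewrite mulrDr -{1 2}[n.+1%:R]ger0_norm// -!normrM.
move: h2; rewrite sub0r normrN => h2.
have : `|n.+1%:R * (cosE P (fun w => B w / r n) - w)| <= e / 3 + e / 3.
  have -> : n.+1%:R * (cosE P (fun w => B w / r n) - w) =
    (t2 / 2 - n.+1%:R * (1 - cosE P (fun w => B w / r n))) - (t2 / 2 - n.+1%:R * (1 - w)) by ring.
  by apply: le_trans (ler_normB _ _) _; exact: lerD.
lra.
Unshelve. all: by end_near. Qed.

End IidCLT.

Section MdependentCLT.
Context {R : realType} {d : measure_display} {O : measurableType d} (P : probability O R).
Local Notation normc := (@Normc.normc R).

Lemma expRN_lip (a b : R) : 0 <= a -> 0 <= b -> `|expR (- a) - expR (- b)| <= `|a - b|.
Proof.
wlog ab : a b / a <= b.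
  move=> H; case: (leP a b) => h a0 b0; first exact: H.
  by rewrite distrC (distrC a b); apply: H => //; exact: ltW.
move=> a0 b0.
have -> : expR (- b) = expR (- a) * expR (- (b - a)) by rewrite -expRD; congr expR; ring.
have e1 : expR (- a) <= 1 by rewrite -[leRHS]expR0 ler_expR oppr_le0.
have e2 : expR (- (b - a)) <= 1 by rewrite -[leRHS]expR0 ler_expR oppr_le0 subr_ge0.
have := expR_ge1Dx (- (b - a)); have := expR_ge0 (- a) => e3 e4.
rewrite (_ : _ - _ = expR (- a) * (1 - expR (- (b - a)))); last by ring.
rewrite ger0_norm ?mulr_ge0 ?subr_ge0// distrC ger0_norm ?subr_ge0//.
nra.
Qed.

Context (M : nat -> O -> R) (s2 : R) (m : nat).
Context (ML : forall s, L2 P (M s)).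
Context (M0 : forall s, Eint P (M s) = 0).
Context (Morth : forall s t, s != t -> Eint P (fun w => M s w * M t w) = 0).
Context (Mvar : forall s, nrm2 P (M s) = s2).

Lemma nrm2_orth (s : seq nat) : uniq s -> nrm2 P (fun w => \sum_(i <- s) M i w) = (size s)%:R * s2.
Proof.
elim: s => [_|i s IH /= /andP[is_ us]].
  rewrite mul0r /nrm2 -[RHS](Eint_cst P 0); congr Eint; apply/funext => w.
  by rewrite big_nil expr0n.
have SL : L2 P (fun w => \sum_(j <- s) M j w) by exact: L2_sum.
have cross : Eint P (fun w => M i w * \sum_(j <- s) M j w) = 0.
  under [X in Eint _ X]eq_fun do rewrite big_distrr/=.
  rewrite Eint_sum; last by move=> j; exact: L2M.
  rewrite big_seq big1// => j js; apply: Morth; apply: contraNN is_ => /eqP ->//.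
rewrite /nrm2 (_ : (fun w => _) = (fun w => (M i w ^+ 2 + (\sum_(j <- s) M j w) ^+ 2) +
   2 * (M i w * \sum_(j <- s) M j w))); last by apply/funext => w; rewrite big_cons; ring.
rewrite EintD; [|by apply: intgD; [exact: (ML i).2|exact: SL.2]|exact/intgZ/L2M].
rewrite EintD; [|exact: (ML i).2|exact: SL.2].
rewrite EintZ ?cross; last exact: L2M.
by have := IH us; have := Mvar i; rewrite /nrm2 => -> ->; rewrite -natr1; ring.
Qed.

Definition blk (K L j : nat) (w : O) : R := \sum_(i < L) M (j * K + i) w.

(** The only trace of independence and stationarity: for blocks of length [L] separated by gaps of
    length [m], the characteristic function of the sum is a power. The rest of the argument uses
    orthogonality. *)
Context (Hblk : forall L c q, (0 < L)%N ->
  chf P (fun w => c * \sum_(j < q) blk (L + m) L j w) =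
  chf P (fun w => c * blk (L + m) L 0 w) ^+ q).

(** The two extra lists are the [q] gaps and the last incomplete period. They are kept as lists of
    indices so that [nrm2_orth] can count their variance. *)
Lemma blk_split K L q r w : (L <= K)%N ->
  \sum_(s < q * K + r) M s w = \sum_(j < q) blk K L j w +
   (\sum_(s <- [seq (j * K + i)%N | j <- iota 0 q, i <- iota L (K - L)]) M s w +
    \sum_(s <- iota (q * K) r) M s w).
Proof.
move=> LK; rewrite addrA -(big_mkord xpredT (fun s => M s w)).
rewrite (@big_cat_nat _ _ _ (q * K)%N) ?leq_addr//= [in X in _ + X]/index_iota addKn; congr (_ + _).
rewrite big_allpairs_dep/= -(big_mkord xpredT (fun j => blk K L j w)) /index_iota !subn0.
elim: q => [|q IH]; first by rewrite mul0n !big_nil addr0.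
rewrite -[in iota 0 q.+1]addn1 iotaD !big_cat/= !big_seq1 add0n.
rewrite addrACA -IH mulSn addnC iotaD big_cat/= add0n; congr (_ + _).
have -> : iota (q * K) K = iota (q * K) L ++ iota (q * K + L) (K - L) by rewrite -iotaD subnKC.
rewrite big_cat/=; congr (_ + _); last by rewrite iotaDl big_map.
rewrite /blk -(big_mkord xpredT (fun i => M (q * K + i)%N w)) /index_iota subn0.
by rewrite -{1}[(q * K)%N]addn0 iotaDl big_map.
Qed.

(** The block length [L] is fixed before [n]: the gaps carry a share of the variance at most
    [m / L], uniformly in [n], and the incomplete period has fewer than [K] terms. The retained
    blocks are treated by [cf_pow_near]. *)
Lemma Mdependent_clt (e : R) : 0 < e -> \forall n \near \oo,
  `|cosE P (fun w => (\sum_(s < n.+1) M s w) / Num.sqrt n.+1%:R) - expR (- (s2 / 2))| <= e /\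
  `|sinE P (fun w => (\sum_(s < n.+1) M s w) / Num.sqrt n.+1%:R)| <= e.
Proof.
move=> e0; have s20 : 0 <= s2 by rewrite -(Mvar 0) nrm2_ge0.
have e3 : 0 < e / 3 by rewrite divr_gt0.
have e6 : 0 < (e / 3) ^+ 2 / 2 by rewrite divr_gt0// exprn_gt0.
(* The first bound makes the gaps small in L2, the factor 2 being that of [nrm2D_le]; the second
   brings the variance of the retained blocks close to [s2]. *)
have [L [L0 hL1 hL2]] : exists L, [/\ (0 < L)%N, 2 * s2 * m%:R / L%:R <= (e / 3) ^+ 2 / 2 &
     s2 / 2 * m%:R / L%:R <= e / 6].
  have e6' : 0 < e / 6 by rewrite divr_gt0.
  near (\oo : set_system nat) => L; exists L; split.
  - by near: L; exists 1%N.
  - by near: L; exact: near_invn.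
  - by near: L; exact: near_invn.
pose K := (L + m)%N; have K0 : (0 < K)%N by rewrite /K addn_gt0 L0.
have BL : L2 P (blk K L 0) by exact: L2_sum.
have B0 : Eint P (blk K L 0) = 0.
  by rewrite /blk Eint_sum ?big1// => i; exact/L2_intg.
have Bvar : nrm2 P (blk K L 0) = L%:R * s2.
  rewrite -{2}(size_iota 0 L) -nrm2_orth ?iota_uniq//; congr nrm2; apply/funext => w.
  by rewrite /blk -(big_mkord xpredT (fun i => M i w)) /index_iota subn0.
have mm : m%:R / K%:R <= (m%:R / L%:R : R).
  by rewrite ler_wpM2l// lef_pV2 ?posrE ?ltr0n// ler_nat leq_addr.
have e6' : 0 < e / 6 by rewrite divr_gt0.
near=> n.
have N0 : (0 : R) < n.+1%:R by rewrite ltr0n.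
set q := (n.+1 %/ K)%N; set r := (n.+1 %% K)%N.
have nE : n.+1 = (q * K + r)%N by exact: divn_eq.
have qK : (q * K <= n.+1)%N by rewrite nE leq_addr.
have qn : (q <= n.+1)%N by apply: leq_trans qK; rewrite leq_pmulr.
have rK : (r < K)%N by rewrite ltn_mod.
have h1 : normc (chf P (fun w => blk K L 0 w / Num.sqrt n.+1%:R) ^+ q -
     (expR (- (q%:R * (L%:R * s2 / 2) / n.+1%:R)))%:C%C) <= e / 3.
  rewrite -Bvar; move: q qn {nE qK}; near: n; exact: cf_pow_near.
have h2 : 2 * s2 * K%:R / n.+1%:R <= (e / 3) ^+ 2 / 2.
  have h : 2 * s2 * K%:R / n%:R <= (e / 3) ^+ 2 / 2 by near: n; exact: near_invn.
  have n0 : (0 < n)%N by near: n; exists 1%N.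
  apply: le_trans h; rewrite ler_wpM2l ?mulr_ge0// lef_pV2 ?posrE ?ltr0n// ler_nat//.
have h3 : s2 / 2 * K%:R / n.+1%:R <= e / 6.
  have h : s2 / 2 * K%:R / n%:R <= e / 6 by near: n; exact: near_invn.
  have n0 : (0 < n)%N by near: n; exists 1%N.
  apply: le_trans h; rewrite ler_wpM2l ?mulr_ge0 ?divr_ge0// lef_pV2 ?posrE ?ltr0n// ler_nat//.
set sn := Num.sqrt n.+1%:R in h1 *.
have sn0 : 0 < sn by rewrite sqrtr_gt0.
have sn2 : sn ^+ 2 = n.+1%:R by rewrite sqr_sqrtr// ltW.
pose l1 := [seq (j * K + i)%N | j <- iota 0 q, i <- iota L (K - L)].
pose D w := \sum_(s <- l1) M s w + \sum_(s <- iota (q * K) r) M s w.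
have DL : L2 P D by apply: L2D; exact: L2_sum.
have ul1 : uniq l1.
  apply: allpairs_uniq; [exact: iota_uniq|exact: iota_uniq|].
  move=> [a b] [a' b'] /=.
  case/allpairsP => -[x y] /= [_ yI [-> ->]] /allpairsP[[x' y'] /= [_ yI' [-> ->]]] E.
  move: yI yI'; rewrite !mem_iota subnKC ?leq_addr// => /andP[_ yK] /andP[_ yK'].
  have := congr1 (fun z => z %/ K)%N E; rewrite !divnMDl// !divn_small// !addn0 => xx.
  by move: E; rewrite xx => /addnI ->.
have D2 : nrm2 P (fun w => sn^-1 * D w) <= (e / 3) ^+ 2.
  rewrite nrm2Z// exprVn sn2.
  have := @nrm2D_le _ _ _ P _ _ (L2_sum l1 ML) (L2_sum (iota (q * K) r) ML).
  rewrite -/D !nrm2_orth ?iota_uniq// size_iota size_allpairs !size_iota /K addKn natrM => hD.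
  have : nrm2 P D <= 2 * s2 * m%:R / K%:R * n.+1%:R + 2 * s2 * K%:R.
    apply: le_trans hD _; apply: lerD.
      have : (q%:R : R) <= n.+1%:R / K%:R by rewrite ler_pdivlMr ?ltr0n// -natrM ler_nat.
      move=> hq; have : 0 <= 2 * s2 * m%:R by rewrite !mulr_ge0.
      by nra.
    have : (r%:R : R) <= K%:R by rewrite ler_nat ltnW.
    by nra.
  move=> hD2; rewrite -(@ler_pM2l _ n.+1%:R)// mulrA divff ?gt_eqF// mul1r.
  apply: le_trans hD2 _.
  have : 2 * s2 * m%:R / K%:R <= (e / 3) ^+ 2 / 2.
    by apply: le_trans hL1; rewrite -!mulrA; do 2 (rewrite ler_wpM2l//).
  move: h2; rewrite ler_pdivrMr// => h2 h4; have := ler_wpM2r (ltW N0) h4; lra.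
pose S w := \sum_(j < q) blk K L j w.
have SL : L2 P S by apply: L2_sum => j; exact: L2_sum.
have SD w : (\sum_(s < n.+1) M s w) / sn = sn^-1 * S w + sn^-1 * D w.
  have -> : \sum_(s < n.+1) M s w = \sum_(s < q * K + r) M s w by rewrite -nE.
  by rewrite (@blk_split K L q r) ?leq_addr// -mulrDr mulrC.
have eD : Eint P (fun w => `|(\sum_(s < n.+1) M s w) / sn - sn^-1 * S w|) <= e / 3.
  rewrite (_ : (fun w => _) = (fun w => `|sn^-1 * D w|)); last first.
    by apply/funext => w; rewrite SD addrC addKr.
  by apply: Eabs_le => //; [exact: L2Z|exact: ltW].
have mT : measurable_fun setT (fun w => (\sum_(s < n.+1) M s w) / sn).
  by apply: measurable_funM => //; exact: (L2mf (L2_sum _ _)).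
have mS : measurable_fun setT (fun w => sn^-1 * S w) by exact: L2mf (L2Z _ SL).
have iTS : intg P (fun w => (\sum_(s < n.+1) M s w) / sn - sn^-1 * S w).
  apply: (intg_eq _ (L2_intg (L2Z sn^-1 DL))) => w; by rewrite SD addrC addKr.
have hc := cosE_near mT mS iTS; have hs := sinE_near mT mS iTS.
move: h1; under eq_fun do rewrite mulrC.
rewrite -Hblk// -/K -/S.
set a := expR (- (q%:R * _ / _)).
have -> : chf P (fun w => sn^-1 * S w) - (a%:C)%C =
    ((cosE P (fun w => sn^-1 * S w) - a) +i* sinE P (fun w => sn^-1 * S w))%C.
  by rewrite /chf; apply/eqP; rewrite eq_complex /= subr0 !eqxx.
move=> h1; have [h1a h1b] := abs_le_normc (cosE P (fun w => sn^-1 * S w) - a) (sinE P (fun w => sn^-1 * S w)).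
have ha : `|a - expR (- (s2 / 2))| <= e / 3.
  apply: le_trans (expRN_lip _ _) _.
  - by rewrite divr_ge0// ?mulr_ge0// divr_ge0// mulr_ge0.
  - by rewrite divr_ge0.
  (* The blocks use [q * L] of the [n.+1] indices; the other [q * m + r] indices make up the missing
     variance. *)
  have -> : q%:R * (L%:R * s2 / 2) / n.+1%:R - s2 / 2 = - (s2 / 2 * ((q * m + r)%N%:R / n.+1%:R)).
    have -> : (q * m + r)%N%:R = n.+1%:R - q%:R * L%:R :> R.
      by rewrite nE /K mulnDr !natrD !natrM; ring.
    by move: N0; move: (n.+1%:R : R) => N N0; field; rewrite gt_eqF.
  rewrite normrN ger0_norm ?mulr_ge0 ?divr_ge0//.
  have : (q * m + r)%N%:R / n.+1%:R <= m%:R / L%:R + K%:R / n.+1%:R :> R.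
    rewrite natrD mulrDl; apply: lerD; last by rewrite ler_wpM2r ?invr_ge0 ?ltW// ltr_nat.
    apply: le_trans mm; rewrite ler_pdivrMr// mulrAC ler_pdivlMr ?ltr0n//.
    by rewrite -!natrM ler_nat mulnAC [leqRHS]mulnC leq_mul2r qK orbT.
  have s22 : 0 <= s2 / 2 by rewrite divr_ge0.
  move=> /(ler_wpM2l s22) h; apply: le_trans h _; rewrite mulrDr.
  have -> : e / 3 = e / 6 + e / 6 by field.
  by apply: lerD; rewrite mulrA.
split.
  rewrite (_ : _ - _ = (cosE P (fun w => (\sum_(s < n.+1) M s w) / sn) - cosE P (fun w => sn^-1 * S w))
     + ((cosE P (fun w => sn^-1 * S w) - a) + (a - expR (- (s2 / 2))))); last by ring.
  apply: le_trans (ler_normD _ _) _; apply: le_trans (lerD (lexx _) (ler_normD _ _)) _.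
  by move: hc hs h1 h1a h1b ha eD; lra.
rewrite (_ : sinE _ _ = (sinE P (fun w => (\sum_(s < n.+1) M s w) / sn) - sinE P (fun w => sn^-1 * S w))
     + sinE P (fun w => sn^-1 * S w)); last by ring.
apply: le_trans (ler_normD _ _) _.
by move: hc hs h1 h1a h1b ha eD; lra.
Unshelve. all: by end_near. Qed.

End MdependentCLT.

(** * From characteristic functions to convergence in distribution *)

Section Bernstein.
Context {R : realType}.
Implicit Types (g : nat -> R) (y : R).

(* the mean of g under the binomial law (N, y), by first-step recursion *)
Fixpoint bern N g y : R :=
  if N is n.+1 then y * bern n (fun k => g k.+1) y + (1 - y) * bern n g y else g 0%N.

Lemma bernD N g1 g2 y : bern N (fun k => g1 k + g2 k) y = bern N g1 y + bern N g2 y.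
Proof. by elim: N g1 g2 => [//|N IH] g1 g2 /=; rewrite !IH; ring. Qed.

Lemma bernZ N a g y : bern N (fun k => a * g k) y = a * bern N g y.
Proof. by elim: N g => [//|N IH] g /=; rewrite !IH; ring. Qed.

Lemma bern_cst N a y : bern N (fun=> a) y = a.
Proof. by elim: N => [//|N IH] /=; rewrite !IH; ring. Qed.

Lemma bern_le N g1 g2 y : 0 <= y <= 1 -> (forall k, g1 k <= g2 k) -> bern N g1 y <= bern N g2 y.
Proof.
move=> /andP[y0 y1]; elim: N g1 g2 => [|N IH] g1 g2 h //=.
by apply: lerD; apply: ler_wpM2l; rewrite ?subr_ge0//; apply: IH => k.
Qed.

(** The centre [c] is free because the recursion shifts it by one; [c = N y] gives the binomial
    variance [N y (1 - y)]. *)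
Lemma bern_sqr N (c : R) y :
  bern N (fun k => (k%:R - c) ^+ 2) y = N%:R * (y * (1 - y)) + (N%:R * y - c) ^+ 2.
Proof.
elim: N c => [|N IH] c /=; first by ring.
have -> : (fun k => (k.+1%:R - c) ^+ 2) = (fun k => (k%:R - (c - 1)) ^+ 2) :> (nat -> R).
  by apply/funext => k; rewrite -natr1; ring.
by rewrite !IH -natr1; ring.
Qed.

Context {h : nat}.
Implicit Types (G : ('I_h -> nat) -> R) (Y : 'I_h -> R) (js : seq 'I_h).

Definition upd (k : 'I_h -> nat) (j : 'I_h) (c : nat) : 'I_h -> nat :=
  fun i => if i == j then c else k i.

(** The mean of [G] under independent binomial coordinates with parameters [Y j], drawn one after
    the other along [js]; [k] stores the values already drawn. *)
Fixpoint mbern N js G Y (k : 'I_h -> nat) : R :=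
  if js is j :: js' then bern N (fun c => mbern N js' G Y (upd k j c)) (Y j) else G k.

Lemma mbernD N js G1 G2 Y k :
  mbern N js (fun k => G1 k + G2 k) Y k = mbern N js G1 Y k + mbern N js G2 Y k.
Proof.
elim: js k => [//|j js IH] k /=; rewrite -bernD; congr bern.
by apply/funext => c; rewrite IH.
Qed.

Lemma mbernZ N js a G Y k : mbern N js (fun k => a * G k) Y k = a * mbern N js G Y k.
Proof.
elim: js k => [//|j js IH] k /=; rewrite -bernZ; congr bern.
by apply/funext => c; rewrite IH.
Qed.

Lemma mbern_cst N js a Y k : mbern N js (fun=> a) Y k = a.
Proof.
elim: js k => [//|j js IH] k /=; rewrite -[RHS](bern_cst N a (Y j)); congr bern.
by apply/funext => c; rewrite IH.
Qed.

Lemma mbern_le N js G1 G2 Y k : (forall i, 0 <= Y i <= 1) -> (forall k, G1 k <= G2 k) ->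
  mbern N js G1 Y k <= mbern N js G2 Y k.
Proof. by move=> Y01 G12; elim: js k => [//|j js IH] k /=; apply: bern_le. Qed.

Lemma mbern_coord_notin N js i (p : nat -> R) Y k : i \notin js ->
  mbern N js (fun k => p (k i)) Y k = p (k i).
Proof.
elim: js k => [//|j js IH] k /=; rewrite inE negb_or => /andP[ij ijs].
rewrite -[RHS](bern_cst N _ (Y j)); congr bern; apply/funext => c.
by rewrite IH// /upd (negbTE ij).
Qed.

Lemma mbern_coord N js i (p : nat -> R) Y k : uniq js -> i \in js ->
  mbern N js (fun k => p (k i)) Y k = bern N p (Y i).
Proof.
elim: js k => [//|j js IH] k /= /andP[jjs us]; rewrite inE => /orP[/eqP ->|ijs].
  by congr bern; apply/funext => c; rewrite mbern_coord_notin// /upd eqxx.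
rewrite -[RHS](bern_cst N _ (Y j)); congr bern; apply/funext => c.
by rewrite IH.
Qed.

Lemma mbern_sum N js (I : Type) (s : seq I) (F : I -> ('I_h -> nat) -> R) Y k :
  mbern N js (fun k => \sum_(i <- s) F i k) Y k = \sum_(i <- s) mbern N js (F i) Y k.
Proof.
elim: s => [|i s IH].
  rewrite big_nil -[RHS](mbern_cst N js 0 Y k); congr mbern.
  by apply/funext => k'; rewrite big_nil.
rewrite big_cons -IH -mbernD; congr mbern.
by apply/funext => k'; rewrite big_cons.
Qed.

End Bernstein.

(** * Uniform approximation by trigonometric polynomials *)

Section TrigPolynomials.
Context {R : realType} {h : nat}.
Notation vec := 'cV[R]_h.

(** The phase [b] brings in the sines, and [a = 0] the constants; the expectation of such a function
    of a random vector is a combination of values of the characteristic function. *)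
Inductive trig : (vec -> R) -> Prop :=
| trig_cos (a : vec) (b : R) : trig (fun x => cos ((a^T *m x) 0 0 + b))
| trig_add p q : trig p -> trig q -> trig (fun x => p x + q x)
| trig_scale c p : trig p -> trig (fun x => c * p x).

Lemma trig_eq p q : p =1 q -> trig p -> trig q.
Proof. by move=> /funext ->. Qed.

Lemma trig_cst c : trig (fun=> c).
Proof.
apply: (trig_eq _ (trig_scale c (trig_cos 0 0))) => x.
by rewrite trmx0 mul0mx mxE addr0 cos0 mulr1.
Qed.

(** The product-to-sum formula makes these functions an algebra, which therefore contains the
    Bernstein polynomials in the sines of the coordinates. *)
Lemma trig_mul p q : trig p -> trig q -> trig (fun x => p x * q x).
Proof.
move=> tp tq; elim: tp => [a b|p1 p2 _ t1 _ t2|c p1 _ t1]; last 2 first.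
- by apply: (trig_eq _ (trig_add t1 t2)) => x; ring.
- by apply: (trig_eq _ (trig_scale c t1)) => x; ring.
elim: tq => [a' b'|q1 q2 _ t1 _ t2|c q1 _ t1]; last 2 first.
- by apply: (trig_eq _ (trig_add t1 t2)) => x; ring.
- by apply: (trig_eq _ (trig_scale c t1)) => x; ring.
apply: (trig_eq _ (trig_scale 2^-1 (trig_add (trig_cos (a + a') (b + b')) (trig_cos (a - a') (b - b'))))) => x.
rewrite linearD linearB /= mulmxDl mulmxBl !mxE.
set A := \sum_(_ < _) _; set A' := \sum_(_ < _) _.
have -> : A + A' + (b + b') = (A + b) + (A' + b') by ring.
have -> : A - A' + (b - b') = (A + b) - (A' + b') by ring.
by rewrite cosD cosB; field.
Qed.

Lemma trig_bern N (F : nat -> vec -> R) (Y : vec -> R) :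
  (forall c, trig (F c)) -> trig Y -> trig (fun x => bern N (fun c => F c x) (Y x)).
Proof.
move=> tF tY; elim: N F tF => [|N IH] F tF /=; first exact: tF.
apply: trig_add; apply: trig_mul => //; [exact: (IH (fun c => F c.+1))| |exact: IH].
by apply: (trig_eq _ (trig_add (trig_cst 1) (trig_scale (-1) tY))) => x; ring.
Qed.

Lemma trig_mbern N js (G : ('I_h -> nat) -> R) (Y : vec -> 'I_h -> R) k :
  (forall i, trig (fun x => Y x i)) -> trig (fun x => mbern N js G (Y x) k).
Proof.
move=> tY; elim: js k => [|j js IH] k /=; first exact: trig_cst.
exact: (@trig_bern N (fun c x => mbern N js G (Y x) (upd k j c))).
Qed.

Lemma trmx_continuous (m n : nat) : continuous (@trmx R m n).
Proof.
move=> x A [U Ux UA]; exists (fun i j => U j i) => [i j|y Uy /=].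
  by have := Ux j i; rewrite mxE.
by apply: UA => i j; rewrite mxE; exact: Uy.
Qed.

Lemma ball_cV (x y : vec) (e : R) : 0 < e ->
  ball x e y <-> forall i, `|x i 0 - y i 0| < e.
Proof. by move=> e0; split=> [[_ H] i|H]; [exact: H|split=> // i j; rewrite (ord1 j); exact: H]. Qed.

(** Only [x] is confined to the box, since the grid points that play the part of [y] may lie outside
    it. Compactness makes the radius common to all [x]. *)
Lemma box_unif (g : vec -> R) (K e : R) : continuous g -> 0 < e ->
  exists2 dl : R, 0 < dl & forall x y : vec, (forall i, `|x i 0| <= K) ->
    (forall i, `|x i 0 - y i 0| < dl) -> `|g x - g y| <= e.
Proof.
move=> cg e0.
have cK : compact [set x : vec | forall i, `|x i 0| <= K].
  have := @rV_compact R h (fun=> `[-K, K]%classic) (fun=> @segment_compact R (-K) K).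
  move=> /(continuous_compact (continuous_subspaceT (@trmx_continuous 1 h))).
  congr compact; apply/seteqP; split => [_ [x xK <-] i|x xK].
    by rewrite mxE ler_norml; have := xK i; rewrite /= in_itv.
  exists x^T; last by rewrite trmxK.
  by move=> i; rewrite /= in_itv/= mxE -ler_norml.
have := (compact_near_coveringP _).1 cK R (0^'+)%R (fun dl x => forall y : vec,
   (forall i, `|x i 0 - y i 0| < dl) -> `|g x - g y| <= e).
case.
  move=> x xK; have e2 : 0 < e / 2 by rewrite divr_gt0.
  have [r /= r0 hr] := (nbhs_ballP _ _).1 ((cvgrPdist_le _ _).1 (cg x) _ e2).
  have r2 : 0 < r / 2 by rewrite divr_gt0.
  exists (ball x (r / 2), [set dl | 0 < dl < r / 2]) => /=.
    split; first exact: nbhsx_ballx.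
    by near=> dl; apply/andP; split; near: dl; [exact: nbhs_right_gt|exact: nbhs_right_lt].
  move=> [x' dl] /= [bx /andP[dl0 dlr]] y xy.
  have bx' : `|g x - g x'| <= e / 2 by apply: hr; apply: le_ball bx; lra.
  have by' : `|g x - g y| <= e / 2.
    apply: hr; apply/ball_cV => // i.
    have h1 := (ball_cV _ _ r2).1 bx i; have h2 := xy i.
    have -> : x i 0 - y i 0 = (x i 0 - x' i 0) + (x' i 0 - y i 0) by ring.
    by rewrite (le_lt_trans (ler_normD _ _))//; lra.
  have -> : g x' - g y = (g x - g y) - (g x - g x') by ring.
  by rewrite (le_trans (ler_normB _ _))//; lra.
move=> dl0 /= dl00 H.
exists (dl0 / 2); first by rewrite divr_gt0.
move=> x y xK xy; apply: (H (dl0 / 2)) => //=.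
- by rewrite sub0r normrN ger0_norm ?divr_ge0// ?ltW//; move: dl00 => /=; lra.
- by rewrite divr_gt0.
Unshelve. all: by end_near. Qed.

(** A step of length [d] within [[-3 pi / 8, 3 pi / 8]] raises the sine by at least
    [d cos (3 pi / 8)]; the cap [pi / 8] on [d] keeps [th - d] and [th + d] in that interval. *)
Lemma asin_near (dl : R) : 0 < dl -> exists2 eta, 0 < eta & forall th y : R,
  `|th| <= pi / 4 -> `|y - sin th| < eta -> `|asin y - th| < dl.
Proof.
move=> dl0; have pi0 : 0 < (pi : R) by exact: pi_gt0.
pose d := Num.min dl (pi / 8); have d0 : 0 < d by rewrite lt_min dl0 divr_gt0.
have d8 : d <= pi / 8 by rewrite ge_min lexx orbT.
have ddl : d <= dl by rewrite ge_min lexx.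
have c0 : 0 < cos (3 * pi / 8 : R) by apply: cos_gt0_pihalf; apply/andP; split; lra.
exists (d * cos (3 * pi / 8)); first exact: mulr_gt0.
move=> th y; rewrite ler_norml => /andP[t1 t2]; rewrite ltr_norml => /andP[y1 y2].
have key (a : R) : - (3 * pi / 8) <= a -> a + d <= 3 * pi / 8 -> d * cos (3 * pi / 8) <= sin (a + d) - sin a.
  move=> a1 a2; have ad : a < a + d by lra.
  have [c /itvP cad ->] := @MVT R sin cos a (a + d) ad (fun z _ => is_derive_sin z)
      (continuous_subspaceT (@continuous_sin R)).
  rewrite addrAC subrr add0r mulrC ler_pM2r//.
  have [c1 c2] : a < c /\ c < a + d by rewrite !cad.
  rewrite -[cos c]cos_norm; have [->|cn] := eqVneq `|c| (3 * pi / 8); first by [].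
  have cc : `|c| < 3 * pi / 8 by rewrite lt_neqAle cn ler_norml; apply/andP; split; lra.
  have nc := normr_ge0 c.
  apply: ltW; rewrite ltr_cos ?in_itv//=; apply/andP; split; lra.
have k1 := key th; have k2 := key (th - d); rewrite subrK in k2.
have s1 : sin (th - d) < y by have := k2 ltac:(lra) ltac:(lra); lra.
have s2 : y < sin (th + d) by have := k1 ltac:(lra) ltac:(lra); lra.
have yI : y \in `[(-1), 1].
  rewrite in_itv/=; apply/andP; split.
    by apply: ltW; apply: le_lt_trans s1; exact: sin_geN1.
  by apply: ltW; apply: lt_le_trans s2 _; exact: sin_le1.
have yI' : -1 <= y <= 1 by move: yI; rewrite in_itv.
have aI : asin y \in `[(- (pi/2)), pi/2] by rewrite in_itv/= asin_geNpi2// asin_lepi2.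
rewrite -(asinK yI) ltr_sin// in s1; last by rewrite in_itv/=; apply/andP; split; lra.
rewrite -(asinK yI) ltr_sin// in s2; last by rewrite in_itv/=; apply/andP; split; lra.
by rewrite ltr_norml; apply/andP; split; lra.
Qed.

(** Bernstein's approximation in the variables [(1 + sin (s x_i)) / 2], with [s K = pi / 4] so that
    the sine is invertible on the box. The operator is a mean of values of [g], so the bound [M]
    survives on the whole space, outside the box as well. *)
Lemma trig_approx (g : vec -> R) (M K e : R) : continuous g -> (forall x, `|g x| <= M) ->
  0 < K -> 0 < e -> exists p, [/\ trig p, forall x, `|p x| <= M &
    forall x : vec, (forall i, `|x i 0| <= K) -> `|p x - g x| <= e].
Proof.
move=> cg gM K0 e0; have M0 : 0 <= M by apply: le_trans (gM 0).
have pi0 : 0 < (pi : R) by exact: pi_gt0.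
have e2 : 0 < e / 2 by rewrite divr_gt0.
have [dl dl0 hdl] := box_unif K cg e2.
pose s : R := pi / 4 / K; have s0 : 0 < s by rewrite !divr_gt0.
have sdl : 0 < s * dl by rewrite mulr_gt0.
have [eta eta0 heta] := asin_near sdl.
pose Y (x : vec) i := (1 + sin (s * x i 0)) / 2.
have Y01 x i : 0 <= Y x i <= 1.
  by rewrite /Y; have := sin_geN1 (s * x i 0); have := sin_le1 (s * x i 0); move=> *; apply/andP; split; lra.
have tY i : trig (fun x => Y x i).
  apply: (trig_eq _ (trig_add (trig_cst 2^-1) (trig_scale 2^-1 (trig_cos (s *: delta_mx i 0) (- (pi / 2)))))) => x.
  rewrite cosBpihalf /Y linearZ/= -scalemxAl mxE trmx_delta -rowE mxE; by field.
(* Chosen so that [C] times the square of a deviation of [eta / 2] pays for the trivial bound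
   [2 M]. *)
pose C := 2 * M / (eta / 2) ^+ 2.
have C0 : 0 <= C by apply: divr_ge0; [exact: mulr_ge0|apply: exprn_ge0; lra].
have [N [N0 hN]] : exists N, (0 < N)%N /\ C * h%:R / N%:R <= e / 2.
  near (\oo : set_system nat) => N; exists N; split; first by near: N; exists 1%N.
  by near: N; exact: near_invn.
have N0' : 0 < N%:R :> R by rewrite ltr0n.
(* The point whose variables [(1 + sin (s x_i)) / 2] are the binomial frequencies [k i / N]. *)
pose v (k : 'I_h -> nat) : vec := \col_i (asin (2 * ((k i)%:R / N%:R) - 1) / s).
pose p x := mbern N (enum 'I_h) (fun k => g (v k)) (Y x) (fun=> 0%N).
exists p; split.
- exact: trig_mbern.
- move=> x; rewrite ler_norml; apply/andP; split.
    rewrite -[leLHS](mbern_cst N (enum 'I_h) (- M) (Y x) (fun=> 0%N)).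
    by apply: mbern_le => // k; have := gM (v k); rewrite ler_norml => /andP[].
  rewrite -[leRHS](mbern_cst N (enum 'I_h) M (Y x) (fun=> 0%N)).
  by apply: mbern_le => // k; have := gM (v k); rewrite ler_norml => /andP[].
- move=> x xK.
  (* Chebyshev's argument: [e / 2] covers the [k] with all frequencies near [Y x], the quadratic
     term covers the others, and its mean is at most [C h / N]. *)
  pose B (k : 'I_h -> nat) := e / 2 + C * \sum_(i <- enum 'I_h) N%:R ^- 2 * ((k i)%:R - N%:R * Y x i) ^+ 2.
  have gB k : `|g (v k) - g x| <= B k.
    have S0 : 0 <= \sum_(i <- enum 'I_h) N%:R ^- 2 * ((k i)%:R - N%:R * Y x i) ^+ 2.
      by apply: sumr_ge0 => i _; rewrite mulr_ge0 ?sqr_ge0// invr_ge0 exprn_ge0// ltW.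
    have [near|] := pselect (forall i, `|(k i)%:R / N%:R - Y x i| < eta / 2).
      apply: (@le_trans _ _ (e / 2)); last by rewrite lerDl mulr_ge0.
      rewrite distrC; apply: hdl => // i.
      have th4 : `|s * x i 0| <= pi / 4.
        rewrite normrM gtr0_norm//; have -> : pi / 4 = s * K by rewrite /s divfK ?gt_eqF.
        by rewrite ler_pM2l.
      have := heta _ (2 * ((k i)%:R / N%:R) - 1) th4.
      have -> : 2 * ((k i)%:R / N%:R) - 1 - sin (s * x i 0) = 2 * ((k i)%:R / N%:R - Y x i) by rewrite /Y; field; rewrite gt_eqF.
      rewrite normrM (@gtr0_norm _ 2)// => /(_ ltac:(have := near i; lra)).
      move=> hh; have -> : x i 0 - v k i 0 = - (s^-1 * (asin (2 * ((k i)%:R / N%:R) - 1) - s * x i 0)).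
        by rewrite /v mxE; field; rewrite gt_eqF.
      by rewrite normrN normrM normfV (gtr0_norm s0) -ltr_pdivlMl ?invr_gt0// invrK.
    move=> /existsNP[i /negP]; rewrite -leNgt => far.
    apply: (@le_trans _ _ (2 * M)).
      by apply: le_trans (ler_normB _ _) _; have := gM (v k); have := gM x; lra.
    rewrite /B -[leLHS]add0r; apply: lerD; first exact: ltW.
    have -> : 2 * M = C * (eta / 2) ^+ 2 by rewrite /C divfK// expf_neq0// mulf_neq0 ?gt_eqF// invr_gt0.
    apply: ler_wpM2l => //; rewrite (bigD1_seq i) ?mem_enum ?enum_uniq//=.
    rewrite -[leLHS]addr0; apply: lerD; last first.
      by apply: sumr_ge0 => j _; rewrite mulr_ge0 ?sqr_ge0// invr_ge0 exprn_ge0// ltW.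
    have -> : N%:R ^- 2 * ((k i)%:R - N%:R * Y x i) ^+ 2 = ((k i)%:R / N%:R - Y x i) ^+ 2.
      by move: N0'; move: (N%:R : R) => N' N0'; field; rewrite gt_eqF.
    by apply: sqr_le_norm; rewrite gtr0_norm// divr_gt0.
  have mB : mbern N (enum 'I_h) B (Y x) (fun=> 0%N) <= e.
    rewrite mbernD mbern_cst mbernZ mbern_sum.
    have : \sum_(i <- enum 'I_h) mbern N (enum 'I_h) (fun k => N%:R ^- 2 * ((k i)%:R - N%:R * Y x i) ^+ 2) (Y x) (fun=> 0%N) <= h%:R / N%:R.
      have -> : h%:R / N%:R = \sum_(i <- enum 'I_h) N%:R^-1 :> R.
        by rewrite -[in LHS](size_enum_ord h) mulr_natl big_const_seq count_predT iter_addr_0.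
      apply: ler_sum => i _.
      rewrite mbernZ (@mbern_coord _ _ N _ i (fun c => (c%:R - N%:R * Y x i) ^+ 2)) ?enum_uniq ?mem_enum//.
      rewrite bern_sqr subrr expr0n addr0.
      have -> : N%:R ^- 2 * (N%:R * (Y x i * (1 - Y x i))) = N%:R^-1 * (Y x i * (1 - Y x i)).
        by move: N0'; move: (N%:R : R) => N' N0'; field; rewrite gt_eqF.
      rewrite ler_piMr ?invr_ge0 ?ltW//; have /andP[] := Y01 x i; nra.
    move=> /(ler_wpM2l C0); move: hN; rewrite mulrA; lra.
  rewrite ler_norml; apply/andP; split.
    have : mbern N (enum 'I_h) (fun k => g x - B k) (Y x) (fun=> 0%N) <= p x.
      apply: mbern_le => // k; have := gB k; rewrite ler_norml => /andP[]; lra.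
    rewrite (_ : (fun k => g x - B k) = (fun k => g x + (-1) * B k)); last by apply/funext => k; ring.
    rewrite mbernD mbern_cst mbernZ; lra.
  have : p x <= mbern N (enum 'I_h) (fun k => g x + B k) (Y x) (fun=> 0%N).
    apply: mbern_le => // k; have := gB k; rewrite ler_norml => /andP[]; lra.
  rewrite mbernD mbern_cst; lra.
Unshelve. all: by end_near. Qed.

End TrigPolynomials.

(** * Tightness and convergence in distribution *)

Section CfToDist.
Context {R : realType} {h : nat}.
Notation vec := 'cV[R]_h.

Section MeasurableVec.
Context {d : measure_display} {O : measurableType d}.

Definition mvec (X : O -> vec) := forall i, measurable_fun setT (fun w => X w i 0).

Lemma measurable_dot (a : vec) (X : O -> vec) : mvec X -> measurable_fun setT (fun w => (a^T *m X w) 0 0).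
Proof.
move=> mX; rewrite (_ : (fun w => _) = fun w => \sum_(i < h) a i 0 * X w i 0); last first.
  by apply/funext => w; rewrite mxE; apply: eq_bigr => i _; rewrite mxE.
by apply: measurable_sum => i; apply: measurable_funM => //; exact: mX.
Qed.

Lemma measurable_trig p (X : O -> vec) : trig p -> mvec X -> measurable_fun setT (fun w => p (X w)).
Proof.
move=> tp mX; elim: tp => [a b|p1 p2 _ m1 _ m2|c p1 _ m1].
- by apply: measurable_cos'; apply: measurable_funD => //; exact: measurable_dot.
- exact: measurable_funD.
- exact: measurable_funM.
Qed.

(** The vector is known to be measurable coordinate by coordinate; [g] composed with it is a
    pointwise limit of trigonometric polynomials that approximate [g] on growing boxes, and those
    are explicitly measurable. *)
Lemma measurable_cont (g : vec -> R) (M : R) (X : O -> vec) : continuous g -> (forall x, `|g x| <= M) ->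
  mvec X -> measurable_fun setT (fun w => g (X w)).
Proof.
move=> cg gM mX.
have /choice[p hp] (n : nat) : exists p : vec -> R, trig p /\
    forall x : vec, (forall i, `|x i 0| <= n.+1%:R) -> `|p x - g x| <= n.+1%:R^-1.
  have n0 : (0 : R) < n.+1%:R by rewrite ltr0n.
  have n0' : (0 : R) < n.+1%:R^-1 by rewrite invr_gt0.
  by have [p [tp _ hp]] := trig_approx cg gM n0 n0'; exists p.
apply: (@measurable_fun_cvg _ _ _ _ (fun n w => p n (X w))).
  by move=> n; apply: measurable_trig => //; exact: (hp n).1.
move=> w _; apply/cvgrPdist_le => e e0; near=> n.
rewrite distrC; apply: (le_trans ((hp n).2 (X w) _)) => [i|].
  apply: (@le_trans _ _ (\sum_i `|X w i 0|)).
    by rewrite (bigD1 i)//= lerDl sumr_ge0.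
  near: n; apply: filterS (nbhs_infty_ger (\sum_i `|X w i 0|)) => n /le_trans; apply.
  by rewrite ler_nat.
near: n; move/cvgrPdist_le: (@cvg_harmonic R) => /(_ _ e0); apply: filterS => n.
by rewrite sub0r normrN /= => /(le_trans (ler_norm _)).
Unshelve. all: by end_near. Qed.

Lemma measurable_tail (Z : O -> R) (K : R) : measurable_fun setT Z -> measurable [set w | K < `|Z w|].
Proof.
move=> mZ; rewrite (_ : mkset _ = ~` (setT `&` [set w | `|Z w| <= K])); last first.
  by rewrite setTI; apply/seteqP; split=> w /= => [h1 h2|/negP]; [have := lt_le_trans h1 h2; rewrite ltxx|rewrite -ltNge].
by apply: measurableC; apply: measurable_fun_le => //; exact: measurableT_comp.
Qed.

Definition tailE (P : probability O R) (Z : O -> R) (K : R) : R := Eint P \1_[set w | K < `|Z w|].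

Lemma intg_tail (P : probability O R) (Z : O -> R) (K : R) : measurable_fun setT Z -> intg P \1_[set w | K < `|Z w|].
Proof. by move=> mZ; apply: integrable_indic; exact: measurable_tail. Qed.

Lemma tailE_mono (P : probability O R) (Z : O -> R) (K K' : R) : measurable_fun setT Z ->
  K <= K' -> tailE P Z K' <= tailE P Z K.
Proof.
move=> mZ KK; apply: Eint_le; [exact: intg_tail|exact: intg_tail|move=> w].
rewrite !indicE; case: (boolP (w \in [set w | K' < `|Z w|])) => // /set_mem /= h1.
by rewrite mem_set//=; exact: le_lt_trans h1.
Qed.

Lemma tail_tight (P : probability O R) (Z : O -> R) (e : R) : measurable_fun setT Z -> 0 < e ->
  exists K, tailE P Z K <= e.
Proof.
move=> mZ e0.
have : (fun n => tailE P Z n%:R) @ \oo --> Eint P (fun=> 0).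
  apply: (@Eint_dom _ _ _ _ _ (fun=> 1)) => //.
  - by move=> n; apply: measurable_indic; exact: measurable_tail.
  - exact: intg_cst.
  - by move=> n w; rewrite indicE; case: (_ \in _); rewrite ?normr1 ?normr0.
  move=> w; apply/cvgrPdist_le => e' e'0.
  apply: filterS (nbhs_infty_ger `|Z w|) => n hn.
  rewrite indicE memNset ?subrr ?normr0 ?ltW//= => h1.
  by have := lt_le_trans h1 hn; rewrite ltxx.
rewrite Eint_cst => /cvgrPdist_le/(_ _ e0) [N _ /(_ N (leqnn N))] /=.
by rewrite sub0r normrN => /(le_trans (ler_norm _)) h1; exists N%:R.
Qed.

Lemma Eint_box (P : probability O R) (X : O -> vec) (g p : vec -> R) (M K e : R) :
  mvec X -> measurable_fun setT (fun w => g (X w)) -> measurable_fun setT (fun w => p (X w)) ->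
  (forall x, `|g x| <= M) -> (forall x, `|p x| <= M) -> 0 <= e ->
  (forall x : vec, (forall i, `|x i 0| <= K) -> `|p x - g x| <= e) ->
  `|Eint P (fun w => p (X w)) - Eint P (fun w => g (X w))| <=
    e + 2 * M * \sum_i tailE P (fun w => X w i 0) K.
Proof.
move=> mX mg mp gM pM e0 pg.
have ig : intg P (fun w => g (X w)) by exact: (@intg_bounded _ _ _ P _ M mg).
have ip : intg P (fun w => p (X w)) by exact: (@intg_bounded _ _ _ P _ M mp).
rewrite -EintB//; apply: le_trans (Eint_norm _) _; first exact: intgB.
have iS : intg P (fun w => \sum_(i < h) \1_[set w | K < `|X w i 0|] w).
  by apply: intg_sum => i; exact: intg_tail.
apply: (@le_trans _ _ (Eint P (fun w => e + 2 * M * \sum_(i < h) \1_[set w | K < `|X w i 0|] w))).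
  apply: Eint_le; first exact/intg_norm/intgB.
    by apply: intgD; [exact: intg_cst|exact: intgZ].
  move=> w; have M0 : 0 <= M by exact: le_trans (gM 0).
  have S0 : 0 <= \sum_(i < h) (\1_[set w | K < `|X w i 0|] w : R) by apply: sumr_ge0.
  have [inb|] := pselect (forall i, `|X w i 0| <= K).
    by rewrite -[leLHS]addr0 lerD ?pg// !mulr_ge0.
  move=> /existsNP[i /negP]; rewrite -ltNge => far.
  rewrite -[leLHS]add0r lerD// (bigD1 i)//= indicE mem_set//= mulrDr mulr1.
  rewrite -[leLHS]addr0 lerD//.
    by rewrite (le_trans (ler_normB _ _))//; have := gM (X w); have := pM (X w); lra.
  by rewrite !mulr_ge0// sumr_ge0.
rewrite EintD; [|exact: intg_cst|exact: intgZ].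
rewrite Eint_cst EintZ// Eint_sum//; by move=> i; exact: intg_tail.
Qed.

End MeasurableVec.

(** A continuity theorem with a given limit [Y] and a tight sequence: means of trigonometric
    polynomials converge by the hypotheses on [cosE] and [sinE], and one box large enough for [Y]
    and for almost all [X n] controls the replacement of [g]. *)
Lemma cf_cvg_dist {d} {O : measurableType d} (P : probability O R)
   {d'} {O' : measurableType d'} (P' : probability O' R) (X : nat -> O -> vec) (Y : O' -> vec) :
  (forall n, mvec (X n)) -> mvec Y ->
  (forall a : vec, (fun n => cosE P (fun w => (a^T *m X n w) 0 0)) @ \oo --> cosE P' (fun w => (a^T *m Y w) 0 0)) ->
  (forall a : vec, (fun n => sinE P (fun w => (a^T *m X n w) 0 0)) @ \oo --> sinE P' (fun w => (a^T *m Y w) 0 0)) ->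
  (forall i e, 0 < e -> exists K, \forall n \near \oo, tailE P (fun w => X n w i 0) K <= e) ->
  forall (g : vec -> R) (M : R), continuous g -> (forall x, `|g x| <= M) ->
  (fun n => Eint P (fun w => g (X n w))) @ \oo --> Eint P' (fun w => g (Y w)).
Proof.
move=> mX mY cX sX tX g M cg gM.
have M0 : 0 <= M by exact: le_trans (gM 0).
have tcvg p : trig p -> (fun n => Eint P (fun w => p (X n w))) @ \oo --> Eint P' (fun w => p (Y w)).
  have itrig d0 (O0 : measurableType d0) (Q : probability O0 R) (Z : O0 -> vec) q : trig q -> mvec Z -> intg Q (fun w => q (Z w)).
    move=> tq mZ; elim: tq => [a b|q1 q2 _ m1 _ m2|c q1 _ m1].
    - by apply: intg_cos; apply: measurable_funD => //; exact: measurable_dot.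
    - exact: intgD.
    - exact: intgZ.
  elim => [a b|p1 p2 t1 c1 t2 c2|c p1 t1 c1].
  - have e d0 (O0 : measurableType d0) (Q : probability O0 R) (Z : O0 -> vec) : mvec Z ->
      Eint Q (fun w => cos ((a^T *m Z w) 0 0 + b)) = cos b * cosE Q (fun w => (a^T *m Z w) 0 0) + (- sin b) * sinE Q (fun w => (a^T *m Z w) 0 0).
      move=> mZ; have i1 := intg_cos Q (measurable_dot a mZ); have i2 := intg_sin Q (measurable_dot a mZ).
      rewrite -!EintZ// -EintD; [|exact: intgZ|exact: intgZ].
      by congr Eint; apply/funext => w; rewrite cosD; ring.
    under eq_fun do rewrite e//.
    by rewrite e//; apply: cvgD; apply: cvgMr; [exact: cX|exact: sX].
  - have e n : Eint P (fun w => p1 (X n w) + p2 (X n w)) = Eint P (fun w => p1 (X n w)) + Eint P (fun w => p2 (X n w)).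
      by rewrite EintD//; exact: itrig.
    under eq_fun do rewrite e.
    by rewrite EintD; [exact: cvgD|exact: itrig|exact: itrig].
  - have e n : Eint P (fun w => c * p1 (X n w)) = c * Eint P (fun w => p1 (X n w)).
      by rewrite EintZ//; exact: itrig.
    under eq_fun do rewrite e.
    by rewrite EintZ; [exact: cvgMr|exact: itrig].
apply/cvgrPdist_le => e e0.
(* Chosen so that the error [dl] on the box and the [h] tails, each at most [dl] and weighted by
   [2 M], add up to [e / 3]. *)
pose dl := e / (3 * (1 + 2 * M * h%:R)).
have D0 : 0 < 1 + 2 * M * h%:R by rewrite ltr_pwDl// !mulr_ge0.
have dl0 : 0 < dl by rewrite divr_gt0// mulr_gt0.
have /choice[K hK] i := tX i _ dl0.
have /choice[K' hK'] i := tail_tight P' (mY i) dl0.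
pose KK : R := 1 + \sum_i (`|K i| + `|K' i|).
have KKi i : K i <= KK /\ K' i <= KK.
  have : `|K i| + `|K' i| <= \sum_i (`|K i| + `|K' i|).
    by rewrite (bigD1 i)//= lerDl sumr_ge0// => j _; rewrite addr_ge0.
  rewrite /KK; have := ler_norm (K i); have := ler_norm (K' i).
  have := normr_ge0 (K i); have := normr_ge0 (K' i); split; lra.
have KK0 : 0 < KK by rewrite /KK ltr_pwDl// sumr_ge0// => j _; rewrite addr_ge0.
have [p [tp pM pg]] := trig_approx cg gM KK0 dl0.
have tot : dl + 2 * M * (h%:R * dl) = e / 3.
  have -> : dl + 2 * M * (h%:R * dl) = (1 + 2 * M * h%:R) * dl by ring.
  by rewrite /dl; field; rewrite gt_eqF.
have bY : `|Eint P' (fun w => p (Y w)) - Eint P' (fun w => g (Y w))| <= e / 3.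
  apply: le_trans (Eint_box _ mY _ _ gM pM (ltW dl0) pg) _.
  - exact: measurable_cont cg gM mY.
  - exact: measurable_trig.
  rewrite -tot lerD2l ler_wpM2l ?mulr_ge0//.
  apply: (@le_trans _ _ (\sum_(i < h) dl)); last by rewrite sumr_const card_ord mulr_natl.
  by apply: ler_sum => i _; apply: le_trans (hK' i); apply: tailE_mono => //; exact: (KKi i).2.
have e3 : 0 < e / 3 by rewrite divr_gt0.
near=> n.
have bX : `|Eint P (fun w => p (X n w)) - Eint P (fun w => g (X n w))| <= e / 3.
  apply: le_trans (Eint_box _ (mX n) _ _ gM pM (ltW dl0) pg) _.
  - exact: measurable_cont cg gM (mX n).
  - exact: measurable_trig.
  rewrite -tot lerD2l ler_wpM2l ?mulr_ge0//.
  apply: (@le_trans _ _ (\sum_(i < h) dl)); last by rewrite sumr_const card_ord mulr_natl.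
  have hKn : forall i, tailE P (fun w => X n w i 0) (K i) <= dl by near: n; exact: filter_forall.
  by apply: ler_sum => i _; apply: le_trans (hKn i); apply: tailE_mono => //; [exact: mX|exact: (KKi i).1].
have bp : `|Eint P' (fun w => p (Y w)) - Eint P (fun w => p (X n w))| <= e / 3.
  by near: n; move/cvgrPdist_le: (tcvg p tp); exact.
move: bY bX bp; rewrite !ler_norml => /andP[? ?] /andP[? ?] /andP[? ?]; apply/andP; split; lra.
Unshelve. all: by end_near. Qed.

End CfToDist.

(** * Integration against a density *)

Section DensityIntegral.
Import HBNNSimple.
Context {R : realType} {d : measure_display} {T : measurableType d}
  (m nu : {measure set T -> \bar R}) (g : T -> R).
Context (mg : measurable_fun setT g) (g0 : forall x, 0 <= g x)
  (nuE : forall A, measurable A -> (nu A = \int[m]_(x in A) (g x)%:E)%E).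
Local Open Scope ereal_scope.

Lemma ge0_integral_density (f : T -> \bar R) : measurable_fun setT f -> (forall x, 0 <= f x) ->
  \int[nu]_x f x = \int[m]_x (f x * (g x)%:E).
Proof.
move=> mf f0; pose a := nnsfun_approx measurableT mf.
have acvg x : (EFin \o a ^~ x) @ \oo --> f x by exact: cvg_nnsfun_approx.
have and_ x : nondecreasing_seq (fun n => (a n x)%:E).
  by move=> i j ij; rewrite lee_fin; have /lefP := nd_nnsfun_approx measurableT mf ij; exact.
have an n : \int[nu]_x (a n x)%:E = \int[m]_x ((a n x)%:E * (g x)%:E).
  have key : \int[m]_x ((a n x)%:E * (g x)%:E) =
      \sum_(k \in range (a n)) \int[m]_x ((k * \1_(a n @^-1` [set k]) x)%:E * (g x)%:E).
    rewrite -ge0_integral_fsum//.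
    - apply: eq_integral => x _; rewrite fimfunE -fsumEFin// ge0_mule_fsuml//.
      by move=> r; rewrite lee_fin; exact: (nnfun_muleindic_ge0 (a n) r x) || exact: nnfun_muleindic_ge0.
    - move=> r; apply: emeasurable_funM; apply/measurable_EFinP => //.
      by apply: measurable_funM => //; exact: measurable_indic.
    - move=> r x _; apply: mule_ge0; last by rewrite lee_fin.
      exact: nnfun_muleindic_ge0.
  rewrite key integralT_nnsfun sintegralE; apply: eq_fsbigr => k kr.
  have k0 : (0 <= k)%R by move: kr => /set_mem [x _ <-].
  have mk : measurable (a n @^-1` [set k]) by [].
  rewrite nuE// (integral_mkcond (a n @^-1` [set k])) -ge0_integralZl//.
  - apply: eq_integral => x _; rewrite patchE indicE.
    by case: (x \in _); rewrite ?mulr1 ?mulr0 ?mul0e ?mule0.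
  - by apply: (measurable_restrictT _ _).1 => //; apply/measurable_EFinP; exact: measurable_funTS.
  - by move=> x _; rewrite patchE; case: ifP => // _; rewrite lee_fin.
transitivity (limn (fun n => \int[nu]_x (a n x)%:E)).
  rewrite -monotone_convergence//.
  - by apply: eq_integral => x _; apply/esym/cvg_lim => //; exact: acvg.
  - by move=> n; exact/measurable_EFinP.
  - by move=> n x _; rewrite lee_fin.
under eq_fun do rewrite an.
rewrite -monotone_convergence//.
- apply: eq_integral => x _; apply/cvg_lim => //.
  by apply: cvgeZr => //; exact: acvg.
- by move=> n; apply: emeasurable_funM; exact/measurable_EFinP.
- by move=> n x _; rewrite mule_ge0// lee_fin.
- by move=> x _ i j ij; rewrite lee_wpmul2r ?lee_fin//; have /lefP := nd_nnsfun_approx measurableT mf ij; exact.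
Qed.

Lemma integral_density (f : T -> \bar R) : measurable_fun setT f ->
  \int[nu]_x f x = \int[m]_x (f x * (g x)%:E).
Proof.
move=> mf; rewrite integralE [RHS]integralE !ge0_integral_density//; try exact: measurable_funepos; try exact: measurable_funeneg.
congr (_ - _); apply: eq_integral => x _; rewrite ?funeposE ?funenegE.
  have [fx|/ltW fx] := leP 0 (f x).
    by rewrite (max_idPl _)// mule_ge0// lee_fin.
  by rewrite (max_idPr _) ?mul0e// mule_le0_ge0// lee_fin.
rewrite -mulNe; have [fx|/ltW fx] := leP 0 (- f x).
  by rewrite (max_idPl _)// mule_ge0// lee_fin.
by rewrite (max_idPr _) ?mul0e// mule_le0_ge0// lee_fin.
Qed.

End DensityIntegral.

(** * Gaussian vectors *)

Section NormalCF.
Context {R : realType}.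
Local Notation leb := (@lebesgue_measure R).
Local Notation RR := (measurableTypeR R).

Definition gker (x : R) : R := expR (- (x ^+ 2 / 2)).

Let pk : R := normal_peak 1.

Lemma normal_pdf_gker x : normal_pdf 0 1 x = pk * gker x.
Proof.
rewrite normal_pdfE ?oner_neq0//= /normal_fun subr0 expr1n /gker.
by congr (_ * expR _); rewrite -mulr_natl mulr1 mulNr.
Qed.

Let pk0 : 0 < pk. Proof. exact: normal_peak_gt0 (oner_neq0 _). Qed.

Lemma intg_gker : intg leb gker.
Proof.
have := @integrable_normal_pdf R 0 1.
move=> /(intgZ pk^-1); apply: intg_eq => x.
by rewrite normal_pdf_gker mulrA mulVf ?mul1r// gt_eqF.
Qed.

Lemma gker_ge0 x : 0 <= gker x. Proof. exact: expR_ge0. Qed.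

Lemma intg_absx_gker : intg leb (fun x => `|x| * gker x).
Proof.
have s2 : Num.sqrt 2 != 0 :> R by rewrite gt_eqF// sqrtr_gt0.
have i2 := @integrable_normal_pdf R 0 (Num.sqrt 2).
(* The function is at most [2 e^(- x^2 / 4)], a multiple of the normal density of variance 2. *)
apply: (@intg_le R _ RR leb _ (fun x => (2 * (normal_peak (Num.sqrt 2))^-1) * normal_pdf 0 (Num.sqrt 2) x)); last exact: intgZ.
  apply: measurable_funM; first by apply: continuous_measurable_fun; exact: norm_continuous.
  exact: intgmf intg_gker.
move=> x; rewrite normrM normr_id (ger0_norm (gker_ge0 x)).
rewrite normal_pdfE//= /normal_fun subr0 sqr_sqrtr// mulrA mulfVK ?gt_eqF ?normal_peak_gt0//.
have -> : gker x = expR (- (x ^+ 2 / 4)) * expR (- (x ^+ 2 / 4)) by rewrite -expRD /gker; congr expR; field.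
have -> : - x ^+ 2 / (2 *+ 2) = - (x ^+ 2 / 4) by rewrite -mulr_natl -natrM mulNr.
rewrite mulrA ler_wpM2r ?expR_ge0// expRN ler_pdivrMr ?expR_gt0//.
have h1 := expR_ge1Dx (x ^+ 2 / 4).
have := sqr_ge0 (`|x| / 2 - 1); have := sqr_norm x; nra.
Qed.

Lemma is_derive_gker (x : R) : is_derive x (1 : R) gker (- x * gker x).
Proof.
have h : is_derive x (1:R) (fun z : R => - (z ^+ 2 / 2)) (- x).
  apply: is_derive_eq.
  by rewrite /GRing.scale/=; field.
have h2 := @is_derive1_comp R expR (fun z : R => - (z ^+ 2 / 2)) x _ _ (is_derive_expR _) h.
by apply: is_derive_eq h2 _; rewrite mulrC.
Qed.

Section Fixed.
Context (b : R).

Let k (t x : R) := cos (t * x + b) * gker x.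

Let k_bound t x : `|k t x| <= gker x.
Proof. by rewrite /k normrM (ger0_norm (gker_ge0 x)) ler_piMl ?gker_ge0// cos_max. Qed.

Let mk t : measurable_fun [set: RR] (k t).
Proof.
apply: measurable_funM; last exact: intgmf intg_gker.
by apply: measurable_cos'; apply: measurable_funD.
Qed.

Let ik t : intg leb (k t).
Proof. by apply: intg_le (mk t) (k_bound t) intg_gker. Qed.

Let sk (t x : R) := sin (t * x + b) * gker x.

Let sk_bound t x : `|sk t x| <= gker x.
Proof. by rewrite /sk normrM (ger0_norm (gker_ge0 x)) ler_piMl ?gker_ge0// sin_max. Qed.

Let msk t : measurable_fun [set: RR] (sk t).
Proof.
apply: measurable_funM; last exact: intgmf intg_gker.
by apply: measurable_sin'; apply: measurable_funD.
Qed.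

Let ixsk t : intg leb (fun x => x * sk t x).
Proof.
apply: intg_le intg_absx_gker; first exact: measurable_funM.
by move=> x; rewrite normrM ler_wpM2l.
Qed.

Let dk t x : is_derive t (1:R) (fun t => k t x) (- (x * sk t x)).
Proof.
have h : is_derive t (1:R) (fun t : R => t * x + b) x by apply: is_derive_eq; rewrite /GRing.scale/=; ring.
have h2 := @is_derive1_comp R cos (fun t : R => t * x + b) t _ _ (is_derive_cos _) h.
have h3 := is_deriveM h2 (is_derive_cst (gker x) t (1:R)).
by apply: is_derive_eq h3 _; rewrite /GRing.scale/= /sk; ring.
Qed.

Let dsk t x : is_derive x (1:R) (sk t) (t * k t x - x * sk t x).
Proof.
have h : is_derive x (1:R) (fun x : R => t * x + b) t by apply: is_derive_eq; rewrite /GRing.scale/=; ring.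
have h2 := @is_derive1_comp R sin (fun x : R => t * x + b) x _ _ (is_derive_sin _) h.
have h3 := is_deriveM h2 (is_derive_gker x).
by apply: is_derive_eq h3 _; rewrite /GRing.scale/= /sk /k; ring.
Qed.

Let gker_cvg0 : (fun n => gker n%:R) @ \oo --> (0 : R).
Proof.
apply/cvgrPdist_le => e e0; near=> n.
rewrite sub0r normrN ger0_norm ?gker_ge0// /gker expRN.
have : (2 : R) / n%:R <= e by near: n; exact: near_invn.
have n0 : (0 < n)%N by near: n; exists 1%N.
have n0' : (1 : R) <= n%:R by rewrite ler1n.
move=> /(le_trans _); apply; rewrite -[leRHS]invrK lef_pV2 ?posrE ?expR_gt0 ?invr_gt0 ?divr_gt0 ?ltr0n//.
rewrite invf_div; have := expR_ge1Dx ((n%:R : R) ^+ 2 / 2); nra.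
Unshelve. all: by end_near. Qed.

Let csk t : continuous (sk t).
Proof.
by move=> x; apply: differentiable_continuous; apply/derivable1_diffP; case: (dsk t x).
Qed.

(** Integration by parts: the integrand is the derivative of [sk t], which vanishes at both ends of
    the line. *)
Let total t : Eint leb (fun x => t * k t x - x * sk t x) = 0.
Proof.
set D := (fun x => _).
have iD : intg leb D by apply: intgB; [exact: intgZ|exact: ixsk].
have cD : continuous D.
  move=> x; apply: differentiable_continuous; apply/derivable1_diffP.
  rewrite /D /k /sk.
  have h : is_derive x (1:R) (fun x : R => t * x + b) t by apply: is_derive_eq; rewrite /GRing.scale/=; ring.
  have h2 := @is_derive1_comp R sin (fun x : R => t * x + b) x _ _ (is_derive_sin _) h.
  have h3 := @is_derive1_comp R cos (fun x : R => t * x + b) x _ _ (is_derive_cos _) h.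
  have h4 := is_derive_gker x.
  by apply: derivableB; [apply: derivableM => //; case: (is_deriveM h3 h4)|
    apply: derivableM => //; case: (is_deriveM h2 h4)].
have half (n : nat) : Eint leb (fun x => \1_(`[- n.+1%:R, n.+1%:R]%classic) x * D x) = sk t n.+1%:R - sk t (- n.+1%:R).
  rewrite /Eint /Rintegral.
  have ab : (- n.+1%:R : R) < n.+1%:R by rewrite -subr_gt0 opprK addr_gt0// ltr0n.
  have := @continuous_FTC2 R D (sk t) _ _ ab (continuous_subspaceT cD).
  move=> ftc.
  have -> : (\int[leb]_x (\1_(`[(- n.+1%:R)%R, n.+1%:R]%classic) x * D x)%:E = \int[leb]_(x in `[(- n.+1%:R)%R, n.+1%:R]) (D x)%:E)%E.
    rewrite [RHS]integral_mkcond; apply: eq_integral => x _; rewrite patchE indicE.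
    by case: ifP => _; rewrite ?mul1r ?mul0r.
  rewrite ftc//.
    split; first by move=> x _; case: (dsk t x).
      by apply: cvg_at_right_filter; exact: csk.
    by apply: cvg_at_left_filter; exact: csk.
  by move=> x _; have [_ hd] := dsk t x; rewrite derive1E hd.
have c1 : (fun n : nat => Eint leb (fun x => \1_(`[- n.+1%:R, n.+1%:R]%classic) x * D x)) @ \oo --> Eint leb D.
  have mI n : measurable_fun [set: RR] (fun x : R => \1_(`[- n.+1%:R, n.+1%:R]%classic) x * D x).
    by apply: measurable_funM; [exact: measurable_indic|exact: intgmf iD].
  have c x : (\1_(`[- n.+1%:R, n.+1%:R]%classic) x * D x)%:E @[n --> \oo] --> (D x)%:E.
    apply: cvg_EFin; first exact: nearW.
    apply/cvgrPdist_le => e e0; near=> n => /=; rewrite indicE mem_set ?mul1r ?subrr ?normr0 ?ltW//=.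
    rewrite in_itv/= -ler_norml; apply: (@le_trans _ _ n%:R); last by rewrite ler_nat.
    by near: n; exact: nbhs_infty_ger.
  have bd n x : (`|(\1_(`[- n.+1%:R, n.+1%:R]%classic) x * D x)%:E| <= (`|D x|)%:E)%E.
    by rewrite /= lee_fin normrM indicE; case: (_ \in _); rewrite ?normr1 ?normr0 ?mul1r ?mul0r//.
  have [h1 _ h2] := @dominated_convergence _ _ _ leb setT measurableT (fun n x => (\1_(`[- n.+1%:R, n.+1%:R]%classic) x * D x)%:E)
    (EFin \o D) (fun x => (`|D x|)%:E) (fun n => (measurable_EFinP _ _).2 (mI n)) ((measurable_EFinP _ _).2 (intgmf iD))
    (aeW leb (fun x _ => c x)) (intg_norm iD) (aeW leb (fun x n _ => bd n x)).
  by move: h2; rewrite (intg_fin h1) => /fine_cvg.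
have c2 : (fun n : nat => Eint leb (fun x => \1_(`[- n.+1%:R, n.+1%:R]%classic) x * D x)) @ \oo --> (0 : R).
  under eq_fun do rewrite half.
  apply/cvgrPdist_le => e e0.
  have e2 : 0 < e / 2 by rewrite divr_gt0.
  have gs : \forall n \near \oo, `|0 - gker n.+1%:R| <= e / 2.
    have := gker_cvg0; rewrite -(cvg_shiftS (fun n => gker n%:R)) => /cvgrPdist_le /(_ _ e2).
    by apply: filterS => n.
  near=> n.
  rewrite sub0r normrN (le_trans (ler_normB _ _))//.
  have h1 := sk_bound t n.+1%:R; have h2 := sk_bound t (- n.+1%:R).
  have h3 : gker (- n.+1%:R) = gker n.+1%:R by rewrite /gker sqrrN.
  have : gker n.+1%:R <= e / 2.
    have : `|0 - gker n.+1%:R| <= e / 2 by near: n.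
    by rewrite sub0r normrN ger0_norm// gker_ge0.
  by rewrite h3 in h2; lra.
exact: (cvg_unique _ c1 c2).
Unshelve. all: by end_near. Qed.

Let C (t : R) := Eint leb (k t).

(** Differentiation under the integral produces [- x * sk t x], and [total] turns its integral into
    [- t * C t]. *)
Let dC t : is_derive t (1:R) C (- t * C t).
Proof.
have tI : `]t - 1, t + 1[%classic t by rewrite /= in_itv/=; apply/andP; split; lra.
have di (x y : R) : derivable (k^~ y) x 1 by by case: (dk x y).
have p1 x y : partial1of2 k x y = - (y * sk x y).
  by have [_ hd] := dk x y; rewrite /partial1of2 derive1E hd.
have G0 y : 0 <= `|y| * gker y by rewrite mulr_ge0// gker_ge0.
have bd x y : `|partial1of2 k x y| <= `|y| * gker y by rewrite p1 normrN normrM ler_wpM2l.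
have h1 := @differentiation_under_integral R _ _ leb k setT measurableT t _ _ tI (fun x _ => ik x)
  (fun x y _ _ => di x y) _ G0 intg_absx_gker (fun x y _ _ => bd x y).
have h2 := @derivable_under_integral R _ _ leb k setT measurableT t _ _ tI (fun x _ => ik x)
  (fun x y _ _ => di x y) _ G0 intg_absx_gker (fun x y _ _ => bd x y).
apply: DeriveDef; first exact: h2.
rewrite -derive1E h1.
have -> : \int[leb]_y partial1of2 k t y = Eint leb (fun y => (-1) * (y * sk t y)).
  by congr Rintegral; apply/funext => y; rewrite p1 mulN1r.
rewrite EintZ; last exact: ixsk.
have := total t; rewrite EintB; [|exact: intgZ|exact: ixsk].
by rewrite EintZ// /C => h3; lra.
Qed.

(** By [dC] the product of [C t] with [e^(t^2 / 2)] has zero derivative. The free phase [b] treats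
    the real and the imaginary part of the characteristic function together. *)
Lemma gker_cf t : Eint leb (k t) = expR (- (t ^+ 2 / 2)) * (cos b * Eint leb gker).
Proof.
pose H (t : R) := C t * expR (t ^+ 2 / 2).
have dH (x : R) : is_derive x (1:R) H 0.
  have h : is_derive x (1:R) (fun z : R => z ^+ 2 / 2) x.
    by apply: is_derive_eq; rewrite /GRing.scale/=; field.
  have h2 := @is_derive1_comp R expR (fun z : R => z ^+ 2 / 2) x _ _ (is_derive_expR _) h.
  have h3 := is_deriveM (dC x) h2.
  by apply: is_derive_eq h3 _; rewrite /GRing.scale/=; ring.
have : H t = H 0 by exact: is_derive_0_is_cst.
rewrite /H expr0n/= mul0r expR0 mulr1 => hh.
have -> : Eint leb (k t) = C t * expR (t ^+ 2 / 2) * expR (- (t ^+ 2 / 2)).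
  by rewrite -mulrA -expRD subrr expR0 mulr1.
rewrite hh mulrC; congr (_ * _); rewrite /C -EintZ; last exact: intg_gker.
by congr Eint; apply/funext => x; rewrite /k mul0r add0r.
Qed.

End Fixed.

Lemma normal_cf (t b : R) :
  Eint (normal_prob 0 1) (fun x : R => cos (t * x + b)) = expR (- (t ^+ 2 / 2)) * cos b.
Proof.
have mc : measurable_fun [set: RR] (fun x : R => cos (t * x + b)) by apply: measurable_cos'; apply: measurable_funD.
have tot : Eint leb gker = pk^-1.
  have : Eint leb (normal_pdf 0 1) = 1.
    by rewrite /Eint /Rintegral integral_normal_pdf.
  rewrite (_ : normal_pdf 0 1 = fun x => pk * gker x); last by apply/funext => x; rewrite normal_pdf_gker.
  rewrite EintZ; last exact: intg_gker.
  by move=> h; apply: (mulfI (lt0r_neq0 pk0)); rewrite h mulfV// gt_eqF.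
transitivity (Eint leb (fun x => pk * (cos (t * x + b) * gker x))).
  rewrite /Eint /Rintegral; congr fine.
  rewrite (@integral_density _ _ _ leb (normal_prob 0 1) (normal_pdf 0 1))//.
  - by apply: eq_integral => x _; rewrite -EFinM normal_pdf_gker; congr EFin; ring.
  - exact: measurable_normal_pdf.
  - by move=> x; exact: normal_pdf_ge0.
  - exact/measurable_EFinP.
rewrite EintZ ?gker_cf ?tot.
  by move: (lt0r_neq0 pk0) => p0; field.
apply: intg_le intg_gker; last first.
  by move=> x; rewrite normrM (ger0_norm (gker_ge0 x)) ler_piMl ?gker_ge0// cos_max.
by apply: measurable_funM => //; exact: intgmf intg_gker.
Qed.

End NormalCF.

Section GaussianVector.
Context {R : realType}.

(** The phase [b] carries the induction: after integrating the new coordinate by [normal_cf], the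
    contribution of the others is part of the phase. *)
Lemma std_gauss_exists (n : nat) : exists (d : measure_display) (O : measurableType d)
  (P : probability O R) (Z : O -> 'cV[R]_n), mvec Z /\
   forall (a : 'cV[R]_n) (b : R), Eint P (fun w => cos ((a^T *m Z w) 0 0 + b)) =
      expR (- ((a^T *m a) 0 0 / 2)) * cos b.
Proof.
elim: n => [|n [d [ O [P [Z [mZ Zcf]]]]]].
  exists _, (measurableTypeR R), (normal_prob 0 1), (fun=> 0); split=> [[]//|a b].
  rewrite (_ : (fun w => _) = fun=> cos b); last first.
    by apply/funext => w; rewrite mulmx0 mxE add0r.
  by rewrite Eint_cst (_ : a^T *m a = 0) ?mxE ?mul0r ?oppr0 ?expR0 ?mul1r//; apply/matrixP => i j; rewrite !mxE big_ord0.
pose N := normal_prob (0 : R) 1.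
pose W (w : O * measurableTypeR R) : 'cV[R]_(n.+1) := col_mx (const_mx w.2 : 'cV[R]_1) (Z w.1).
have mW : mvec W.
  move=> i; rewrite /W; have [j ->|j ->] := split_ordP (i : 'I_(1 + n)).
    rewrite (_ : (fun w => _) = snd); first exact: measurable_snd.
    by apply/funext => w; rewrite (@col_mxEu R 1 n 1) mxE.
  rewrite (_ : (fun w => _) = fun w => Z w.1 j 0); last by apply/funext => w; rewrite (@col_mxEd R 1 n 1).
  exact: (measurableT_comp (mZ j) measurable_fst).
exists _, (O * measurableTypeR R)%type, (P \x N)%E, W; split=> // a b.
pose a1 : 'cV[R]_1 := usubmx (a : 'cV[R]_(1 + n)); pose a2 : 'cV[R]_n := dsubmx (a : 'cV[R]_(1 + n)).
have aE : a = col_mx a1 a2 by rewrite vsubmxK.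
clearbody a1 a2; rewrite aE {a aE}.
have dotE (w : O * measurableTypeR R) : ((col_mx a1 a2)^T *m W w) 0 0 = a1 0 0 * w.2 + (a2^T *m Z w.1) 0 0.
  by rewrite tr_col_mx mul_row_col mxE; congr (_ + _); rewrite mxE big_ord1 !mxE.
have mc : measurable_fun setT (fun w : O * measurableTypeR R => cos (((col_mx a1 a2)^T *m W w) 0 0 + b)).
  by apply: measurable_cos'; apply: measurable_funD => //; exact: measurable_dot.
have ic : intg ((P \x N)%E : probability (O * measurableTypeR R)%type R) (fun w : O * measurableTypeR R => cos (((col_mx a1 a2)^T *m W w) 0 0 + b)).
  exact: (@intg_bounded _ _ _ _ _ 1 mc (fun w => cos_max _)).
have -> : Eint (P \x N)%E (fun w => cos (((col_mx a1 a2)^T *m W w) 0 0 + b)) =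
   Eint P (fun w => Eint N (fun x => cos (a1 0 0 * x + ((a2^T *m Z w) 0 0 + b)))).
  rewrite /Eint /Rintegral -(integral12_prod_meas1 ic) /fubini_F; congr fine; apply: eq_integral => w _.
  rewrite -intg_fin; last first.
    by apply: intg_bounded (fun x => cos_max _); apply: measurable_cos'; apply: measurable_funD => //; exact: measurable_funM.
  by apply: eq_integral => x _ /=; rewrite dotE addrA.
under eq_fun do rewrite normal_cf.
rewrite EintZ ?Zcf; last by apply: intg_cos; apply: measurable_funD => //; exact: measurable_dot.
rewrite mulrA -expRD; congr (expR _ * _).
have e : ((col_mx a1 a2 : 'cV[R]_(1 + n))^T *m col_mx a1 a2) 0 0 = a1 0 0 ^+ 2 + (a2^T *m a2) 0 0.
  by rewrite tr_col_mx mul_row_col mxE; congr (_ + _); rewrite mxE big_ord1 mxE expr2.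
by rewrite [X in _ = - (X / 2)]e; field.
Qed.

(** Cholesky factorisation by Schur complements; semidefinite matrices occur, so a zero pivot has to
    be allowed. *)
Lemma psd_factor (n : nat) (S : 'M[R]_n) : S^T = S -> (forall a : 'cV[R]_n, 0 <= (a^T *m S *m a) 0 0) ->
  exists A : 'M[R]_n, S = A *m A^T.
Proof.
elim: n S => [|n IH] S Ssym Spos.
  by exists 0; apply/matrixP => -[].
move: S Ssym Spos; rewrite -[n.+1]/(1 + n)%N => S Ssym Spos.
rewrite -(submxK S) in Ssym Spos *.
set s := (ulsubmx S) in Ssym Spos *; set u := ursubmx S in Ssym Spos *.
set v := dlsubmx S in Ssym Spos *; set T := drsubmx S in Ssym Spos *.
move: Ssym; rewrite tr_block_mx => /eq_block_mx[_ vu uv Tsym].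
have {}vu : v = u^T by rewrite -uv.
clearbody s u v T => {S}.
have addE (A B : 'M[R]_1) : (A + B) 0 0 = A 0 0 + B 0 0 by rewrite mxE.
have subE (A B : 'M[R]_1) c : (A - c *: B) 0 0 = A 0 0 - c * B 0 0 by rewrite !mxE.
have Q (x : 'cV[R]_1) (y : 'cV[R]_n) : 0 <= (x^T *m s *m x) 0 0 + 2 * (x^T *m u *m y) 0 0 + (y^T *m T *m y) 0 0.
  have := Spos (col_mx x y); rewrite tr_col_mx mul_row_block mul_row_col !mulmxDl !addE.
  have -> : (y^T *m v *m x) 0 0 = (x^T *m u *m y) 0 0.
    have -> : x^T *m u *m y = (y^T *m v *m x)^T by rewrite trmx_mul trmx_mul trmxK vu trmxK mulmxA.
    by rewrite [RHS]mxE.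
  by set p := (x^T *m s *m x) 0 0; set q := (x^T *m u *m y) 0 0; set r := (y^T *m T *m y) 0 0; lra.
have s0 : 0 <= s 0 0.
  have := Q 1%:M 0; rewrite !mulmx0 trmx1 mul1mx mulmx1 !mxE; lra.
have uE (x : 'cV[R]_1) (y : 'cV[R]_n) : (x^T *m u *m y) 0 0 = x 0 0 * (u *m y) 0 0.
  by rewrite -mulmxA mxE big_ord1 mxE.
have sE (x : 'cV[R]_1) : (x^T *m s *m x) 0 0 = s 0 0 * x 0 0 ^+ 2.
  by rewrite mxE big_ord1 mxE big_ord1 mxE; ring.
have [s00|sn0] := eqVneq (s 0 0) 0.
  have u0 : u = 0.
    apply/matrixP => i j; rewrite (ord1 i) [RHS]mxE; apply/eqP/negPn/negP => un.
    pose y : 'cV[R]_n := delta_mx j 0.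
    pose t := (y^T *m T *m y) 0 0.
    (* With a zero pivot the form is affine in the first coordinate; if [u 0 j] were nonzero, this
       value would make the form equal to [- 1]. *)
    have := Q (const_mx (- (t + 1) / (2 * u 0 j))) y; rewrite uE sE s00 mul0r [const_mx _ 0 0]mxE -/t.
    have -> : (u *m y) 0 0 = u 0 j by rewrite /y -colE mxE.
    have -> : 2 * (- (t + 1) / (2 * u 0 j) * u 0 j) = - (t + 1) by field.
    lra.
  have [||A AE] := IH T; [exact: Tsym| |].
    by move=> y; have := Q 0 y; rewrite trmx0 !mul0mx !mxE; lra.
  exists (block_mx 0 0 0 A).
  rewrite tr_block_mx mulmx_block !trmx0 !mulmx0 !mul0mx !addr0 !add0r -AE vu u0 trmx0.
  by congr block_mx; apply/matrixP => i j; rewrite (ord1 i) (ord1 j) s00 mxE.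
have sp : 0 < s 0 0 by rewrite lt_def sn0.
pose r := Num.sqrt (s 0 0); have r0 : r != 0 by rewrite gt_eqF// sqrtr_gt0.
have r2 : r * r = s 0 0 by rewrite -expr2 sqr_sqrtr.
have [||A AE] := IH (T - (s 0 0)^-1 *: (u^T *m u)).
- by rewrite linearB/= linearZ/= trmx_mul trmxK Tsym.
(* The minimiser of the form in its first coordinate, where the value is the Schur complement. *)
- move=> y; have := Q (const_mx (- (u *m y) 0 0 / s 0 0)) y; rewrite uE sE [const_mx _ 0 0]mxE.
  have -> : (y^T *m (T - (s 0 0)^-1 *: (u^T *m u)) *m y) 0 0 =
      (y^T *m T *m y) 0 0 - (s 0 0)^-1 * (y^T *m (u^T *m u) *m y) 0 0.
    by rewrite mulmxBr mulmxBl -scalemxAr -scalemxAl subE.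
  have -> : (y^T *m (u^T *m u) *m y) 0 0 = (u *m y) 0 0 ^+ 2.
    by rewrite mulmxA -trmx_mul -mulmxA mxE big_ord1 mxE.
  set q := (u *m y) 0 0; set p := (y^T *m T *m y) 0 0.
  by rewrite (_ : s 0 0 * (- q / s 0 0) ^+ 2 + 2 * (- q / s 0 0 * q) = - ((s 0 0)^-1 * q ^+ 2)); [lra|field].
exists (block_mx (r%:M) 0 (r^-1 *: u^T) A).
rewrite tr_block_mx mulmx_block !trmx0 !mulmx0 !mul0mx !addr0 linearZ/= trmxK tr_scalar_mx -AE.
congr block_mx.
- by apply/matrixP => i j; rewrite (ord1 i) (ord1 j) -scalar_mxM mxE mulr1n r2.
- by rewrite -scalemxAr mul_scalar_mx scalerA mulVf// scale1r.
- by rewrite mul_mx_scalar scalerA mulfV// scale1r vu.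
- by rewrite -scalemxAr -scalemxAl scalerA -invfM r2 addrC subrK.
Qed.

Lemma gauss_vec_exists (n : nat) (S : 'M[R]_n) : S^T = S -> (forall a : 'cV[R]_n, 0 <= (a^T *m S *m a) 0 0) ->
  exists (d : measure_display) (O : measurableType d) (P : probability O R) (Y : O -> 'cV[R]_n),
   mvec Y /\ forall (a : 'cV[R]_n), cosE P (fun w => (a^T *m Y w) 0 0) = expR (- ((a^T *m S *m a) 0 0 / 2)) /\
     sinE P (fun w => (a^T *m Y w) 0 0) = 0.
Proof.
move=> Ssym Spos; have [A AE] := psd_factor Ssym Spos.
have [d [ O [P [Z [mZ Zcf]]]]] := std_gauss_exists n.
exists d, O, P, (fun w => A *m Z w); split.
  move=> i; rewrite (_ : (fun w => _) = fun w => ((row i A)^T^T *m Z w) 0 0).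
    exact: measurable_dot.
  by apply/funext => w; rewrite trmxK -row_mul [RHS]mxE.
move=> a; have e (w : O) : (a^T *m (A *m Z w)) 0 0 = ((A^T *m a)^T *m Z w) 0 0 by rewrite trmx_mul trmxK mulmxA.
have e2 : (a^T *m S *m a) 0 0 = ((A^T *m a)^T *m (A^T *m a)) 0 0 by rewrite trmx_mul trmxK AE !mulmxA.
split.
  have := Zcf (A^T *m a) 0; rewrite cos0 mulr1 -e2 => <-; congr Eint; apply/funext => w.
  by rewrite e addr0.
have := Zcf (A^T *m a) (- (pi / 2)); rewrite cosN cos_pihalf mulr0 => <-; congr Eint; apply/funext => w.
by rewrite e cosBpihalf.
Qed.

End GaussianVector.

(** * Independence on the path space *)

Section PathSpace.
Context {R : realType}.
Notation path := (int -> R -> R).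

Definition cylset (ts : seq int) (E : int -> seq (R * set R)) : set path :=
  [set x | forall t, t \in ts -> forall j, (j < size (E t))%N ->
     (nth (0, setT) (E t) j).2 (x t (nth (0, setT) (E t) j).1)].

Definition cyl (S : set int) : set (set path) :=
  [set A | exists ts E, [/\ forall t, t \in ts -> S t, forall t, meas_list (E t) & A = cylset ts E]].

(** The carrier is the whole path space for every [S]; only the sigma-algebra changes. That a
    functional depends on the innovations with index in [S] is thus expressed by its measurability
    on [XS S]. *)
Definition XS (S : set int) := g_sigma_algebraType (cyl S).

Lemma cylsetI ts E ts' E' : cylset ts E `&` cylset ts' E' =
  cylset (ts ++ ts') (fun t => (if t \in ts then E t else [::]) ++ (if t \in ts' then E' t else [::])).
Proof.
apply/seteqP; split=> x.
  move=> [h1 h2] t _ j; rewrite size_cat nth_cat.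
  case: ifPn => tts; last first.
    by rewrite /= subn0 add0n; case: ifPn => // tts' jS; exact: (h2 t tts' j jS).
  have [jE|jE] := ltnP j (size (E t)); first by move=> _; exact: (h1 t tts j jE).
  case: ifPn => tts'; last by rewrite addn0 ltnNge jE.
  by move=> jS; apply: (h2 t tts' (j - size (E t))%N); rewrite ltn_subLR.
move=> h; split=> t tts j jE.
  have := h t; rewrite mem_cat tts => /(_ isT j); rewrite size_cat nth_cat jE; apply.
  exact: leq_trans jE (leq_addr _ _).
have := h t; rewrite mem_cat tts orbT => /(_ isT); set s := (if t \in ts then _ else _).
move=> /(_ (size s + j)%N); rewrite size_cat nth_cat ltn_add2l jE => /(_ isT).
by rewrite ltnNge leq_addr/= addKn.
Qed.

Lemma meas_list_cat (s1 s2 : seq (R * set R)) : meas_list s1 -> meas_list s2 -> meas_list (s1 ++ s2).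
Proof. by move=> h1 h2 j; rewrite nth_cat; case: ifP. Qed.

Lemma meas_list_nil : meas_list ([::] : seq (R * set R)).
Proof. by move=> j; rewrite nth_nil; exact: measurableT. Qed.

Lemma cyl_setI S : setI_closed (cyl S).
Proof.
move=> _ _ [ts [E [tsS mE ->]]] [ts' [E' [tsS' mE' ->]]].
rewrite cylsetI; eexists; eexists; split; last by [].
  by move=> t; rewrite mem_cat => /orP[/tsS|/tsS'].
by move=> t; apply: meas_list_cat; case: ifP => // _; exact: meas_list_nil.
Qed.

Lemma cyl_setT S : cyl S setT.
Proof.
exists [::], (fun=> [::]); split=> // [t|]; first exact: meas_list_nil.
by apply/seteqP; split.
Qed.

Lemma cylS S S' : S `<=` S' -> cyl S `<=` cyl S'.
Proof. by move=> SS A [ts [E [tsS mE ->]]]; exists ts, E; split=> // t /tsS /SS. Qed.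

Lemma measurable_XS_mono d (T : measurableType d) S S' (F : path -> T) : S `<=` S' ->
  measurable_fun (setT : set (XS S)) F -> measurable_fun (setT : set (XS S')) F.
Proof.
move=> SS mF _ B mB; have := mF measurableT B mB.
exact: (sub_smallest2r _ (cylS SS)).
Qed.

Lemma measurable_eval S t u : S t -> measurable_fun (setT : set (XS S)) (fun x : path => x t u).
Proof.
move=> St _ B mB; apply: sub_sigma_algebra; exists [:: t], (fun=> [:: (u, B)]); split.
- by move=> s; rewrite inE => /eqP ->.
- by move=> s [|j] //=; rewrite nth_nil; exact: measurableT.
- rewrite setTI; apply/seteqP; split=> x /=; first by move=> xB s; rewrite inE => /eqP -> [|].
  by move=> /(_ t (mem_head _ _) 0%N isT).
Qed.

Lemma XS_measure_unique S (m1 m2 : {measure set (XS S) -> \bar R}) : (m1 setT < +oo)%E ->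
  (forall A, cyl S A -> m1 A = m2 A) ->
  forall A : set (XS S), measurable A -> m1 A = m2 A.
Proof.
move=> fin H A mA; apply: (@measure_unique _ R (XS S) (cyl S) (fun=> setT) erefl) => //.
- exact: cyl_setI.
- by move=> _; exact: cyl_setT.
- by apply/seteqP; split => // x _; exists 0%N.
Qed.

Context {d : measure_display} {Om : measurableType d} (P : probability Om R) (eps : int -> Om -> R -> R).
Context (iid : iid_proc P eps).

Let measurable_allin (I : eqType) (ts : seq I) (F : I -> set Om) : (forall t, measurable (F t)) ->
  measurable [set w | forall t, t \in ts -> F t w].
Proof.
move=> mF; elim: ts => [|t ts IH].
  by rewrite (_ : mkset _ = setT)//; apply/seteqP; split.
rewrite (_ : mkset _ = F t `&` [set w | forall t, t \in ts -> F t w]); first exact: measurableI.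
apply/seteqP; split=> w /=.
  by move=> h; split=> [|s sts]; apply: h; rewrite inE ?eqxx ?sts ?orbT.
by move=> [h1 h2] s; rewrite inE => /orP[/eqP ->|/h2].
Qed.

Definition sample (w : Om) : path := fun t u => eps t w u.

Let mfdd t E : meas_list E -> measurable (fdd_event (eps t) E).
Proof.
move=> mE; case: iid => mev _ _.
rewrite (_ : fdd_event _ _ = [set w | forall j, j \in iota 0 (size E) ->
    ((fun w => eps t w (nth (0, setT) E j).1) @^-1` (nth (0, setT) E j).2) w]).
  apply: (@measurable_allin _ (iota 0 (size E)) (fun j => (fun w => eps t w (nth (0, setT) E j).1) @^-1` (nth (0, setT) E j).2)) => j.
  by rewrite -[X in measurable X]setTI; apply: mev.
by apply/seteqP; split=> w /= h j => [|jE]; [rewrite mem_iota => /andP[_]; exact: h|apply: h; rewrite mem_iota].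
Qed.

Lemma measurable_sample S : measurable_fun setT (sample : Om -> XS S).
Proof.
apply: (@measurability _ _ Om (XS S) setT sample (cyl S) erefl) => _ [A [ts [E [tsS mE ->]]] <-]; rewrite setTI.
exact: (@measurable_allin _ ts (fun t => fdd_event (eps t) (E t)) (fun t => mfdd t (mE t))).
Qed.

Let P_cyl ts E : (forall t, meas_list (E t)) ->
  P (sample @^-1` cylset ts E) = (\prod_(t <- undup ts) fine (P (fdd_event (eps t) (E t))))%:E.
Proof.
move=> mE; case: iid => _ ind _.
have -> : cylset ts E = cylset (undup ts) E.
  by apply/seteqP; split=> x h t tts; apply: h; rewrite ?mem_undup// in tts *.
rewrite -(ind (undup ts) E (undup_uniq ts) mE) fineK//; apply: fin_num_measure.
exact: (@measurable_allin _ (undup ts) (fun t => fdd_event (eps t) (E t)) (fun t => mfdd t (mE t))).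
Qed.

Let P_cylI S1 S2 A B : S1 `&` S2 = set0 -> cyl S1 A -> cyl S2 B ->
  P (sample @^-1` A `&` sample @^-1` B) = (P (sample @^-1` A) * P (sample @^-1` B))%E.
Proof.
move=> S12 [ts [E [tsS mE ->]]] [ts' [E' [tsS' mE' ->]]].
have dj t : t \in ts -> t \notin ts'.
  by move=> /tsS h1; apply/negP => /tsS' h2; have : (S1 `&` S2) t by []; rewrite S12.
rewrite -preimage_setI cylsetI !P_cyl//; last first.
  by move=> t; apply: meas_list_cat; case: ifP => // _; exact: meas_list_nil.
rewrite -EFinM; congr EFin.
rewrite (perm_big (undup ts ++ undup ts'))/=; last first.
  apply: uniq_perm; first exact: undup_uniq.
    rewrite cat_uniq !undup_uniq/= andbT; apply/hasPn => t; rewrite !mem_undup => t'.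
    by apply/negP => /dj; rewrite t'.
  by move=> t; rewrite mem_undup !mem_cat !mem_undup.
rewrite big_cat; congr (_ * _); apply: eq_big_seq => t; rewrite mem_undup => tts.
  by rewrite tts (negbTE (dj _ tts)) cats0.
by rewrite tts; case: ifP => // /dj; rewrite tts.
Qed.

Let SS (S : set int) : {mfun Om >-> XS S} := HB.pack sample (isMeasurableFun.Build _ _ _ _ _ (@measurable_sample S)).

(** The hypothesis gives the product rule for cylinders. Uniqueness of measures extends it twice,
    once in each set: with the other event fixed, a restricted image of [P] is compared with a
    scaled one. *)
Lemma sample_indep S1 S2 A B : S1 `&` S2 = set0 ->
  measurable (A : set (XS S1)) -> measurable (B : set (XS S2)) ->
  P (sample @^-1` A `&` sample @^-1` B) = (P (sample @^-1` A) * P (sample @^-1` B))%E.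
Proof.
move=> S12 mA mB.
have mpre S C : measurable (C : set (XS S)) -> measurable (sample @^-1` C).
  by move=> mC; have := @measurable_sample S measurableT C mC; rewrite setTI.
have gen S C : measurable (C : set Om) -> (forall D, cyl S D ->
     P (sample @^-1` D `&` C) = (P (sample @^-1` D) * P C)%E) ->
   forall D : set (XS S), measurable D -> P (sample @^-1` D `&` C) = (P (sample @^-1` D) * P C)%E.
  move=> mC H D mD.
  have r0 : 0 <= fine (P C) by rewrite fine_ge0.
  have ms := @measurable_sample S.
  pose m1 : {measure set (XS S) -> \bar R} := measure_function_pushforward__canonical__measure_function_Measure (mrestr P mC) ms.
  pose m0 : {measure set (XS S) -> \bar R} := measure_function_pushforward__canonical__measure_function_Measure P ms.
  pose m2 : {measure set (XS S) -> \bar R} := measure_function_mscale__canonical__measure_function_Measure (NngNum r0) m0.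
  have e1 (D' : set (XS S)) : m1 D' = P (sample @^-1` D' `&` C) by [].
  have e2 (D' : set (XS S)) : m2 D' = (P (sample @^-1` D') * P C)%E.
    by rewrite /m2/= /mscale/= fineK ?fin_num_measure// muleC.
  rewrite -e1 -e2; apply: (@XS_measure_unique S m1 m2) => //.
    by rewrite e1 preimage_setT setTI ltey_eq fin_num_measure.
  by move=> D' cD'; rewrite e1 e2 H.
apply: (@gen S1 _ (mpre _ _ mB)) => // C cC.
have mC : measurable (sample @^-1` C) by apply: (mpre S1); exact: sub_sigma_algebra.
have h (D : set path) : cyl S2 D -> P (sample @^-1` D `&` sample @^-1` C) = (P (sample @^-1` D) * P (sample @^-1` C))%E.
  by move=> cD; rewrite setIC (P_cylI S12 cC cD) muleC.
by rewrite setIC (gen S2 (sample @^-1` C) mC h B mB) muleC.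
Qed.

Definition shiftp (k : int) (x : path) : path := fun t => x (t + k).

Lemma sample_shift (k : int) A : measurable (A : set (XS setT)) ->
  P ((shiftp k \o sample) @^-1` A) = P (sample @^-1` A).
Proof.
move=> mA.
have mk : measurable_fun setT (shiftp k \o sample : Om -> XS setT).
  apply: (@measurability _ _ Om (XS setT) setT _ (cyl setT) erefl) => _ [A' [ts [E [tsS mE ->]]] <-]; rewrite setTI.
  exact: (@measurable_allin _ ts (fun t => fdd_event (eps (t + k)) (E t)) (fun t => mfdd (t + k) (mE t))).
pose SK : {mfun Om >-> XS setT} := HB.pack (shiftp k \o sample : Om -> XS setT) (isMeasurableFun.Build _ _ _ _ _ mk).
have ms := @measurable_sample setT.
have := @XS_measure_unique setT (pushforward P (shiftp k \o sample : Om -> XS setT)) (pushforward P (sample : Om -> XS setT)).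
move=> /(_ mk ms); rewrite /pushforward => H; apply: H => //.
  have f1 : (P ((shiftp k \o sample) @^-1` setT) < +oo)%E by rewrite preimage_setT ltey_eq fin_num_measure.
  exact: f1.
move=> D [ts [E [_ mE ->]]].
suff : P ((shiftp k \o sample) @^-1` cylset ts E) = P (sample @^-1` cylset ts E) by [].
rewrite (_ : (shiftp k \o sample) @^-1` _ = sample @^-1` cylset (map (fun t => t + k) ts) (fun t => E (t - k))); last first.
  apply/seteqP; split=> w /= h.
    by move=> _ /mapP[t tts ->] j; rewrite addrK; exact: h.
  by move=> t tts j jE; have := h (t + k) (map_f _ tts) j; rewrite addrK; exact.
rewrite !P_cyl//; congr EFin.
rewrite undup_map_inj; last exact: addIr.
rewrite big_map; apply: eq_bigr => t _; rewrite addrK.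
by case: iid => _ _ /(_ (t + k) t (E t) (mE t)) ->.
Qed.

Local Notation RR := (measurableTypeR R).

Let mnorm : measurable_fun [set: RR] (fun y : R => `|y|).
Proof. by apply: continuous_measurable_fun; exact: norm_continuous. Qed.

(** By uniqueness on rectangles the joint law of the two variables is the product of their laws;
    Tonelli and Fubini then give the integrability of the product and its expectation. *)
Lemma sample_indep_E S1 S2 (F1 F2 : path -> R) : S1 `&` S2 = set0 ->
  measurable_fun (setT : set (XS S1)) F1 -> measurable_fun (setT : set (XS S2)) F2 ->
  intg P (F1 \o sample) -> intg P (F2 \o sample) ->
  intg P (fun w => F1 (sample w) * F2 (sample w)) /\
  Eint P (fun w => F1 (sample w) * F2 (sample w)) = Eint P (F1 \o sample) * Eint P (F2 \o sample).
Proof.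
move=> S12 mF1 mF2 i1 i2.
have m1 : measurable_fun setT (F1 \o sample : Om -> RR) by apply: measurableT_comp mF1 _; exact: measurable_sample.
have m2 : measurable_fun setT (F2 \o sample : Om -> RR) by apply: measurableT_comp mF2 _; exact: measurable_sample.
have m12 : measurable_fun setT (fun w => (F1 (sample w), F2 (sample w)) : RR * RR) by exact/measurable_fun_pairP.
pose X1 : {mfun Om >-> RR} := HB.pack (F1 \o sample : Om -> RR) (isMeasurableFun.Build _ _ _ _ _ m1).
pose X2 : {mfun Om >-> RR} := HB.pack (F2 \o sample : Om -> RR) (isMeasurableFun.Build _ _ _ _ _ m2).
pose X12 : {mfun Om >-> (RR * RR)%type} := HB.pack (fun w => (F1 (sample w), F2 (sample w)) : RR * RR) (isMeasurableFun.Build _ _ _ _ _ m12).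
pose n1 : probability RR R := distribution P X1.
pose n2 : probability RR R := distribution P X2.
have uniq (X : set (RR * RR)) : measurable X -> (n1 \x n2)%E X = pushforward P X12 X.
  apply: product_measure_unique => A B mA mB.
  have := @sample_indep S1 S2 (F1 @^-1` A) (F2 @^-1` B) S12.
  rewrite -[X in measurable X -> _]setTI -[X in _ -> measurable X -> _]setTI.
  by move=> /(_ (mF1 measurableT _ mA) (mF2 measurableT _ mB)).
have mxy : measurable_fun setT (fun z : RR * RR => (z.1 * z.2)%:E).
  by apply/measurable_EFinP; apply: measurable_funM; [exact: measurable_fst|exact: measurable_snd].
have j1 : intg n1 (fun x : RR => x) by apply: integrable_pushforward => //; exact/measurable_EFinP.
have j2 : intg n2 (fun x : RR => x) by apply: integrable_pushforward => //; exact/measurable_EFinP.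
have e1 : Eint n1 (fun x : RR => x) = Eint P (F1 \o sample).
  by rewrite /Eint /Rintegral integral_pushforward//; exact/measurable_EFinP.
have e2 : Eint n2 (fun x : RR => x) = Eint P (F2 \o sample).
  by rewrite /Eint /Rintegral integral_pushforward//; exact/measurable_EFinP.
have ixy : (n1 \x n2)%E.-integrable setT (fun z : RR * RR => (z.1 * z.2)%:E).
  apply/(integrable12ltyP _ _ mxy).
  under eq_integral => x _.
    rewrite (_ : (fun y => _) = fun y => (`|x|%:E * `|y|%:E)%E); last by apply/funext => y; rewrite /= normrM EFinM.
    rewrite ge0_integralZl//; [|exact/measurable_EFinP].
    rewrite (intg_fin (intg_norm j2)) muleC; over.
  rewrite ge0_integralZl//; [|exact/measurable_EFinP|by rewrite lee_fin; exact: Eint_ge0].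
  by rewrite (intg_fin (intg_norm j1)) -EFinM ltry.
have ip : intg P (fun w => F1 (sample w) * F2 (sample w)).
  apply/integrableP; split; first by apply/measurable_EFinP; exact: measurable_funM.
  move/integrableP: ixy => [_]; rewrite (@eq_measure_integral _ _ _ _ (pushforward P X12)); last by move=> A mA _; exact: uniq.
  by rewrite ge0_integral_pushforward//; exact: measurableT_comp.
split=> //.
have : (\int[(n1 \x n2)%E]_z (z.1 * z.2)%:E = (Eint P (fun w => F1 (sample w) * F2 (sample w)))%:E)%E.
  rewrite (@eq_measure_integral _ _ _ _ (pushforward P X12)); last by move=> A mA _; exact: uniq.
  by rewrite integral_pushforward// -intg_fin.
rewrite -(integral12_prod_meas1 ixy) /fubini_F/=.
under eq_integral => x _.
  rewrite (_ : (fun y => _) = fun y => (x%:E * y%:E)%E); last by apply/funext => y; rewrite EFinM.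
  rewrite integralZl// (intg_fin j2) muleC; over.
rewrite integralZl// (intg_fin j1) -EFinM => -[<-].
by rewrite e1 e2 mulrC.
Qed.

Lemma sample_shift_E (k : int) (F : path -> \bar R) : measurable_fun (setT : set (XS setT)) F ->
  (\int[P]_w F (shiftp k (sample w)) = \int[P]_w F (sample w))%E.
Proof.
move=> mF.
have mk : measurable_fun setT (shiftp k \o sample : Om -> XS setT).
  apply: (@measurability _ _ Om (XS setT) setT _ (cyl setT) erefl) => _ [A' [ts [E [tsS mE ->]]] <-]; rewrite setTI.
  exact: (@measurable_allin _ ts (fun t => fdd_event (eps (t + k)) (E t)) (fun t => mfdd (t + k) (mE t))).
pose SK : {mfun Om >-> XS setT} := HB.pack (shiftp k \o sample : Om -> XS setT) (isMeasurableFun.Build _ _ _ _ _ mk).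
have key (G : path -> \bar R) : measurable_fun (setT : set (XS setT)) G -> (forall x, 0 <= G x)%E ->
    (\int[P]_w G (shiftp k (sample w)) = \int[P]_w G (sample w))%E.
  move=> mG G0.
  transitivity (\int[pushforward P SK]_x G x)%E; first by rewrite ge0_integral_pushforward.
  transitivity (\int[pushforward P (SS setT)]_x G x)%E; last by rewrite ge0_integral_pushforward.
  by apply: eq_measure_integral => A mA _; exact: sample_shift.
rewrite integralE [RHS]integralE; congr (_ - _)%E.
  transitivity (\int[P]_w (F^\+)%E (shiftp k (sample w)))%E.
    by apply: eq_integral => w _; rewrite !funeposE.
  rewrite key//; last exact: measurable_funepos.
  by apply: eq_integral => w _; rewrite !funeposE.
transitivity (\int[P]_w (F^\-)%E (shiftp k (sample w)))%E.
  by apply: eq_integral => w _; rewrite !funenegE.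
rewrite key//; last exact: measurable_funeneg.
by apply: eq_integral => w _; rewrite !funenegE.
Qed.

End PathSpace.

(** * Jointly measurable versions *)

Lemma cvg_sumr {R : realType} {T : Type} (F : set_system T) {FF : Filter F} (I : Type) (r : seq I)
    (f : I -> T -> R) (l : I -> R) :
  (forall i, f i @ F --> l i) -> (fun x => \sum_(i <- r) f i x) @ F --> \sum_(i <- r) l i.
Proof.
move=> fl; elim: r => [|i r IH]; first by rewrite big_nil; under eq_fun do rewrite big_nil; exact: cvg_cst.
by rewrite big_cons; under eq_fun do rewrite big_cons; exact: cvgD.
Qed.

Lemma measurable_fine_esup {R : realType} {d} {X : measurableType d} (f : nat -> X -> R) :
  (forall k, measurable_fun setT (f k)) -> measurable_fun setT (fun x => fine (limn_esup (fun k => (f k x)%:E))).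
Proof.
move=> mf; apply: (measurableT_comp (fine_measurable measurableT)).
by apply: measurable_fun_limn_esup => k; exact/measurable_EFinP.
Qed.

Section Rounding.
Context {R : realType} (u0 : R).
Local Notation RR := (measurableTypeR R).

Definition gridpt (k n : nat) (b : bool) : R := u0 + (if b then 1 else -1) * (n%:R / k.+1%:R).

(* rounds u towards u0 on the grid u0 + Z/(k+1), so that it never leaves an interval containing u and u0 *)
Definition rnd (k : nat) (u : R) : R := gridpt k (Num.truncn (`|u - u0| * k.+1%:R)) (u0 <= u).

Lemma rnd_spec k u : exists2 r : R, 0 <= r <= `|u - u0| /\ `|u - u0| - r <= k.+1%:R^-1 &
  rnd k u = u0 + (if u0 <= u then 1 else -1) * r.
Proof.
have K0 : (0 : R) < k.+1%:R by rewrite ltr0n.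
set n := Num.truncn (`|u - u0| * k.+1%:R).
have /truncn_itv/andP[h1 h2] : 0 <= `|u - u0| * k.+1%:R by rewrite mulr_ge0// ltW.
rewrite -/n in h1 h2.
exists (n%:R / k.+1%:R); last by [].
split.
  by apply/andP; split; [rewrite divr_ge0// ler0n|rewrite ler_pdivrMr].
by rewrite lerBlDl -[X in _ <= _ + X]mul1r -mulrDl ler_pdivlMr// natr1 ltW.
Qed.

Lemma rnd_near k u : `|rnd k u - u| <= k.+1%:R^-1.
Proof.
have [r [/andP[r0 r1] r2] ->] := rnd_spec k u.
move: r2; move: k.+1%:R^-1 => c r2.
case: ifPn => [uu|]; last rewrite -ltNge => uu.
  by move: r1 r2; rewrite ger0_norm ?subr_ge0// => r1 r2; rewrite ler_norml; apply/andP; split; lra.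
by move: r1 r2; rewrite ltr0_norm ?subr_lt0// => r1 r2; rewrite ler_norml; apply/andP; split; lra.
Qed.

Lemma rnd_in (D : set R) k u : is_interval D -> D u0 -> D u -> D (rnd k u).
Proof.
move=> iD Du0 Du; have [r [/andP[r0 r1] r2] ->] := rnd_spec k u.
case: ifPn => [uu|]; last rewrite -ltNge => uu.
  by apply: (iD u0 u Du0 Du); move: r1; rewrite ger0_norm ?subr_ge0// => r1; apply/andP; split; lra.
by apply: (iD u u0 Du Du0); move: r1; rewrite ltr0_norm ?subr_lt0// => r1; apply/andP; split; lra.
Qed.

(** On each cell the rounded point is constant, so a preimage is a countable union of rectangles,
    and measurability of [G] at fixed points is enough. *)
Lemma measurable_rnd {d} {X : measurableType d} (G : X -> R -> R) k :
  (forall q, measurable_fun setT (G ^~ q)) ->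
  measurable_fun setT (fun z : X * RR => G z.1 (rnd k z.2)).
Proof.
move=> mG _ A mA; rewrite setTI.
pose C (n : nat) (b : bool) : set RR := [set u | (u0 <= u) = b /\ n%:R <= `|u - u0| * k.+1%:R < n.+1%:R].
have mC n b : measurable (C n b).
  have -> : C n b = [set u : RR | (u0 <= u) = b] `&` [set u : RR | n%:R <= `|u - u0| * k.+1%:R < n.+1%:R] by [].
  apply: measurableI.
    have -> : [set u : RR | (u0 <= u) = b] = if b then [set` `[u0, +oo[ ] else [set` `]-oo, u0[ ].
      case: b; apply/seteqP; split=> x /=; rewrite in_itv/= ?andbT// ltNge; first by move=> ->.
      by move/negbTE.
    by case: b; exact: measurable_itv.
  have mh : measurable_fun [set: RR] (fun u : R => `|u - u0| * k.+1%:R).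
    by apply: continuous_measurable_fun => x; apply: cvgMl; apply: cvg_norm; apply: cvgB => //; exact: cvg_cst.
  have := mh measurableT [set` `[n%:R, n.+1%:R[ ] (measurable_itv _); rewrite setTI.
  by congr measurable; apply/seteqP; split=> x /=; rewrite in_itv.
rewrite (_ : _ @^-1` A = \bigcup_n (((fun x => G x (gridpt k n true)) @^-1` A `*` C n true) `|`
    ((fun x => G x (gridpt k n false)) @^-1` A `*` C n false))).
  apply: bigcupT_measurable => n; apply: measurableU; apply: measurableX => //;
    by rewrite -[X in measurable X]setTI; apply: mG.
have K0 : (0 : R) < k.+1%:R by rewrite ltr0n.
apply/seteqP; split=> -[x u] /=.
  move=> xA; exists (Num.truncn (`|u - u0| * k.+1%:R)) => //.
  have ti : 0 <= `|u - u0| * k.+1%:R by rewrite mulr_ge0// ltW.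
  by case: (boolP (u0 <= u)) => uu; [left|right]; rewrite /= ?truncn_itv//; move: xA; rewrite /rnd ?uu ?(negbTE uu) => xA; split=> //; split=> //; rewrite ?(negbTE uu) ?truncn_itv.
move=> [n _ [[/= xA [uu /truncn_def tn]]|[/= xA [uu /truncn_def tn]]]]; by rewrite /rnd tn uu.
Qed.

(** An upper limit exists and is measurable for every path; it is the limit wherever there is
    one. *)
Definition rlim (g : R -> R) (u : R) : R := fine (limn_esup (fun k => (g (rnd k u))%:E)).

Lemma fine_esup_cvg (a : nat -> R) (l : R) : a @ \oo --> l -> fine (limn_esup (fun k => (a k)%:E)) = l.
Proof.
move=> al; have h : (fun k => (a k)%:E) @ \oo --> l%:E by apply: cvg_EFin => //; exact: nearW.
by have [_ ->] := cvg_limn_einf_sup h.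
Qed.

Lemma measurable_rlim {d} {X : measurableType d} (G : X -> R -> R) :
  (forall q, measurable_fun setT (G ^~ q)) ->
  measurable_fun setT (fun z : X * RR => rlim (G z.1) z.2).
Proof. by move=> mG; apply: (@measurable_fine_esup _ _ _ (fun k (z : X * RR) => G z.1 (rnd k z.2))) => k; exact: measurable_rnd. Qed.

(** Agreement with [h] is asked on the countable grid only. In this way an almost sure identity at
    each fixed point becomes one that holds at all points simultaneously. *)
Lemma rlim_cont (D : set R) (g h : R -> R) u : is_interval D -> D u0 -> D u ->
  (forall k n b, D (gridpt k n b) -> g (gridpt k n b) = h (gridpt k n b)) ->
  {for u, continuous h} -> rlim g u = h u.
Proof.
move=> iD D0 Du gh ch; apply: fine_esup_cvg.
have e k : g (rnd k u) = h (rnd k u) by apply: gh; exact: rnd_in.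
under eq_fun do rewrite e.
apply: (continuous_cvg _ ch); apply/cvgrPdist_le => eps e0; near=> k.
rewrite distrC (le_trans (rnd_near k u))//; near: k.
have := @cvg_harmonic R; move=> /cvgrPdist_le/(_ _ e0); apply: filterS => k.
by rewrite sub0r normrN => /(le_trans (ler_norm _)).
Unshelve. all: by end_near. Qed.

End Rounding.

(** * Recovering the innovations from the process *)

Section ARInversion.
Context {R : realType} (p : nat) (beta psi : nat -> R) (psiP : is_inv_series p beta psi).

Lemma triangular_sum (a : nat -> R) (g : nat -> nat -> R) M :
  \sum_(k < M) a k * \sum_(i < M - k) g k i = \sum_(n < M) \sum_(k < n.+1) a k * g k (n - k)%N.
Proof.
elim: M => [|M IH]; first by rewrite !big_ord0.
rewrite [in RHS]big_ord_recr/= -IH.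
transitivity (\sum_(k < M.+1) (a k * \sum_(i < M - k) g k i + a k * g k (M - k)%N)).
  by apply: eq_bigr => k _; rewrite subSn ?big_ord_recr/= ?mulrDr// -ltnS.
by rewrite big_split/=; congr (_ + _); rewrite big_ord_recr/= subnn big_ord0 mulr0 addr0.
Qed.

Lemma ar_coef_gt k : (p < k)%N -> ar_coef p beta k = 0 :> R.
Proof. by rewrite /ar_coef; case: k => // k pk; rewrite leqNgt pk. Qed.

(** Cutting the [k]-th series at [M - k] makes the double sum exactly triangular. By [psiP] its
    coefficients are those of the constant series 1, so it equals [x t] for every [M > p], without
    remainder. *)
Lemma ar_inversion (x v : int -> R) (t : int) :
  (forall s, (fun N : nat => \sum_(i < N) psi i * x (s - i%:Z)) @ \oo --> v s) ->
  \sum_(k < p.+1) ar_coef p beta k * v (t - k%:Z) = x t.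
Proof.
move=> xv.
have h1 : (fun M : nat => \sum_(k < p.+1) ar_coef p beta k * \sum_(i < M - k) psi i * x (t - k%:Z - i%:Z)) @ \oo -->
   \sum_(k < p.+1) ar_coef p beta k * v (t - k%:Z).
  apply: cvg_sumr => k; apply: cvgMr.
  have := xv (t - k%:Z); move=> h; rewrite -(cvg_shiftn k).
  apply: cvg_trans h; apply: near_eq_cvg; apply: nearW => n /=; by rewrite addnK.
have h2 : \forall M \near \oo, \sum_(k < p.+1) ar_coef p beta k * \sum_(i < M - k) psi i * x (t - k%:Z - i%:Z) = x t.
  near=> M.
  have pM : (p.+1 <= M)%N by near: M; exists p.+1.
  transitivity (\sum_(k < M) ar_coef p beta k * \sum_(i < M - k) psi i * x (t - k%:Z - i%:Z)).
    rewrite -(big_mkord xpredT (fun k => ar_coef p beta k * \sum_(i < M - k) psi i * x (t - k%:Z - i%:Z))).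
    rewrite -[RHS](big_mkord xpredT (fun k => ar_coef p beta k * \sum_(i < M - k) psi i * x (t - k%:Z - i%:Z))).
    rewrite [in RHS](@big_cat_nat _ _ _ p.+1)//=.
    rewrite [X in _ = _ + X]big_nat_cond [X in _ = _ + X]big1 ?addr0// => k /andP[/andP[pk _] _].
    by rewrite ar_coef_gt// mul0r.
  rewrite (triangular_sum (ar_coef p beta) (fun k i => psi i * x (t - k%:Z - i%:Z))).
  have M0 : (0 < M)%N by apply: leq_trans pM.
  rewrite (bigD1 (Ordinal M0))//= [X in _ + X]big1 ?addr0.
    by have := psiP 0; rewrite !big_ord1/= subnn /ar_coef/= !mul1r !subr0 => ->; rewrite mul1r.
  move=> n /eqP n0.
  transitivity ((\sum_(k < n.+1) ar_coef p beta k * psi (n - k)%N) * x (t - n%:Z)).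
    rewrite mulr_suml; apply: eq_bigr => k _; rewrite mulrA; congr (_ * x _).
    by rewrite -addrA -opprD -PoszD subnKC// -ltnS.
  by rewrite psiP; case: eqP => [e|_]; [case: n0; apply/val_inj|rewrite mul0r].
have h3 : (fun M : nat => \sum_(k < p.+1) ar_coef p beta k * \sum_(i < M - k) psi i * x (t - k%:Z - i%:Z)) @ \oo --> x t.
  by apply: cvg_near_cst.
have e1 := cvg_lim (@Rhausdorff R) h1; have e3 := cvg_lim (@Rhausdorff R) h3.
by rewrite -e1 -[RHS]e3.
Unshelve. all: by end_near. Qed.

End ARInversion.

Section CanonicalVersions.
Context {R : realType} {d : measure_display} {Om : measurableType d} (P : probability Om R).
Local Notation RR := (measurableTypeR R).
Local Notation path := (int -> R -> R).

Lemma ae_countable (I : countType) (Q : I -> Om -> Prop) :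
  (forall i, {ae P, forall w, Q i w}) -> {ae P, forall w, forall i, Q i w}.
Proof.
move=> aeQ; have : {ae P, forall w, forall n : nat, if (unpickle n : option I) is Some i then Q i w else True}.
  by apply: ae_foralln => n; case: unpickle => [i|]; [exact: aeQ|exact: aeW].
by apply: filterS => w h i; have := h (pickle i); rewrite pickleK.
Qed.

Context (u0 : R) (p : nat) (beta psi : nat -> R).

Definition ecan (x : path) (t : int) (u : R) : R := rlim u0 (x t) u.

Definition Scan (x : path) (t : int) (q : R) : R :=
  fine (limn_esup (fun N : nat => (\sum_(i < N) psi i * x (t - i%:Z) q)%:E)).

Definition vcan (x : path) (t : int) (u : R) : R := rlim u0 (Scan x t) u.

Lemma measurable_ecan S t : S t -> measurable_fun setT (fun z : XS S * RR => ecan z.1 t z.2).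
Proof. by move=> St; apply: (@measurable_rlim _ _ _ (XS S) (fun x : XS S => x t)) => q; exact: measurable_eval. Qed.

Lemma measurable_vcan t : measurable_fun setT (fun z : XS setT * RR => vcan z.1 t z.2).
Proof.
apply: (@measurable_rlim _ _ _ (XS setT) (fun x : XS setT => Scan x t)) => q.
apply: measurable_fine_esup => N; apply: measurable_sum => i.
by apply: measurable_funM => //; exact: measurable_eval.
Qed.

Context (D : set R) (iD : is_interval D) (D0 : D u0).
Context (psiP : is_inv_series p beta psi) (eps V : int -> Om -> R -> R).
Context (VS : forall t u, D u ->
     {ae P, forall w, (fun N : nat => \sum_(i < N) psi i * eps (t - i%:Z) w u) @ \oo --> V t w u}).
Context (VD : forall t, {ae P, forall w, forall u, D u -> derivable (V t w) u 1}).

Local Notation smp := (sample eps).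

(** At the grid points, outside countably many null events, inversion gives [eps t = phi(B) V_t];
    the right side is continuous on [D] because each [V t] is differentiable, which determines the
    versions off the grid. *)
Lemma canonical_good : {ae P, forall w, forall t u, D u -> vcan (smp w) t u = V t w u /\
  ecan (smp w) t u = \sum_(k < p.+1) ar_coef p beta k * V (t - k%:Z) w u}.
Proof.
have h1 : {ae P, forall w, forall i : (int * nat * nat * bool)%type, D (gridpt u0 i.1.1.2 i.1.2 i.2) ->
   (fun N : nat => \sum_(j < N) psi j * eps (i.1.1.1 - j%:Z) w (gridpt u0 i.1.1.2 i.1.2 i.2)) @ \oo -->
      V i.1.1.1 w (gridpt u0 i.1.1.2 i.1.2 i.2)}.
  apply: ae_countable => -[[[t k] n] b] /=.
  have [Dg|nD] := pselect (D (gridpt u0 k n b)); last by apply: aeW.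
  by have := VS t Dg; apply: filterS => w h _.
have h2 : {ae P, forall w, forall t, forall u, D u -> derivable (V t w) u 1} by exact: ae_countable.
apply: (filterS2 _ _ h1 h2) => w g1 g2 t u Du.
have cV s x : D x -> {for x, continuous (V s w)}.
  by move=> Dx; apply: differentiable_continuous; apply/derivable1_diffP; exact: g2.
have gV s k n b : D (gridpt u0 k n b) -> (fun N : nat => \sum_(j < N) psi j * eps (s - j%:Z) w (gridpt u0 k n b)) @ \oo --> V s w (gridpt u0 k n b).
  by move=> Dg; exact: (g1 (s, k, n, b) Dg).
split.
  apply: (rlim_cont iD D0 Du) => [k n b Dg|]; last exact: cV.
  by apply: fine_esup_cvg; exact: gV.
apply: (rlim_cont (h := fun u => \sum_(k < p.+1) ar_coef p beta k * V (t - k%:Z) w u) iD D0 Du) => [k n b Dg|].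
  rewrite (ar_inversion psiP (x := fun s => eps s w (gridpt u0 k n b)) (v := fun s => V s w (gridpt u0 k n b)))// => s.
  exact: gV.
apply: cvg_sumr => k; apply: cvgMr; exact: cV.
Qed.

(** At one fixed [u] the series converge almost surely for all times together, so both sides are
    [phi(B) V_t] at [u]. *)
Lemma ecan_eps t u : D u -> {ae P, forall w, ecan (smp w) t u = eps t w u}.
Proof.
move=> Du; have h : {ae P, forall w, forall s, (fun N : nat => \sum_(i < N) psi i * eps (s - i%:Z) w u) @ \oo --> V s w u}.
  by apply: ae_countable => s; exact: VS.
apply: (filterS2 _ _ canonical_good h) => w g1 g2.
rewrite (g1 t u Du).2; exact: (ar_inversion psiP (x := fun s => eps s w u) (v := fun s => V s w u)).
Qed.

Lemma vcan_series t u : D u ->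
  {ae P, forall w, (fun N : nat => \sum_(i < N) psi i * ecan (smp w) (t - i%:Z) u) @ \oo --> vcan (smp w) t u}.
Proof.
move=> Du; have h : {ae P, forall w, forall s, ecan (smp w) s u = eps s w u}.
  by apply: ae_countable => s; exact: ecan_eps.
apply: (filterS3 _ _ canonical_good h (VS t Du)) => w g1 g2 g3.
rewrite (g1 t u Du).1; under eq_fun => N do under eq_bigr => i _ do rewrite g2.
exact: g3.
Qed.

End CanonicalVersions.

(** * Absolute summability and two-sided sums *)

Section Summability.
Context {R : realType} (p : nat) (beta psi : nat -> R).
Local Notation C := R[i].

Definition series_mul (q : {poly C}) (x : nat -> C) (n : nat) : C := \sum_(k < n.+1) q`_k * x (n - k)%N.

Lemma series_mul_XsubC (r : C) (q : {poly C}) (x : nat -> C) n :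
  series_mul (('X - r%:P) * q) x n = (if n is m.+1 then series_mul q x m else 0) - r * series_mul q x n.
Proof.
rewrite /series_mul mulr_sumr.
under eq_bigr => k _ do rewrite mulrBl coefB coefXM coefCM mulrBl -mulrA.
rewrite big_split/= sumrN; congr (_ - _); rewrite big_ord_recl/= mul0r add0r.
by case: n => [|m]; [rewrite big_ord0|apply: eq_bigr => k _; rewrite /= /bump leq0n add1n subSS].
Qed.

(** The relation reads [r z_n = z_(n-1) - y_n]; taking moduli and summing, the sum of [|z|] on the
    right is absorbed because [|r| > 1]. *)
Lemma geometric_step (r : C) (y z : nat -> C) N : 1 < `|r| ->
  (forall n, y n = (if n is m.+1 then z m else 0) - r * z n) ->
  (`|r| - 1) * \sum_(n < N) `|z n| <= \sum_(n < N) `|y n|.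
Proof.
move=> r1 yz.
suff h : `|r| * \sum_(n < N) `|z n| <= \sum_(n < N) `|y n| + \sum_(n < N.-1) `|z n|.
  rewrite mulrBl mul1r lerBlDr (le_trans h)// lerD2l.
  by case: (N) => [|m]//=; rewrite big_ord_recr/= lerDl.
elim: N {yz}(yz) => [|N IH] yz; first by rewrite !big_ord0 mulr0 addr0.
rewrite big_ord_recr/= mulrDr [in X in _ <= X + _]big_ord_recr/=.
have st : `|r| * `|z N| <= `|y N| + (if N is m.+1 then `|z m| else 0).
  rewrite -normrM; have -> : r * z N = (if N is m.+1 then z m else 0) - y N by rewrite yz opprB addrCA subrr addr0.
  rewrite (le_trans (ler_normB _ _))// addrC lerD2l; by case: (N) => [|m] //; rewrite normr0.
apply: (le_trans (lerD (IH yz) st)).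
rewrite addrACA lerD2l; by case: (N) => [|m] /=; [rewrite !big_ord0 addr0|rewrite [in X in _ <= X]big_ord_recr/=].
Qed.

Lemma roots_bound (s : seq C) (x : nat -> C) N : (forall z, z \in s -> 1 < `|z|) ->
  (\prod_(z <- s) (`|z| - 1)) * \sum_(n < N) `|x n| <= \sum_(n < N) `|series_mul (\prod_(z <- s) ('X - z%:P)) x n|.
Proof.
elim: s => [|z s IH] hs.
  rewrite !big_nil mul1r ler_sum// => n _; rewrite /series_mul big_ord_recl/= coefC/= mul1r subn0.
  by rewrite big1 ?addr0// => k _; rewrite coefC/= mul0r.
rewrite !big_cons.
have h := @geometric_step z _ _ N (hs z (mem_head _ _)) (series_mul_XsubC z (\prod_(z <- s) ('X - z%:P)) x).
apply: le_trans h; rewrite -mulrA ler_wpM2l//; last by apply: IH => y ys; apply: hs; rewrite inE ys orbT.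
by rewrite subr_ge0 ltW// hs// mem_head.
Qed.

(** The polynomial is split into linear factors over the complex numbers and [geometric_step] is
    applied root by root, so multiple roots need no special treatment. The product with [psi] is the
    sequence 1, 0, 0, ..., which has norm 1. *)
Lemma inv_series_summable :
  (forall z : C, `|z| <= 1 -> ~~ root (ar_poly p beta) z) -> is_inv_series p beta psi ->
  exists M : R, forall N, \sum_(n < N) `|psi n| <= M.
Proof.
move=> noroot hpsi.
have [s hs] := closed_field_poly_normal (ar_poly p beta).
set lc := lead_coef _ in hs.
have lc0 : lc != 0.
  rewrite lead_coef_eq0; apply/eqP => a0; have := noroot 0; rewrite normr0 ler01 => /(_ isT).
  by rewrite a0 root0.
have s1 z : z \in s -> 1 < `|z|.
  move=> zs; rewrite real_ltNge ?real1 ?normr_real//.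
  apply/negP => /noroot; rewrite hs rootZ// root_prod_XsubC zs//.
have c0 : 0 < \prod_(z <- s) (`|z| - 1).
  by rewrite big_seq prodr_gt0// => z /s1; rewrite subr_gt0.
pose x n := ((psi n)%:C)%C : C.
have act n : series_mul (ar_poly p beta) x n = ((n == 0%N)%:R : C).
  have := hpsi n => /(congr1 (fun r => (r%:C)%C)); rewrite rmorph_sum/= rmorph_nat => <-.
  apply: eq_bigr => k _; rewrite /x rmorphM/= coef_poly; congr (_ * _).
  rewrite /ar_coef ltnS; case: (k == 0%N :> nat) /eqP => [->|_]; first by rewrite rmorph1.
  by case: ifP => _; rewrite ?rmorph0// rmorphN.
have key N : (`|lc| * \prod_(z <- s) (`|z| - 1)) * \sum_(n < N) `|x n| <= 1.
  rewrite -mulrA (@le_trans _ _ (`|lc| * \sum_(n < N) `|series_mul (\prod_(z <- s) ('X - z%:P)) x n|))//.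
    by rewrite ler_wpM2l//; exact: roots_bound.
  rewrite mulr_sumr (_ : \sum_(_ < _) _ = \sum_(n < N) (((n == 0 :> nat)%N)%:R : C)).
    case: N => [|N]; first by rewrite big_ord0.
    by rewrite big_ord_recl big1 ?addr0.
  apply: eq_bigr => n _; rewrite -normrM -[RHS]normr_nat -act hs; congr (`|_|).
  by rewrite /series_mul mulr_sumr; apply: eq_bigr => k _; rewrite coefZ mulrA.
set c := `|lc| * _ in key.
have cpos : 0 < c by rewrite mulr_gt0// normr_gt0.
(* The constant is a positive real seen as a complex number; the order of [R[i]] is read on real
   parts. *)
exists (complex.Re (c^-1)) => N.
have := key N; rewrite -ler_pdivlMl// mulr1.
have -> : \sum_(n < N) `|x n| = ((\sum_(n < N) `|psi n|)%:C)%C.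
  by rewrite rmorph_sum; apply: eq_bigr => n _; rewrite /x normc_def/= expr0n addr0 sqrtr_sqr.
by case: (c^-1) => a b; rewrite lecE/= => /andP[].
Qed.

End Summability.

(** * Symmetric sums over the integers *)

Section Zsum.
Context {R : realType}.
Implicit Types a b : int -> R.

Definition zpart (N : nat) a : R := \sum_(k < (2 * N).+1) a (k%:Z - N%:Z).

Definition zl1 a := exists M : R, forall N, zpart N (fun k => `|a k|) <= M.

Lemma zpart0 a : zpart 0 a = a 0.
Proof. by rewrite /zpart big_ord1. Qed.

Lemma zpartS N a : zpart N.+1 a = zpart N a + (a N.+1%:Z + a (- N.+1%:Z)).
Proof.
rewrite /zpart (_ : (2 * N.+1).+1 = (2 * N).+3)%N; last by lia.
rewrite [LHS]big_ord_recl [X in _ + X = _]big_ord_recr/= [LHS]addrC -[LHS]addrA; congr (_ + (_ + _)).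
- by apply: eq_bigr => k _; congr a; rewrite /= /bump; lia.
- by congr a; rewrite /bump; lia.
- by congr a; lia.
Qed.

Lemma zpartD N a b : zpart N (fun k => a k + b k) = zpart N a + zpart N b.
Proof. by rewrite /zpart big_split. Qed.

Lemma zpartB N a b : zpart N (fun k => a k - b k) = zpart N a - zpart N b.
Proof. by rewrite /zpart sumrB. Qed.

Lemma zpartZ N c a : zpart N (fun k => c * a k) = c * zpart N a.
Proof. by rewrite /zpart mulr_sumr. Qed.

Lemma ler_zpart N a b : (forall k, a k <= b k) -> zpart N a <= zpart N b.
Proof. by move=> h; apply: ler_sum. Qed.

Lemma zpart_ge0 N a : (forall k, 0 <= a k) -> 0 <= zpart N a.
Proof. by move=> h; apply: sumr_ge0. Qed.

Lemma eq_zpart N a b : (forall k, a k = b k) -> zpart N a = zpart N b.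
Proof. by move=> h; apply: eq_bigr. Qed.

Lemma ler_norm_zpart N a : `|zpart N a| <= zpart N (fun k => `|a k|).
Proof. exact: ler_norm_sum. Qed.

Lemma zpart_nondecreasing a : (forall k, 0 <= a k) -> nondecreasing_seq (zpart ^~ a).
Proof. by move=> a0; apply/nondecreasing_seqP => N; rewrite zpartS lerDl addr_ge0. Qed.

Lemma ler_zpart_term N a k : (forall k, 0 <= a k) -> (absz k <= N)%N -> a k <= zpart N a.
Proof.
move=> a0 kN; have hk : (absz (k + N%:Z)%R < (2 * N).+1)%N by lia.
rewrite /zpart (bigD1 (Ordinal hk))//= (_ : (absz (k + N%:Z)%R)%:Z - N%:Z = k); last by lia.
by rewrite lerDl sumr_ge0.
Qed.

Lemma zl1_le a b : (forall k, `|a k| <= `|b k|) -> zl1 b -> zl1 a.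
Proof. by move=> h [M hM]; exists M => N; apply: le_trans (hM N); exact: ler_zpart. Qed.

Lemma zl1D a b : zl1 a -> zl1 b -> zl1 (fun k => a k + b k).
Proof.
move=> [M hM] [M' hM']; exists (M + M') => N; apply: le_trans (lerD (hM N) (hM' N)).
by rewrite -zpartD; apply: ler_zpart => k; exact: ler_normD.
Qed.

Lemma zl1Z c a : zl1 a -> zl1 (fun k => c * a k).
Proof.
move=> [M hM]; exists (`|c| * M) => N; under eq_zpart do rewrite normrM.
by rewrite zpartZ ler_wpM2l.
Qed.

Lemma zl1_norm a : zl1 a -> zl1 (fun k => `|a k|).
Proof. by apply: zl1_le => k; rewrite normr_id. Qed.

Lemma zl1_bounded a : zl1 a -> exists2 M : R, 0 <= M & forall k, `|a k| <= M.
Proof.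
move=> [M hM]; exists M; first by apply: le_trans (hM 0%N); exact: zpart_ge0.
by move=> k; apply: le_trans (hM `|k|%N); exact: (@ler_zpart_term _ (fun k => `|a k|)).
Qed.

Lemma zl1M a b : zl1 a -> zl1 b -> zl1 (fun k => a k * b k).
Proof.
move=> [M hM] /zl1_bounded[B B0 hB]; exists (M * B) => N; apply: le_trans (ler_wpM2r B0 (hM N)).
by rewrite mulrC -zpartZ; apply: ler_zpart => k; rewrite normrM mulrC ler_wpM2r.
Qed.

Lemma zpart_cvg_nneg a : (forall k, 0 <= a k) -> zl1 a -> (zpart ^~ a) @ \oo --> zsum a.
Proof.
move=> a0 [M hM]; apply: (nondecreasing_is_cvgn (zpart_nondecreasing a0)).
exists M => _ [N _ <-]; apply: le_trans (hM N); rewrite le_eqVlt; apply/orP; left; apply/eqP.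
by apply: eq_zpart => k; rewrite ger0_norm.
Qed.

Lemma zpart_cvg a : zl1 a -> (zpart ^~ a) @ \oo --> zsum a.
Proof.
move=> la; have la' := zl1_norm la.
have h1 : (zpart ^~ (fun k => a k + `|a k|)) @ \oo --> zsum (fun k => a k + `|a k|).
  apply: zpart_cvg_nneg; last exact: zl1D.
  by move=> k; rewrite addrC -lerBlDr sub0r (le_trans (ler_norm _))// normrN.
have h2 := zpart_cvg_nneg (fun k => normr_ge0 _) la'.
have h : cvgn (zpart ^~ a).
  rewrite (_ : zpart ^~ a = (fun N => zpart N (fun k => a k + `|a k|) - zpart N (fun k => `|a k|))).
    by apply: is_cvgB; apply/cvg_ex; eexists; [exact: h1|exact: h2].
  by apply/funext => N; rewrite zpartD addrK.
exact: h.
Qed.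

Lemma zsum_eq a l : (zpart ^~ a) @ \oo --> l -> zsum a = l.
Proof. exact: (cvg_lim (@Rhausdorff R)). Qed.

Lemma eq_zsum a b : (forall k, a k = b k) -> zsum a = zsum b.
Proof. by move=> /funext ->. Qed.

Lemma zsumD a b : zl1 a -> zl1 b -> zsum (fun k => a k + b k) = zsum a + zsum b.
Proof.
move=> la lb; apply: zsum_eq; under eq_fun do rewrite zpartD.
by apply: cvgD; exact: zpart_cvg.
Qed.

Lemma zsumZ c a : zl1 a -> zsum (fun k => c * a k) = c * zsum a.
Proof. by move=> la; apply: zsum_eq; under eq_fun do rewrite zpartZ; apply: cvgMr; exact: zpart_cvg. Qed.

Lemma zsumB a b : zl1 a -> zl1 b -> zsum (fun k => a k - b k) = zsum a - zsum b.
Proof.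
move=> la lb; apply: zsum_eq; under eq_fun do rewrite zpartB.
by apply: cvgB; exact: zpart_cvg.
Qed.

Lemma zsum_sum (I : Type) (r : seq I) (F : I -> int -> R) : (forall i, zl1 (F i)) ->
  zl1 (fun k => \sum_(i <- r) F i k) /\ zsum (fun k => \sum_(i <- r) F i k) = \sum_(i <- r) zsum (F i).
Proof.
move=> lF; elim: r => [|i r [IH1 IH2]].
  split; first by exists 0 => N; rewrite /zpart big1// => k _; rewrite big_nil normr0.
  by rewrite big_nil; apply: zsum_eq; apply: cvg_near_cst; apply: nearW => N; rewrite /zpart big1// => k _; rewrite big_nil.
have e k : \sum_(j <- i :: r) F j k = F i k + \sum_(j <- r) F j k by rewrite big_cons.
split; first by apply: zl1_le (zl1D (lF i) IH1) => k; rewrite e.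
by rewrite big_cons -IH2 -zsumD//; apply: eq_zsum.
Qed.

Lemma zpart_le_zsum N a : (forall k, 0 <= a k) -> zl1 a -> zpart N a <= zsum a.
Proof.
move=> a0 la; have h := zpart_cvg la; rewrite /zsum.
by apply: nondecreasing_cvgn_le; [exact: zpart_nondecreasing|apply/cvg_ex; eexists; exact: h].
Qed.

Lemma zsum_le a b : (forall k, a k <= b k) -> zl1 a -> zl1 b -> zsum a <= zsum b.
Proof.
move=> ab /zpart_cvg ha /zpart_cvg hb; apply: (ler_cvg_to ha hb).
by apply: nearW => N; exact: ler_zpart.
Qed.

Lemma zsum_norm a : zl1 a -> `|zsum a| <= zsum (fun k => `|a k|).
Proof.
move=> la; have ha : (fun N => `|zpart N a|) @ \oo --> `|zsum a| by apply: cvg_norm; exact: zpart_cvg.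
apply: (ler_cvg_to ha (zpart_cvg (zl1_norm la))); apply: nearW => N; exact: ler_norm_zpart.
Qed.

Lemma zsum_tail N a : zl1 a -> `|zsum a - zpart N a| <= zsum (fun k => `|a k|) - zpart N (fun k => `|a k|).
Proof.
move=> la.
have h1 : (fun K => `|zpart K a - zpart N a|) @ \oo --> `|zsum a - zpart N a|.
  by apply: cvg_norm; apply: cvgB; [exact: zpart_cvg|exact: cvg_cst].
have h2 : (fun K => zpart K (fun k => `|a k|) - zpart N (fun k => `|a k|)) @ \oo -->
    zsum (fun k => `|a k|) - zpart N (fun k => `|a k|).
  by apply: cvgB; [exact: zpart_cvg (zl1_norm la)|exact: cvg_cst].
apply: (ler_cvg_to h1 h2); exists N => //= K NK.
rewrite -(subnK NK); elim: (K - N)%N => [|m IH]; first by rewrite add0n !subrr normr0.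
rewrite addSn !zpartS.
rewrite [X in X <= _](_ : _ = `|(zpart (m + N) a - zpart N a) + (a (m + N).+1%:Z + a (- (m + N).+1%:Z))|); last by congr (`|_|); ring.
rewrite (le_trans (ler_normD _ _))//.
rewrite [X in _ <= X](_ : _ = (zpart (m + N) (fun k => `|a k|) - zpart N (fun k => `|a k|)) + (`|a (m + N).+1%:Z| + `|a (- (m + N).+1%:Z)|)); last by ring.
by apply: lerD => //; exact: ler_normD.
Qed.

(** One window serves all indices: outside it the tails of [a] and of every [F n] are below the tail
    of [b], and inside it the convergence is that of finitely many terms. *)
Lemma zsum_dominated (F : nat -> int -> R) (a b : int -> R) : zl1 b ->
  (forall n k, `|F n k| <= b k) -> (forall k, F ^~ k @ \oo --> a k) ->
  zl1 a /\ (fun n => zsum (F n)) @ \oo --> zsum a.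
Proof.
move=> lb Fb Fa.
have b0 k : 0 <= b k by apply: le_trans (Fb 0%N k).
have ab k : `|a k| <= b k.
  by apply: (ler_cvg_to (cvg_norm (Fa k)) (cvg_cst (b k))); apply: nearW => n; exact: Fb.
have bn k : b k <= `|b k| := ler_norm _.
have la : zl1 a by apply: zl1_le lb => k; exact: le_trans (ab k) (bn k).
have lF n : zl1 (F n) by apply: zl1_le lb => k; exact: le_trans (Fb n k) (bn k).
split=> //; apply/cvgrPdist_le => e e0.
have hb := zpart_cvg lb.
have e30 : 0 < e / 3 by rewrite divr_gt0.
have [N _ hN] : \forall N \near \oo, zsum b - zpart N b <= e / 3.
  have /cvgrPdist_le/(_ _ e30) := hb; apply: filterS => N.
  by apply: le_trans; exact: ler_norm.
have tailb (c : int -> R) : zl1 c -> (forall k, `|c k| <= b k) -> `|zsum c - zpart N c| <= e / 3.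
  move=> lc cb; apply: le_trans (zsum_tail N lc) _; apply: le_trans (hN N (leqnn N)).
  rewrite lerBlDr -addrA (_ : - zpart N b + _ = - (zpart N (fun k => b k - `|c k|))); last by rewrite zpartB; ring.
  rewrite lerBrDr -lerBrDl -zsumB//; last exact: zl1_norm.
  by apply: zpart_le_zsum => [k|]; [rewrite subr_ge0|apply: zl1D => //; apply: zl1_le (zl1_norm lc) => k; rewrite normrN].
have hp : (fun n => zpart N (F n)) @ \oo --> zpart N a.
  by rewrite /zpart; apply: cvg_sumr => k; exact: Fa.
have /cvgrPdist_le/(_ _ e30) := hp; apply: filterS => n hn.
rewrite (_ : zsum a - zsum (F n) = (zsum a - zpart N a) + (zpart N a - zpart N (F n)) - (zsum (F n) - zpart N (F n))); last by ring.
rewrite (le_trans (ler_normB _ _))//.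
apply: (@le_trans _ _ (e / 3 + e / 3 + e / 3)); last by lra.
apply: lerD; last exact: tailb.
by apply: (le_trans (ler_normD _ _)); apply: lerD => //; exact: tailb.
Qed.

Lemma zl1_cvg0 a : zl1 a -> (fun N : nat => a N%:Z) @ \oo --> 0 /\ (fun N : nat => a (- N%:Z)) @ \oo --> 0.
Proof.
move=> la; have h := zpart_cvg (zl1_norm la).
have hS : (fun N => zpart N.+1 (fun k => `|a k|) - zpart N (fun k => `|a k|)) @ \oo --> (0 : R).
  rewrite -[X in _ --> X](subrr (zsum (fun k => `|a k|))); apply: cvgB => //.
  by rewrite (cvg_shiftS (zpart ^~ (fun k => `|a k|))).
split; rewrite -cvg_shiftS; apply/cvgrPdist_le => e e0;
  have /cvgrPdist_le/(_ _ e0) := hS; apply: filterS => N; rewrite !sub0r !normrN zpartS addrAC subrr add0r;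
  apply: le_trans; rewrite (le_trans _ (ler_norm _))//= ?lerDl ?lerDr//.
Qed.

Lemma zpart_shift1 N a : zpart N (fun k => a (k + 1)) = zpart N a - a (- N%:Z) + a N.+1%:Z.
Proof.
rewrite /zpart [in RHS]big_ord_recl/= [in LHS]big_ord_recr/= (_ : 0%N%:Z - N%:Z = - N%:Z); last by lia.
rewrite [a (- _) + _]addrC addrK; congr (_ + a _); last by lia.
by apply: eq_bigr => k _; congr a; rewrite /= /bump; lia.
Qed.

Lemma zpart_refl N a : zpart N (fun k => a (- k)) = zpart N a.
Proof.
rewrite /zpart (reindex_inj rev_ord_inj)/=; apply: eq_bigr => k _; congr a.
by have := ltn_ord k; lia.
Qed.

Lemma zsum_refl a : zl1 a -> zl1 (fun k => a (- k)) /\ zsum (fun k => a (- k)) = zsum a.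
Proof.
move=> la; split.
  by case: la => M hM; exists M => N; rewrite (zpart_refl N (fun k => `|a k|)).
by apply: zsum_eq; under eq_fun do rewrite zpart_refl; exact: zpart_cvg.
Qed.

Lemma zsum_shift1 a : zl1 a -> zl1 (fun k => a (k + 1)) /\ zsum (fun k => a (k + 1)) = zsum a.
Proof.
move=> la; split.
  case: (la) => M hM; exists M => N; apply: le_trans (hM N.+1).
  rewrite (zpart_shift1 N (fun k => `|a k|)) zpartS lerD// ?lerBlDr ?lerDl//.
apply: zsum_eq; under eq_fun do rewrite zpart_shift1.
have [h1 h2] := zl1_cvg0 la.
rewrite -[zsum a]addr0 -[X in X + 0]subr0; apply: cvgD; last by rewrite (cvg_shiftS (fun N : nat => a N%:Z)).
by apply: cvgB => //; exact: zpart_cvg.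
Qed.

(** A unit shift changes a symmetric window by boundary terms that tend to 0; negative shifts are
    positive ones conjugated by the reflection. *)
Lemma zsum_shift c a : zl1 a -> zl1 (fun k => a (k + c)) /\ zsum (fun k => a (k + c)) = zsum a.
Proof.
move=> la.
have nat_shift (m : nat) b : zl1 b -> zl1 (fun k => b (k + m%:Z)) /\ zsum (fun k => b (k + m%:Z)) = zsum b.
  elim: m b => [|m IH] b lb.
    have -> : (fun k => b (k + 0%N%:Z)) = b by apply/funext => k; rewrite addr0.
    by [].
  have [l1 e1] := zsum_shift1 lb; have [l2 e2] := IH _ l1.
  have -> : (fun k => b (k + m.+1%:Z)) = (fun k => b (k + m%:Z + 1)).
    by apply/funext => k; congr b; lia.
  by rewrite e2 e1.
case: (intP c) => [|n|n]; first by have := nat_shift 0%N a la.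
  exact: nat_shift.
have [lr er] := zsum_refl la; have [ls es] := nat_shift n.+1 _ lr.
have [lt et] := zsum_refl ls.
have e : (fun k => a (- (- k + n.+1%:Z))) = (fun k => a (k + - n.+1%:Z)) by apply/funext => k; congr a; lia.
by rewrite e in lt et; rewrite et es er.
Qed.

Definition zcorr a b (r : int) : R := zsum (fun k => a k * b (k + r)).

Lemma zcorr_term a b r : zl1 a -> zl1 b -> zl1 (fun k => a k * b (k + r)).
Proof. by move=> la lb; apply: zl1M => //; case: (zsum_shift r lb). Qed.

Lemma zcorr_nneg_partial a b N : (forall k, 0 <= a k) -> (forall k, 0 <= b k) -> zl1 a -> zl1 b ->
  zpart N (zcorr a b) <= zsum a * zsum b.
Proof.
move=> a0 b0 la lb; rewrite /zpart /zcorr.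
have [l1 <-] := zsum_sum (index_enum 'I_(2 * N).+1) (fun i : 'I_(2 * N).+1 => zcorr_term (i%:Z - N%:Z) la lb).
rewrite mulrC -zsumZ//; apply: zsum_le => //; last exact: zl1Z.
move=> k; rewrite -mulr_sumr mulrC ler_wpM2r//.
have [ls es] := zsum_shift k lb.
rewrite -es; apply: le_trans (zpart_le_zsum N _ ls) => [|j]; last exact: b0.
by rewrite /zpart le_eqVlt; apply/orP; left; apply/eqP; apply: eq_bigr => i _; rewrite addrC.
Qed.

Lemma zcorr_norm a b r : zl1 a -> zl1 b -> `|zcorr a b r| <= zcorr (fun k => `|a k|) (fun k => `|b k|) r.
Proof.
move=> la lb; apply: (le_trans (zsum_norm (zcorr_term r la lb))).
by rewrite le_eqVlt; apply/orP; left; apply/eqP; apply: eq_zsum => k; rewrite normrM.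
Qed.

Lemma zcorr_l1 a b : zl1 a -> zl1 b -> zl1 (zcorr a b).
Proof.
move=> la lb; exists (zsum (fun k => `|a k|) * zsum (fun k => `|b k|)) => N.
apply: le_trans (zcorr_nneg_partial N _ _ (zl1_norm la) (zl1_norm lb)) => //.
by apply: ler_zpart => r; exact: zcorr_norm.
Qed.

(** Fubini for series: a window over the lag is a series in [k] of [a k] times a window of [b],
    dominated by a multiple of [|a k|], and each such window tends to the full sum of [b]. *)
Lemma zsum_zcorr a b : zl1 a -> zl1 b -> zsum (zcorr a b) = zsum a * zsum b.
Proof.
move=> la lb; apply: zsum_eq.
pose F (n : nat) k := a k * zpart n (fun r => b (k + r)).
have eF n : zpart n (zcorr a b) = zsum (F n).
  rewrite /zpart /zcorr.
  have [_ <-] := zsum_sum (index_enum 'I_(2 * n).+1) (fun i : 'I_(2 * n).+1 => zcorr_term (i%:Z - n%:Z) la lb).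
  by apply: eq_zsum => k; rewrite /F /zpart mulr_sumr.
under eq_fun do rewrite eF.
rewrite mulrC -zsumZ//.
have [|n k|k|] := @zsum_dominated F (fun k => zsum b * a k) (fun k => zsum (fun k => `|b k|) * `|a k|) => //.
- by apply: zl1Z; exact: zl1_norm.
- rewrite /F normrM mulrC ler_wpM2r//; apply: (le_trans (ler_norm_zpart _ _)).
  have [ls <-] := zsum_shift k (zl1_norm lb).
  apply: le_trans (zpart_le_zsum n _ ls) => //; by apply: ler_zpart => j; rewrite addrC.
- rewrite /F mulrC; apply: cvgMr; have [ls <-] := zsum_shift k lb.
  have := zpart_cvg ls; apply: cvg_trans; apply: near_eq_cvg; apply: nearW => n /=.
  by apply: eq_zpart => j; rewrite addrC.
Qed.

Lemma zcorr_even a : zl1 a -> forall r, zcorr a a (- r) = zcorr a a r.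
Proof.
move=> la r; have [_ e] := zsum_shift r (zcorr_term (- r) la la); rewrite /zcorr -e.
by apply: eq_zsum => k; rewrite addrK mulrC.
Qed.

End Zsum.

(** * Quantile functions *)

Section DensityLaw.
Context {R : realType}.
Local Notation RR := (measurableTypeR R).
Local Notation leb := (@lebesgue_measure R).
Local Open Scope ereal_scope.

Definition dprob (g : R -> R) (hg : is_density g) : set RR -> \bar R :=
  fun A => \int[leb]_(x in A) (g x)%:E.

Section instances.
Context (g : R -> R) (hg : is_density g).

Lemma measurable_density : measurable_fun [set: RR] g. Proof. by case: hg. Qed.

Lemma density_ge0 x : (0 <= g x)%R. Proof. by case: hg => _ []. Qed.

Let dprob0 : dprob hg set0 = 0.
Proof. by rewrite /dprob integral_set0. Qed.

Let dprob_ge0 A : 0 <= dprob hg A.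
Proof. by apply: integral_ge0 => x _; rewrite lee_fin density_ge0. Qed.

Let dprob_sigma_additive : semi_sigma_additive (dprob hg).
Proof.
move=> /= F mF tF mUF; rewrite /dprob; apply: cvg_toP.
  apply: ereal_nondecreasing_is_cvgn => m n mn.
  by apply: lee_sum_nneg_natr => // k _ _; exact: dprob_ge0.
rewrite ge0_integral_bigcup//=.
- by apply: measurable_funTS; apply/measurable_EFinP; exact: measurable_density.
- by move=> x _; rewrite lee_fin density_ge0.
Qed.

HB.instance Definition _ := isMeasure.Build _ _ _ (dprob hg) dprob0 dprob_ge0 dprob_sigma_additive.

Let dprob_setT : dprob hg [set: _] = 1%:E.
Proof. exact: hg.2.2. Qed.

HB.instance Definition _ := @Measure_isProbability.Build _ _ R (dprob hg) dprob_setT.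

End instances.

Lemma dprob_integral (g : R -> R) (hg : is_density g) (f : RR -> \bar R) : measurable_fun setT f ->
  \int[dprob hg]_x f x = \int[leb]_x (f x * (g x)%:E).
Proof.
move=> mf; apply: integral_density => //; first exact: measurable_density.
exact: density_ge0.
Qed.

Lemma probability_unique (m1 m2 : probability RR R) :
  (forall x : R, m1 [set` `]-oo, x]] = m2 [set` `]-oo, x]]) -> forall A, measurable A -> m1 A = m2 A.
Proof.
move=> h A mA; apply: (@measure_unique _ R RR (@RGenOInfty.G R) (fun k : nat => [set` `](- k%:R)%R, +oo[])) => //.
- exact: RGenOInfty.measurableE.
- move=> _ _ [x ->] [y ->]; exists (Num.max x y); apply/seteqP; split=> z /=; rewrite !in_itv/= !andbT gt_max.
    by move=> [-> ->].
  by move=> /andP.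
- by move=> k; eexists; reflexivity.
- apply/seteqP; split=> // x _; exists (Num.truncn `|x|).+1 => //=; rewrite in_itv/= andbT.
  by rewrite ltrNl (le_lt_trans (ler_norm _))// normrN truncnS_gt.
- move=> _ [x ->]; have -> : `]x, +oo[%classic = ~` `]-oo, x]%classic by rewrite setCitvl.
  rewrite -[LHS]/(m1 (~` (`]-oo, x]%classic : set RR))) -[RHS]/(m2 (~` (`]-oo, x]%classic : set RR))).
  by rewrite !probability_setC// h.
- by move=> k; rewrite (le_lt_trans (probability_le1 _ _))// ltry.
Qed.

Definition unif01 : probability RR R := uniform_prob (@ltr01 R).

Lemma unif01E (A : set RR) : measurable A -> unif01 A = leb (A `&` `[0%R, 1%R]%classic).
Proof.
move=> mA; rewrite /unif01/= /uniform_prob integral_uniform_pdf.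
transitivity (\int[leb]_(x in A `&` `[0%R, 1%R]) (cst 1 x)).
  apply: eq_integral => x; rewrite inE => -[_ /=]; rewrite in_itv/= /uniform_pdf => ->.
  by rewrite subr0 invr1.
by rewrite integral_cst ?mul1e//; exact: measurableI.
Qed.

Lemma unif01_oo (c : R) : (0 <= c <= 1)%R -> unif01 `]0%R, c[%classic = c%:E.
Proof.
move=> /andP[c0 c1]; rewrite unif01E// (_ : _ `&` _ = `]0%R, c[%classic).
  rewrite lebesgue_measure_itv/= lte_fin; case: ltP => [_|]; first by rewrite sube0.
  by move=> h; congr EFin; apply/eqP; rewrite eq_le c0 h.
apply/seteqP; split=> x /=; rewrite !in_itv/=; first by case.
by move=> /andP[x0 xc]; rewrite x0 xc (ltW x0) (ltW (lt_le_trans xc c1)).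
Qed.

Lemma unif01_oc (c : R) : (0 <= c <= 1)%R -> unif01 `]0%R, c]%classic = c%:E.
Proof.
move=> /andP[c0 c1]; rewrite unif01E// (_ : _ `&` _ = `]0%R, c]%classic).
  rewrite lebesgue_measure_itv/= lte_fin; case: ltP => [_|]; first by rewrite sube0.
  by move=> h; congr EFin; apply/eqP; rewrite eq_le c0 h.
apply/seteqP; split=> x /=; rewrite !in_itv/=; first by case.
by move=> /andP[x0 xc]; rewrite x0 xc (ltW x0) (le_trans xc c1).
Qed.

Lemma unif01_ae : {ae unif01, forall s, (0 < s < 1)%R}.
Proof.
exists (~` `]0%R, 1%R[%classic); split.
- by apply: measurableC; exact: measurable_itv.
- have h : unif01 (~` `]0%R, 1%R[%classic) = 1 - unif01 `]0%R, 1%R[%classic by rewrite probability_setC.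
  by rewrite h unif01_oo ?ler01 ?lexx// subee.
- by move=> s /=; rewrite in_itv.
Qed.

Lemma unif01_eq (A B : set RR) : measurable A -> measurable B ->
  (forall s, (0 < s < 1)%R -> A s <-> B s) -> unif01 A = unif01 B.
Proof.
move=> mA mB AB; have [N [mN N0 hN]] := unif01_ae.
have : \int[unif01]_x (\1_A x)%:E = \int[unif01]_x (\1_B x)%:E.
  apply: (eq_integral_null mN N0) => s Ns; rewrite !indicE; congr (_%:R%:E).
  have hs : (0 < s < 1)%R by apply: contrapT => h; apply: Ns; exact: hN.
  by apply: congr1; apply/idP/idP; rewrite !inE => /(AB _ hs).
by rewrite !integral_indic// !setIT.
Qed.

End DensityLaw.

Section Quantile.
Context {R : realType} (g : R -> R) (hg : is_density g).
Local Notation RR := (measurableTypeR R).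
Local Notation leb := (@lebesgue_measure R).
Local Notation G := (cdf_of g).
Local Notation q := (quantile_of g).

Lemma dprob_cdf (x : R) : dprob hg `]-oo, x]%classic = (G x)%:E.
Proof.
rewrite /cdf_of (_ : [set u | u <= x] = `]-oo, x]%classic); last by apply/seteqP; split=> z /=; rewrite in_itv.
rewrite fineK//; have -> : (\int[leb]_(u in `]-oo, x]) (g u)%:E)%E = dprob hg `]-oo, x]%classic by [].
exact: fin_num_measure.
Qed.

Lemma cdf_ge0 x : 0 <= G x.
Proof. by rewrite -lee_fin -dprob_cdf measure_ge0. Qed.

Lemma cdf_le1 x : G x <= 1.
Proof. by rewrite -lee_fin -dprob_cdf; exact: probability_le1. Qed.

Lemma cdf_nd x y : x <= y -> G x <= G y.
Proof.
move=> xy; rewrite -lee_fin -!dprob_cdf le_measure ?inE//.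
by move=> z /=; rewrite !in_itv/= => /le_trans; apply.
Qed.

Lemma dprob_cdf_lt (x : R) : dprob hg `]-oo, x[%classic = (G x)%:E.
Proof.
rewrite -dprob_cdf -(@setUitv1 _ _ -oo%O x true)// measureU//.
- have z : dprob hg [set x] = 0%E by rewrite /dprob integral_set1.
  by apply/esym; transitivity (dprob hg `]-oo, x[%classic + dprob hg [set x])%E; rewrite // z adde0.
- by apply/seteqP; split=> z //= [/=]; rewrite in_itv/= => h e; move: h; rewrite e ltxx.
Qed.

Lemma cdf_cvg_shift (x : R) (e : R) : 0 < e -> exists2 y, x < y & G y < G x + e.
Proof.
move=> e0; pose F (n : nat) : set RR := `]-oo, x + n.+1%:R^-1]%classic.
have h : dprob hg (F n) @[n --> \oo] --> dprob hg (\bigcap_n F n).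
  apply: nonincreasing_cvg_mu => //.
  - by rewrite ltey_eq fin_num_measure//; exact: measurable_itv.
  - by move=> i; exact: measurable_itv.
  - by apply: bigcap_measurable => // i _; exact: measurable_itv.
  - move=> m n mn; apply/subsetPset => z /=; rewrite /F/= !in_itv/= => /le_trans; apply.
    by rewrite lerD2l lef_pV2 ?posrE// ler_nat.
rewrite -itvNycEbigcap dprob_cdf in h.
have {}h : (fun n => G (x + n.+1%:R^-1)) @ \oo --> G x.
  by move/fine_cvg: h => h; apply: cvg_trans h; apply: near_eq_cvg; apply: nearW => n /=; rewrite /F dprob_cdf.
have /cvgrPdist_lt/(_ _ e0)[N _ hN] := h.
exists (x + N.+1%:R^-1); first by rewrite ltrDl.
have := hN N (leqnn N); rewrite distrC => /(le_lt_trans (ler_norm _)); rewrite ltrBlDl//.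
Qed.

Lemma cdf_left (x s : R) : (forall y, y < x -> G y <= s) -> G x <= s.
Proof.
move=> hs; have U : `]-oo, x[%classic = \bigcup_n `]-oo, x - n.+1%:R^-1]%classic :> set RR.
  apply/seteqP; split=> z /=; rewrite in_itv/=.
    move=> zx; have xz : 0 < x - z by rewrite subr_gt0.
    have [N _ /(_ N.+1 (leqnSn N)) hN] := near_invn 1 xz; rewrite div1r in hN.
    by exists N => //=; rewrite in_itv/= lerBrDl -lerBrDr.
  by move=> [n _ /=]; rewrite in_itv/= => /le_lt_trans; apply; rewrite ltrBlDr ltrDl.
have h : dprob hg `]-oo, x - n.+1%:R^-1]%classic @[n --> \oo] --> dprob hg `]-oo, x[%classic.
  rewrite U; apply: nondecreasing_cvg_mu => //; first exact: bigcup_measurable.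
  move=> m n mn; apply/subsetPset => z /=; rewrite !in_itv/= => /le_trans; apply.
  by rewrite lerD2l lerN2 lef_pV2 ?posrE// ler_nat.
rewrite dprob_cdf_lt in h.
rewrite -lee_fin; apply: (cvge_le _ h); apply: nearW => n.
by rewrite dprob_cdf lee_fin hs// ltrBlDr ltrDl.
Qed.

Lemma cdf_large (s : R) : s < 1 -> exists x, s <= G x.
Proof.
move=> s1; have U : [set: RR] = \bigcup_n `]-oo, n%:R]%classic.
  by apply/seteqP; split=> // z _; exists (Num.truncn z).+1 => //=; rewrite in_itv/= ltW// truncnS_gt.
have h : dprob hg `]-oo, n%:R]%classic @[n --> \oo] --> dprob hg setT.
  rewrite U; apply: nondecreasing_cvg_mu => //; first exact: bigcup_measurable.
  by move=> m n mn; apply/subsetPset => z /=; rewrite !in_itv/= => /le_trans; apply; rewrite ler_nat.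
rewrite probability_setT in h.
apply: contrapT => no; have : (1 <= s%:E)%E.
  apply: (cvge_le _ h); apply: nearW => n; rewrite dprob_cdf lee_fin.
  by apply/ltW; rewrite ltNge; apply/negP => hn; apply: no; exists n%:R.
by rewrite lee_fin leNgt s1.
Qed.

Lemma cdf_small (s : R) : 0 < s -> exists x, G x < s.
Proof.
move=> s0; have U : set0 = \bigcap_n `]-oo, (- n%:R)%R]%classic :> set RR.
  apply/esym; rewrite -subset0 => t /(_ (Num.truncn `|t|).+1 I).
  by rewrite /= in_itv/= leNgt => /negP; apply; rewrite ltrNl (le_lt_trans (ler_norm _))// normrN truncnS_gt.
have h : dprob hg `]-oo, (- n%:R)]%classic @[n --> \oo] --> dprob hg set0.
  rewrite U; apply: nonincreasing_cvg_mu => //.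
  - by rewrite ltey_eq fin_num_measure//; exact: measurable_itv.
  - exact: bigcap_measurable.
  - move=> m n mn; apply/subsetPset => z /=; rewrite !in_itv/= => /le_trans; apply.
    by rewrite lerN2 ler_nat.
rewrite measure0 in h.
apply: contrapT => no; have : (s%:E <= 0)%E.
  apply: (cvge_ge _ h); apply: nearW => n; rewrite dprob_cdf lee_fin leNgt.
  by apply/negP => hn; apply: no; exists (- n%:R).
by rewrite lee_fin leNgt s0.
Qed.

Lemma quantile_le (s x : R) : 0 < s < 1 -> (q s <= x) = (s <= G x).
Proof.
move=> /andP[s0 s1]; set A := [set x | s <= G x].
have [x1 hx1] := cdf_large s1; have [x0 hx0] := cdf_small s0.
have lA : lbound A x0.
  move=> y /= sy; rewrite leNgt; apply/negP => yx0.
  by have := le_lt_trans (cdf_nd (ltW yx0)) hx0; rewrite ltNge sy.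
have iA : has_inf A by split; [exists x1|exists x0].
apply/idP/idP => [qx|sx]; last by apply: ge_inf => //; exists x0.
rewrite leNgt; apply/negP => Gx.
have [y xy Gy] := @cdf_cvg_shift x (s - G x) ltac:(by rewrite subr_gt0).
have [z Az zy] := inf_adherent (eps := y - x) ltac:(by rewrite subr_gt0) iA.
have zy' : z <= y by apply: ltW; apply: lt_le_trans zy _; rewrite -lerBrDr opprB addrC subrK.
have := le_trans Az (cdf_nd zy'); rewrite leNgt => /negP; apply.
by apply: lt_le_trans Gy _; rewrite addrC subrK.
Qed.

Lemma cdf_quantile (s : R) : 0 < s < 1 -> G (q s) = s.
Proof.
move=> hs; apply/eqP; rewrite eq_le; apply/andP; split; last by rewrite -quantile_le.
by apply: cdf_left => y yq; rewrite leNgt; apply/negP => /ltW; rewrite -quantile_le// leNgt yq.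
Qed.

Lemma quantile_lt (s t : R) : 0 < s < 1 -> 0 < t < 1 -> s < t -> q s < q t.
Proof.
move=> hs ht st; rewrite ltNge; apply/negP; rewrite quantile_le// cdf_quantile// => /(lt_le_trans st).
by rewrite ltxx.
Qed.

Lemma quantile_nd (s t : R) : 0 < s < 1 -> 0 < t < 1 -> s <= t -> q s <= q t.
Proof. by move=> hs ht; rewrite le_eqVlt => /predU1P[->//|/(quantile_lt hs ht)/ltW]. Qed.

Lemma measurable_quantile : measurable_fun [set: RR] q.
Proof.
apply: (measurability (@RGenCInfty.G R)) => [|/= _ [_] [r] -> <-].
  exact: RGenCInfty.measurableE.
rewrite setTI.
(* For [s <= 0] the set under [inf] is the whole line and for [s > 1] it is empty, so [q] takes
   constant default values there; monotonicity serves on []0, 1[], and the point 1 is treated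
   apart. *)
have c0 s : s <= 0 -> q s = q 0.
  move=> s0; rewrite /quantile_of; congr inf; apply/seteqP; split=> x _ /=; first exact: cdf_ge0.
  exact: le_trans (cdf_ge0 x).
have c1 s : 1 < s -> q s = q 2.
  move=> s1; rewrite /quantile_of; congr inf; apply/seteqP; split=> x /= h; exfalso;
    have := le_trans h (cdf_le1 x); rewrite leNgt => /negP; apply => //.
  by rewrite ltrDl.
have -> : q @^-1` `[r, +oo[%classic = (`]-oo, 0]%classic `&` [set s | r <= q 0]) `|`
    ((`]0, 1[%classic `&` q @^-1` `[r, +oo[%classic) `|` (([set 1] `&` [set s | r <= q 1]) `|` (`]1, +oo[%classic `&` [set s | r <= q 2]))) :> set RR.
  apply/seteqP; split=> s /=; rewrite !in_itv/= !andbT.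
    have [s0|s0] := leP s 0; first by rewrite c0//; left.
    have [s1|s1|->] := ltgtP s 1; first by right; left.
      by rewrite c1//; right; right; right.
    by right; right; left.
  by move=> [[/c0 ->]//|[[]//|[[->]//|[/c1 ->]//]]].
have mc (b : bool) : measurable ([set s | b] : set RR).
  by case: b; [rewrite (_ : mkset _ = setT)|rewrite (_ : mkset _ = set0)] => //; apply/seteqP; split.
apply: measurableU; first by apply: measurableI => //; exact: mc.
apply: measurableU.
  apply: is_interval_measurable => s t/= [hs qs] [ht qt] u /andP[su ut].
  move: hs ht qs qt; rewrite !in_itv/= !andbT => hs ht qs qt.
  have hu : 0 < u < 1 by case/andP: hs => s0 _; case/andP: ht => _ t1; rewrite (lt_le_trans s0 su) (le_lt_trans ut t1).
  by split=> //; apply: le_trans qs _; exact: quantile_nd.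
by apply: measurableU; apply: measurableI => //; exact: mc.
Qed.

Lemma quantile_law (A : set RR) : measurable A -> unif01 (q @^-1` A) = dprob hg A.
Proof.
move=> mA; have := @probability_unique R.
pose Q : {mfun RR >-> RR} := HB.pack (q : RR -> RR) (isMeasurableFun.Build _ _ _ _ (q : RR -> RR) measurable_quantile).
move=> /(_ (distribution unif01 Q) (dprob hg)) h; apply: (h _ A mA) => x; apply: etrans (esym (dprob_cdf x)).
have mq : measurable (q @^-1` `]-oo, x]%classic : set RR).
  by rewrite -[X in measurable X]setTI; apply: measurable_quantile.
rewrite -(@unif01_oc R (G x)) ?cdf_ge0 ?cdf_le1//; apply: unif01_eq => // s hs /=.
rewrite !in_itv/= quantile_le//.
by split=> [->|/andP[]//]; rewrite andbT; case/andP: hs.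
Qed.

End Quantile.

(** * The average quantile function *)

Section NullSets.
Context {R : realType}.
Local Notation RR := (measurableTypeR R).
Local Notation leb := (@lebesgue_measure R).

Lemma null_cover (N : set RR) (e : R) : measurable N -> leb N = 0%E -> 0 < e ->
  exists I : nat -> R * R, (forall i, (I i).1 <= (I i).2) /\
    N `<=` \bigcup_i `](I i).1, (I i).2]%classic /\ (\sum_(i <oo) ((I i).2 - (I i).1)%:E <= e%:E)%E.
Proof.
move=> mN N0 e0.
have : (leb N < e%:E)%E by rewrite N0 lte_fin.
move=> /ereal_inf_lt[z [/= F [mF NF] Fz ze]].
have h (i : nat) : exists I : R * R, I.1 <= I.2 /\ F i = `]I.1, I.2]%classic.
  have /ocitvP[->|[[a b] /= ab ->]] := mF i.
    by exists (0, 0); split=> //=; rewrite set_itvoc0.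
  by exists (a, b); split=> //=; exact: ltW.
have [I hI] := choice h.
exists I; split; first by move=> i; exact: (hI i).1.
split; first by move=> x /NF[i _]; rewrite (hI i).2 => ?; exists i.
rewrite -Fz in ze; apply/ltW; apply: le_lt_trans ze; apply: lee_nneseries => [i _ _|i _].
  by rewrite lee_fin subr_ge0 (hI i).1.
by rewrite (hI i).2 wlength_itv_bnd// (hI i).1.
Qed.

(** On the image of [phi] the map from [phi s] to [q s] is [K]-Lipschitz, and a Lipschitz map sends
    a null set into a null set: a cover by short intervals becomes a cover by intervals at most
    [2 K] times as long. *)
Lemma expansive_null (D : set R) (phi q : R -> R) (K : R) (N : set RR) : 0 < K ->
  (forall s t, D s -> D t -> `|q s - q t| <= K * `|phi s - phi t|) ->
  measurable N -> leb N = 0%E ->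
  exists J : set RR, [/\ measurable J, leb J = 0%E & forall s, D s -> N (phi s) -> J (q s)].
Proof.
move=> K0 hq mN N0.
have step (m : nat) : exists J : set RR, [/\ measurable J, (leb J <= (m.+1%:R^-1)%:E)%E & forall s, D s -> N (phi s) -> J (q s)].
  have e0 : 0 < m.+1%:R^-1 / (2 * K) by rewrite divr_gt0// mulr_gt0.
  have [I [I12 [NI sI]]] := null_cover mN N0 e0.
  (* The centre is the value of [q] at any parameter that [phi] sends into the interval, and 0 if
     there is none. *)
  have h (i : nat) : exists c : R, forall s, D s -> (`](I i).1, (I i).2]%classic : set R) (phi s) ->
      `|q s - c| <= K * ((I i).2 - (I i).1).
    have [[s0 [Ds0 Is0]]|no] := pselect (exists s0, D s0 /\ (`](I i).1, (I i).2]%classic : set R) (phi s0)).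
      exists (q s0) => s Ds Is; apply: le_trans (hq _ _ Ds Ds0) _; rewrite ler_pM2l//.
      move: Is Is0; rewrite /= !in_itv/= => /andP[a1 a2] /andP[b1 b2].
      by rewrite ler_norml; apply/andP; split; lra.
    by exists 0 => s Ds Is; exfalso; apply: no; exists s.
  have [c hc] := choice h.
  pose J := \bigcup_i `[c i - K * ((I i).2 - (I i).1), c i + K * ((I i).2 - (I i).1)]%classic : set RR.
  exists J; split.
  - by apply: bigcup_measurable => i _; exact: measurable_itv.
  - have sJ : (leb J <= \sum_(i <oo) leb `[(c i - K * ((I i).2 - (I i).1))%R, (c i + K * ((I i).2 - (I i).1))%R]%classic)%E.
      by apply: measure_sigma_subadditive => //; last exact: bigcup_measurable.
    apply: (le_trans sJ).
    have e (i : nat) : leb `[(c i - K * ((I i).2 - (I i).1))%R, (c i + K * ((I i).2 - (I i).1))%R]%classic = ((2 * K)%:E * ((I i).2 - (I i).1)%:E)%E.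
      rewrite lebesgue_measure_itv/= lte_fin; case: ltP => h1.
        by rewrite -EFinD -EFinM; congr EFin; ring.
      have Kp : 0 <= K * ((I i).2 - (I i).1) by apply: mulr_ge0; [exact: ltW|rewrite subr_ge0].
      by rewrite -EFinM -[2 * K * _]mulrA; rewrite (_ : K * ((I i).2 - (I i).1) = 0) ?mulr0//; lra.
    under eq_eseriesr do rewrite e.
    rewrite nneseriesZl//; last by move=> i _; rewrite lee_fin subr_ge0.
    apply: (le_trans (lee_wpmul2l _ sI)); first by rewrite lee_fin mulr_ge0// ltW.
    by rewrite -EFinM lee_fin mulrC divfK// gt_eqF// mulr_gt0.
  - move=> s Ds /NI[i _ hi]; exists i => //=.
    by have := hc i s Ds hi; rewrite ler_norml in_itv/= => /andP[h1 h2]; apply/andP; split; lra.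
have [J hJ] := choice step.
exists (\bigcap_m J m); split.
- by apply: bigcap_measurable => // m _; case: (hJ m).
- apply/eqP; rewrite eq_le measure_ge0 andbT.
  apply/lee_addgt0Pr => e e0; rewrite add0e.
  have [m _ /(_ m (leqnn m)) hm] := near_infty_natSinv_lt (PosNum e0).
  have [mJ le _] := hJ m; apply: le_trans (le_trans le _).
    apply: le_measure; rewrite ?inE//; last by move=> x; apply.
    by apply: bigcap_measurable => // k _; case: (hJ k).
  by rewrite lee_fin ltW.
- by move=> s Ds Ns m _; case: (hJ m) => _ _; apply.
Qed.

End NullSets.

(** * Derivative of a generalized inverse *)

Section GeneralizedInverse.
Context {R : realType} (phi : R -> R).
Local Notation RR := (measurableTypeR R).
Local Notation leb := (@lebesgue_measure R).
Context (mphi : measurable_fun [set: RR] phi)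
  (inc : forall s t, 0 < s < 1 -> 0 < t < 1 -> s < t -> phi s < phi t).

(** For [phi = Qbar f n w] this is [Fhat f n w]. The restriction to [0 < s < 1] keeps out the
    default values of quantile functions. *)
Definition ginv (x : R) : R := sup [set s : R | (0 < s < 1) /\ phi s <= x].

Lemma ginvK s : 0 < s < 1 -> ginv (phi s) = s.
Proof.
move=> hs; rewrite /ginv (_ : [set _ | _] = [set` `]0, s]]) ?sup_itv//; first by case/andP: hs => h _; rewrite bnd_simp.
apply/seteqP; split=> t /=; rewrite in_itv/=.
  move=> [ht pt]; case/andP: (ht) => -> _ /=; rewrite leNgt; apply/negP => /(inc hs ht).
  by rewrite ltNge pt.
move=> /andP[t0 ts]; have ht : 0 < t < 1 by rewrite t0; case/andP: hs => _ /(le_lt_trans ts).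
by split=> //; move: ts; rewrite le_eqVlt => /predU1P[->//|/(inc ht hs)/ltW].
Qed.

Lemma ginv_mem x : 0 <= ginv x <= 1.
Proof.
rewrite /ginv; set A := mkset _.
have [A0|/set0P[s As]] := eqVneq A set0; first by rewrite A0 sup0 lexx ler01.
have hs : has_sup A by split; [exists s|exists 1 => t [/andP[_ /ltW]]].
apply/andP; split.
  by apply: le_trans (ub_le_sup hs.2 As); case: As => /andP[/ltW].
by apply: sup_le_ub; [exists s|move=> t [/andP[_ /ltW]]].
Qed.

Lemma ginv_lt x s : 0 < s < 1 -> s < ginv x -> phi s <= x.
Proof.
move=> hs; rewrite /ginv; set A := mkset _ => sA.
have A0 : A !=set0.
  apply/set0P/eqP => A0; move: sA; rewrite A0 sup0 => h; case/andP: hs => s0 _.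
  by have := lt_trans s0 h; rewrite ltxx.
have hA : has_sup A by split=> //; exists 1 => t [/andP[_ /ltW]].
have [t [ht pt] st] := sup_adherent (eps := sup A - s) ltac:(by rewrite subr_gt0) hA.
apply: le_trans pt; apply/ltW/inc => //; move: st; by rewrite opprB addrC subrK.
Qed.

Lemma ginv_ge x s : 0 < s < 1 -> phi s <= x -> s <= ginv x.
Proof.
by move=> hs px; apply: ub_le_sup => //; exists 1 => t [/andP[_ /ltW]].
Qed.

Lemma ginv_nd x y : x <= y -> ginv x <= ginv y.
Proof.
move=> xy; rewrite {1}/ginv; set A := mkset _.
have [A0|/set0P[s As]] := eqVneq A set0; first by rewrite A0 sup0; case/andP: (ginv_mem y).
apply: sup_le_ub; first by exists s.
by move=> t [ht pt]; apply: ginv_ge => //; exact: le_trans xy.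
Qed.

(** The preimage of a half-line lies, within []0, 1[], between []0, ginv x[] and []0, ginv x]]; thus
    [ginv] is the distribution function of the image of the uniform law. *)
Lemma ginv_law (x : R) : unif01 (phi @^-1` `]-oo, x]%classic : set RR) = (ginv x)%:E.
Proof.
have mA : measurable (phi @^-1` `]-oo, x]%classic : set RR).
  by rewrite -[X in measurable X]setTI; apply: mphi.
have [g0 g1] := andP (ginv_mem x).
apply/eqP; rewrite eq_le; apply/andP; split.
  rewrite -(unif01_oc (ginv_mem x)).
  rewrite (@unif01_eq _ _ ((phi @^-1` `]-oo, x]%classic) `&` `]0, 1[%classic)) //; first last.
  - by move=> s hs; split=> [h|[]//]; split=> //=; rewrite in_itv.
  - exact: measurableI.
  apply: le_measure; rewrite ?inE//; first exact: measurableI.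
  move=> s [/=]; rewrite !in_itv/= => px hs; case/andP: (hs) => -> _ /=; exact: ginv_ge.
rewrite -(unif01_oo (ginv_mem x)); apply: le_measure; rewrite ?inE// => s /=; rewrite !in_itv/= => /andP[s0 sg].
by apply: ginv_lt => //; rewrite s0 (lt_le_trans sg g1).
Qed.

(** The image law has a Radon-Nikodym density [g], so [ginv] is an indefinite integral of [g], and
    Lebesgue's differentiation theorem identifies the pointwise derivative with [g] almost
    everywhere. Absolute continuity rules out mass invisible to the derivative. *)
Lemma ginv_integral (F : R -> R) : measurable_fun [set: RR] F ->
  content_dominates leb (pushforward (@unif01 R) phi) ->
  LInt (fun u => F u * derive1 ginv u) = Eint (@unif01 R) (fun s => F (phi s)).
Proof.
move=> mF dom.
pose Q : {mfun RR >-> RR} := HB.pack (phi : RR -> RR) (isMeasurableFun.Build _ _ _ _ (phi : RR -> RR) mphi).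
pose nu : probability RR R := distribution (@unif01 R) Q.
have nudom : nu `<< leb by apply/null_content_dominatesP.
have [g0 [g_ge0 g_fin g_int gE]] := radon_nikodym_sigma_finite nudom.
pose g := fine \o g0.
have gE0 : EFin \o g = g0 by apply/funext => x; rewrite /g/= fineK.
have intg0 : leb.-integrable [set: RR] (EFin \o g) by rewrite gE0.
have der : {ae leb, forall x, derive1 ginv x = g x}.
  have inty y : leb.-integrable `]-oo, y]%classic (EFin \o g) by apply: (integrableS measurableT).
  have h := @FTC1Ny R g inty (open_integrable_locally openT intg0).
  have e x : \int[leb]_(t in [set` `]-oo, x]]) g t = ginv x.
    rewrite /Rintegral -[ginv x]/(fine (ginv x)%:E) -ginv_law; congr fine.
    by rewrite -[RHS]/(nu `]-oo, x]%classic) gE//; apply: eq_integral => t _; rewrite -[LHS]/((EFin \o g) t) gE0.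
  have e' : (fun x => \int[leb]_(t in [set` `]-oo, x]]) g t) = ginv by exact/funext.
  by move: h; rewrite e'; apply: (@filterS _ _ (ae_filter_ringOfSetsType leb)) => x [].
rewrite -[LHS]/(Eint leb _) (@eq_Eint_ae _ _ _ leb _ (fun u => F u * g u)); last first.
  by apply: (@filterS _ _ (ae_filter_ringOfSetsType leb) _ _ _ der) => x ->.
rewrite /Eint /Rintegral; congr fine.
have mg : measurable_fun [set: RR] g by apply/measurable_EFinP; exact: measurable_int intg0.
transitivity (\int[nu]_x (F x)%:E)%E.
  rewrite (@integral_density _ _ _ leb nu g) //.
  - by move=> x; rewrite /g/= fine_ge0.
  - by move=> A mA; apply: (etrans (gE A mA)); apply: eq_integral => t _; rewrite -[RHS]/((EFin \o g) t) gE0.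
  - exact/measurable_EFinP.
have mF' : measurable_fun [set: RR] (fun x => (F x)%:E) by exact/measurable_EFinP.
rewrite [LHS]integralE [RHS]integralE; congr (_ - _)%E.
  apply: (etrans (ge0_integral_distribution Q (f := (fun x => (F x)%:E)^\+%E) _ _)); [exact: measurable_funepos|by []|by apply: eq_integral => x _; rewrite /= !funeposE].
apply: (etrans (ge0_integral_distribution Q (f := (fun x => (F x)%:E)^\-%E) _ _)); [exact: measurable_funeneg|by []|by apply: eq_integral => x _; rewrite /= !funenegE].
Qed.

End GeneralizedInverse.

(** * Sample autocovariances as integrals over the unit interval *)

Section SampleAutocovariance.
Context {R : realType} {d : measure_display} {O : measurableType d}
  (f : int -> O -> R -> R) (w : O) (n : nat).
Context (n0 : (0 < n)%N) (hf : forall t, is_density (f t w)).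
Local Notation RR := (measurableTypeR R).
Local Notation leb := (@lebesgue_measure R).
Local Notation Q t := (quantile_of (f t%:Z w)).

Lemma measurable_Qbar : measurable_fun [set: RR] (Qbar f n w).
Proof.
apply: measurable_funM => //; apply: measurable_sum => t; exact: measurable_quantile.
Qed.

Lemma Qbar_incr s t : 0 < s < 1 -> 0 < t < 1 -> s < t -> Qbar f n w s < Qbar f n w t.
Proof.
move=> hs ht st; rewrite /Qbar ltr_pM2l ?invr_gt0 ?ltr0n//.
rewrite big_ltn_cond//= [in ltRHS]big_ltn_cond//=; apply: ltr_leD; first exact: quantile_lt.
by apply: ler_sum => i _; exact/ltW/quantile_lt.
Qed.

Lemma Qbar_expansive s t : 0 < s < 1 -> 0 < t < 1 ->
  `|Q 1%N s - Q 1%N t| <= n%:R * `|Qbar f n w s - Qbar f n w t|.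
Proof.
wlog st : s t / s <= t.
  by move=> W hs ht; have [/W|/ltW/W] := leP s t; [exact|rewrite distrC [`|Qbar _ _ _ s - _|]distrC; exact].
move=> hs ht; have n0' : (n%:R : R) != 0 by rewrite pnatr_eq0 -lt0n.
rewrite -[X in X * `|_|]ger0_norm// -normrM mulrBr /Qbar !mulVKf//.
have le i : Q i s <= Q i t by exact: quantile_nd.
rewrite distrC [leRHS]distrC ger0_norm ?subr_ge0// ger0_norm; last by rewrite subr_ge0 ler_sum.
rewrite big_ltn_cond//= [X in _ <= _ - X]big_ltn_cond//= opprD addrACA lerDl subr_ge0; exact: ler_sum.
Qed.

Lemma Qbar_dominates : content_dominates leb (pushforward (@unif01 R) (Qbar f n w)).
Proof.
move=> N mN N0.
have n0' : 0 < (n%:R : R) by rewrite ltr0n.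
have [J [mJ J0 hJ]] := @expansive_null R [set s | 0 < s < 1] (Qbar f n w) (Q 1%N) n%:R N n0' Qbar_expansive mN N0.
have mQN : measurable (Qbar f n w @^-1` N : set RR) by rewrite -[X in measurable X]setTI; exact: measurable_Qbar.
have mQJ : measurable (Q 1%N @^-1` J : set RR) by rewrite -[X in measurable X]setTI; exact: measurable_quantile.
rewrite /pushforward; apply/eqP; rewrite eq_le measure_ge0 andbT.
rewrite (@unif01_eq _ _ ((Qbar f n w @^-1` N) `&` `]0, 1[%classic)) //; first last.
- by move=> s hs; split=> [h|[]//]; split=> //=; rewrite in_itv.
- exact: measurableI.
apply: (@le_trans _ _ (unif01 (Q 1%N @^-1` J))).
  apply: le_measure; rewrite ?inE//; first exact: measurableI.
  by move=> s [/= Ns]; rewrite in_itv/= => hs; exact: hJ.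
rewrite (quantile_law (hf 1))// /dprob.
rewrite null_set_integral//; apply: measurable_funTS; apply/measurable_EFinP; exact: measurable_density.
Qed.

(** The substitution [u = Qbar s] and [Fhat (Qbar s) = s] turn [That t u - u] into
    [Q t s - Qbar s]. *)
Lemma autocov_uniform i :
  LInt (fun u => etahat f n w i u * fhat f n w u) =
  Eint (@unif01 R) (fun s => n%:R^-1 * \sum_(1 <= t < (n - i).+1)
     ((Q t s - Qbar f n w s) * (Q (t + i)%N s - Qbar f n w s))).
Proof.
have mF : measurable_fun [set: RR] (Fhat f n w).
  by apply: nondecreasing_measurable => // x y xy; exact: (@ginv_nd R (Qbar f n w) x y xy).
have mT t : measurable_fun [set: RR] (That f n w t).
  by apply: (measurableT_comp (measurable_quantile (hf t%:Z))).
have -> : LInt (fun u => etahat f n w i u * fhat f n w u) =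
    Eint (@unif01 R) (fun s => etahat f n w i (Qbar f n w s)).
  apply: (ginv_integral measurable_Qbar Qbar_incr _ Qbar_dominates).
  apply: measurable_funM => //; apply: measurable_sum => t.
  by apply: measurable_funM; apply: measurable_funB.
apply: eq_Eint_ae; apply: (@filterS _ _ (ae_filter_ringOfSetsType unif01) _ _ _ unif01_ae) => s hs.
have FQ : Fhat f n w (Qbar f n w s) = s by exact: (ginvK Qbar_incr).
by rewrite /etahat /That; congr (_ * _); apply: eq_bigr => t _; rewrite FQ.
Qed.

End SampleAutocovariance.

(** * Optimal transport from the reference density *)

Section Transport.
Context {R : realType} (f0 : R -> R) (hf0 : is_density f0) (iD : is_interval (dens_support f0)).
Local Notation leb := (@lebesgue_measure R).
Local Notation D := (dens_support f0).
Local Notation Q0 := (quantile_of f0).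
Local Notation F0 := (cdf_of f0).

Lemma density_off_support u : ~ D u -> f0 u = 0.
Proof.
move=> nD; apply/eqP; apply: contra_notT nD => fu0; apply: subset_closure.
by rewrite /= lt_neqAle eq_sym fu0 (density_ge0 hf0).
Qed.

(** [V] is controlled on the support only, so the sets to be compared are related there only; off
    the support the density vanishes. *)
Lemma le_integral_density_set (A B : set R) : (forall u, D u -> A u -> B u) ->
  (\int[leb]_(u in A) (f0 u)%:E <= \int[leb]_(u in B) (f0 u)%:E)%E.
Proof.
move=> AB; rewrite integral_mkcond [leRHS]integral_mkcond.
have h0 (C : set R) u : (0 <= ((fun u => (f0 u)%:E) \_ C) u)%E.
  by rewrite patchE; case: ifP => _ //; rewrite lee_fin (density_ge0 hf0).
apply: (@ge0_le_integral_null _ _ _ leb _ _ set0) => //.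
move=> u _; rewrite !patchE; case: ifPn; rewrite ?inE => Au.
  have [Du|nD] := pselect (D u); first by rewrite mem_set//; exact: AB.
  by rewrite density_off_support//; case: ifP.
by have := h0 B u; rewrite patchE.
Qed.

(** If [Q0 s] had a neighbourhood disjoint from the support, [F0] would be constant just to its left
    and a smaller point would already reach the level [s]. *)
Lemma support_quantile s : 0 < s < 1 -> D (Q0 s).
Proof.
move=> hs; apply: contrapT => nD.
have : nbhs (Q0 s) (~` D) by apply: open_nbhs_nbhs; split=> //; exact/closed_openC/closed_closure.
move=> /nbhs_ballP[e /= e0 he].
have : F0 (Q0 s) <= F0 (Q0 s - e / 2).
  rewrite -lee_fin -!(dprob_cdf hf0); apply: le_integral_density_set => u Du /=; rewrite !in_itv/= => us.
  rewrite leNgt; apply/negP => h; apply: (he u) => //.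
  by rewrite /ball/= ger0_norm ?subr_ge0//; move: h e0; lra.
rewrite (cdf_quantile hf0 hs); rewrite -(quantile_le hf0)// leNgt => /negP; apply.
by rewrite ltrBlDr ltrDl divr_gt0.
Qed.

Context (V g : R -> R)
  (VD : forall u, D u -> derivable V u 1 /\ -1 < derive1 V u) (hg : exp_density f0 V g).

Lemma transport_increasing a b : D a -> D b -> a < b -> V a + a < V b + b.
Proof.
move=> Da Db ab.
have Dm x : a <= x <= b -> D x by move=> h; exact: (iD Da Db h).
have hd x : x \in `]a, b[%R -> is_derive x 1 V (derive1 V x).
  rewrite in_itv/= => /andP[/ltW ax /ltW xb]; apply: DeriveDef; last by rewrite derive1E.
  by apply: (VD _).1; apply: Dm; rewrite ax.
have hc : {within `[a, b], continuous V}.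
  apply: continuous_in_subspaceT => x; rewrite inE/= in_itv/= => hx.
  by apply: differentiable_continuous; apply/derivable1_diffP; exact: (VD (Dm x hx)).1.
have [c cab e] := @MVT R V (derive1 V) a b ab hd hc.
have Dc : D c by apply: Dm; move: cab; rewrite in_itv/= => /andP[/ltW -> /ltW ->].
have := (VD Dc).2; have ba : 0 < b - a by rewrite subr_gt0.
move=> h; have : 0 < (derive1 V c + 1) * (b - a) by rewrite mulr_gt0// -ltrBlDr sub0r.
by rewrite mulrDl mul1r -e; lra.
Qed.

Lemma exp_density_cdf x : (cdf_of g x)%:E = (\int[leb]_(u in [set u | (V u + u <= x)%R]) (f0 u)%:E)%E.
Proof.
by rewrite -(dprob_cdf hg.1) /dprob hg.2.
Qed.

(** If [V + id] exceeds [x] at [Q0 s], continuity and monotonicity keep it above [x] from a point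
    strictly left of [Q0 s] on, so the mass of its sublevel set is below [s]. The converse is
    monotonicity. *)
Lemma transport_cdf s x : 0 < s < 1 -> (s <= cdf_of g x) = (V (Q0 s) + Q0 s <= x).
Proof.
move=> hs; have Dq := support_quantile hs.
apply/idP/idP => [sx|Tx].
  rewrite leNgt; apply/negP => xT.
  have cT : {for Q0 s, continuous (fun u => V u + u)}.
    apply: cvgD; last exact: cvg_id.
    apply: differentiable_continuous; apply/derivable1_diffP; exact: (VD Dq).1.
  have e0 : 0 < V (Q0 s) + Q0 s - x by rewrite subr_gt0.
  have := cT; move=> /cvgrPdist_lt/(_ _ e0)/nbhs_ballP[d /= d0 hd].
  have : cdf_of g x <= F0 (Q0 s - d / 2).
    rewrite -lee_fin exp_density_cdf -(dprob_cdf hf0); apply: le_integral_density_set => u Du /= Tu.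
    rewrite in_itv/= leNgt; apply/negP => h.
    have [uq|qu] := ltP u (Q0 s).
      have := hd u; rewrite /ball/= ger0_norm ?subr_ge0 ?(ltW uq)// => /(_ ltac:(lra)).
      by move=> /(le_lt_trans (ler_norm _)); lra.
    have : V (Q0 s) + Q0 s <= V u + u.
      by move: qu; rewrite le_eqVlt => /predU1P[->//|/(transport_increasing Dq Du)/ltW].
    by move: Tu xT; lra.
  move=> /(le_trans sx); rewrite -(quantile_le hf0)// leNgt => /negP; apply.
  by rewrite ltrBlDr ltrDl divr_gt0.
rewrite -{1}(cdf_quantile hf0 hs) -lee_fin exp_density_cdf -(dprob_cdf hf0).
apply: le_integral_density_set => u Du /=; rewrite in_itv/= => uq; apply: le_trans Tx.
by move: uq; rewrite le_eqVlt => /predU1P[->//|/(transport_increasing Du Dq)/ltW].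
Qed.

Lemma transport_quantile s : 0 < s < 1 -> quantile_of g s = V (Q0 s) + Q0 s.
Proof.
move=> hs; rewrite /quantile_of (_ : [set x | _] = [set` `[V (Q0 s) + Q0 s, +oo[]) ?inf_itv//.
by apply/seteqP; split=> x /=; rewrite (transport_cdf x hs) in_itv/= andbT.
Qed.

End Transport.

Section DensityIntegrals.
Context {R : realType} (f0 : R -> R) (hf0 : is_density f0).
Local Notation RR := (measurableTypeR R).
Local Notation leb := (@lebesgue_measure R).
Local Notation Q0 := (quantile_of f0).
Local Notation F0 := (cdf_of f0).
Local Notation mu := (dprob hf0).

Lemma measurable_cdf : measurable_fun [set: RR] F0.
Proof. by apply: nondecreasing_measurable => // x y; exact: (cdf_nd hf0). Qed.

(** The identity holds at every [Q0 s] with [0 < s < 1], and [mu] is the law of [Q0] under the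
    uniform law. *)
Lemma dprob_quantile_ae : {ae mu, forall u, 0 < F0 u < 1 /\ Q0 (F0 u) = u}.
Proof.
have mq := measurable_quantile hf0; have mF := measurable_cdf.
pose E : set RR := [set u | 0 < F0 u < 1 /\ Q0 (F0 u) = u].
have mE : measurable E.
  have -> : E = (F0 @^-1` `]0, 1[%classic) `&` ((fun u => Q0 (F0 u) - u) @^-1` [set 0]).
    apply/seteqP; split=> u /=; rewrite in_itv/=.
      by move=> [-> ->]; rewrite subrr.
    by case=> h /eqP; rewrite subr_eq0 => /eqP e; split.
  apply: measurableI.
    by rewrite -[X in measurable X]setTI; apply: mF.
  have mc : measurable_fun [set: RR] (fun u => Q0 (F0 u) - u).
    by apply: measurable_funB => //; exact: (measurableT_comp mq mF).
  by rewrite -[X in measurable X]setTI; apply: mc => //; exact: measurable_set1.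
have mQE : measurable (Q0 @^-1` E : set RR) by rewrite -[X in measurable X]setTI; exact: mq.
have E1 : mu E = 1%E.
  rewrite -(quantile_law hf0 mE) -(@probability_setT _ _ _ (@unif01 R)).
  apply: unif01_eq => // s hs; split=> // _ /=.
  by rewrite /E/= !(cdf_quantile hf0 hs).
exists (~` E); split.
- exact: measurableC.
- have h : mu (~` E) = (1 - mu E)%E by rewrite probability_setC.
  by rewrite h E1 subee.
- by move=> u.
Qed.

Lemma dprob_Eint (F : R -> R) : measurable_fun [set: RR] F -> Eint mu F = LInt (fun u => F u * f0 u).
Proof.
move=> mF; rewrite /Eint /Rintegral /LInt dprob_integral//.
exact/measurable_EFinP.
Qed.

Lemma dprob_Eint_quantile (F : R -> R) : measurable_fun [set: RR] F ->
  Eint mu F = Eint (@unif01 R) (fun s => F (Q0 s)).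
Proof.
move=> mF; rewrite /Eint /Rintegral; congr fine.
pose Q : {mfun RR >-> RR} := HB.pack (Q0 : RR -> RR) (isMeasurableFun.Build _ _ _ _ (Q0 : RR -> RR) (measurable_quantile hf0)).
have mF' : measurable_fun [set: RR] (fun x => (F x)%:E) by exact/measurable_EFinP.
have e (h : RR -> \bar R) : measurable_fun setT h -> (forall x, 0 <= h x)%E ->
   (\int[mu]_x h x = \int[@unif01 R]_s h (Q0 s))%E.
  move=> mh h0; rewrite -[RHS]/(\int[@unif01 R]_s (h \o Q) s)%E -ge0_integral_distribution//.
  by apply: eq_measure_integral => A mA _; exact: (esym (quantile_law hf0 mA)).
rewrite [LHS]integralE [RHS]integralE; congr (_ - _)%E.
  by rewrite e//; [apply: eq_integral => x _; rewrite /= !funeposE|exact: measurable_funepos].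
by rewrite e//; [apply: eq_integral => x _; rewrite /= !funenegE|exact: measurable_funeneg].
Qed.

Lemma dprob_null (N : set RR) : measurable N -> mu N = 0%E ->
  leb.-negligible [set u | N u /\ f0 u <> 0].
Proof.
move=> mN N0; have mf := measurable_density hf0.
have : (\int[leb]_(x in N) `|(f0 x)%:E| = 0)%E.
  by rewrite -[RHS]N0; apply: eq_integral => x _; rewrite gee0_abs// lee_fin (density_ge0 hf0).
move=> /(ae_eq_integral_abs leb mN)-/(_ ltac:(by apply/measurable_EFinP; exact: measurable_funTS)).
apply: negligibleS => u /= [Nu fu] h; apply: fu.
by have := h Nu; move=> /= [].
Qed.

Lemma LInt_density_ae (F F' : R -> R) : {ae mu, forall u, F u = F' u} -> measurable_fun [set: RR] F' ->
  LInt (fun u => F u * f0 u) = Eint mu F'.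
Proof.
move=> [N [mN N0 hN]] mF'; rewrite dprob_Eint//.
apply: (@eq_Eint_ae _ _ _ leb); apply: negligibleS (dprob_null mN N0) => u /= h.
split; first by apply: hN => /= e; apply: h; rewrite e.
by move=> f00; apply: h; rewrite f00 !mulr0.
Qed.

Lemma dprob_prod_integral (H : RR * RR -> \bar R) : measurable_fun setT H -> (forall z, 0 <= H z)%E ->
  (\int[leb \x leb]_z (H z * (f0 z.1 * f0 z.2)%:E) = \int[mu \x mu]_z H z)%E.
Proof.
move=> mH H0; have mf := measurable_density hf0; have f_ge0 := density_ge0 hf0.
rewrite fubini_tonelli1//=; first last.
- by move=> z; rewrite mule_ge0// lee_fin mulr_ge0.
- apply: emeasurable_funM => //; apply/measurable_EFinP; apply: measurable_funM.
    exact: (measurableT_comp mf measurable_fst).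
  exact: (measurableT_comp mf measurable_snd).
rewrite (@fubini_tonelli1 _ _ _ _ _ mu mu)// dprob_integral; last exact: measurable_fun_fubini_tonelli_F.
apply: eq_integral => x _; rewrite /fubini_F/=.
have mHx : measurable_fun [set: RR] (fun y => H (x, y)) by apply: measurableT_comp mH _; exact: measurable_pair1.
rewrite dprob_integral// -ge0_integralZr//.
- by apply: eq_integral => y _; rewrite -muleA -EFinM [f0 y * _]mulrC.
- by apply: emeasurable_funM => //; exact/measurable_EFinP.
- by move=> y _; rewrite mule_ge0// lee_fin.
- by rewrite lee_fin.
Qed.

Lemma dprob_prod_Eint (H : RR * RR -> R) : measurable_fun setT H ->
  fine (\int[leb \x leb]_z ((H z * f0 z.1 * f0 z.2)%:E))%E = Eint (mu \x mu)%E H.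
Proof.
move=> mH; have f_ge0 := density_ge0 hf0; rewrite /Eint /Rintegral; congr fine.
have mH' : measurable_fun setT (fun z => (H z)%:E) by exact/measurable_EFinP.
rewrite [LHS]integralE [RHS]integralE; congr (_ - _)%E.
  rewrite -dprob_prod_integral//; last exact: measurable_funepos.
  apply: eq_integral => z _; rewrite !funeposE -mulrA EFinM maxe_pMl ?mul0e// lee_fin mulr_ge0//.
rewrite -dprob_prod_integral//; last exact: measurable_funeneg.
by apply: eq_integral => z _; rewrite !funenegE -mulrA EFinM -mulNe maxe_pMl ?mul0e// lee_fin mulr_ge0.
Qed.

End DensityIntegrals.

(** * Moments of the innovations *)

Section AlmostEverywhere.
Context {R : realType} {d : measure_display} {T : measurableType d} (m : {measure set T -> \bar R}).

Lemma aeS (A B : T -> Prop) : (forall x, A x -> B x) -> {ae m, forall x, A x} -> {ae m, forall x, B x}.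
Proof. by move=> AB; apply: (@filterS _ _ (ae_filter_ringOfSetsType m)). Qed.

Lemma aeS2 (A B C : T -> Prop) : (forall x, A x -> B x -> C x) ->
  {ae m, forall x, A x} -> {ae m, forall x, B x} -> {ae m, forall x, C x}.
Proof. by move=> ABC; apply: (@filterS2 _ _ (ae_filter_ringOfSetsType m)). Qed.

Lemma aeS3 (A B C E : T -> Prop) : (forall x, A x -> B x -> C x -> E x) ->
  {ae m, forall x, A x} -> {ae m, forall x, B x} -> {ae m, forall x, C x} -> {ae m, forall x, E x}.
Proof. by move=> ABC; apply: (@filterS3 _ _ (ae_filter_ringOfSetsType m)). Qed.

End AlmostEverywhere.

(** * Fubini's theorem for real integrals *)

Section EintFubini.
Context {R : realType} {d1 d2 : measure_display} {X : measurableType d1} {Y : measurableType d2}.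

Lemma measurable_Eint_section (m2 : probability Y R) (F : X * Y -> R) : measurable_fun setT F ->
  measurable_fun setT (fun x => Eint m2 (fun y => F (x, y))).
Proof.
move=> mF; apply: (measurableT_comp (fine_measurable measurableT)).
have mF' : measurable_fun setT (EFin \o F) by exact/measurable_EFinP.
have -> : (fun x => \int[m2]_y (F (x, y))%:E)%E =
    (fun x => fubini_F m2 (EFin \o F)^\+ x - fubini_F m2 (EFin \o F)^\- x)%E.
  apply/funext => x; rewrite integralE /fubini_F; congr (_ - _)%E; apply: eq_integral => y _.
    by rewrite !funeposE.
  by rewrite !funenegE.
apply: emeasurable_funB; apply: measurable_fun_fubini_tonelli_F => //;
  [exact: measurable_funepos|exact: measurable_funeneg].
Qed.

Context (m1 : probability X R) (m2 : probability Y R).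
Local Notation m12 := (m1 \x m2)%E.

Lemma intg_le_ae {d} {T : measurableType d} (m : probability T R) (f g : T -> R) : measurable_fun setT f ->
  {ae m, forall x, `|f x| <= g x} -> intg m g -> intg m f.
Proof.
move=> mf [N [mN N0 hN]] ig; apply/integrableP; split; first exact/measurable_EFinP.
apply: (@le_lt_trans _ _ (\int[m]_x `|(g x)%:E|)%E); last by have /integrableP[] := ig.
apply: (ge0_le_integral_null mN N0) => // x Nx.
rewrite lee_fin; apply: le_trans (ler_norm _); apply: contrapT => h; apply: Nx; exact: hN.
Qed.

Lemma intg_section1 (F : X * Y -> R) : intg m12 F -> {ae m1, forall x, intg m2 (fun y => F (x, y))}.
Proof. by move=> iF; have := ae_integrable1 iF. Qed.

Lemma intg_section2 (F : X * Y -> R) : intg m12 F -> {ae m2, forall y, intg m1 (fun x => F (x, y))}.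
Proof. by move=> iF; have := ae_integrable2 iF. Qed.

Lemma measurable_section1 (F : X * Y -> R) x : measurable_fun setT F -> measurable_fun setT (fun y => F (x, y)).
Proof. by move=> mF; apply: measurableT_comp mF _; exact: measurable_pair1. Qed.

Lemma measurable_section2 (F : X * Y -> R) y : measurable_fun setT F -> measurable_fun setT (fun x => F (x, y)).
Proof. by move=> mF; apply: measurableT_comp mF _; exact: measurable_pair2. Qed.

Lemma L2_section1 (F : X * Y -> R) : L2 m12 F -> {ae m1, forall x, L2 m2 (fun y => F (x, y))}.
Proof.
by move=> [mF /intg_section1]; apply: filterS => x ix; split=> //; exact: measurable_section1.
Qed.

Lemma L2_section2 (F : X * Y -> R) : L2 m12 F -> {ae m2, forall y, L2 m1 (fun x => F (x, y))}.
Proof.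
by move=> [mF /intg_section2]; apply: filterS => x ix; split=> //; exact: measurable_section2.
Qed.

Lemma Eint_fubini1 (F : X * Y -> R) : intg m12 F ->
  intg m1 (fun x => Eint m2 (fun y => F (x, y))) /\
  Eint m1 (fun x => Eint m2 (fun y => F (x, y))) = Eint m12 F.
Proof.
move=> iF; have iFF := integrable_fubini_F iF; have mF := intgmf iF.
have ae1 : {ae m1, forall x, fubini_F m2 (EFin \o F) x = (Eint m2 (fun y => F (x, y)))%:E}.
  by apply: filterS (intg_section1 iF) => x ix; rewrite /fubini_F/= (intg_fin ix).
split.
  apply/integrableP; split; first by apply/measurable_EFinP; exact: measurable_Eint_section.
  rewrite (@eq_integral_negligible _ _ _ m1 _ (fun x => `|fubini_F m2 (EFin \o F) x|%E)).
    by have /integrableP[] := iFF.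
  by apply: negligibleS ae1 => x /= h h2; apply: h; rewrite h2.
rewrite -[LHS]/(fine _) -[RHS]/(fine _); congr fine.
rewrite -(integral12_prod_meas1 iF); apply: eq_integral_negligible.
by apply: negligibleS ae1 => x /= h h2; apply: h; rewrite h2.
Qed.

End EintFubini.

Section EintFubini2.
Context {R : realType} {d1 d2 : measure_display} {X : measurableType d1} {Y : measurableType d2}
  (m1 : probability X R) (m2 : probability Y R).
Local Notation m12 := (m1 \x m2)%E.

Lemma intg_swap (F : X * Y -> R) : intg m12 F -> intg (m2 \x m1)%E (F \o (fun z => (z.2, z.1))).
Proof.
move=> iF; have mF := intgmf iF.
have mF' : measurable_fun setT (EFin \o F) by exact/measurable_EFinP.
apply/integrable12ltyP; first by apply: measurableT_comp mF' _; apply/measurable_fun_pairP; split; [exact: measurable_snd|exact: measurable_fst].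
exact: ((@integrable21ltyP _ _ _ _ _ m1 m2 _ mF').1 iF).
Qed.

Lemma Eint_fubini2 (F : X * Y -> R) : intg m12 F ->
  intg m2 (fun y => Eint m1 (fun x => F (x, y))) /\
  Eint m2 (fun y => Eint m1 (fun x => F (x, y))) = Eint m12 F.
Proof.
move=> iF.
have ae1 : {ae m2, forall y, fubini_G m1 (EFin \o F) y = (Eint m1 (fun x => F (x, y)))%:E}.
  by apply: filterS (intg_section2 iF) => x ix; rewrite /fubini_G/= (intg_fin ix).
split; first by have [] := Eint_fubini1 (intg_swap iF).
rewrite -[LHS]/(fine _) -[RHS]/(fine _); congr fine.
rewrite -(integral21_prod_meas1 iF); apply: eq_integral_negligible.
by apply: negligibleS ae1 => x /= h h2; apply: h; rewrite h2.
Qed.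

Lemma L2_Eint (F : X * Y -> R) : L2 m12 F ->
  L2 m1 (fun x => Eint m2 (fun y => F (x, y))) /\ nrm2 m1 (fun x => Eint m2 (fun y => F (x, y))) <= nrm2 m12 F.
Proof.
move=> lF; have [mF iF2] := lF; have [i1 e1] := Eint_fubini1 iF2.
have mE := measurable_Eint_section m2 mF.
have le : {ae m1, forall x, `|Eint m2 (fun y => F (x, y)) ^+ 2| <= Eint m2 (fun y => F (x, y) ^+ 2)}.
  apply: filterS (L2_section1 lF) => x lx; rewrite ger0_norm ?sqr_ge0//.
  apply: le_trans (sqr_Eint_le lx); rewrite -sqr_norm ler_sqr ?nnegrE ?Eint_ge0//.
  exact: Eint_norm (L2_intg lx).
have i2 : intg m1 (fun x => Eint m2 (fun y => F (x, y)) ^+ 2).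
  by apply: (intg_le_ae _ le i1); exact: measurable_funX.
split=> //; rewrite /nrm2 -e1 -subr_ge0 -EintB//.
(* The difference is nonnegative for almost every [x] only; its absolute value has the same integral
   and is nonnegative everywhere. *)
rewrite (@eq_Eint_ae _ _ _ m1 _ (fun x => `|Eint m2 (fun y => F (x, y) ^+ 2) - Eint m2 (fun y => F (x, y)) ^+ 2|)).
  by apply: Eint_ge0.
by apply: filterS le => x h; rewrite ger0_norm// subr_ge0 (le_trans (ler_norm _)).
Qed.

Lemma intg_prodM (f : X -> R) (g : Y -> R) : intg m1 f -> intg m2 g ->
  intg m12 (fun z => f z.1 * g z.2) /\ Eint m12 (fun z => f z.1 * g z.2) = Eint m1 f * Eint m2 g.
Proof.
move=> fi gi; have mf := intgmf fi; have mg := intgmf gi.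
have mF : measurable_fun setT (fun z : X * Y => f z.1 * g z.2).
  by apply: measurable_funM; [exact: measurableT_comp mf measurable_fst|exact: measurableT_comp mg measurable_snd].
have iF : intg m12 (fun z => f z.1 * g z.2).
  apply/integrable12ltyP; first exact/measurable_EFinP.
  have gn := intg_norm gi; have fn := intg_norm fi.
  rewrite (_ : (fun x => \int[m2]_y `|(EFin \o _) (x, y)|) = (fun x => (`|f x| * Eint m2 (fun y => `|g y|))%:E))%E.
    have h : intg m1 (fun x => Eint m2 (fun y => `|g y|) * `|f x|) by exact: intgZ.
    rewrite (_ : (fun x => _) = (fun x => (Eint m2 (fun y => `|g y|) * `|f x|)%:E)); last by apply/funext => x; rewrite mulrC.
    by rewrite (intg_fin h) ltry.
  apply/funext => x; rewrite (_ : `|f x| * _ = Eint m2 (fun y => `|f x| * `|g y|)); last by rewrite EintZ.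
  rewrite -(intg_fin (intgZ _ gn)); apply: eq_integral => y _; by rewrite /= normrM.
split=> //; rewrite -(Eint_fubini1 iF).2 /=.
under eq_fun => x do rewrite EintZ//.
under eq_fun => x do rewrite mulrC.
by rewrite EintZ// mulrC.
Qed.

Lemma intg_prod_fst (f : X -> R) : intg m1 f -> intg m12 (fun z => f z.1).
Proof.
move=> fi; have [+ _] := intg_prodM fi (intg_cst m2 1).
by apply: intg_eq => z; rewrite mulr1.
Qed.

Lemma intg_prod_snd (g : Y -> R) : intg m2 g -> intg m12 (fun z => g z.2).
Proof.
move=> gi; have [+ _] := intg_prodM (intg_cst m1 1) gi.
by apply: intg_eq => z; rewrite mul1r.
Qed.

Lemma ae_prod_fst (A : X -> Prop) : {ae m1, forall x, A x} -> {ae m12, forall z, A z.1}.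
Proof.
move=> [N [mN N0 hN]]; exists (N `*` setT); split; first exact: measurableX.
  transitivity (m1 N * m2 setT)%E; first exact: product_measure1E.
  by rewrite N0 mul0e.
by move=> z /= h; split=> //; apply: hN.
Qed.

Lemma ae_prod_snd (A : Y -> Prop) : {ae m2, forall y, A y} -> {ae m12, forall z, A z.2}.
Proof.
move=> [N [mN N0 hN]]; exists (setT `*` N); split; first exact: measurableX.
  transitivity (m1 setT * m2 N)%E; first exact: product_measure1E.
  by rewrite N0 mule0.
by move=> z /= h; split=> //; apply: hN.
Qed.

End EintFubini2.

Section Moments.
Context {R : realType} {d : measure_display} {Om : measurableType d} (P : probability Om R)
  (eps : int -> Om -> R -> R) (iid : iid_proc P eps).
Local Notation RR := (measurableTypeR R).
Local Notation path := (int -> R -> R).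
Local Notation smp := (sample eps).
Context (mu : probability RR R) (e : path -> int -> R -> R).
(** Asked for every [S] containing [t], in particular the singleton: [e x t] uses no other
    innovation, so it inherits their independence. *)
Context (me : forall (S : set int) t, S t -> measurable_fun setT (fun z : XS S * RR => e z.1 t z.2)).
Context (es : forall k x t u, e (shiftp k x) t u = e x (t + k) u).
Local Notation Pm := (P \x mu)%E.

Definition ep (t : int) (z : Om * RR) : R := e (smp z.1) t z.2.

Context (e4 : L2 Pm (fun z => ep 0 z ^+ 2)).
Context (em : {ae mu, forall u, Eint P (fun w => e (smp w) 0 u) = 0}).

Lemma Eint_shift k (F : path -> R) : measurable_fun (setT : set (XS setT)) F ->
  Eint P (fun w => F (shiftp k (smp w))) = Eint P (fun w => F (smp w)).
Proof.
move=> mF; rewrite /Eint /Rintegral; congr fine.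
by apply: (@sample_shift_E _ _ _ _ _ iid k (EFin \o F)); exact/measurable_EFinP.
Qed.

Lemma measurable_e (S : set int) t u : S t -> measurable_fun (setT : set (XS S)) (fun x : path => e x t u).
Proof.
by move=> St; apply: (measurable_section2 (F := fun z : XS S * RR => e z.1 t z.2)); exact: me.
Qed.

Lemma measurable_smp_pair (S : set int) : measurable_fun setT (fun z : Om * RR => (smp z.1, z.2) : XS S * RR).
Proof.
apply/measurable_fun_pairP; split; last exact: measurable_snd.
by apply: measurableT_comp measurable_fst; exact: (measurable_sample iid).
Qed.

Lemma measurable_ep t : measurable_fun setT (ep t).
Proof.
apply: (@measurableT_comp _ _ _ _ _ _ (fun z : XS setT * RR => e z.1 t z.2) _ (fun z : Om * RR => (smp z.1, z.2) : XS setT * RR)).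
  exact: me.
exact: measurable_smp_pair.
Qed.

Lemma ep_mean t : {ae mu, forall u, Eint P (fun w => e (smp w) t u) = 0}.
Proof.
apply: (aeS _ em) => u h; rewrite -h -(@Eint_shift t (fun x => e x 0 u)); last exact: measurable_e.
by under [in RHS]eq_fun do rewrite es add0r.
Qed.

Lemma ep_sqr_L2 t : L2 Pm (fun z => ep t z ^+ 2).
Proof.
have me4 s : measurable_fun setT (fun z => (((ep s z ^+ 2) ^+ 2)%:E)).
  by apply/measurable_EFinP; apply: measurable_funX; apply: measurable_funX; exact: measurable_ep.
split; first by apply: measurable_funX; exact: measurable_ep.
apply/integrableP; split; first exact: me4.
have [_ /integrableP[_]] := e4.
have nn s : (\int[Pm]_x `|((ep s x ^+ 2) ^+ 2)%:E| = \int[Pm]_x ((ep s x ^+ 2) ^+ 2)%:E)%E.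
  by apply: eq_integral => z _; rewrite gee0_abs// lee_fin sqr_ge0.
rewrite !nn; congr (_ < _)%E.
rewrite !(fubini_tonelli2 (fun z => ((ep _ z ^+ 2) ^+ 2)%:E)) => [|//|z|//|z]; try by rewrite lee_fin sqr_ge0.
apply: eq_integral => u _; rewrite /fubini_G/ep/=.
have := @sample_shift_E _ _ _ _ _ iid t (fun x => ((e x 0 u ^+ 2) ^+ 2)%:E).
move=> <-; first by apply: eq_integral => w _; rewrite es add0r.
apply/measurable_EFinP; apply: measurable_funX; apply: measurable_funX; exact: measurable_e.
Qed.

Lemma ep_L2 t : L2 Pm (ep t).
Proof. by split; [exact: measurable_ep|exact: L2_intg (ep_sqr_L2 t)]. Qed.

Lemma epM_L2 a b : L2 Pm (fun z => ep a z * ep b z).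
Proof.
have ma := measurable_ep a; have mb := measurable_ep b.
split; first exact: measurable_funM.
apply: (@intg_le _ _ _ Pm _ (fun z => (ep a z ^+ 2) ^+ 2 + (ep b z ^+ 2) ^+ 2)).
- by apply: measurable_funX; exact: measurable_funM.
- move=> z; rewrite ger0_norm ?sqr_ge0// exprMn; have := sqr_ge0 (ep a z); have := sqr_ge0 (ep b z); nra.
- by apply: intgD; [case: (ep_sqr_L2 a)|case: (ep_sqr_L2 b)].
Qed.

Definition Zp (a b : int) (x : path) : R := Eint mu (fun u => e x a u * e x b u).

Lemma measurable_Zp (S : set int) a b : S a -> S b -> measurable_fun (setT : set (XS S)) (Zp a b).
Proof.
move=> Sa Sb; apply: (measurable_Eint_section mu (F := fun z : XS S * RR => e z.1 a z.2 * e z.1 b z.2)).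
by apply: measurable_funM; exact: me.
Qed.

Lemma Zp_L2 a b : L2 P (fun w => Zp a b (smp w)).
Proof. by have [] := L2_Eint (epM_L2 a b). Qed.

Lemma Zp_shift k a b x : Zp a b (shiftp k x) = Zp (a + k) (b + k) x.
Proof. by congr Eint; apply/funext => u; rewrite !es. Qed.

Lemma Zp_sym a b x : Zp a b x = Zp b a x.
Proof. by congr Eint; apply/funext => u; rewrite mulrC. Qed.

Lemma L2_prod_fst (G : Om -> R) : L2 P G -> L2 Pm (fun z => G z.1).
Proof.
by move=> [mG iG]; split; [exact: (measurableT_comp mG measurable_fst)|exact: (intg_prod_fst mu iG)].
Qed.

Lemma Eint_Zp (G : Om -> R) a b : L2 P G ->
  Eint P (fun w => G w * Zp a b (smp w)) =
  Eint mu (fun u => Eint P (fun w => G w * (e (smp w) a u * e (smp w) b u))).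
Proof.
move=> lG; have iF : intg Pm (fun z => G z.1 * (ep a z * ep b z)).
  by apply: L2M; [exact: L2_prod_fst|exact: epM_L2].
rewrite (Eint_fubini2 iF).2 -(Eint_fubini1 iF).2; apply: eq_Eint_ae.
apply: filterS (intg_section1 (L2_intg (epM_L2 a b))) => w iw.
by rewrite /= EintZ.
Qed.

Lemma ew_L2 t : {ae mu, forall u, L2 P (fun w => e (smp w) t u)}.
Proof. exact: L2_section2 (ep_L2 t). Qed.

Lemma ewM_L2 a b : {ae mu, forall u, L2 P (fun w => e (smp w) a u * e (smp w) b u)}.
Proof. exact: L2_section2 (epM_L2 a b). Qed.

(** An index that occurs once kills the expectation: after exchanging the integrals, at almost every
    [u] the factor [e x a u] is centred and independent of the rest, which depends on [S] only. *)
Lemma single_index (S : set int) (G : path -> R) a b : ~ S a -> S b ->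
  measurable_fun (setT : set (XS S)) G -> L2 P (fun w => G (smp w)) ->
  Eint P (fun w => G (smp w) * Zp a b (smp w)) = 0.
Proof.
move=> Sa Sb mG lG; rewrite Eint_Zp//.
rewrite (@eq_Eint_ae _ _ _ mu _ (fun=> 0)) ?Eint_cst//.
apply: (aeS3 _ (ep_mean a) (ew_L2 a) (ew_L2 b)) => u hm ha hb.
have dis : [set a] `&` S = set0 by apply/seteqP; split=> // x [-> /Sa].
have [_ h] := @sample_indep_E _ _ _ _ _ iid [set a] S (fun x => e x a u) (fun x => G x * e x b u) dis
  (measurable_e u (erefl : [set a] a)) (measurable_funM mG (measurable_e u Sb)) (L2_intg ha) (L2M lG hb).
transitivity (Eint P (fun w => e (smp w) a u * (G (smp w) * e (smp w) b u))).
  by congr Eint; apply/funext => w; ring.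
by rewrite h -[Eint P (_ \o _)]/(Eint P (fun w => e (smp w) a u)) hm mul0r.
Qed.

Definition gam : R := Eint P (fun w => Zp 0 0 (smp w)).

Lemma EZp_diag a : Eint P (fun w => Zp a a (smp w)) = gam.
Proof.
rewrite /gam -(@Eint_shift a (Zp 0 0)); last exact: measurable_Zp.
by congr Eint; apply/funext => w; rewrite Zp_shift add0r.
Qed.

Lemma EZp_off a b : a != b -> Eint P (fun w => Zp a b (smp w)) = 0.
Proof.
move=> ab; rewrite -(@single_index [set b] (fun=> 1) a b)//; last exact: L2_cst.
  by congr Eint; apply/funext => w; rewrite mul1r.
by move=> /= h; rewrite h eqxx in ab.
Qed.

Definition Yp (a b : int) (x : path) : R := Zp a b x - (a == b)%:R * gam.

Lemma measurable_Yp (S : set int) a b : S a -> S b -> measurable_fun (setT : set (XS S)) (Yp a b).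
Proof. by move=> Sa Sb; apply: measurable_funB => //; exact: measurable_Zp. Qed.

Lemma Yp_L2 a b : L2 P (fun w => Yp a b (smp w)).
Proof. by apply: L2B; [exact: Zp_L2|exact: L2_cst]. Qed.

Lemma Yp_shift k a b x : Yp a b (shiftp k x) = Yp (a + k) (b + k) x.
Proof. by rewrite /Yp Zp_shift (inj_eq (addIr k)). Qed.

Lemma Yp_sym a b x : Yp a b x = Yp b a x.
Proof. by rewrite /Yp Zp_sym eq_sym. Qed.

Lemma EYp a b : Eint P (fun w => Yp a b (smp w)) = 0.
Proof.
rewrite EintB; [|exact: L2_intg (Zp_L2 a b)|exact: intg_cst]; rewrite Eint_cst.
have [->|ab] := eqVneq a b; first by rewrite EZp_diag mul1r subrr.
by rewrite EZp_off// mul0r subrr.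
Qed.

Lemma Yp_orth_single a b c k : a != b -> a != c -> a != k ->
  Eint P (fun w => Yp a b (smp w) * Yp c k (smp w)) = 0.
Proof.
move=> ab ac ak.
rewrite -(@single_index [set t | t = b \/ t = c \/ t = k] (Yp c k) a b).
- by congr Eint; apply/funext => w; rewrite {1}/Yp (negbTE ab) mul0r subr0 mulrC.
- by move=> /= [h|[h|h]]; [move: ab|move: ac|move: ak]; rewrite h eqxx.
- by left.
- by apply: measurable_Yp; [right; left|right; right].
- exact: Yp_L2.
Qed.

Lemma Yp_orth_diag a c : a != c -> Eint P (fun w => Yp a a (smp w) * Yp c c (smp w)) = 0.
Proof.
move=> ac; have dis : [set a] `&` [set c] = set0.
  by apply/seteqP; split=> // x [-> h]; rewrite h eqxx in ac.
have [_ ->] := @sample_indep_E _ _ _ _ _ iid [set a] [set c] (Yp a a) (Yp c c) dis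
  (measurable_Yp (erefl : [set a] a) (erefl : [set a] a)) (measurable_Yp (erefl : [set c] c) (erefl : [set c] c))
  (L2_intg (Yp_L2 a a)) (L2_intg (Yp_L2 c c)).
by rewrite -[Eint P (Yp a a \o _)]/(Eint P (fun w => Yp a a (smp w))) EYp mul0r.
Qed.

(** The order of the indices selects one representative of each unordered pair. Two different pairs
    leave an index that occurs only once, unless both are diagonal, and then the two factors are
    independent. *)
Lemma Yp_orth (a b c k : int) : (b <= a)%R -> (k <= c)%R -> (a, b) != (c, k) ->
  Eint P (fun w => Yp a b (smp w) * Yp c k (smp w)) = 0.
Proof.
move=> ba kc ne.
have sw : Eint P (fun w => Yp a b (smp w) * Yp c k (smp w)) = Eint P (fun w => Yp c k (smp w) * Yp a b (smp w)).
  by congr Eint; apply/funext => w; rewrite mulrC.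
have [ab|ab] := eqVneq a b.
  rewrite -ab in ne sw *; have [ck|ck] := eqVneq c k.
    by rewrite -ck in ne *; apply: Yp_orth_diag; apply: contraNneq ne => ->.
  rewrite sw; have [ca|ca] := eqVneq c a; last exact: Yp_orth_single.
  have ka : k != a by rewrite -ca eq_sym.
  have -> : (fun w => Yp c k (smp w) * Yp a a (smp w)) = (fun w => Yp k c (smp w) * Yp a a (smp w)).
    by apply/funext => w; rewrite Yp_sym.
  by apply: Yp_orth_single => //; rewrite eq_sym.
have [ck|ck] := eqVneq c k.
  rewrite -ck in ne sw *; have [ac|ac] := eqVneq a c; last exact: Yp_orth_single.
  have bc : b != c by rewrite -ac eq_sym.
  have -> : (fun w => Yp a b (smp w) * Yp c c (smp w)) = (fun w => Yp b a (smp w) * Yp c c (smp w)).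
    by apply/funext => w; rewrite Yp_sym.
  by apply: Yp_orth_single => //; rewrite eq_sym.
have [ac|ac] := eqVneq a c.
  have bk : b != k by apply: contraNneq ne => ->; rewrite ac.
  have -> : (fun w => Yp a b (smp w) * Yp c k (smp w)) = (fun w => Yp b a (smp w) * Yp c k (smp w)).
    by apply/funext => w; rewrite Yp_sym.
  by apply: Yp_orth_single => //; rewrite ?ac eq_sym// -ac.
have [ak|ak] := eqVneq a k; last exact: Yp_orth_single.
rewrite sw; apply: Yp_orth_single => //; first by rewrite eq_sym.
by apply/eqP => cb; move: ba kc ac; rewrite -cb -ak => h1 h2 /eqP; apply; apply/eqP; rewrite eq_le h1 h2.
Qed.

Lemma Eint_double_fubini (F G : Om * RR -> R) : L2 Pm F -> L2 Pm G ->
  intg (mu \x mu)%E (fun z => Eint P (fun w => F (w, z.1) * G (w, z.2))).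
Proof.
move=> lF lG; have [mF iF] := lF; have [mG iG] := lG.
have mH : measurable_fun setT (fun x : (RR * RR) * Om => F (x.2, x.1.1) * G (x.2, x.1.2)).
  apply: measurable_funM.
    apply: (@measurableT_comp _ _ _ _ _ _ F _ (fun x : (RR * RR) * Om => (x.2, x.1.1))) => //.
    apply/measurable_fun_pairP; split; [exact: measurable_snd|exact: measurableT_comp measurable_fst measurable_fst].
  apply: (@measurableT_comp _ _ _ _ _ _ G _ (fun x : (RR * RR) * Om => (x.2, x.1.2))) => //.
  apply/measurable_fun_pairP; split; [exact: measurable_snd|exact: measurableT_comp measurable_snd measurable_fst].
have [f2 _] := Eint_fubini2 iF; have [g2 _] := Eint_fubini2 iG.
apply: (intg_le_ae _ _ (intgD (intg_prod_fst mu f2) (intg_prod_snd mu g2))).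
  exact: (measurable_Eint_section P mH).
apply: (aeS2 _ (ae_prod_fst mu (L2_section2 lF)) (ae_prod_snd mu (L2_section2 lG))) => z lFz lGz /=.
have i1 := L2M lFz lGz; apply: le_trans (Eint_norm i1) _.
have [_ iFz] := lFz; have [_ iGz] := lGz.
rewrite -EintD//; apply: Eint_le; [exact: intg_norm|exact: intgD|move=> w].
by rewrite ler_norml; apply/andP; split; nra.
Qed.

(** [Eint_Zp] is applied twice, first with the weight [Zp a b] itself, then with the product of the
    innovations at a fixed point as weight. *)
Lemma Zp_sqr a b : Eint P (fun w => Zp a b (smp w) ^+ 2) =
  Eint (mu \x mu)%E (fun z => Eint P (fun w => (ep a (w, z.1) * ep b (w, z.1)) * (ep a (w, z.2) * ep b (w, z.2)))).
Proof.
have lM := epM_L2 a b.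
rewrite -(Eint_fubini1 (Eint_double_fubini lM lM)).2.
transitivity (Eint P (fun w => Zp a b (smp w) * Zp a b (smp w))).
  by congr Eint; apply/funext => w; rewrite expr2.
rewrite (Eint_Zp a b (Zp_L2 a b)); apply: eq_Eint_ae.
apply: aeS (ewM_L2 a b) => u lu.
rewrite -(Eint_Zp a b lu).
by congr Eint; apply/funext => w; rewrite mulrC.
Qed.

Definition Cov2 (z : RR * RR) : R := Eint P (fun w => e (smp w) 0 z.1 * e (smp w) 0 z.2).
Definition Mom4 (z : RR * RR) : R := Eint P (fun w => e (smp w) 0 z.1 ^+ 2 * e (smp w) 0 z.2 ^+ 2).

Lemma Cov2_shift t z : Eint P (fun w => e (smp w) t z.1 * e (smp w) t z.2) = Cov2 z.
Proof.
rewrite /Cov2 -(@Eint_shift t (fun x => e x 0 z.1 * e x 0 z.2)).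
  by congr Eint; apply/funext => w; rewrite !es add0r.
by apply: measurable_funM; exact: measurable_e.
Qed.

Lemma Cov2_intg : intg (mu \x mu)%E Cov2.
Proof. exact: (Eint_double_fubini (ep_L2 0) (ep_L2 0)). Qed.

Lemma Mom4_intg : intg (mu \x mu)%E Mom4.
Proof. exact: (Eint_double_fubini (ep_sqr_L2 0) (ep_sqr_L2 0)). Qed.

Lemma Cov2_sqr_ae a b : a != b -> {ae (mu \x mu)%E, forall z,
  Eint P (fun w => (ep a (w, z.1) * ep b (w, z.1)) * (ep a (w, z.2) * ep b (w, z.2))) = Cov2 z ^+ 2}.
Proof.
move=> ab; have l1 := aeS2 (fun u ha hb => conj ha hb) (ew_L2 a) (ew_L2 b).
apply: (aeS2 _ (ae_prod_fst mu l1) (ae_prod_snd mu l1)) => z [a1 b1] [a2 b2].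
have dis : [set a] `&` [set b] = set0.
  by apply/seteqP; split=> // x [-> h]; rewrite h eqxx in ab.
have := @sample_indep_E _ _ _ _ _ iid [set a] [set b] (fun x => e x a z.1 * e x a z.2) (fun x => e x b z.1 * e x b z.2) dis.
have me2 t : measurable_fun (setT : set (XS [set t])) (fun x : path => e x t z.1 * e x t z.2).
  by apply: measurable_funM; exact: measurable_e.
move=> /(_ (me2 a) (me2 b) (L2M a1 a2) (L2M b1 b2))[_].
rewrite -[Eint P ((fun x => e x a z.1 * _) \o _)]/(Eint P (fun w => e (smp w) a z.1 * e (smp w) a z.2)).
rewrite -[Eint P ((fun x => e x b z.1 * _) \o _)]/(Eint P (fun w => e (smp w) b z.1 * e (smp w) b z.2)).
rewrite !Cov2_shift expr2 => <-; congr Eint; apply/funext => w; rewrite /ep/=; ring.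
Qed.

(** The square is almost everywhere the mixed fourth moment of the independent innovations with
    indices 0 and 1, whose integrability over both points is [Eint_double_fubini]. *)
Lemma Cov2_sqr_intg : intg (mu \x mu)%E (fun z => Cov2 z ^+ 2).
Proof.
have lM := epM_L2 0 1; have i1 := Eint_double_fubini lM lM.
apply: (intg_le_ae _ _ (intg_norm i1)); first by apply: measurable_funX; exact: intgmf Cov2_intg.
by apply: aeS (@Cov2_sqr_ae 0 1 isT) => z ->.
Qed.

Definition kap1 : R := Eint (mu \x mu)%E (fun z => Cov2 z ^+ 2).
(** The integrated joint fourth cumulant of an innovation at two points; it vanishes for Gaussian
    innovations. *)
Definition kap2 : R := Eint (mu \x mu)%E (fun z => Mom4 z - 2 * Cov2 z ^+ 2 - Cov2 (z.1, z.1) * Cov2 (z.2, z.2)).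

Lemma gam_Cov2 : intg mu (fun u => Cov2 (u, u)) /\ gam = Eint mu (fun u => Cov2 (u, u)).
Proof.
have i1 : intg Pm (fun z => ep 0 z * ep 0 z) := L2M (ep_L2 0) (ep_L2 0).
have [h1 h2] := Eint_fubini2 i1; split=> //.
by rewrite -[RHS]/(Eint mu (fun u => Eint P (fun w => ep 0 (w, u) * ep 0 (w, u)))) h2 -(Eint_fubini1 i1).2.
Qed.

Lemma Yp_sqr_off a b : a != b -> Eint P (fun w => Yp a b (smp w) ^+ 2) = kap1.
Proof.
move=> ab; transitivity (Eint P (fun w => Zp a b (smp w) ^+ 2)).
  by congr Eint; apply/funext => w; rewrite /Yp (negbTE ab) mul0r subr0.
by rewrite Zp_sqr; apply: eq_Eint_ae; exact: Cov2_sqr_ae.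
Qed.

(** The variance of [Zp a a] integrates [Mom4] minus the product of the two variances; relative to
    the cumulant, [2 Cov2^2] is left over. *)
Lemma Yp_sqr_diag a : Eint P (fun w => Yp a a (smp w) ^+ 2) = kap2 + 2 * kap1.
Proof.
have [ig eg] := gam_Cov2; have [icc ecc] := intg_prodM ig ig.
have iz := Zp_L2 a a.
transitivity (Eint P (fun w => Zp a a (smp w) ^+ 2) - gam ^+ 2).
  transitivity (Eint P (fun w => Zp a a (smp w) ^+ 2 - 2 * gam * Zp a a (smp w) + gam ^+ 2)).
    by congr Eint; apply/funext => w; rewrite /Yp eqxx mul1r; ring.
  have i1 := iz.2; have i2 := intgZ (2 * gam) (L2_intg iz).
  rewrite EintD; [|exact: intgB|exact: intg_cst].
  by rewrite EintB// EintZ ?Eint_cst ?EZp_diag; [ring|exact: L2_intg].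
have -> : Eint P (fun w => Zp a a (smp w) ^+ 2) = Eint (mu \x mu)%E Mom4.
  rewrite Zp_sqr; congr Eint; apply/funext => z.
  rewrite /Mom4 -(@Eint_shift a (fun x => e x 0 z.1 ^+ 2 * e x 0 z.2 ^+ 2)).
    by congr Eint; apply/funext => w; rewrite /ep !es add0r/=; ring.
  by apply: measurable_funM; apply: measurable_funX; exact: measurable_e.
have i2 := intgZ 2 Cov2_sqr_intg.
rewrite /kap2 EintB; [|exact: (intgB Mom4_intg i2)|exact: icc].
rewrite (EintB Mom4_intg i2) (EintZ 2 Cov2_sqr_intg) ecc -eg -[Eint _ (fun z => Cov2 z ^+ 2)]/kap1; ring.
Qed.

End Moments.

(** * The linear process *)

Section TailOfSeries.
Context {R : realType} (psi : nat -> R) (Psum : exists M : R, forall N, \sum_(n < N) `|psi n| <= M).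

Definition psl : R := limn (fun N : nat => \sum_(n < N) `|psi n|).
Definition pst (N : nat) : R := psl - \sum_(n < N) `|psi n|.

Lemma psl_cvg : (fun N : nat => \sum_(n < N) `|psi n|) @ \oo --> psl.
Proof.
case: Psum => M hM; apply: nondecreasing_is_cvgn.
  by apply/nondecreasing_seqP => n; rewrite big_ord_recr/= lerDl.
by exists M => _ [N _ <-].
Qed.

Lemma psum_le N : \sum_(n < N) `|psi n| <= psl.
Proof.
apply: (nondecreasing_cvgn_le _ _ N); last by apply/cvg_ex; exists psl; exact: psl_cvg.
by apply/nondecreasing_seqP => n; rewrite big_ord_recr/= lerDl.
Qed.

Lemma psl_ge0 : 0 <= psl. Proof. by apply: le_trans (psum_le 0); rewrite big_ord0. Qed.

Lemma pst_ge0 N : 0 <= pst N. Proof. by rewrite subr_ge0 psum_le. Qed.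

Lemma pst_cvg : pst @ \oo --> 0.
Proof. by rewrite -(subrr psl); apply: cvgB; [exact: cvg_cst|exact: psl_cvg]. Qed.

Lemma psum_tail N N' : \sum_(N <= i < N') `|psi i| <= pst N.
Proof.
have [NN|NN] := leqP N N'; last by rewrite big_geq ?pst_ge0// ltnW.
rewrite lerBrDl; apply: le_trans (psum_le N').
by rewrite -!(big_mkord xpredT (fun i => `|psi i|)) -big_cat_nat.
Qed.

End TailOfSeries.

Section LinearProcess.
Context {R : realType} {d : measure_display} {Om : measurableType d} (P : probability Om R)
  (eps : int -> Om -> R -> R) (iid : iid_proc P eps).
Local Notation RR := (measurableTypeR R).
Local Notation path := (int -> R -> R).
Local Notation smp := (sample eps).
Context (mu : probability RR R) (e : path -> int -> R -> R).
Context (me : forall (S : set int) t, S t -> measurable_fun setT (fun z : XS S * RR => e z.1 t z.2)).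
Context (es : forall k x t u, e (shiftp k x) t u = e x (t + k) u).
Local Notation Pm := (P \x mu)%E.
Local Notation ep := (ep eps e).
Context (e4 : L2 Pm (fun z => ep 0 z ^+ 2)).
Context (em : {ae mu, forall u, Eint P (fun w => e (smp w) 0 u) = 0}).
Context (psi : nat -> R) (Psum : exists M : R, forall N, \sum_(n < N) `|psi n| <= M).
Context (v : path -> int -> R -> R)
  (mv : forall t, measurable_fun setT (fun z : XS setT * RR => v z.1 t z.2)).
Context (vser : forall t, {ae mu, forall u, {ae P, forall w,
   (fun N : nat => \sum_(i < N) psi i * e (smp w) (t - i%:Z) u) @ \oo --> v (smp w) t u}}).
Local Notation g := (gam P eps mu e).
Local Notation Z a b w := (Zp mu e a b (smp w)).
Local Notation l := (psl psi).
Local Notation tl := (pst psi).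

Lemma ep_inner a b : Eint Pm (fun z => ep a z * ep b z) = (a == b)%:R * g.
Proof.
have i1 : intg Pm (fun z => ep a z * ep b z) := L2M (ep_L2 iid me es e4 a) (ep_L2 iid me es e4 b).
rewrite -(Eint_fubini1 i1).2 -[LHS]/(Eint P (fun w => Z a b w)).
have [->|ab] := eqVneq a b; first by rewrite mul1r EZp_diag.
by rewrite mul0r EZp_off.
Qed.

Lemma gam_ge0 : 0 <= g.
Proof. by rewrite -[g]mul1r -(ep_inner 0 0); apply: Eint_ge0 => z; rewrite -expr2 sqr_ge0. Qed.

Lemma ep_nrm2 t : nrm2 Pm (ep t) = g.
Proof.
transitivity (Eint Pm (fun z => ep t z * ep t z)); first by congr Eint; apply/funext => z; rewrite expr2.
by rewrite ep_inner eqxx mul1r.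
Qed.

Definition vv (t : int) (z : Om * RR) : R := v (smp z.1) t z.2.
Definition vN (N : nat) (t : int) (z : Om * RR) : R := \sum_(i < N) psi i * ep (t - i%:Z) z.

Lemma measurable_vv t : measurable_fun setT (vv t).
Proof.
apply: (@measurableT_comp _ _ _ _ _ _ (fun z : XS setT * RR => v z.1 t z.2) _ (fun z : Om * RR => (smp z.1, z.2) : XS setT * RR)).
  exact: mv.
exact: (measurable_smp_pair iid).
Qed.

Lemma vN_L2 N t : L2 Pm (vN N t).
Proof. by apply: L2_sum => i; apply: L2Z; exact: ep_L2. Qed.

Lemma vN_nrm2 N t : nrm2 Pm (vN N t) <= l ^+ 2 * g.
Proof.
have LE (i : 'I_N) : L2 Pm (ep (t - i%:Z)) by exact: ep_L2.
have hE (i : 'I_N) : nrm2 Pm (ep (t - i%:Z)) <= g by rewrite ep_nrm2.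
apply: le_trans (nrm2_wsum_le (index_enum 'I_N) (fun i : 'I_N => psi i) LE hE) _.
by rewrite ler_wpM2r ?gam_ge0// ler_sqr ?nnegrE ?sumr_ge0 ?psl_ge0//; exact: psum_le.
Qed.

Lemma vN_diff N N' t : (N <= N')%N -> L2 Pm (fun z => vN N' t z - vN N t z) /\
  nrm2 Pm (fun z => vN N' t z - vN N t z) <= tl N ^+ 2 * g.
Proof.
move=> NN; split; first by apply: L2B; exact: vN_L2.
have -> : (fun z => vN N' t z - vN N t z) = (fun z => \sum_(i <- index_iota N N') psi i * ep (t - i%:Z) z).
  apply/funext => z; rewrite /vN -!(big_mkord xpredT (fun i => psi i * ep (t - i%:Z) z)).
  by rewrite (@big_cat_nat _ _ _ N)//= [LHS]addrC addKr.
have LE (i : nat) : L2 Pm (ep (t - i%:Z)) by exact: ep_L2.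
have hE (i : nat) : nrm2 Pm (ep (t - i%:Z)) <= g by rewrite ep_nrm2.
apply: le_trans (nrm2_wsum_le (index_iota N N') psi LE hE) _.
by rewrite ler_wpM2r ?gam_ge0// ler_sqr ?nnegrE ?sumr_ge0 ?pst_ge0//; exact: psum_tail.
Qed.

(** The series is known to converge almost everywhere only; Fatou's lemma applied to the squared
    distance from [vN N] to later truncations gives the L2 statement with its rate. *)
Lemma vv_approx N t : L2 Pm (vv t) /\ L2 Pm (fun z => vv t z - vN N t z) /\
  nrm2 Pm (fun z => vv t z - vN N t z) <= tl N ^+ 2 * g.
Proof.
have mvv := measurable_vv t; have mvN K : measurable_fun setT (vN K t) by case: (vN_L2 K t).
have C0 : 0 <= tl N ^+ 2 * g by rewrite mulr_ge0 ?sqr_ge0 ?gam_ge0.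
pose D (K : nat) (z : Om * RR) : \bar R := ((vN K t z - vN N t z) ^+ 2)%:E.
have mD K : measurable_fun setT (D K).
  by apply/measurable_EFinP; apply: measurable_funX; exact: measurable_funB.
have D0 K z : (0 <= D K z)%E by rewrite lee_fin sqr_ge0.
have mL : measurable_fun setT (fun z : Om * RR => ((vv t z - vN N t z) ^+ 2)%:E).
  by apply/measurable_EFinP; apply: measurable_funX; exact: measurable_funB.
have mE : measurable_fun setT (fun z => limn_einf (D ^~ z)).
  have -> : (fun z => limn_einf (D ^~ z)) = (fun z => - limn_esup (fun K => - D K z))%E.
    by apply/funext => z; rewrite -limn_einfN; congr limn_einf; apply/funext => K; apply/esym; exact: oppeK.
  apply: measurableT_comp => //; apply: (@measurable_fun_limn_esup _ _ _ _ (fun K z => - D K z)%E) => K.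
  exact: measurableT_comp.
have E0 z : (0 <= limn_einf (D ^~ z))%E.
  by rewrite limn_einf_lim; apply: lime_ge; [exact: is_cvg_einfs|apply: nearW => n; apply: le_ereal_inf_tmp => _ [k _ <-]].
have bound : (\int[Pm]_z ((vv t z - vN N t z) ^+ 2)%:E <= (tl N ^+ 2 * g)%:E)%E.
  (* The convergence holds for almost every [u] and then almost every [w]; comparing iterated
     integrals uses it in exactly this form, without a joint null set. *)
  have -> : (\int[Pm]_z ((vv t z - vN N t z) ^+ 2)%:E = \int[Pm]_z limn_einf (D ^~ z))%E.
    rewrite (fubini_tonelli2 (fun z => ((vv t z - vN N t z) ^+ 2)%:E))//; last by move=> z; rewrite lee_fin sqr_ge0.
    rewrite (fubini_tonelli2 (fun z => limn_einf (D ^~ z)) mE E0).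
    apply: eq_integral_negligible; apply: negligibleS (vser t) => u /= h h2; apply: h; rewrite /fubini_G.
    apply: eq_integral_negligible; apply: negligibleS h2 => w /= k k2; apply: k.
    have : (fun K => D K (w, u)) @ \oo --> ((vv t (w, u) - vN N t (w, u)) ^+ 2)%:E.
      apply: cvg_EFin; first exact: nearW.
      have c1 : (fun K => vN K t (w, u) - vN N t (w, u)) @ \oo --> vv t (w, u) - vN N t (w, u).
        by apply: cvgB; [exact: k2|exact: cvg_cst].
      by under eq_fun do rewrite /D/= expr2; rewrite expr2; exact: cvgM.
    by move=> /cvg_limn_einf_sup[-> _].
  apply: le_trans (fatou _ measurableT mD (fun K z _ => D0 K z)) _.
  rewrite limn_einf_lim; apply: lime_le; first exact: is_cvg_einfs.
  apply: nearW => K; apply: (@le_trans _ _ (\int[Pm]_z D (maxn N K) z)%E).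
    by apply: ereal_inf_lbound; exists (maxn N K) => //=; exact: leq_maxr.
  have [[_ i1] h] := vN_diff t (leq_maxl N K).
  by rewrite (intg_fin i1) lee_fin.
have L1 : L2 Pm (fun z => vv t z - vN N t z).
  split; first exact: measurable_funB.
  apply/integrableP; split=> //; apply: le_lt_trans (ltry (tl N ^+ 2 * g)); apply: le_trans bound.
  by rewrite le_eqVlt; apply/orP; left; apply/eqP; apply: eq_integral => z _; rewrite gee0_abs// lee_fin sqr_ge0.
split; [|split=> //].
  by apply: L2_eq (L2D L1 (vN_L2 N t)) => z; rewrite subrK.
by rewrite -lee_fin -(intg_fin L1.2).
Qed.

Lemma vv_L2 t : L2 Pm (vv t). Proof. by case: (vv_approx 0 t). Qed.

Lemma vv_nrm2 t : nrm2 Pm (vv t) <= l ^+ 2 * g.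
Proof.
have [_ [_]] := vv_approx 0 t; have -> : tl 0 = l by rewrite /pst big_ord0 subr0.
by apply: le_trans; rewrite le_eqVlt; apply/orP; left; apply/eqP; congr Eint; apply/funext => z; rewrite /vN big_ord0 subr0.
Qed.

Lemma ep_sum_nrm2 c n : nrm2 Pm (fun z => \sum_(t < n) ep (t%:Z + c) z) = n%:R * g.
Proof.
have := @nrm2_orth R _ _ Pm (fun (t : nat) => ep (t%:Z + c)) g (fun t => ep_L2 iid me es e4 (t%:Z + c)).
move=> /(_ _ _ (iota 0 n) (iota_uniq 0 n)); rewrite size_iota => h.
transitivity (nrm2 Pm (fun z => \sum_(i <- iota 0 n) ep (i%:Z + c) z)).
  by congr nrm2; apply/funext => z; rewrite -(big_mkord xpredT (fun i => ep (i%:Z + c) z)) /index_iota subn0.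
apply: h => [s t st|t]; last exact: ep_nrm2.
rewrite ep_inner (inj_eq (addIr c)); case: eqP => [[h]|_]; last by rewrite mul0r.
by rewrite h eqxx in st.
Qed.

(** The growth is linear in [n]: after exchanging the sums each coefficient [psi i] multiplies a sum
    of [n] orthogonal innovations. The factor 2 is left by passing from truncations to the limit
    with [nrm2D_le]. *)
Lemma vv_sum_nrm2 c n : L2 Pm (fun z => \sum_(t < n) vv (t%:Z + c) z) /\
  nrm2 Pm (fun z => \sum_(t < n) vv (t%:Z + c) z) <= 2 * l ^+ 2 * g * n%:R.
Proof.
have L := L2_sum (index_enum 'I_n) (fun t : 'I_n => vv_L2 (t%:Z + c)); split=> //.
have LN N := L2_sum (index_enum 'I_n) (fun t : 'I_n => vN_L2 N (t%:Z + c)).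
have main N : nrm2 Pm (fun z => \sum_(t < n) vN N (t%:Z + c) z) <= l ^+ 2 * (n%:R * g).
  have -> : (fun z => \sum_(t < n) vN N (t%:Z + c) z) = (fun z => \sum_(i < N) psi i * \sum_(t < n) ep (t%:Z + (c - i%:Z)) z).
    apply/funext => z; rewrite exchange_big/=; apply: eq_bigr => i _; rewrite mulr_sumr.
    by apply: eq_bigr => t _; rewrite addrA.
  have LE (i : 'I_N) : L2 Pm (fun z => \sum_(t < n) ep (t%:Z + (c - i%:Z)) z) by apply: L2_sum => t; exact: ep_L2.
  have hE (i : 'I_N) : nrm2 Pm (fun z => \sum_(t < n) ep (t%:Z + (c - i%:Z)) z) <= n%:R * g by rewrite ep_sum_nrm2.
  apply: le_trans (nrm2_wsum_le (index_enum 'I_N) (fun i : 'I_N => psi i) LE hE) _.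
  by rewrite ler_wpM2r ?mulr_ge0 ?gam_ge0// ler_sqr ?nnegrE ?sumr_ge0 ?psl_ge0//; exact: psum_le.
have diff N : nrm2 Pm (fun z => \sum_(t < n) vv (t%:Z + c) z - \sum_(t < n) vN N (t%:Z + c) z) <= n%:R ^+ 2 * (tl N ^+ 2 * g).
  have -> : (fun z => \sum_(t < n) vv (t%:Z + c) z - \sum_(t < n) vN N (t%:Z + c) z) =
      (fun z => \sum_(t < n) 1 * (vv (t%:Z + c) z - vN N (t%:Z + c) z)).
    by apply/funext => z; rewrite -sumrB; apply: eq_bigr => t _; rewrite mul1r.
  apply: le_trans (nrm2_wsum_le (index_enum 'I_n) (fun=> 1) (fun t : 'I_n => (vv_approx N (t%:Z + c)).2.1) (fun t => (vv_approx N (t%:Z + c)).2.2)) _.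
  by rewrite normr1 sumr_const card_ord.
have h N : nrm2 Pm (fun z => \sum_(t < n) vv (t%:Z + c) z) <=
    2 * (n%:R ^+ 2 * (tl N ^+ 2 * g)) + 2 * (l ^+ 2 * (n%:R * g)).
  have -> : (fun z => \sum_(t < n) vv (t%:Z + c) z) = (fun z => (\sum_(t < n) vv (t%:Z + c) z - \sum_(t < n) vN N (t%:Z + c) z) + \sum_(t < n) vN N (t%:Z + c) z).
    by apply/funext => z; rewrite subrK.
  apply: le_trans (nrm2D_le (L2B L (LN N)) (LN N)) _; apply: lerD; rewrite ler_pM2l//.
have cv : (fun N => 2 * (n%:R ^+ 2 * (tl N ^+ 2 * g)) + 2 * (l ^+ 2 * (n%:R * g))) @ \oo -->
   2 * (n%:R ^+ 2 * (0 ^+ 2 * g)) + 2 * (l ^+ 2 * (n%:R * g)).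
  apply: cvgD; last exact: cvg_cst.
  apply: cvgMr; apply: cvgMr; apply: cvgMl; rewrite expr2; under eq_fun do rewrite expr2.
  by apply: cvgM; exact: pst_cvg.
have h2 : nrm2 Pm (fun z => \sum_(t < n) vv (t%:Z + c) z) <= 2 * (n%:R ^+ 2 * (0 ^+ 2 * g)) + 2 * (l ^+ 2 * (n%:R * g)).
  by apply: (ler_cvg_to (cvg_cst _) cv); apply: nearW => N; exact: h.
rewrite expr0n/= mul0r mulr0 mulr0 add0r in h2; apply: le_trans h2 _.
by rewrite le_eqVlt; apply/orP; left; apply/eqP; ring.
Qed.

Definition W (s t : int) (w : Om) : R := Eint mu (fun u => v (smp w) s u * v (smp w) t u).
Definition WN (N : nat) (s t : int) (w : Om) : R := \sum_(k < N) \sum_(j < N) psi k * psi j * Z (s - k%:Z) (t - j%:Z) w.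

Lemma vv_prod_intg s t : intg Pm (fun z => vv s z * vv t z).
Proof. by apply: L2M; exact: vv_L2. Qed.

Lemma W_intg s t : intg P (W s t).
Proof. by have [] := Eint_fubini1 (vv_prod_intg s t). Qed.

Lemma WN_L2 N s t : L2 P (WN N s t).
Proof. by apply: L2_sum => k; apply: L2_sum => j; apply: L2Z; exact: Zp_L2. Qed.

Lemma WN_ae N s t : {ae P, forall w, WN N s t w = Eint mu (fun u => vN N s (w, u) * vN N t (w, u))}.
Proof.
have h : {ae P, forall w, forall r, L2 mu (fun u => ep r (w, u))}.
  by apply: ae_countable => r; exact: L2_section1 (ep_L2 iid me es e4 r).
apply: aeS h => w hw; rewrite /WN.
have -> : (fun u => vN N s (w, u) * vN N t (w, u)) =
    (fun u => \sum_(k < N) \sum_(j < N) psi k * psi j * (ep (s - k%:Z) (w, u) * ep (t - j%:Z) (w, u))).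
  apply/funext => u; rewrite /vN mulr_suml; apply: eq_bigr => k _; rewrite mulr_sumr.
  by apply: eq_bigr => j _; ring.
have ii k j : intg mu (fun u => psi k * psi j * (ep (s - k%:Z) (w, u) * ep (t - j%:Z) (w, u))).
  by apply: intgZ; apply: L2M.
rewrite Eint_sum; last by move=> k; apply: intg_sum => j; exact: ii.
apply: eq_bigr => k _; rewrite Eint_sum//; apply: eq_bigr => j _.
by rewrite EintZ//; apply: L2M.
Qed.

(** The difference of the products is split into two terms, each with one truncation error as a
    factor, and each is bounded by Cauchy-Schwarz. *)
Lemma W_approx N s t : Eint P (fun w => `|W s t w - WN N s t w|) <= 2 * l * tl N * g.
Proof.
pose F z := vv s z * vv t z - vN N s z * vN N t z.
have iN : intg Pm (fun z => vN N s z * vN N t z) := L2M (vN_L2 N s) (vN_L2 N t).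
have iF : intg Pm F by apply: intgB => //; exact: vv_prod_intg.
have [i1 e1] := Eint_fubini1 (intg_norm iF).
have [iv _] := Eint_fubini1 (vv_prod_intg s t); have [iw _] := Eint_fubini1 iN.
apply: (@le_trans _ _ (Eint Pm (fun z => `|F z|))).
  rewrite -e1 (@eq_Eint_ae _ _ _ P _ (fun w => `|Eint mu (fun u => F (w, u))|)).
    rewrite (@eq_Eint_ae _ _ _ P (fun x => Eint mu (fun y => `|F (x, y)|)) (fun w => `|Eint mu (fun u => F (w, u))| + `|Eint mu (fun y => `|F (w, y)|) - `|Eint mu (fun u => F (w, u))| |)).
      have [i2 _] := Eint_fubini1 iF.
      have i3 := intg_norm i2.
      rewrite EintD//; first by rewrite lerDl; apply: Eint_ge0.
      by apply: intg_norm; exact: intgB.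
    apply: aeS (intg_section1 iF) => w iw'; rewrite [X in _ + X]ger0_norm; first by rewrite addrC subrK.
    by rewrite subr_ge0; exact: Eint_norm.
  apply: (aeS3 _ (WN_ae N s t) (intg_section1 (vv_prod_intg s t)) (intg_section1 iN)) => w -> a1 a2.
  by rewrite /F EintB.
have [_ [Ls hs]] := vv_approx N s; have [_ [Lt ht]] := vv_approx N t.
have g0 := gam_ge0; pose r := Num.sqrt g.
have r0 : 0 <= r by exact: sqrtr_ge0.
have rr : r ^+ 2 = g by rewrite sqr_sqrtr.
have l0 := psl_ge0 Psum; have t0 := pst_ge0 Psum N.
have b1 : Eint Pm (fun z => `|(vv s z - vN N s z) * vv t z|) <= (tl N * r) * (l * r).
  apply: (Emul_le Ls (vv_L2 t)); rewrite ?mulr_ge0//; rewrite exprMn rr//; exact: vv_nrm2.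
have b2 : Eint Pm (fun z => `|vN N s z * (vv t z - vN N t z)|) <= (l * r) * (tl N * r).
  apply: (Emul_le (vN_L2 N s) Lt); rewrite ?mulr_ge0//; rewrite exprMn rr//; exact: vN_nrm2.
have j1 : intg Pm (fun z => `|(vv s z - vN N s z) * vv t z|) by apply: intg_norm; apply: L2M => //; exact: vv_L2.
have j2 : intg Pm (fun z => `|vN N s z * (vv t z - vN N t z)|) by apply: intg_norm; apply: L2M => //; exact: vN_L2.
apply: (@le_trans _ _ (Eint Pm (fun z => `|(vv s z - vN N s z) * vv t z| + `|vN N s z * (vv t z - vN N t z)|))).
  apply: Eint_le; [exact: intg_norm|exact: intgD|move=> z].
  have -> : F z = (vv s z - vN N s z) * vv t z + vN N s z * (vv t z - vN N t z) by rewrite /F; ring.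
  exact: ler_normD.
rewrite EintD//; apply: le_trans (lerD b1 b2) _.
by rewrite -rr le_eqVlt; apply/orP; left; apply/eqP; ring.
Qed.

End LinearProcess.

(** * The limiting variance *)

Section PsiSequences.
Context {R : realType} (psi : nat -> R) (Psum : exists M : R, forall N, \sum_(n < N) `|psi n| <= M).
Local Notation ps := (psiZ psi).

Lemma zpart_nneg_supp (a : int -> R) N : (forall n, a (Negz n) = 0) -> zpart N a = \sum_(k < N.+1) a k%:Z.
Proof.
move=> a0; elim: N => [|N IH]; first by rewrite zpart0 big_ord1.
by rewrite zpartS IH [RHS]big_ord_recr/= -NegzE a0 addr0.
Qed.

Lemma zsum_fin_supp (a : int -> R) N : (forall n, a (Negz n) = 0) -> (forall n : nat, (N <= n)%N -> a n%:Z = 0) ->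
  zl1 a /\ zsum a = \sum_(k < N) a k%:Z.
Proof.
move=> a0 aN.
have fin (b : int -> R) K : (forall n, b (Negz n) = 0) -> (forall n : nat, (N <= n)%N -> b n%:Z = 0) ->
    (N <= K)%N -> zpart K b = \sum_(k < N) b k%:Z.
  move=> b0 bN NK; rewrite zpart_nneg_supp// -!(big_mkord xpredT (fun k => b k%:Z)).
  rewrite (@big_cat_nat _ _ _ N)//=; last exact: leqW.
  by rewrite [X in _ + X]big_nat_cond [X in _ + X]big1 ?addr0// => i /andP[/andP[Ni _] _]; exact: bN.
split.
  exists (\sum_(k < N) `|a k%:Z|) => K.
  have : zpart K (fun k => `|a k|) <= zpart (maxn N K) (fun k => `|a k|).
    by apply: zpart_nondecreasing; [move=> k; exact: normr_ge0|exact: leq_maxr].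
  move=> /le_trans; apply; rewrite (fin (fun k => `|a k|)) ?leq_maxl// => n; first by rewrite a0 normr0.
  by move=> /aN ->; rewrite normr0.
by apply: zsum_eq; apply: cvg_near_cst; exists N => // K /= NK; exact: fin.
Qed.

Lemma zl1_psiZ : zl1 ps.
Proof.
case: Psum => M hM; exists M => N.
by rewrite (zpart_nneg_supp (a := fun k => `|ps k|)) => [|n]; [exact: hM N.+1|rewrite /= normr0].
Qed.

Definition psiT (N : nat) (k : int) : R := if k is Posz n then (if (n < N)%N then psi n else 0) else 0.

Lemma psiT_le N k : `|psiT N k| <= `|ps k|.
Proof. by case: k => [n|n] //=; case: ifP => _ //; rewrite normr0. Qed.

Lemma zl1_psiT N : zl1 (psiT N).
Proof. exact: zl1_le (psiT_le N) zl1_psiZ. Qed.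

Lemma psiT_cvg k : psiT ^~ k @ \oo --> ps k.
Proof.
by apply: cvg_near_cst; case: k => [n|n] /=; [exists n.+1 => // K /= ->|exact: nearW].
Qed.

Definition RZ (r : int) : R := zcorr ps ps r.
Definition RT (N : nat) (r : int) : R := \sum_(k < N) \sum_(j < N) psi k * psi j * (j%:Z - k%:Z == r)%:R.
Definition RA (r : int) : R := zcorr (fun k => `|ps k|) (fun k => `|ps k|) r.

Lemma zl1_RZ : zl1 RZ. Proof. exact: zcorr_l1 zl1_psiZ zl1_psiZ. Qed.
Lemma zl1_RA : zl1 RA. Proof. exact: zcorr_l1 (zl1_norm zl1_psiZ) (zl1_norm zl1_psiZ). Qed.

Lemma RT_zcorr N r : RT N r = zcorr (psiT N) (psiT N) r.
Proof.
rewrite /zcorr; have [n|n nN|_ ->] := @zsum_fin_supp (fun k => psiT N k * psiT N (k + r)) N.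
- by rewrite mul0r.
- by rewrite /= ltnNge nN mul0r.
apply: eq_bigr => k _; rewrite /= ltn_ord.
transitivity (psi k * \sum_(j < N) psi j * (j%:Z - k%:Z == r)%:R).
  by rewrite mulr_sumr; apply: eq_bigr => j _; rewrite mulrA.
congr (_ * _); rewrite /psiT; case E : (k%:Z + r) => [m|m].
  have [mN|Nm] := ltnP m N; last first.
    rewrite big1// => j _; case: eqP => [h|_]; last by rewrite mulr0.
    by exfalso; have := ltn_ord j; lia.
  rewrite (bigD1 (Ordinal mN))//= big1 ?addr0 => [|j jm].
    by rewrite (_ : _ == r) ?mulr1//; apply/eqP; lia.
  case: eqP => [h|_]; last by rewrite mulr0.
  by exfalso; move/eqP: jm; apply; apply/val_inj => /=; lia.
rewrite big1// => j _; case: eqP => [h|_]; last by rewrite mulr0.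
by exfalso; lia.
Qed.

Lemma RT_le N r : `|RT N r| <= RA r.
Proof.
rewrite RT_zcorr; apply: (le_trans (zcorr_norm r (zl1_psiT N) (zl1_psiT N))).
apply: zsum_le; [|exact: (zcorr_term r (zl1_norm (zl1_psiT N)) (zl1_norm (zl1_psiT N)))|exact: (zcorr_term r (zl1_norm zl1_psiZ) (zl1_norm zl1_psiZ))].
by move=> k; apply: ler_pM => //; exact: psiT_le.
Qed.

Lemma RT_cvg r : RT ^~ r @ \oo --> RZ r.
Proof.
have [||_ h] := @zsum_dominated R (fun N k => psiT N k * psiT N (k + r)) (fun k => ps k * ps (k + r))
  (fun k => `|ps k| * `|ps (k + r)|) (zcorr_term r (zl1_norm zl1_psiZ) (zl1_norm zl1_psiZ)).
- by move=> n k; rewrite normrM; apply: ler_pM => //; exact: psiT_le.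
- by move=> k; apply: cvgM; exact: psiT_cvg.
by rewrite (_ : RT ^~ r = (fun N => zsum (fun k => psiT N k * psiT N (k + r)))) //; apply/funext => N; rewrite RT_zcorr.
Qed.

Lemma RZ_even r : RZ (- r) = RZ r. Proof. exact: zcorr_even zl1_psiZ r. Qed.

Context (h : nat) (al : nat -> R) (k1 k2 : R).

(** The total coefficient of the products of innovations at signed lag [x] in the combination of
    autocovariances with weights [al]; [AT] is its truncated form. *)
Definition AZ (x : int) : R := \sum_(i < h.+1) al i * RZ (i%:Z - x).
Definition AT (N : nat) (x : int) : R := \sum_(i < h.+1) al i * RT N (i%:Z - x).
Definition AA (x : int) : R := \sum_(i < h.+1) `|al i| * RA (i%:Z - x).

(** Products at lags [x] and [- x] coincide up to a translation in time, so their coefficients add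
    up: this produces the sum of [AT x * AT (- x)]. At lag 0 the variance is [k2 + 2 k1], whence the
    separate term in [k2]. *)
Definition sigT (N : nat) : R := k2 * AT N 0 ^+ 2 + k1 * (zsum (fun x => AT N x ^+ 2) + zsum (fun x => AT N x * AT N (- x))).
Definition sigZ : R := k2 * AZ 0 ^+ 2 + k1 * (zsum (fun x => AZ x ^+ 2) + zsum (fun x => AZ x * AZ (- x))).

Lemma zl1_reflshift (a : int -> R) c : zl1 a -> zl1 (fun x => a (c - x)) /\ zsum (fun x => a (c - x)) = zsum a.
Proof.
move=> la; have [l1 e1] := zsum_shift c la; have [l2 e2] := zsum_refl l1.
have E : (fun k => a (- k + c)) = (fun x => a (c - x)) by apply/funext => x; rewrite addrC.
by rewrite E in l2 e2; rewrite e2.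
Qed.

Lemma zl1_AA : zl1 AA.
Proof.
have [] // := @zsum_sum R 'I_h.+1 (index_enum _) (fun (i : 'I_h.+1) x => `|al i| * RA (i%:Z - x)).
by move=> i; apply: zl1Z; have [] := zl1_reflshift i%:Z zl1_RA.
Qed.

Lemma AT_le N x : `|AT N x| <= AA x.
Proof.
apply: (le_trans (ler_norm_sum _ _ _)); apply: ler_sum => i _.
by rewrite normrM ler_wpM2l// RT_le.
Qed.

Lemma AT_cvg x : AT ^~ x @ \oo --> AZ x.
Proof. by apply: cvg_sumr => i; apply: cvgMr; exact: RT_cvg. Qed.

Lemma sigT_cvg : sigT @ \oo --> sigZ.
Proof.
have sq (a : nat -> R) (b : R) : a @ \oo --> b -> (fun n => a n ^+ 2) @ \oo --> b ^+ 2.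
  by move=> ab; under eq_fun do rewrite expr2; rewrite expr2; exact: cvgM.
have d1 N x : `|AT N x ^+ 2| <= AA x * AA x.
  by rewrite normrX expr2; apply: ler_pM => //; exact: AT_le.
have d2 N x : `|AT N x * AT N (- x)| <= AA x * AA (- x).
  by rewrite normrM; apply: ler_pM => //; exact: AT_le.
have lr : zl1 (fun x => AA (- x)) by have [] := zsum_refl zl1_AA.
have c1 x : (fun N => AT N x ^+ 2) @ \oo --> AZ x ^+ 2 by apply: sq; exact: AT_cvg.
have c2 x : (fun N => AT N x * AT N (- x)) @ \oo --> AZ x * AZ (- x) by apply: cvgM; exact: AT_cvg.
have [_ h1] := zsum_dominated (zl1M zl1_AA zl1_AA) d1 c1.
have [_ h2] := zsum_dominated (zl1M zl1_AA lr) d2 c2.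
by apply: cvgD; apply: cvgMr; [exact: c1|exact: cvgD].
Qed.

Lemma zsum_delta2 (a b : int) : zl1 (fun x => (a == x)%:R * (b == x)%:R : R) /\
  zsum (fun x => (a == x)%:R * (b == x)%:R : R) = (a == b)%:R.
Proof.
have l0 : zl1 (fun x : int => (0 == x)%:R : R) /\ zsum (fun x : int => (0 == x)%:R : R) = 1.
  by have [//|[]//|l1 ->] := @zsum_fin_supp (fun x : int => (0 == x)%:R : R) 1; split=> //; rewrite big_ord1.
have [ls es] := zsum_shift (- a) l0.1.
have e0 : (fun k : int => (0 == k + - a)%:R : R) = (fun x => (a == x)%:R).
  by apply/funext => x; congr (_%:R); rewrite eq_sym subr_eq0 eq_sym.
rewrite e0 l0.2 in ls es.
have E : (fun x => (a == x)%:R * (b == x)%:R : R) = (fun x => (a == b)%:R * (a == x)%:R).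
  apply/funext => x; case: (eqVneq a x) => [->|ax]; last by rewrite mul0r mulr0.
  by rewrite mul1r mulr1 eq_sym.
by rewrite E; split; [exact: zl1Z|rewrite zsumZ// es mulr1].
Qed.

Lemma zsum_expand (I : finType) (c : I -> R) (dl dr : I -> int) :
  zsum (fun x => (\sum_(i : I) c i * (dl i == x)%:R) * (\sum_(i : I) c i * (dr i == x)%:R)) =
  \sum_(i : I) \sum_(j : I) c i * c j * (dl i == dr j)%:R.
Proof.
have E x : (\sum_(i : I) c i * (dl i == x)%:R) * (\sum_(i : I) c i * (dr i == x)%:R) =
    \sum_(i : I) \sum_(j : I) c i * c j * ((dl i == x)%:R * (dr j == x)%:R).
  rewrite mulr_suml; apply: eq_bigr => i _; rewrite mulr_sumr; apply: eq_bigr => j _; ring.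
rewrite (eq_zsum E).
have l1 i j : zl1 (fun x => c i * c j * ((dl i == x)%:R * (dr j == x)%:R)).
  by apply: zl1Z; case: (zsum_delta2 (dl i) (dr j)).
have l2 i := @zsum_sum R I (index_enum I) (fun j x => c i * c j * ((dl i == x)%:R * (dr j == x)%:R)) (l1 i).
have [_ ->] := @zsum_sum R I (index_enum I) (fun i x => \sum_(j : I) c i * c j * ((dl i == x)%:R * (dr j == x)%:R)) (fun i => (l2 i).1).
apply: eq_bigr => i _; rewrite (l2 i).2; apply: eq_bigr => j _.
by have [lz ez] := zsum_delta2 (dl i) (dr j); rewrite zsumZ// ez.
Qed.

Definition tau N := ('I_h.+1 * 'I_N * 'I_N)%type.
Definition tcoef N (q : tau N) : R := al q.1.1 * (psi q.1.2 * psi q.2).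
Definition tlag N (q : tau N) : int := (q.1.2 : nat)%:Z + (q.1.1 : nat)%:Z - (q.2 : nat)%:Z.

Lemma AT_tau N x : AT N x = \sum_(q : tau N) tcoef q * (tlag q == x)%:R.
Proof.
rewrite /AT/RT -(pair_big xpredT xpredT (fun (p : 'I_h.+1 * 'I_N) j => tcoef (p, j) * (tlag (p, j) == x)%:R))/=.
rewrite -(pair_big xpredT xpredT (fun (i : 'I_h.+1) (k : 'I_N) => \sum_(j : 'I_N) tcoef (i, k, j) * (tlag (i, k, j) == x)%:R))/=.
apply: eq_bigr => i _; rewrite mulr_sumr; apply: eq_bigr => k _; rewrite mulr_sumr; apply: eq_bigr => j _.
rewrite /tcoef/tlag/= -mulrA [in RHS]mulrA mulrA !mulrA; congr (_ * (_)%:R).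
by apply/eqP/eqP; lia.
Qed.

Lemma sigT_tau N : sigT N = \sum_(q : tau N) \sum_(q' : tau N) tcoef q * tcoef q' *
   (k2 * ((tlag q == 0)%:R * (tlag q' == 0)%:R) + k1 * ((tlag q == tlag q')%:R + (tlag q == - tlag q')%:R)).
Proof.
have e1 : zsum (fun x => AT N x ^+ 2) = \sum_(q : tau N) \sum_(q' : tau N) tcoef q * tcoef q' * (tlag q == tlag q')%:R.
  by rewrite -zsum_expand; apply: eq_zsum => x; rewrite expr2 AT_tau.
have e2 : zsum (fun x => AT N x * AT N (- x)) = \sum_(q : tau N) \sum_(q' : tau N) tcoef q * tcoef q' * (tlag q == - tlag q')%:R.
  rewrite -(zsum_expand (@tcoef N) (@tlag N) (fun q => - tlag q)); apply: eq_zsum => x; rewrite !AT_tau; congr (_ * _).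
  by apply: eq_bigr => q _; rewrite eqr_oppLR.
have e0 : AT N 0 ^+ 2 = \sum_(q : tau N) \sum_(q' : tau N) tcoef q * tcoef q' * ((tlag q == 0)%:R * (tlag q' == 0)%:R).
  rewrite expr2 AT_tau mulr_suml; apply: eq_bigr => q _; rewrite mulr_sumr; apply: eq_bigr => q' _; ring.
rewrite /sigT e0 e1 e2 -big_split/= !mulr_sumr -big_split/=; apply: eq_bigr => q _.
rewrite -big_split/= !mulr_sumr -big_split/=; apply: eq_bigr => q' _; ring.
Qed.

(** Summed over [r], [S1] is a full sum of a cross-correlation and factorises by [zsum_zcorr]; [S2]
    takes the stated form after [r = i - x], and [S3] by evenness of [RZ]. *)
Lemma Vmat_entry (i j : 'I_h.+1) : Vmat psi h k1 k2 i j =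
  k2 * (RZ i%:Z * RZ j%:Z) + k1 * (zsum (fun x => RZ (i%:Z - x) * RZ (j%:Z - x)) + zsum (fun x => RZ (i%:Z - x) * RZ (j%:Z + x))).
Proof.
rewrite mxE.
have lp m : zl1 (fun k => ps k * ps (k + m)) := zcorr_term m zl1_psiZ zl1_psiZ.
have E1 r : S1 psi i j r = zcorr (fun k => ps k * ps (k + i%:Z)) (fun k => ps k * ps (k + j%:Z)) r.
  by rewrite /S1/zcorr; apply: eq_zsum => k; rewrite !mulrA.
have E2 r : S2 psi i j r = RZ r * RZ (r + j%:Z - i%:Z).
  by rewrite /S2/RZ/zcorr; congr (_ * _); apply: eq_zsum => k; congr (_ * ps _); lia.
have E3 r : S3 psi i j r = RZ (i%:Z - r) * RZ (j%:Z + r).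
  rewrite /S3 mulrC; congr (_ * _); last by apply: eq_zsum => k; congr (_ * ps _); lia.
  rewrite -RZ_even opprB /RZ /zcorr; apply: eq_zsum => k; congr (_ * ps _); lia.
have L1 := zcorr_l1 (lp i%:Z) (lp j%:Z).
have [lA eA] := zl1_reflshift i%:Z zl1_RZ; have [lB _] := zl1_reflshift j%:Z zl1_RZ.
have lC : zl1 (fun x => RZ (j%:Z + x)).
  have [+ _] := zsum_shift j%:Z zl1_RZ; by apply: zl1_le => x; rewrite addrC.
have [l2 e2] := zl1_reflshift i%:Z (zl1M lA lB).
have e2' x : RZ (i%:Z - (i%:Z - x)) * RZ (j%:Z - (i%:Z - x)) = S2 psi i j x.
  by rewrite E2; congr (RZ _ * RZ _); lia.
have L2' : zl1 (S2 psi i j) by apply: zl1_le l2 => x; rewrite e2'.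
have L3 := zl1M lA lC.
have L1' : zl1 (S1 psi i j) by apply: zl1_le L1 => x; rewrite E1.
have L3' : zl1 (S3 psi i j) by apply: zl1_le L3 => x; rewrite E3.
transitivity (zsum (fun r => k2 * S1 psi i j r + (k1 * S2 psi i j r + k1 * S3 psi i j r))).
  by apply: eq_zsum => r; ring.
rewrite zsumD; [|exact: zl1Z|by apply: zl1D; exact: zl1Z].
rewrite zsumD; [|exact: zl1Z|exact: zl1Z].
rewrite !zsumZ// (eq_zsum E1) zsum_zcorr// -(eq_zsum e2') e2 (eq_zsum E3) mulrDr.
by [].
Qed.

Lemma sigZ_Vmat : sigZ = \sum_(i < h.+1) \sum_(j < h.+1) al i * al j * Vmat psi h k1 k2 i j.
Proof.
have lA (i : 'I_h.+1) : zl1 (fun x => RZ (i%:Z - x)) by have [] := zl1_reflshift i%:Z zl1_RZ.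
have lC (j : 'I_h.+1) : zl1 (fun x => RZ (j%:Z + x)).
  by have [+ _] := zsum_shift j%:Z zl1_RZ; apply: zl1_le => x; rewrite addrC.
have expand (G : 'I_h.+1 -> int -> R) (lG : forall j, zl1 (G j)) :
    zsum (fun x => (\sum_(i < h.+1) al i * RZ (i%:Z - x)) * (\sum_(j < h.+1) al j * G j x)) =
    \sum_(i < h.+1) \sum_(j < h.+1) al i * al j * zsum (fun x => RZ (i%:Z - x) * G j x).
  have E x : (\sum_(i < h.+1) al i * RZ (i%:Z - x)) * (\sum_(j < h.+1) al j * G j x) =
      \sum_(i < h.+1) \sum_(j < h.+1) al i * al j * (RZ (i%:Z - x) * G j x).
    rewrite mulr_suml; apply: eq_bigr => i _; rewrite mulr_sumr; apply: eq_bigr => j _; ring.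
  rewrite (eq_zsum E).
  have l1 (i j : 'I_h.+1) : zl1 (fun x => al i * al j * (RZ (i%:Z - x) * G j x)) by apply: zl1Z; exact: zl1M.
  have l2 (i : 'I_h.+1) := @zsum_sum R _ (index_enum 'I_h.+1) (fun (j : 'I_h.+1) x => al i * al j * (RZ (i%:Z - x) * G j x)) (l1 i).
  have [_ ->] := @zsum_sum R _ (index_enum 'I_h.+1) (fun (i : 'I_h.+1) x => \sum_(j < h.+1) al i * al j * (RZ (i%:Z - x) * G j x)) (fun i => (l2 i).1).
  apply: eq_bigr => i _; rewrite (l2 i).2; apply: eq_bigr => j _; rewrite zsumZ//; exact: zl1M.
have e1 : zsum (fun x => AZ x ^+ 2) = \sum_(i < h.+1) \sum_(j < h.+1) al i * al j * zsum (fun x => RZ (i%:Z - x) * RZ (j%:Z - x)).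
  by rewrite -(expand (fun (j : 'I_h.+1) x => RZ (j%:Z - x)) lA); apply: eq_zsum => x; rewrite expr2.
have e2 : zsum (fun x => AZ x * AZ (- x)) = \sum_(i < h.+1) \sum_(j < h.+1) al i * al j * zsum (fun x => RZ (i%:Z - x) * RZ (j%:Z + x)).
  rewrite -(expand (fun (j : 'I_h.+1) x => RZ (j%:Z + x)) lC); apply: eq_zsum => x; congr (_ * _).
  by apply: eq_bigr => i _; rewrite opprK.
rewrite /sigZ e1 e2.
rewrite expr2 /AZ mulr_suml -big_split/= !mulr_sumr -big_split/=; apply: eq_bigr => i _.
rewrite -big_split/= !mulr_sumr -big_split/=; apply: eq_bigr => j _.
by rewrite Vmat_entry !subr0; ring.
Qed.

End PsiSequences.

(** * Central limit theorem for the autocovariances *)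

Section MdependentArray.
Context {R : realType} {d : measure_display} {Om : measurableType d} (P : probability Om R)
  (eps : int -> Om -> R -> R) (iid : iid_proc P eps).
Local Notation RR := (measurableTypeR R).
Local Notation path := (int -> R -> R).
Local Notation smp := (sample eps).

Lemma chf_indep (S1 S2 : set int) (F1 F2 : path -> R) : S1 `&` S2 = set0 ->
  measurable_fun (setT : set (XS S1)) F1 -> measurable_fun (setT : set (XS S2)) F2 ->
  chf P (fun w => F1 (smp w) + F2 (smp w)) = chf P (fun w => F1 (smp w)) * chf P (fun w => F2 (smp w)).
Proof.
move=> S12 m1 m2.
have mm (S : set int) (F : path -> R) : measurable_fun (setT : set (XS S)) F -> measurable_fun setT (fun w => F (smp w)).
  by move=> mF; apply: measurableT_comp mF _; exact: (measurable_sample iid).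
have n1 := mm _ _ m1; have n2 := mm _ _ m2.
have ic F (mF : measurable_fun setT (fun w : Om => F (smp w))) := intg_cos P mF.
have is_ F (mF : measurable_fun setT (fun w : Om => F (smp w))) := intg_sin P mF.
have mc (S : set int) (F : path -> R) : measurable_fun (setT : set (XS S)) F ->
  measurable_fun (setT : set (XS S)) (fun x : path => cos (F x)) by exact: measurable_cos'.
have ms (S : set int) (F : path -> R) : measurable_fun (setT : set (XS S)) F ->
  measurable_fun (setT : set (XS S)) (fun x : path => sin (F x)) by exact: measurable_sin'.
have [icc ecc] := sample_indep_E iid S12 (mc _ _ m1) (mc _ _ m2) (ic _ n1) (ic _ n2).
have [iss ess] := sample_indep_E iid S12 (ms _ _ m1) (ms _ _ m2) (is_ _ n1) (is_ _ n2).
have [ics ecs] := sample_indep_E iid S12 (mc _ _ m1) (ms _ _ m2) (ic _ n1) (is_ _ n2).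
have [isc esc] := sample_indep_E iid S12 (ms _ _ m1) (mc _ _ m2) (is_ _ n1) (ic _ n2).
apply/eqP; rewrite eq_complex /=; apply/andP; split; apply/eqP; rewrite /cosE /sinE.
  rewrite -[X in _ = X - _]ecc -[X in _ = _ - X]ess -EintB//; congr Eint; apply/funext => w.
  by rewrite cosD.
rewrite -[X in _ = X + _]ecs -[X in _ = _ + X]esc addrC -EintD//; congr Eint; apply/funext => w.
by rewrite sinD.
Qed.

Lemma chf_shift k (F : path -> R) : measurable_fun (setT : set (XS setT)) F ->
  chf P (fun w => F (shiftp k (smp w))) = chf P (fun w => F (smp w)).
Proof.
move=> mF; have mc : measurable_fun (setT : set (XS setT)) (fun x : path => cos (F x)) by exact: measurable_cos'.
have ms : measurable_fun (setT : set (XS setT)) (fun x : path => sin (F x)) by exact: measurable_sin'.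
by rewrite /chf /cosE /sinE (Eint_shift iid k mc) (Eint_shift iid k ms).
Qed.

Lemma chf0 : chf P (fun=> 0) = 1.
Proof. by rewrite /chf /cosE /sinE cos0 sin0 !Eint_cst. Qed.

Lemma Eint_bilinear (I J : finType) (c : I -> R) (b : J -> R) (X : I -> Om -> R) (Y : J -> Om -> R) :
  (forall i, L2 P (X i)) -> (forall j, L2 P (Y j)) ->
  Eint P (fun w => (\sum_i c i * X i w) * (\sum_j b j * Y j w)) =
  \sum_i \sum_j c i * b j * Eint P (fun w => X i w * Y j w).
Proof.
move=> LX LY.
have -> : (fun w => (\sum_i c i * X i w) * (\sum_j b j * Y j w)) =
    (fun w => \sum_i \sum_j c i * b j * (X i w * Y j w)).
  apply/funext => w; rewrite mulr_suml; apply: eq_bigr => i _; rewrite mulr_sumr.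
  by apply: eq_bigr => j _; ring.
have ii i j : intg P (fun w => c i * b j * (X i w * Y j w)) by apply: intgZ; exact: L2M.
rewrite Eint_sum; last by move=> i; exact: intg_sum.
apply: eq_bigr => i _; rewrite Eint_sum//; apply: eq_bigr => j _.
by rewrite EintZ//; exact: L2M.
Qed.

Context (mu : probability RR R) (e : path -> int -> R -> R).
Context (me : forall (S : set int) t, S t -> measurable_fun setT (fun z : XS S * RR => e z.1 t z.2)).
Context (es : forall k x t u, e (shiftp k x) t u = e x (t + k) u).
Context (e4 : L2 (P \x mu)%E (fun z => ep eps e 0 z ^+ 2)).
Context (em : {ae mu, forall u, Eint P (fun w => e (smp w) 0 u) = 0}).
Context (psi : nat -> R) (h : nat) (al : nat -> R).
Local Notation Y a b x := (Yp P eps mu e a b x).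
Local Notation k1 := (kap1 P eps mu e).
Local Notation k2 := (kap2 P eps mu e).

Lemma Yp_cov (s : int) (a b : nat) : Eint P (fun w => Y s (s - a%:Z) (smp w) * Y s (s - b%:Z) (smp w)) =
  k2 * ((a == 0%N)%:R * (b == 0%N)%:R) + k1 * ((a == b)%:R + (a == 0%N)%:R * (b == 0%N)%:R).
Proof.
have [->|ab] := eqVneq a b.
  transitivity (Eint P (fun w => Y s (s - b%:Z) (smp w) ^+ 2)).
    by congr Eint; apply/funext => w; rewrite expr2.
  have [->|b0] := eqVneq b 0%N.
    by rewrite subr0 Yp_sqr_diag//=; ring.
  rewrite Yp_sqr_off//; first by rewrite /=; ring.
  by apply: contra_neq b0 => /eqP; rewrite eq_sym subr_eq -[X in X == _]addr0 (inj_eq (addrI s)) => /eqP [].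
rewrite Yp_orth//; [|by rewrite lerBlDr lerDl|by rewrite lerBlDr lerDl|].
  have [a0|a0] := eqVneq a 0%N; have [b0|b0] := eqVneq b 0%N; rewrite /=; try ring.
  by move: ab; rewrite a0 b0 eqxx.
apply: contra_neq ab => [[]] /addrI/oppr_inj[]; exact.
Qed.

(** Every product is anchored at its larger index [s], by symmetry and a translation. Different [s]
    then involve different pairs, which makes the [Ms N s] orthogonal, and each uses only
    innovations from a window ending at [s]. *)
Definition Ms (N : nat) (s : int) (x : path) : R :=
  \sum_(q : tau h N) tcoef psi al q * Y s (s - `|tlag q|%N%:Z) x.

Lemma Ms_L2 N s : L2 P (fun w => Ms N s (smp w)).
Proof. by apply: L2_sum => q; apply: L2Z; exact: Yp_L2. Qed.

Lemma Ms_mean N s : Eint P (fun w => Ms N s (smp w)) = 0.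
Proof.
rewrite Eint_sum; last by move=> q; apply: intgZ; apply: L2_intg; exact: Yp_L2.
by rewrite big1// => q _; rewrite EintZ ?EYp ?mulr0//; apply: L2_intg; exact: Yp_L2.
Qed.

Lemma Ms_orth N s t : s != t -> Eint P (fun w => Ms N s (smp w) * Ms N t (smp w)) = 0.
Proof.
move=> st; rewrite Eint_bilinear; [|by move=> q; exact: Yp_L2|by move=> q; exact: Yp_L2].
rewrite big1// => q _; rewrite big1// => q' _; rewrite Yp_orth ?mulr0//.
- by rewrite lerBlDr lerDl.
- by rewrite lerBlDr lerDl.
- by apply: contra_neq st => [[]].
Qed.

Lemma Ms_var N s : nrm2 P (fun w => Ms N s (smp w)) = sigT psi h al k1 k2 N.
Proof.
transitivity (Eint P (fun w => Ms N s (smp w) * Ms N s (smp w))).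
  by congr Eint; apply/funext => w; rewrite expr2.
rewrite Eint_bilinear; [|by move=> q; exact: Yp_L2|by move=> q; exact: Yp_L2].
rewrite sigT_tau; apply: eq_bigr => q _; apply: eq_bigr => q' _; congr (_ * _).
rewrite Yp_cov !absz_eq0; congr (_ + k1 * _).
have [-> |d0] := eqVneq (tlag q) 0.
  rewrite eq_sym absz_eq0 [0 == tlag q']eq_sym mul1r; congr (_ + _).
  by rewrite -eqr_oppLR oppr0 eq_sym.
rewrite mul0r addr0.
have [E|E] := eqVneq (tlag q) (tlag q'); first by rewrite E eqxx (_ : _ == - _ = false) ?addr0//; apply/eqP; move: d0; rewrite E; move: (tlag q') => z /eqP; lia.
have [F|F] := eqVneq (tlag q) (- tlag q'); first by rewrite F abszN eqxx add0r.
rewrite (_ : _ == _ = false) ?addr0//; apply/eqP; move: E F; move: (tlag q) (tlag q') => z z' /eqP E /eqP F; lia.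
Qed.

Definition win (a b : int) : set int := [set t | a <= t /\ t < b].

Lemma measurable_Ms N (s a b : int) : a <= s - (N + h)%N%:Z -> s < b -> measurable_fun (setT : set (XS (win a b))) (Ms N s).
Proof.
move=> as_ sb; apply: measurable_sum => q; apply: measurable_funM => //.
have hq : (`|tlag q| <= N + h)%N.
  by case: q => [[i k] j]; rewrite /tlag/=; have := ltn_ord i; have := ltn_ord k; have := ltn_ord j; lia.
by apply: measurable_Yp => //; rewrite /win/=; lia.
Qed.

Lemma Ms_shift N k s x : Ms N s (shiftp k x) = Ms N (s + k) x.
Proof. by apply: eq_bigr => q _; rewrite Yp_shift// addrAC. Qed.

(** Lags are at most [N + h], so block [j] uses the innovations from [j K - (N + h)] to
    [j K + L - 1]; the window of the next block starts right after, at [(j + 1) K - (N + h)].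
    Disjoint windows give independence, and shifts give equality in law. *)
Lemma Ms_blk (N : nat) L c q : (0 < L)%N ->
  chf P (fun w => c * \sum_(j < q) blk (fun s w => Ms N s%:Z (smp w)) (L + (N + h)) L j w) =
  chf P (fun w => c * blk (fun s w => Ms N s%:Z (smp w)) (L + (N + h)) L 0 w) ^+ q.
Proof.
move=> L0; set K := (L + (N + h))%N; set m := (N + h)%N.
pose B (j : nat) (x : path) := c * \sum_(i < L) Ms N (j * K + i)%N%:Z x.
have BE j w : c * blk (fun s w => Ms N s%:Z (smp w)) K L j w = B j (smp w) by [].
have mB (j : nat) (a b : int) : a <= (j * K)%N%:Z - m%:Z -> (j * K + L)%N%:Z <= b -> measurable_fun (setT : set (XS (win a b))) (B j).
  move=> ha hb; apply: measurable_funM => //; apply: measurable_sum => i; have := ltn_ord i => il.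
  by apply: measurable_Ms; move: ha hb il; rewrite /m; lia.
have shiftB j : chf P (fun w => B j (smp w)) = chf P (fun w => B 0%N (smp w)).
  rewrite -(chf_shift (j * K)%N%:Z (F := B 0%N)); last first.
    apply: (measurable_XS_mono (S := win (- m%:Z) L%:Z)) => //.
    by apply: mB; rewrite mul0n ?add0n// sub0r.
  congr (chf P); apply/funext => w; congr (_ * _); apply: eq_bigr => i _; rewrite Ms_shift; apply: (congr1 (fun z => Ms N z (smp w))).
  by rewrite mul0n add0n; lia.
under [in RHS]eq_fun do rewrite BE.
have E w : c * \sum_(j < q) blk (fun s w => Ms N s%:Z (smp w)) K L j w = \sum_(j < q) B j (smp w).
  by rewrite mulr_sumr.
under eq_fun do rewrite E.
elim: q {E} => [|q IH].
  rewrite expr0 -chf0; congr chf; apply/funext => w; exact: big_ord0.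
under eq_fun do rewrite big_ord_recr/=.
pose x0 : int := - m%:Z.
have dis : win x0 ((q * K)%N%:Z - m%:Z) `&` win ((q * K)%N%:Z - m%:Z) (q * K + L)%N%:Z = set0.
  by apply/seteqP; split=> // t; rewrite /win/=; lia.
have mS : measurable_fun (setT : set (XS (win x0 ((q * K)%N%:Z - m%:Z)))) (fun x : path => \sum_(j < q) B j x).
  apply: measurable_sum => j; have jq := ltn_ord j; apply: mB; rewrite /x0; first by lia.
  have : (j.+1 * K <= q * K)%N by rewrite leq_mul2r jq orbT.
  by rewrite mulSn /K /m; lia.
rewrite (chf_indep (F1 := fun x => \sum_(j < q) B j x) (F2 := B q) dis mS); last exact: mB.
by rewrite IH shiftB exprSr.
Qed.

Lemma Ms_clt N (e0 : R) : 0 < e0 -> \forall n \near \oo,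
  `|cosE P (fun w => (\sum_(s < n.+1) Ms N s%:Z (smp w)) / Num.sqrt n.+1%:R) - expR (- (sigT psi h al k1 k2 N / 2))| <= e0 /\
  `|sinE P (fun w => (\sum_(s < n.+1) Ms N s%:Z (smp w)) / Num.sqrt n.+1%:R)| <= e0.
Proof.
move=> e00.
apply: (@Mdependent_clt _ _ _ P (fun s w => Ms N s%:Z (smp w)) (sigT psi h al k1 k2 N) (N + h)) => //.
- by move=> s; exact: Ms_L2.
- by move=> s; exact: Ms_mean.
- by move=> s t st; apply: Ms_orth; apply: contra_neq st => -[].
- by move=> s; exact: Ms_var.
- by move=> L c q L0; exact: Ms_blk.
Qed.

End MdependentArray.

(** * Truncation and alignment of the sample autocovariances *)

Section AutocovApprox.
Context {R : realType} {d : measure_display} {Om : measurableType d} (P : probability Om R)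
  (eps : int -> Om -> R -> R) (iid : iid_proc P eps).
Local Notation RR := (measurableTypeR R).
Local Notation path := (int -> R -> R).
Local Notation smp := (sample eps).
Context (mu : probability RR R) (e : path -> int -> R -> R).
Context (me : forall (S : set int) t, S t -> measurable_fun setT (fun z : XS S * RR => e z.1 t z.2)).
Context (es : forall k x t u, e (shiftp k x) t u = e x (t + k) u).
Local Notation Pm := (P \x mu)%E.
Local Notation ep := (ep eps e).
Context (e4 : L2 Pm (fun z => ep 0 z ^+ 2)).
Context (em : {ae mu, forall u, Eint P (fun w => e (smp w) 0 u) = 0}).
Context (psi : nat -> R) (Psum : exists M : R, forall N, \sum_(n < N) `|psi n| <= M).
Context (v : path -> int -> R -> R)
  (mv : forall t, measurable_fun setT (fun z : XS setT * RR => v z.1 t z.2)).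
Context (vser : forall t, {ae mu, forall u, {ae P, forall w,
   (fun N : nat => \sum_(i < N) psi i * e (smp w) (t - i%:Z) u) @ \oo --> v (smp w) t u}}).
Local Notation g := (gam P eps mu e).
Local Notation Z a b w := (Zp mu e a b (smp w)).
Local Notation Y a b w := (Yp P eps mu e a b (smp w)).
Local Notation k1 := (kap1 P eps mu e).
Local Notation k2 := (kap2 P eps mu e).
Local Notation l := (psl psi).
Local Notation tl := (pst psi).
Local Notation W := (W eps mu v).
Local Notation WN := (WN eps mu e psi).
Local Notation vv := (vv eps v).

Definition CY : R := k1 + (k2 + 2 * k1).

Lemma Yp_nrm2_le a b : nrm2 P (fun w => Y a b w) <= CY.
Proof.
have k10 : 0 <= k1 by apply: Eint_ge0 => z; exact: sqr_ge0.
have kd : 0 <= k2 + 2 * k1 by rewrite -(Yp_sqr_diag iid me es e4 0) nrm2_ge0.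
rewrite /nrm2 /CY; have [->|ab] := eqVneq a b; first by rewrite Yp_sqr_diag// lerDr.
by rewrite Yp_sqr_off// lerDl.
Qed.

Lemma CY_ge0 : 0 <= CY. Proof. by apply: le_trans (Yp_nrm2_le 0 0); exact: nrm2_ge0. Qed.

Lemma Yp_orth_any a b c k : (a, b) != (c, k) -> (a, b) != (k, c) ->
  Eint P (fun w => Y a b w * Y c k w) = 0.
Proof.
have core a' b' c' k' : b' <= a' -> (a', b') != (c', k') -> (a', b') != (k', c') -> Eint P (fun w => Y a' b' w * Y c' k' w) = 0.
  move=> ba n1 n2; have [kc|/ltW ck] := leP k' c'; first exact: Yp_orth.
  have -> : (fun w => Y a' b' w * Y c' k' w) = (fun w => Y a' b' w * Y k' c' w).
    by apply/funext => w; rewrite (Yp_sym _ _ _ _ c').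
  exact: Yp_orth.
move=> n1 n2; have [ba|/ltW ab] := leP b a; first exact: core.
have -> : (fun w => Y a b w * Y c k w) = (fun w => Y b a w * Y c k w).
  by apply/funext => w; rewrite (Yp_sym _ _ _ _ a).
by apply: core => //; [apply: contra_neq n2|apply: contra_neq n1] => -[-> ->].
Qed.

Definition Tn (a b : int) (n : nat) (w : Om) : R := \sum_(t < n) Y (t%:Z + a) (t%:Z + b) w.

Lemma Tn_L2 a b n : L2 P (Tn a b n).
Proof. by apply: L2_sum => t; exact: Yp_L2. Qed.

Lemma Tn_nrm2 a b n : nrm2 P (Tn a b n) <= n%:R * CY.
Proof.
have := @nrm2_orth R _ _ P (fun (t : nat) w => Y (t%:Z + a) (t%:Z + b) w) (nrm2 P (fun w => Y a b w)) (fun t => Yp_L2 iid me es e4 _ _).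
move=> /(_ _ _ (iota 0 n) (iota_uniq 0 n)); rewrite size_iota => h.
have -> : Tn a b n = (fun w => \sum_(t <- iota 0 n) Y (t%:Z + a) (t%:Z + b) w).
  by apply/funext => z; rewrite /Tn -(big_mkord xpredT (fun i => Y (i%:Z + a) (i%:Z + b) z)) /index_iota subn0.
rewrite h; first by rewrite ler_wpM2l// Yp_nrm2_le.
  move=> s t st; apply: Yp_orth_any; apply/eqP => -[]; [move=> /addIr[st'] _; by rewrite st' eqxx in st|].
  by move=> h1 h2; move/eqP: st; apply; move: h1 h2; lia.
move=> t; rewrite /nrm2.
have mF : measurable_fun (setT : set (XS setT)) (fun x => Yp P eps mu e a b x ^+ 2).
  by apply: measurable_funX; exact: measurable_Yp.
rewrite -(Eint_shift iid t%:Z mF); congr Eint; apply/funext => w.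
by rewrite Yp_shift// ![_ + t%:Z]addrC.
Qed.

Definition SN (N i n : nat) (w : Om) : R :=
  \sum_(k < N) \sum_(j < N) psi k * psi j * Tn (1 - k%:Z) (1 + i%:Z - j%:Z) n w.

Lemma SN_L2 N i n : L2 P (SN N i n).
Proof. by apply: L2_sum => k; apply: L2_sum => j; apply: L2Z; exact: Tn_L2. Qed.

(** The decisive rate: [Tn] is a sum of orthogonal terms, so its norm grows like [sqrt n], and only
    coefficients with an index beyond [N] are left. After division by [sqrt n] the bound is uniform
    in [n]. *)
Lemma SN_diff N N' i n : (N <= N')%N ->
  Eint P (fun w => `|SN N' i n w - SN N i n w|) <= 2 * l * tl N * Num.sqrt (n%:R * CY).
Proof.
move=> NN; have l0 := psl_ge0 Psum; have t0 := pst_ge0 Psum N.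
(* The coefficients cancel on the common square of indices; off it one of the two indices is at
   least [N], which gives the mass [2 l tl N]. *)
pose c (q : 'I_N' * 'I_N') : R := psi q.1 * psi q.2 * (~~ ((q.1 < N)%N && (q.2 < N)%N))%:R.
pose X (q : 'I_N' * 'I_N') w : R := Tn (1 - (q.1 : nat)%:Z) (1 + i%:Z - (q.2 : nat)%:Z) n w.
have E w : SN N' i n w - SN N i n w = \sum_(q : 'I_N' * 'I_N') c q * X q w.
  have e1 : SN N i n w = \sum_(k < N') \sum_(j < N') psi k * psi j * ((k < N)%N && (j < N)%N)%:R * X (k, j) w.
    rewrite /SN (big_ord_widen_cond _ xpredT (fun k => \sum_(j < N) psi k * psi j * Tn (1 - k%:Z) (1 + i%:Z - j%:Z) n w) NN)/= big_mkcond/=.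
    apply: eq_bigr => k _; case: ifP => kN; last by rewrite big1// => j _; rewrite mulr0 mul0r.
    rewrite (big_ord_widen_cond _ xpredT (fun j => psi k * psi j * Tn (1 - k%:Z) (1 + i%:Z - j%:Z) n w) NN)/= big_mkcond/=.
    by apply: eq_bigr => j _; case: ifP => jN; rewrite ?mulr1// mulr0 mul0r.
  rewrite e1 /SN -sumrB -(pair_big xpredT xpredT (fun k j => c (k, j) * X (k, j) w))/=.
  apply: eq_bigr => k _; rewrite -sumrB; apply: eq_bigr => j _; rewrite /c/X/=.
  by case: (_ && _); rewrite /= ?mulr1 ?mulr0 ?mul0r ?subrr ?subr0.
have csum : \sum_q `|c q| <= 2 * l * tl N.
  have tN : \sum_(k < N' | (N <= k)%N) `|psi k| <= tl N.
    apply: le_trans (psum_tail Psum N N'); rewrite [leRHS]big_nat_cond -(big_mkord (fun k => (N <= k)%N) (fun k => `|psi k|)).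
    rewrite (@big_cat_nat _ _ _ N)//= [X in X + _]big_nat_cond [X in X + _]big1 ?add0r; last first.
      by move=> k /andP[/andP[_ h1] h2]; move: h1; rewrite ltnNge h2.
    rewrite [leLHS]big_nat_cond le_eqVlt; apply/orP; left; apply/eqP; apply: eq_bigl => k.
    by case: (N <= k)%N; rewrite ?andbT ?andbF.
  have lN := psum_le Psum N'.
  have h1 : \sum_q `|c q| <= \sum_(k < N') \sum_(j < N') (`|psi k| * (N <= k)%:R * `|psi j| + `|psi k| * (`|psi j| * (N <= j)%:R)).
    rewrite -(pair_big xpredT xpredT (fun k j => `|c (k, j)|))/=; apply: ler_sum => k _; apply: ler_sum => j _.
    rewrite /c/= !normrM normr_nat negb_and -!leqNgt.
    by case: (N <= k)%N; case: (N <= j)%N; rewrite /= ?mulr1 ?mulr0 ?mul0r ?addr0 ?add0r ?lerDl ?mulr_ge0.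
  apply: le_trans h1 _.
  have -> : \sum_(k < N') \sum_(j < N') (`|psi k| * (N <= k)%:R * `|psi j| + `|psi k| * (`|psi j| * (N <= j)%:R)) =
      (\sum_(k < N' | (N <= k)%N) `|psi k|) * (\sum_(j < N') `|psi j|) + (\sum_(k < N') `|psi k|) * (\sum_(j < N' | (N <= j)%N) `|psi j|).
    under eq_bigr => k _ do rewrite big_split/= -!mulr_sumr.
    rewrite big_split/= -!mulr_suml; congr (_ * _ + _ * _); rewrite [RHS]big_mkcond/=; apply: eq_bigr => k _;
      by case: ifP => _; rewrite ?mulr1 ?mulr0.
  rewrite (_ : 2 * l * tl N = tl N * l + l * tl N); last by ring.
  by apply: lerD; apply: ler_pM => //; apply: sumr_ge0.
apply: Eabs_le.
- by apply: L2B; exact: SN_L2.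
- by rewrite !mulr_ge0// sqrtr_ge0.
under eq_fun do rewrite E.
apply: le_trans (nrm2_wsum_le (index_enum _) c (fun q => Tn_L2 _ _ n) (fun q => Tn_nrm2 _ _ n)) _.
rewrite [leRHS]exprMn sqr_sqrtr; last by rewrite mulr_ge0// CY_ge0.
rewrite ler_wpM2r ?mulr_ge0 ?CY_ge0// ler_sqr ?nnegrE ?sumr_ge0 ?mulr_ge0//.
Qed.

Lemma SN_WN N i n w : SN N i n w = \sum_(t < n) (WN N (t%:Z + 1) (t%:Z + 1 + i%:Z) w - g * RT psi N i%:Z).
Proof.
rewrite /SN/Tn/WN/RT.
under eq_bigr => k _ do under eq_bigr => j _ do rewrite mulr_sumr.
under eq_bigr => k _ do rewrite exchange_big/=.
rewrite exchange_big/=; apply: eq_bigr => t _.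
rewrite mulr_sumr -sumrB; apply: eq_bigr => k _; rewrite mulr_sumr -sumrB; apply: eq_bigr => j _.
rewrite /Yp (_ : (j%:Z - k%:Z == i%:Z) = (t%:Z + (1 - k%:Z) == t%:Z + (1 + i%:Z - j%:Z))); last by apply/eqP/eqP; lia.
by rewrite !addrA; ring.
Qed.

(** A longer truncation [K] is inserted and sent to infinity with [n] and [N] fixed: the termwise
    error between the full sum and [SN K] is of order [n] but vanishes with [K], and [SN_diff]
    bounds the rest independently of [K]. *)
Lemma W_SN N i n : Eint P (fun w => `|\sum_(t < n) (W (t%:Z + 1) (t%:Z + 1 + i%:Z) w - g * RZ psi i%:Z) - SN N i n w|)
  <= 2 * l * tl N * Num.sqrt (n%:R * CY).
Proof.
have iW s t : intg P (W s t) by exact: (W_intg iid me es e4 em Psum mv vser).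
have iWc : intg P (fun w => \sum_(t < n) (W (t%:Z + 1) (t%:Z + 1 + i%:Z) w - g * RZ psi i%:Z)).
  by apply: intg_sum => t; apply: intgB => //; exact: intg_cst.
have iS K : intg P (SN K i n) by apply: L2_intg; exact: SN_L2.
pose B (K : nat) : R := (n%:R * (2 * l * tl K * g + `|g| * `|RT psi K i%:Z - RZ psi i%:Z|)) + 2 * l * tl N * Num.sqrt (n%:R * CY).
have step1 K : Eint P (fun w => `|\sum_(t < n) (W (t%:Z + 1) (t%:Z + 1 + i%:Z) w - g * RZ psi i%:Z) - SN K i n w|) <=
   n%:R * (2 * l * tl K * g + `|g| * `|RT psi K i%:Z - RZ psi i%:Z|).
  have ii (t : 'I_n) : intg P (fun w => `|W (t%:Z + 1) (t%:Z + 1 + i%:Z) w - WN K (t%:Z + 1) (t%:Z + 1 + i%:Z) w| + `|g| * `|RT psi K i%:Z - RZ psi i%:Z|).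
    apply: intgD; last exact: intg_cst.
    apply: intg_norm; apply: intgB => //; apply: L2_intg; exact: WN_L2.
  apply: (@le_trans _ _ (Eint P (fun w => \sum_(t < n) (`|W (t%:Z + 1) (t%:Z + 1 + i%:Z) w - WN K (t%:Z + 1) (t%:Z + 1 + i%:Z) w| + `|g| * `|RT psi K i%:Z - RZ psi i%:Z|)))).
    apply: Eint_le; [by apply: intg_norm; exact: intgB|exact: intg_sum|move=> w].
    rewrite SN_WN -sumrB; apply: le_trans (ler_norm_sum _ _ _) _; apply: ler_sum => t _.
    rewrite -normrM; apply: le_trans (ler_normD _ _); rewrite le_eqVlt; apply/orP; left; apply/eqP; congr (`|_|); ring.
  rewrite Eint_sum//; apply: (@le_trans _ _ (\sum_(t < n) (2 * l * tl K * g + `|g| * `|RT psi K i%:Z - RZ psi i%:Z|))).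
    apply: ler_sum => t _; rewrite EintD; [|by apply: intg_norm; apply: intgB => //; apply: L2_intg; exact: WN_L2|exact: intg_cst].
    rewrite Eint_cst lerD2r; exact: (W_approx iid me es e4 em Psum mv vser).
  by rewrite sumr_const card_ord -[leLHS]mulr_natl.
have bd K : (N <= K)%N -> Eint P (fun w => `|\sum_(t < n) (W (t%:Z + 1) (t%:Z + 1 + i%:Z) w - g * RZ psi i%:Z) - SN N i n w|) <= B K.
  move=> NK; have s2 := SN_diff i n NK.
  have i1 : intg P (fun w => `|\sum_(t < n) (W (t%:Z + 1) (t%:Z + 1 + i%:Z) w - g * RZ psi i%:Z) - SN K i n w|).
    by apply: intg_norm; exact: intgB.
  have i2 : intg P (fun w => `|SN K i n w - SN N i n w|) by apply: intg_norm; exact: intgB.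
  apply: le_trans (lerD (step1 K) s2); rewrite -EintD//.
  apply: Eint_le; [by apply: intg_norm; exact: intgB|exact: intgD|move=> w].
  by apply: le_trans (ler_normD _ _); rewrite addrA subrK.
have cv : B @ \oo --> n%:R * (2 * l * 0 * g + `|g| * `|RZ psi i%:Z - RZ psi i%:Z|) + 2 * l * tl N * Num.sqrt (n%:R * CY).
  apply: cvgD; last exact: cvg_cst.
  apply: cvgMr; apply: cvgD.
    by apply: cvgMl; apply: cvgMr; exact: pst_cvg.
  apply: cvgMr; apply: cvg_norm; apply: cvgB; [exact: RT_cvg|exact: cvg_cst].
rewrite subrr normr0 !mulr0 mul0r addr0 mulr0 add0r in cv.
by apply: (ler_cvg_to (cvg_cst _) cv); exists N => // K; exact: bd.
Qed.

(** Each unit shift of the window replaces one term by another; negative shifts reduce to positive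
    ones by shifting [G]. *)
Lemma shift_sum (G : int -> Om -> R) C (a : int) n : (forall t, intg P (G t)) -> (forall t, Eint P (fun w => `|G t w|) <= C) ->
  Eint P (fun w => `|\sum_(t < n) G (t%:Z + a) w - \sum_(t < n) G t%:Z w|) <= 2 * C * `|a|%N%:R.
Proof.
move=> iG GC.
have nat_case (H : int -> Om -> R) (m : nat) : (forall t, intg P (H t)) -> (forall t, Eint P (fun w => `|H t w|) <= C) ->
    Eint P (fun w => `|\sum_(t < n) H (t%:Z + m%:Z) w - \sum_(t < n) H t%:Z w|) <= 2 * C * m%:R.
  move=> iH HC; elim: m => [|m IH].
    rewrite mulr0 -[leRHS](Eint_cst P 0) le_eqVlt; apply/orP; left; apply/eqP; congr Eint; apply/funext => w.
    by under eq_bigr => t _ do rewrite addr0; rewrite subrr normr0.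
  have tele w : \sum_(t < n) H (t%:Z + m.+1%:Z) w = \sum_(t < n) H (t%:Z + m%:Z) w + (H (n%:Z + m%:Z) w - H m%:Z w).
    elim: (n) => [|n' IHn]; first by rewrite !big_ord0 add0r add0r subrr.
    rewrite !big_ord_recr/= IHn (_ : n'%:Z + m.+1%:Z = n'.+1%:Z + m%:Z); last by lia.
    ring.
  have iS (c : int) : intg P (fun w => \sum_(t < n) H (t%:Z + c) w) by apply: intg_sum => t; exact: iH.
  have iS0 : intg P (fun w => \sum_(t < n) H t%:Z w) by apply: intg_sum => t; exact: iH.
  have i1 : intg P (fun w => `|\sum_(t < n) H (t%:Z + m%:Z) w - \sum_(t < n) H t%:Z w|) by apply: intg_norm; exact: intgB.
  have i2 : intg P (fun w => `|H (n%:Z + m%:Z) w| + `|H m%:Z w|) by apply: intgD; exact: intg_norm.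
  apply: (@le_trans _ _ (Eint P (fun w => `|\sum_(t < n) H (t%:Z + m%:Z) w - \sum_(t < n) H t%:Z w| + (`|H (n%:Z + m%:Z) w| + `|H m%:Z w|)))).
    apply: Eint_le; [by apply: intg_norm; exact: intgB|exact: intgD|move=> w].
    rewrite tele addrAC; apply: le_trans (ler_normD _ _) _; rewrite lerD2l; exact: ler_normB.
  rewrite EintD// EintD; [|exact: intg_norm|exact: intg_norm].
  have h1 := HC (n%:Z + m%:Z); have h2 := HC m%:Z.
  rewrite -[m.+1%:R]natr1 [leRHS]mulrDr mulr1; apply: lerD => //; apply: le_trans (lerD h1 h2) _; lra.
case: (intP a) => [|m|m]; first exact: (nat_case G 0%N).
  exact: (nat_case G m.+1).
have := nat_case (fun t => G (t - m.+1%:Z)) m.+1 (fun t => iG _) (fun t => GC _).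
rewrite abszN/=; congr (_ <= _); congr Eint; apply/funext => w.
by rewrite distrC; congr (`|_ - _|); apply: eq_bigr => t _; rewrite ?addrK.
Qed.

Lemma Tn_shift a b n : Eint P (fun w => `|Tn a b n w - \sum_(s < n) Y s%:Z (s%:Z - `|b - a|%N%:Z) w|) <=
  2 * Num.sqrt CY * (`|a| + `|b|)%N%:R.
Proof.
have C0 : 0 <= Num.sqrt CY := sqrtr_ge0 _.
pose G (t : int) w := Y t (t - `|b - a|%N%:Z) w.
have iG t : intg P (G t) by apply: L2_intg; exact: Yp_L2.
have GC t : Eint P (fun w => `|G t w|) <= Num.sqrt CY.
  by apply: Eabs_le => //; [exact: Yp_L2|rewrite sqr_sqrtr ?CY_ge0// Yp_nrm2_le].
have [ba|/ltW ab] := leP b a.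
  apply: (@le_trans _ _ (2 * Num.sqrt CY * `|a|%N%:R)).
    rewrite -[Eint _ _]/(Eint P (fun w => `|_ - \sum_(s < n) G s%:Z w|)).
    have -> : Tn a b n = (fun w => \sum_(t < n) G (t%:Z + a) w).
      apply/funext => w; apply: eq_bigr => t _; rewrite /G; congr (Yp _ _ _ _ _ _ _); lia.
    exact: shift_sum.
  by rewrite ler_wpM2l ?mulr_ge0// ler_nat leq_addr.
apply: (@le_trans _ _ (2 * Num.sqrt CY * `|b|%N%:R)).
  have -> : Tn a b n = (fun w => \sum_(t < n) G (t%:Z + b) w).
    apply/funext => w; apply: eq_bigr => t _; rewrite Yp_sym /G; congr (Yp _ _ _ _ _ _ _); lia.
  exact: shift_sum.
by rewrite ler_wpM2l ?mulr_ge0// ler_nat leq_addl.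
Qed.

(** For fixed [N] there are finitely many triples of indices, and aligning the products of each
    costs a bounded number of boundary terms: the bound is independent of [n], hence negligible
    after division by [sqrt n]. *)
Lemma SN_Ms (h : nat) (al : nat -> R) N : exists D : R, forall n,
  Eint P (fun w => `|\sum_(i < h.+1) al i * SN N i n w - \sum_(s < n) Ms P eps mu e psi h al N s%:Z (smp w)|) <= D.
Proof.
pose A (q : tau h N) : int := 1 - (q.1.2 : nat)%:Z.
pose B (q : tau h N) : int := 1 + (q.1.1 : nat)%:Z - (q.2 : nat)%:Z.
exists (\sum_(q : tau h N) `|tcoef psi al q| * (2 * Num.sqrt CY * (`|A q| + `|B q|)%N%:R)) => n.
have E w : \sum_(i < h.+1) al i * SN N i n w - \sum_(s < n) Ms P eps mu e psi h al N s%:Z (smp w) =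
   \sum_(q : tau h N) tcoef psi al q * (Tn (A q) (B q) n w - \sum_(s < n) Y s%:Z (s%:Z - `|B q - A q|%N%:Z) w).
  rewrite /Ms exchange_big/= [RHS](_ : _ = \sum_(q : tau h N) tcoef psi al q * Tn (A q) (B q) n w - \sum_(q : tau h N) tcoef psi al q * \sum_(s < n) Y s%:Z (s%:Z - `|B q - A q|%N%:Z) w); last first.
    by rewrite -sumrB; apply: eq_bigr => q _; rewrite mulrBr.
  congr (_ - _).
    rewrite -(pair_big xpredT xpredT (fun (p : 'I_h.+1 * 'I_N) j => tcoef psi al (p, j) * Tn (A (p, j)) (B (p, j)) n w))/=.
    rewrite -(pair_big xpredT xpredT (fun (i : 'I_h.+1) (k : 'I_N) => \sum_(j : 'I_N) tcoef psi al (i, k, j) * Tn (A (i, k, j)) (B (i, k, j)) n w))/=.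
    apply: eq_bigr => i _; rewrite mulr_sumr; apply: eq_bigr => k _; rewrite mulr_sumr; apply: eq_bigr => j _.
    by rewrite /tcoef/A/B/= !mulrA.
  apply: eq_bigr => q _; rewrite mulr_sumr; apply: eq_bigr => s _; apply: (congr1 (fun z => tcoef psi al q * Y s%:Z (s%:Z - z) w)).
  by case: q => [[i k] j]; rewrite /tlag/A/B/=; lia.
have iq (q : tau h N) : intg P (fun w => Tn (A q) (B q) n w - \sum_(s < n) Y s%:Z (s%:Z - `|B q - A q|%N%:Z) w).
  by apply: intgB; [exact: L2_intg (Tn_L2 _ _ _)|apply: intg_sum => s; exact: L2_intg (Yp_L2 iid me es e4 _ _)].
apply: (@le_trans _ _ (Eint P (fun w => \sum_(q : tau h N) `|tcoef psi al q| * `|Tn (A q) (B q) n w - \sum_(s < n) Y s%:Z (s%:Z - `|B q - A q|%N%:Z) w|))).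
  apply: Eint_le.
  - by under eq_fun do rewrite E; apply: intg_norm; apply: intg_sum => q; exact: intgZ.
  - by apply: intg_sum => q; apply: intgZ; exact: intg_norm.
  - by move=> w; rewrite E; apply: le_trans (ler_norm_sum _ _ _) _; apply: ler_sum => q _; rewrite normrM.
rewrite Eint_sum; last by move=> q; apply: intgZ; exact: intg_norm.
apply: ler_sum => q _; rewrite EintZ; last exact: intg_norm.
by rewrite ler_wpM2l// Tn_shift.
Qed.

End AutocovApprox.

Lemma PoszS (t : nat) : t.+1%:Z = t%:Z + 1.
Proof. lia. Qed.

(** * Centring by the sample mean and the limit of linear combinations *)

Section AutocovCLT.
Context {R : realType} {d : measure_display} {Om : measurableType d} (P : probability Om R)
  (eps : int -> Om -> R -> R) (iid : iid_proc P eps).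
Local Notation RR := (measurableTypeR R).
Local Notation path := (int -> R -> R).
Local Notation smp := (sample eps).
Context (mu : probability RR R) (e : path -> int -> R -> R).
Context (me : forall (S : set int) t, S t -> measurable_fun setT (fun z : XS S * RR => e z.1 t z.2)).
Context (es : forall k x t u, e (shiftp k x) t u = e x (t + k) u).
Local Notation Pm := (P \x mu)%E.
Local Notation ep := (ep eps e).
Context (e4 : L2 Pm (fun z => ep 0 z ^+ 2)).
Context (em : {ae mu, forall u, Eint P (fun w => e (smp w) 0 u) = 0}).
Context (psi : nat -> R) (Psum : exists M : R, forall N, \sum_(n < N) `|psi n| <= M).
Context (v : path -> int -> R -> R)
  (mv : forall t, measurable_fun setT (fun z : XS setT * RR => v z.1 t z.2)).
Context (vser : forall t, {ae mu, forall u, {ae P, forall w,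
   (fun N : nat => \sum_(i < N) psi i * e (smp w) (t - i%:Z) u) @ \oo --> v (smp w) t u}}).
Local Notation g := (gam P eps mu e).
Local Notation k1 := (kap1 P eps mu e).
Local Notation k2 := (kap2 P eps mu e).
Local Notation l := (psl psi).
Local Notation tl := (pst psi).
Local Notation W := (W eps mu v).
Local Notation vv := (vv eps v).
Local Notation vvL2 := (vv_L2 iid me es e4 em Psum mv vser).
Local Notation CY := (CY P eps mu e).
Local Notation RZ := (RZ psi).
Local Notation SN := (SN P eps mu e psi).

Lemma L1_section (F : Om * RR -> R) : intg Pm F ->
  Eint P (fun w => `|Eint mu (fun u => F (w, u))|) <= Eint Pm (fun z => `|F z|).
Proof.
move=> iF; have [i1 e1] := Eint_fubini1 (intg_norm iF); have [i2 _] := Eint_fubini1 iF.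
rewrite -e1 (@eq_Eint_ae _ _ _ P (fun x => Eint mu (fun y => `|F (x, y)|)) (fun w => `|Eint mu (fun u => F (w, u))| + `|Eint mu (fun y => `|F (w, y)|) - `|Eint mu (fun u => F (w, u))| |)).
  have i3 := intg_norm i2.
  rewrite EintD//; first by rewrite lerDl; apply: Eint_ge0.
  by apply: intg_norm; exact: intgB.
apply: aeS (intg_section1 iF) => w iw'; rewrite [X in _ + X]ger0_norm; first by rewrite addrC subrK.
by rewrite subr_ge0; exact: Eint_norm.
Qed.

Definition vbar (n : nat) (x : path) (u : R) : R := n%:R^-1 * \sum_(1 <= t < n.+1) v x t%:Z u.

Definition Lam (i n : nat) (w : Om) : R :=
  Eint mu (fun u => n%:R^-1 * \sum_(1 <= t < (n - i).+1)
    ((v (smp w) t%:Z u - vbar n (smp w) u) * (v (smp w) (t + i)%N%:Z u - vbar n (smp w) u))).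

Definition LamF (i n : nat) (z : Om * RR) : R := n%:R^-1 * \sum_(1 <= t < (n - i).+1)
    ((vv t%:Z z - vbar n (smp z.1) z.2) * (vv (t + i)%N%:Z z - vbar n (smp z.1) z.2)).

Lemma vbar_L2 n : L2 Pm (fun z => vbar n (smp z.1) z.2).
Proof. by apply: L2Z; apply: L2_sum => t; exact: vvL2. Qed.

Lemma LamF_intg i n : intg Pm (LamF i n).
Proof.
have vb := vbar_L2 n.
by apply: intgZ; apply: intg_sum => t; apply: L2M; apply: L2B => //; exact: vvL2.
Qed.

Lemma Lam_intg i n : intg P (Lam i n).
Proof. by have [] := Eint_fubini1 (LamF_intg i n). Qed.

Lemma W_intg' s t : intg P (W s t).
Proof. exact: (W_intg iid me es e4 em Psum mv vser). Qed.

Lemma vv_mul_le s t : Eint Pm (fun z => `|vv s z * vv t z|) <= l ^+ 2 * g.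
Proof.
have g0 := gam_ge0 iid me es e4 em; have B0 : 0 <= l ^+ 2 * g by rewrite mulr_ge0// sqr_ge0.
have s0 := sqrtr_ge0 (l ^+ 2 * g).
have nr r : nrm2 Pm (vv r) <= Num.sqrt (l ^+ 2 * g) ^+ 2.
  by rewrite sqr_sqrtr//; exact: (vv_nrm2 iid me es e4 em Psum mv vser).
apply: le_trans (Emul_le (vvL2 s) (vvL2 t) s0 s0 (nr s) (nr t)) _.
by rewrite -expr2 sqr_sqrtr.
Qed.

(** The [i] products absent from the sample sum contribute [i] times [l^2 g]. Each of the three
    terms containing the sample mean contributes at most twice that, by Cauchy-Schwarz between a sum
    of norm of order [sqrt n] and a mean of norm of order [1 / sqrt n]. *)
Lemma Lam_err i n : (0 < n)%N ->
  Eint P (fun w => `|n%:R * Lam i n w - \sum_(t < n) W (t%:Z + 1) (t%:Z + 1 + i%:Z) w|) <= (i%:R + 6) * (l ^+ 2 * g).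
Proof.
move=> n0; set m := (n - i)%N; have n0' : (n%:R : R) != 0 by rewrite pnatr_eq0 -lt0n.
have np : 0 < (n%:R : R) by rewrite ltr0n.
have g0 := gam_ge0 iid me es e4 em; set B := l ^+ 2 * g.
have B0 : 0 <= B by rewrite mulr_ge0// sqr_ge0.
have mn : (m <= n)%N by exact: leq_subr.
have B2 : 0 <= 2 * B by rewrite mulr_ge0.
have nn : 0 <= n%:R :> R by exact: ltW.
pose vb z := vbar n (smp z.1) z.2.
pose A (c : int) z : R := \sum_(t < m) vv (t%:Z + c) z.
have LA c := (vv_sum_nrm2 iid me es e4 em Psum mv vser c m).
have [LV nV] := (vv_sum_nrm2 iid me es e4 em Psum mv vser 1 n).
have vbE z : vb z = n%:R^-1 * \sum_(t < n) vv (t%:Z + 1) z.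
  rewrite /vb/vbar big_add1/= big_mkord; congr (_ * _); apply: eq_bigr => t _; rewrite /vv; congr (v _ _ _); lia.
have vbn : nrm2 Pm vb <= (Num.sqrt (2 * B) / Num.sqrt n%:R) ^+ 2.
  have -> : nrm2 Pm vb = n%:R^-1 ^+ 2 * nrm2 Pm (fun z => \sum_(t < n) vv (t%:Z + 1) z).
    by rewrite -nrm2Z//; congr nrm2; apply/funext => z.
  rewrite expr_div_n (sqr_sqrtr B2) (sqr_sqrtr nn); apply: (@le_trans _ _ (n%:R^-1 ^+ 2 * (2 * l ^+ 2 * g * n%:R))); first by apply: ler_wpM2l => //; exact: sqr_ge0.
  by rewrite /B le_eqVlt; apply/orP; left; apply/eqP; field.
have An c : nrm2 Pm (A c) <= (Num.sqrt (2 * B) * Num.sqrt n%:R) ^+ 2.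
  rewrite exprMn (sqr_sqrtr B2) (sqr_sqrtr nn); apply: le_trans (LA c).2 _.
  by rewrite -[2 * l ^+ 2 * g]mulrA -/B; apply: ler_wpM2l => //; rewrite ler_nat.
have q0 : 0 <= Num.sqrt (2 * B) * Num.sqrt n%:R by rewrite mulr_ge0// sqrtr_ge0.
have q1 : 0 <= Num.sqrt (2 * B) / Num.sqrt n%:R by rewrite divr_ge0// sqrtr_ge0.
have sn0 : Num.sqrt n%:R != 0 :> R by rewrite gt_eqF// sqrtr_gt0.
have qq : (Num.sqrt (2 * B) * Num.sqrt n%:R) * (Num.sqrt (2 * B) / Num.sqrt n%:R) = 2 * B.
  by rewrite mulrACA -expr2 (sqr_sqrtr B2) divff// mulr1.
have Lvb : L2 Pm vb by exact: vbar_L2.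
have bA c : Eint Pm (fun z => `|A c z * vb z|) <= 2 * B.
  by rewrite -qq; apply: Emul_le => //; exact: (LA c).1.
have bv : Eint Pm (fun z => `|vb z * vb z|) <= 2 * B / n%:R.
  apply: le_trans (Emul_le Lvb Lvb q1 q1 vbn vbn) _.
  by rewrite -expr2 expr_div_n (sqr_sqrtr B2) (sqr_sqrtr nn).
pose Rm z : R := \sum_(m <= t < n) vv (t%:Z + 1) z * vv (t%:Z + 1 + i%:Z) z.
have iR : intg Pm Rm by apply: intg_sum => t; apply: L2M; exact: vvL2.
have bR : Eint Pm (fun z => `|Rm z|) <= i%:R * B.
  apply: (@le_trans _ _ (Eint Pm (fun z => \sum_(m <= t < n) `|vv (t%:Z + 1) z * vv (t%:Z + 1 + i%:Z) z|))).
    apply: Eint_le; [exact: intg_norm|by apply: intg_sum => t; apply: intg_norm; apply: L2M; exact: vvL2|].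
    by move=> z; exact: ler_norm_sum.
  rewrite Eint_sum; last by move=> t; apply: intg_norm; apply: L2M; exact: vvL2.
  apply: (@le_trans _ _ (\sum_(m <= t < n) B)); first by apply: ler_sum => t _; exact: vv_mul_le.
  rewrite sumr_const_nat -[leLHS]mulr_natl; apply: ler_wpM2r => //; rewrite ler_nat /m.
  by rewrite leq_subLR addnC -leq_subLR.
have E z : n%:R * LamF i n z - \sum_(t < n) vv (t%:Z + 1) z * vv (t%:Z + 1 + i%:Z) z =
    - (Rm z + A 1 z * vb z + A (1 + i%:Z) z * vb z - m%:R * (vb z * vb z)).
  rewrite /LamF mulVKf// big_add1/= big_mkord -/m.
  have -> : \sum_(t < n) vv (t%:Z + 1) z * vv (t%:Z + 1 + i%:Z) z =
      \sum_(t < m) vv (t%:Z + 1) z * vv (t%:Z + 1 + i%:Z) z + Rm z.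
    by rewrite -!(big_mkord xpredT (fun t => vv (t%:Z + 1) z * vv (t%:Z + 1 + i%:Z) z)) -big_cat_nat.
  have -> : \sum_(t < m) (vv t.+1%:Z z - vbar n (smp z.1) z.2) * (vv (t.+1 + i)%N%:Z z - vbar n (smp z.1) z.2) =
      \sum_(t < m) (vv (t%:Z + 1) z * vv (t%:Z + 1 + i%:Z) z - vb z * vv (t%:Z + 1) z - vb z * vv (t%:Z + (1 + i%:Z)) z + vb z * vb z).
    apply: eq_bigr => t _; have -> : vbar n (smp z.1) z.2 = vb z by [].
    by rewrite PoszD PoszS -[_ + 1 + i%:Z]addrA; ring.
  have s0 : \sum_(t < m) vb z * vb z = m%:R * (vb z * vb z) by rewrite sumr_const card_ord -[LHS]mulr_natl.
  have s1 : \sum_(t < m) vb z * vv (t%:Z + 1) z = vb z * A 1 z by rewrite -mulr_sumr.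
  have s2 : \sum_(t < m) vb z * vv (t%:Z + (1 + i%:Z)) z = vb z * A (1 + i%:Z) z by rewrite -mulr_sumr.
  by rewrite big_split/= !sumrB s0 s1 s2; ring.
pose G z : R := n%:R * LamF i n z - \sum_(t < n) vv (t%:Z + 1) z * vv (t%:Z + 1 + i%:Z) z.
have ivv (s t : int) : intg Pm (fun z => vv s z * vv t z) by apply: L2M; exact: vvL2.
have iG : intg Pm G by apply: intgB; [apply: intgZ; exact: LamF_intg|exact: intg_sum].
rewrite (@eq_Eint_ae _ _ _ P _ (fun w => `|Eint mu (fun u => G (w, u))|)); last first.
  have h : {ae P, forall w, forall st : int * int, intg mu (fun u => vv st.1 (w, u) * vv st.2 (w, u))}.
    by apply: ae_countable => st; exact: intg_section1 (ivv _ _).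
  apply: aeS2 h (intg_section1 (LamF_intg i n)) => w hw iL.
  rewrite /G EintB; [|exact: intgZ|by apply: intg_sum => t; exact: (hw (_, _))].
  by rewrite EintZ// Eint_sum => [|t]; last exact: (hw (_, _)).
apply: le_trans (L1_section iG) _.
have iA c : intg Pm (fun z => A c z * vb z) by apply: L2M => //; exact: (LA c).1.
have iv : intg Pm (fun z => vb z * vb z) by exact: L2M.
have ia := intg_norm iR; have ib := intg_norm (iA 1); have ic := intg_norm (iA (1 + i%:Z)); have id' := intgZ m%:R (intg_norm iv).
apply: (@le_trans _ _ (Eint Pm (fun z => `|Rm z| + `|A 1 z * vb z| + `|A (1 + i%:Z) z * vb z| + m%:R * `|vb z * vb z|))).
  apply: Eint_le; [exact: intg_norm|by apply: intgD => //; apply: intgD => //; exact: intgD|move=> z].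
  rewrite /G E normrN; apply: le_trans (ler_normB _ _) _.
  rewrite [X in _ + X]normrM normr_nat lerD2r.
  by apply: le_trans (ler_normD _ _) _; rewrite lerD2r; exact: ler_normD.
rewrite EintD; [|by apply: intgD => //; exact: intgD|by []].
rewrite EintD; [|exact: intgD|by []]; rewrite EintD// EintZ; last exact: intg_norm.
have h4 : m%:R * Eint Pm (fun z => `|vb z * vb z|) <= 2 * B.
  apply: (@le_trans _ _ (n%:R * (2 * B / n%:R))); last by rewrite mulrC divfK.
  by apply: ler_pM => //; [apply: Eint_ge0|rewrite ler_nat].
rewrite (_ : (i%:R + 6) * B = i%:R * B + 2 * B + 2 * B + 2 * B); last by ring.
by do 3 (apply: lerD => //).
Qed.

Definition Dev (i n : nat) (w : Om) : R := Num.sqrt n%:R * (Lam i n w - g * RZ i%:Z).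

Lemma Dev_intg i n : intg P (Dev i n).
Proof. by apply: intgZ; apply: intgB; [exact: Lam_intg|exact: intg_cst]. Qed.

Lemma Dev_SN i n N : (0 < n)%N -> Eint P (fun w => `|Num.sqrt n%:R * Dev i n w - SN N i n w|) <=
  (i%:R + 6) * (l ^+ 2 * g) + 2 * l * tl N * Num.sqrt (n%:R * CY).
Proof.
move=> n0; have h1 := Lam_err i n0; have h2 := W_SN iid me es e4 em Psum mv vser N i n.
have iS : intg P (SN N i n) by apply: L2_intg; exact: (SN_L2 iid me es e4).
have iWs : intg P (fun w => \sum_(t < n) W (t%:Z + 1) (t%:Z + 1 + i%:Z) w) by apply: intg_sum => t; exact: W_intg'.
have iWc : intg P (fun w => \sum_(t < n) (W (t%:Z + 1) (t%:Z + 1 + i%:Z) w - g * RZ i%:Z)).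
  by apply: intg_sum => t; apply: intgB; [exact: W_intg'|exact: intg_cst].
have i1 : intg P (fun w => `|n%:R * Lam i n w - \sum_(t < n) W (t%:Z + 1) (t%:Z + 1 + i%:Z) w|).
  by apply: intg_norm; apply: intgB => //; apply: intgZ; exact: Lam_intg.
have i2 : intg P (fun w => `|\sum_(t < n) (W (t%:Z + 1) (t%:Z + 1 + i%:Z) w - g * RZ i%:Z) - SN N i n w|).
  by apply: intg_norm; exact: intgB.
apply: le_trans (lerD h1 h2); rewrite -EintD//; apply: Eint_le.
- by apply: intg_norm; apply: intgB => //; apply: intgZ; exact: Dev_intg.
- exact: intgD.
move=> w; apply: le_trans (ler_normD _ _); rewrite le_eqVlt; apply/orP; left; apply/eqP; congr (`|_|).
rewrite /Dev mulrA -expr2 sqr_sqrtr// sumrB sumr_const card_ord -[_ *+ n]mulr_natl; ring.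
Qed.

(** At truncation level 0 the approximation [SN] is an empty sum, so the approximation error bounds
    [Dev] itself. *)
Lemma Dev_bounded i : exists K : R, forall n, (0 < n)%N -> Eint P (fun w => `|Dev i n w|) <= K.
Proof.
exists ((i%:R + 6) * (l ^+ 2 * g) + 2 * l * tl 0 * Num.sqrt CY) => n n0.
have g0 := gam_ge0 iid me es e4 em.
have CY0 : 0 <= CY by exact: (CY_ge0 iid me es e4).
have s1 : 1 <= Num.sqrt n%:R :> R by rewrite -[leLHS]sqrtr1 ler_sqrt// ler1n.
have sp : 0 < Num.sqrt n%:R :> R by apply: lt_le_trans s1.
have := Dev_SN i 0 n0; have -> : (fun w => `|Num.sqrt n%:R * Dev i n w - SN 0 i n w|) = (fun w => Num.sqrt n%:R * `|Dev i n w|).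
  have S0 w : SN 0 i n w = 0 by exact: big_ord0.
  by apply/funext => w; rewrite S0 subr0 normrM ger0_norm// ltW.
rewrite EintZ; last exact: intg_norm (Dev_intg i n).
rewrite sqrtrM// => h; rewrite -(ler_pM2l sp); apply: le_trans h _.
rewrite [leRHS]mulrDr; apply: lerD; last by rewrite le_eqVlt; apply/orP; left; apply/eqP; ring.
apply: ler_peMl => //; apply: mulr_ge0; [by apply: addr_ge0|by rewrite mulr_ge0// sqr_ge0].
Qed.

Context (h : nat) (al : nat -> R).
Definition Xn (n : nat) (w : Om) : R := \sum_(i < h.+1) al i * Dev i n w.

Lemma Xn_intg n : intg P (Xn n).
Proof. by apply: intg_sum => i; apply: intgZ; exact: Dev_intg. Qed.

Lemma Xn_Ms N : exists D : R, forall n, (0 < n)%N ->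
  Eint P (fun w => `|Xn n w - (\sum_(s < n) Ms P eps mu e psi h al N s%:Z (smp w)) / Num.sqrt n%:R|) <=
  D / Num.sqrt n%:R + (\sum_(i < h.+1) `|al i|) * (2 * l * Num.sqrt CY) * tl N.
Proof.
have [D1 hD1] := SN_Ms iid me es e4 psi h al N.
exists (D1 + \sum_(i < h.+1) `|al i| * ((i%:R + 6) * (l ^+ 2 * g))) => n n0.
have sp : 0 < Num.sqrt n%:R :> R by rewrite sqrtr_gt0 ltr0n.
pose Mn w := \sum_(s < n) Ms P eps mu e psi h al N s%:Z (smp w).
have iM : intg P Mn by apply: intg_sum => s; apply: L2_intg; exact: (Ms_L2 iid me es e4).
have iS i : intg P (SN N i n) by apply: L2_intg; exact: (SN_L2 iid me es e4).
have CY0 : 0 <= CY by exact: (CY_ge0 iid me es e4).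
have -> : (fun w => `|Xn n w - Mn w / Num.sqrt n%:R|) = (fun w => (Num.sqrt n%:R)^-1 * `|Num.sqrt n%:R * Xn n w - Mn w|).
  apply/funext => w; rewrite -[X in X * `|_|]gtr0_norm ?invr_gt0// -normrM mulrBr mulKf ?gt_eqF//.
  by rewrite [_^-1 * _]mulrC.
rewrite EintZ; last by apply: intg_norm; apply: intgB => //; apply: intgZ; exact: Xn_intg.
rewrite mulrC ler_pdivrMr// mulrDl divfK ?gt_eqF//.
have iD i : intg P (fun w => `|Num.sqrt n%:R * Dev i n w - SN N i n w|).
  by apply: intg_norm; apply: intgB => //; apply: intgZ; exact: Dev_intg.
have i2 : intg P (fun w => `|\sum_(i < h.+1) al i * SN N i n w - Mn w|).
  by apply: intg_norm; apply: intgB => //; apply: intg_sum => i; exact: intgZ.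
have i1 : intg P (fun w => \sum_(i < h.+1) `|al i| * `|Num.sqrt n%:R * Dev i n w - SN N i n w|).
  by apply: intg_sum => i; exact: intgZ.
apply: (@le_trans _ _ (Eint P (fun w => \sum_(i < h.+1) `|al i| * `|Num.sqrt n%:R * Dev i n w - SN N i n w| + `|\sum_(i < h.+1) al i * SN N i n w - Mn w|))).
  apply: Eint_le; [by apply: intg_norm; apply: intgB => //; apply: intgZ; exact: Xn_intg|exact: intgD|move=> w].
  have -> : Num.sqrt n%:R * Xn n w - Mn w = \sum_(i < h.+1) al i * (Num.sqrt n%:R * Dev i n w - SN N i n w) + (\sum_(i < h.+1) al i * SN N i n w - Mn w).
    rewrite addrA -big_split/= /Xn mulr_sumr; congr (_ - _); apply: eq_bigr => i _; ring.
  apply: le_trans (ler_normD _ _) _; rewrite lerD2r; apply: le_trans (ler_norm_sum _ _ _) _.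
  by apply: ler_sum => i _; rewrite normrM.
rewrite EintD// Eint_sum; last by move=> i; exact: intgZ.
have hi : \sum_(i < h.+1) Eint P (fun w => `|al i| * `|Num.sqrt n%:R * Dev i n w - SN N i n w|) <=
   \sum_(i < h.+1) (`|al i| * ((i%:R + 6) * (l ^+ 2 * g)) + `|al i| * (2 * l * Num.sqrt CY) * tl N * Num.sqrt n%:R).
  apply: ler_sum => i _; rewrite EintZ//; apply: le_trans (ler_wpM2l _ (Dev_SN i N n0)) _ => //.
  by rewrite sqrtrM// le_eqVlt; apply/orP; left; apply/eqP; ring.
apply: le_trans (lerD hi (hD1 n)) _; rewrite big_split/= -!mulr_suml.
by rewrite le_eqVlt; apply/orP; left; apply/eqP; ring.
Qed.

Lemma cosE_lip (X Y : Om -> R) : intg P X -> intg P Y -> `|cosE P X - cosE P Y| <= Eint P (fun w => `|X w - Y w|).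
Proof.
move=> iX iY; have cX := intg_cos P (intgmf iX); have cY := intg_cos P (intgmf iY).
rewrite /cosE -EintB//; apply: le_trans (Eint_norm (intgB cX cY)) _.
by apply: Eint_le; [by apply: intg_norm; exact: intgB|by apply: intg_norm; exact: intgB|move=> w; exact: cos_lip].
Qed.

Lemma sinE_lip (X Y : Om -> R) : intg P X -> intg P Y -> `|sinE P X - sinE P Y| <= Eint P (fun w => `|X w - Y w|).
Proof.
move=> iX iY; have cX := intg_sin P (intgmf iX); have cY := intg_sin P (intgmf iY).
rewrite /sinE -EintB//; apply: le_trans (Eint_norm (intgB cX cY)) _.
by apply: Eint_le; [by apply: intg_norm; exact: intgB|by apply: intg_norm; exact: intgB|move=> w; exact: sin_lip].
Qed.

(** For each truncation level the block theorem gives a Gaussian limit with variance [sigT]; the L1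
    distance to the truncated sum is small for all large [n] once [N] is large, and [sigT] tends to
    [sigZ]. *)
Lemma Xn_clt : (fun n => cosE P (Xn n)) @ \oo --> expR (- (sigZ psi h al k1 k2 / 2)) /\
  (fun n => sinE P (Xn n)) @ \oo --> 0.
Proof.
pose Mn N n w := (\sum_(s < n) Ms P eps mu e psi h al N s%:Z (smp w)) / Num.sqrt n%:R.
have iMn N n : intg P (Mn N n).
  have iM : intg P (fun w => \sum_(s < n) Ms P eps mu e psi h al N s%:Z (smp w)).
    by apply: intg_sum => s; apply: L2_intg; exact: (Ms_L2 iid me es e4).
  by apply: intg_eq (intgZ (Num.sqrt n%:R)^-1 iM) => w; rewrite mulrC.
have near (e0 : R) : 0 < e0 -> \forall N \near \oo, \forall n \near \oo, Eint P (fun w => `|Xn n w - Mn N n w|) <= e0.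
  move=> e00; have e2 : 0 < e0 / 2 by rewrite divr_gt0.
  set E0 := (\sum_(i < h.+1) `|al i|) * (2 * l * Num.sqrt CY).
  have c1 : (fun N => E0 * tl N) @ \oo --> 0 by rewrite -(mulr0 E0); apply: cvgMr; exact: pst_cvg.
  have /cvgrPdist_le/(_ _ e2) := c1; apply: filterS => N; rewrite sub0r normrN => /(le_trans (ler_norm _)) hN.
  have [D hD] := Xn_Ms N.
  have e3 : 0 < e0 / (2 * (`|D| + 1)) by rewrite divr_gt0// mulr_gt0// ltr_wpDl.
  have [K _ hK] := near_invn 1 (exprn_gt0 2 e3).
  exists (maxn K 1) => // n /=; rewrite geq_max => /andP[Kn n0].
  apply: le_trans (hD n n0) _; rewrite [e0](_ : _ = e0 / 2 + e0 / 2); last by field.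
  apply: lerD => //; have := hK n Kn; rewrite div1r => h1.
  have h2 : (Num.sqrt n%:R)^-1 <= e0 / (2 * (`|D| + 1)).
    rewrite -ler_sqr ?nnegrE ?invr_ge0 ?sqrtr_ge0 ?(ltW e3)//.
    by rewrite exprVn sqr_sqrtr.
  apply: (@le_trans _ _ (`|D| * (e0 / (2 * (`|D| + 1))))).
    apply: (@le_trans _ _ (`|D| * (Num.sqrt n%:R)^-1)); last by rewrite ler_wpM2l.
    by rewrite ler_wpM2r ?invr_ge0 ?sqrtr_ge0// ler_norm.
  rewrite mulrA ler_pdivrMr ?mulr_gt0 ?ltr_wpDl//.
  have := normr_ge0 D; move: `|D| => x x0; nra.
have sgc := @sigT_cvg R psi Psum h al k1 k2.
split; apply: cvgn_approx => e0 e00.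
  have c2 : (fun N => expR (- (sigT psi h al k1 k2 N / 2))) @ \oo --> expR (- (sigZ psi h al k1 k2 / 2)).
    apply: continuous_cvg; first exact: continuous_expR.
    by apply: cvgN; apply: cvgMl.
  have [N [hN1 hN2]] : exists N, (`|expR (- (sigT psi h al k1 k2 N / 2)) - expR (- (sigZ psi h al k1 k2 / 2))| <= e0) /\
      \forall n \near \oo, Eint P (fun w => `|Xn n w - Mn N n w|) <= e0.
    have /cvgrPdist_le/(_ _ e00) := c2 => a1; have a2 := near e0 e00.
    by near (\oo : set_system nat) => N; exists N; split; [rewrite distrC; near: N|near: N].
  exists (fun n => cosE P (Mn N n)), (expR (- (sigT psi h al k1 k2 N / 2))); split; [|exact: hN1|].
    rewrite -cvg_shiftS; apply/cvgrPdist_le => e1 e10.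
    by apply: filterS (Ms_clt iid me es e4 em psi h al N e10) => n [+ _]; rewrite distrC.
  by apply: filterS hN2 => n hn; apply: le_trans (cosE_lip (Xn_intg n) (iMn N n)) hn.
have [N hN2] : exists N, \forall n \near \oo, Eint P (fun w => `|Xn n w - Mn N n w|) <= e0.
  have a2 := near e0 e00.
  by near (\oo : set_system nat) => N; exists N; near: N.
exists (fun n => sinE P (Mn N n)), 0; split.
- rewrite -cvg_shiftS; apply/cvgrPdist_le => e1 e10.
  by apply: filterS (Ms_clt iid me es e4 em psi h al N e10) => n [_]; rewrite sub0r normrN.
- by rewrite subrr normr0 ltW.
- by apply: filterS hN2 => n hn; apply: le_trans (sinE_lip (Xn_intg n) (iMn N n)) hn.
Unshelve. all: by end_near. Qed.

End AutocovCLT.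

(** * From autocovariances to autocorrelations *)

Section LinearProcessMoments.
Context {R : realType} {d : measure_display} {Om : measurableType d} (P : probability Om R)
  (eps : int -> Om -> R -> R) (iid : iid_proc P eps).
Local Notation RR := (measurableTypeR R).
Local Notation path := (int -> R -> R).
Local Notation smp := (sample eps).
Context (mu : probability RR R) (e : path -> int -> R -> R).
Context (me : forall (S : set int) t, S t -> measurable_fun setT (fun z : XS S * RR => e z.1 t z.2)).
Context (es : forall k x t u, e (shiftp k x) t u = e x (t + k) u).
Local Notation Pm := (P \x mu)%E.
Local Notation ep := (ep eps e).
Context (e4 : L2 Pm (fun z => ep 0 z ^+ 2)).
Context (em : {ae mu, forall u, Eint P (fun w => e (smp w) 0 u) = 0}).
Context (psi : nat -> R) (Psum : exists M : R, forall N, \sum_(n < N) `|psi n| <= M).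
Context (v : path -> int -> R -> R)
  (mv : forall t, measurable_fun setT (fun z : XS setT * RR => v z.1 t z.2)).
Context (vser : forall t, {ae mu, forall u, {ae P, forall w,
   (fun N : nat => \sum_(i < N) psi i * e (smp w) (t - i%:Z) u) @ \oo --> v (smp w) t u}}).
Local Notation g := (gam P eps mu e).
Local Notation l := (psl psi).
Local Notation tl := (pst psi).
Local Notation W := (W eps mu v).
Local Notation vv := (vv eps v).
Local Notation CY := (CY P eps mu e).
Local Notation RZ := (RZ psi).
Local Notation SN := (SN P eps mu e psi).

Lemma EW (i : nat) : Eint P (W 0 i%:Z) = g * RZ i%:Z.
Proof.
have iW : intg P (W 0 i%:Z) by exact: (W_intg iid me es e4 em Psum mv vser).
have aN N : Eint P (WN eps mu e psi N 0 i%:Z) = g * RT psi N i%:Z.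
  have iZ k j : intg P (fun w => psi k * psi j * Zp mu e (0 - k%:Z) (i%:Z - j%:Z) (smp w)).
    by apply: intgZ; apply: L2_intg; exact: Zp_L2.
  rewrite Eint_sum; last by move=> k; apply: intg_sum => j; exact: iZ.
  rewrite mulr_sumr; apply: eq_bigr => k _; rewrite Eint_sum; last by move=> j; exact: iZ.
  rewrite mulr_sumr; apply: eq_bigr => j _; rewrite EintZ; last by apply: L2_intg; exact: Zp_L2.
  rewrite (_ : (j%:Z - k%:Z == i%:Z) = (0 - k%:Z == i%:Z - j%:Z)); last by apply/eqP/eqP; lia.
  have [->|ne] := eqVneq (0 - k%:Z) (i%:Z - j%:Z); first by rewrite EZp_diag//; rewrite mulr1 mulrC.
  by rewrite EZp_off// !mulr0.
have c1 : (fun N => Eint P (WN eps mu e psi N 0 i%:Z)) @ \oo --> g * RZ i%:Z.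
  by under eq_fun do rewrite aN; apply: cvgMr; exact: RT_cvg.
have c2 : (fun N => Eint P (WN eps mu e psi N 0 i%:Z)) @ \oo --> Eint P (W 0 i%:Z).
  apply/cvgrPdist_le => e0 e00.
  have c3 : (fun N => 2 * l * tl N * g) @ \oo --> 0.
    by rewrite -(mul0r g) -(mulr0 (2 * l)); apply: cvgMl; apply: cvgMr; exact: pst_cvg.
  have /cvgrPdist_le/(_ _ e00) := c3; apply: filterS => N; rewrite sub0r normrN => /(le_trans (ler_norm _)) hN.
  have iN : intg P (WN eps mu e psi N 0 i%:Z) by apply: L2_intg; exact: WN_L2.
  rewrite -EintB//; apply: le_trans (Eint_norm (intgB iW iN)) _; apply: le_trans hN.
  exact: (W_approx iid me es e4 em Psum mv vser).
have E1 := cvg_lim (@Rhausdorff R) c1; have E2 := cvg_lim (@Rhausdorff R) c2.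
by rewrite -E2 -[RHS]E1.
Qed.

(** The series is not integrated term by term at a fixed [u]. Instead the truncations have mean zero
    for almost every [u], so the L2 norm in [u] of the mean is bounded by the truncation error for
    every [N], hence is 0. *)
Lemma vv_section_mean t : {ae mu, forall u, Eint P (fun w => v (smp w) t u) = 0}.
Proof.
pose f u := Eint P (fun w => v (smp w) t u).
have hN N : intg mu (fun u => f u ^+ 2) /\ nrm2 mu f <= tl N ^+ 2 * g.
  have [_ [LD nD]] := vv_approx iid me es e4 em Psum mv vser N t.
  have LS : L2 (mu \x P)%E ((fun z => vv t z - vN eps e psi N t z) \o (fun z : RR * Om => (z.2, z.1))).
    have [mD iD] := LD; split; last exact: (intg_swap iD).
    by apply: (measurableT_comp mD); apply/measurable_fun_pairP; split; [exact: measurable_snd|exact: measurable_fst].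
  have [Lf nf] := L2_Eint LS.
  have E : nrm2 (mu \x P)%E ((fun z => vv t z - vN eps e psi N t z) \o (fun z : RR * Om => (z.2, z.1))) =
      nrm2 Pm (fun z => vv t z - vN eps e psi N t z).
    by rewrite /nrm2 -(Eint_fubini1 (intg_swap LD.2)).2 /= (Eint_fubini2 LD.2).2.
  have aef : {ae mu, forall u, Eint P (fun w => vv t (w, u) - vN eps e psi N t (w, u)) = f u}.
    have he : {ae mu, forall u, forall r : int, L2 P (fun w => e (smp w) r u) /\ Eint P (fun w => e (smp w) r u) = 0}.
      apply: ae_countable => r; apply: aeS2 (ew_L2 iid me es e4 r) (ep_mean iid me es em r) => u h1 h2; by split.
    apply: aeS2 he (L2_section2 (vv_L2 iid me es e4 em Psum mv vser t)) => u hu lv.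
    have iN : intg P (fun w => vN eps e psi N t (w, u)).
      by apply: intg_sum => i; apply: intgZ; apply: L2_intg; exact: (hu _).1.
    rewrite EintB//; last exact: L2_intg.
    rewrite [X in _ - X](_ : _ = 0) ?subr0// Eint_sum; last by move=> i; apply: intgZ; apply: L2_intg; exact: (hu _).1.
    by rewrite big1// => i _; rewrite EintZ ?(hu _).2 ?mulr0//; apply: L2_intg; exact: (hu _).1.
  have i2 : intg mu (fun u => f u ^+ 2).
    apply: (intg_le_ae _ _ Lf.2).
      apply: measurable_funX.
      have mvv := measurable_vv iid mv t.
      apply: (measurable_Eint_section P (F := fun z : RR * Om => vv t (z.2, z.1))).
      by apply: (measurableT_comp mvv); apply/measurable_fun_pairP; split; [exact: measurable_snd|exact: measurable_fst].
    by apply: aeS aef => u hu; rewrite ger0_norm ?sqr_ge0//= hu.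
  split=> //; apply: le_trans nD; rewrite -E; apply: le_trans nf.
  rewrite /nrm2 le_eqVlt; apply/orP; left; apply/eqP; apply: eq_Eint_ae; apply: aeS aef => u hu.
  by rewrite /= hu.
have n0 : nrm2 mu f <= 0.
  have cv : (fun N => tl N ^+ 2 * g) @ \oo --> 0 ^+ 2 * g.
    by apply: cvgMl; under eq_fun do rewrite expr2; rewrite expr2; apply: cvgM; exact: pst_cvg.
  rewrite expr0n mul0r in cv; apply: (ler_cvg_to (cvg_cst _) cv); apply: nearW => N; exact: (hN N).2.
have [i2 _] := hN 0%N.
have z : (\int[mu]_(x in setT) `|(f x ^+ 2)%:E| = 0)%E.
  transitivity (\int[mu]_x (f x ^+ 2)%:E)%E; first by apply: eq_integral => x _; rewrite gee0_abs// lee_fin sqr_ge0.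
  by rewrite (intg_fin i2); congr EFin; apply/eqP; rewrite eq_le n0 nrm2_ge0.
have := (ae_eq_integral_abs mu measurableT (measurable_int _ i2)).1 z.
apply: aeS => u /(_ I) /= [] /eqP; by rewrite sqrf_eq0 => /eqP.
Qed.

Lemma Lam_degenerate i n : g = 0 -> (0 < n)%N -> {ae P, forall w, Lam eps mu v i n w = 0}.
Proof.
move=> g0 n0; have iL := Lam_intg iid me es e4 em Psum mv vser i n.
have W0 s t : Eint P (fun w => `|W s t w|) <= 0.
  apply: le_trans (L1_section (vv_prod_intg iid me es e4 em Psum mv vser s t)) _.
  by apply: le_trans (vv_mul_le iid me es e4 em Psum mv vser s t) _; rewrite g0 mulr0.
have iW s t : intg P (W s t) by exact: (W_intg iid me es e4 em Psum mv vser).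
have iS : intg P (fun w => \sum_(t < n) W (t%:Z + 1) (t%:Z + 1 + i%:Z) w) by apply: intg_sum => t; exact: iW.
have np : 0 < (n%:R : R) by rewrite ltr0n.
have iA : intg P (fun w => `|n%:R * Lam eps mu v i n w - \sum_(t < n) W (t%:Z + 1) (t%:Z + 1 + i%:Z) w|).
  by apply: intg_norm; apply: intgB => //; exact: intgZ.
have iB : intg P (fun w => \sum_(t < n) `|W (t%:Z + 1) (t%:Z + 1 + i%:Z) w|) by apply: intg_sum => t; exact: intg_norm.
have L0 : Eint P (fun w => `|Lam eps mu v i n w|) <= 0.
  rewrite -(ler_pM2l np) mulr0 -EintZ; last exact: intg_norm.
  apply: (@le_trans _ _ (Eint P (fun w => `|n%:R * Lam eps mu v i n w - \sum_(t < n) W (t%:Z + 1) (t%:Z + 1 + i%:Z) w| + \sum_(t < n) `|W (t%:Z + 1) (t%:Z + 1 + i%:Z) w|))).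
    apply: Eint_le; [by apply: intgZ; exact: intg_norm|exact: intgD|move=> w].
    rewrite -[X in X * _]gtr0_norm// -normrM.
    rewrite -[X in `|X|](subrK (\sum_(t < n) W (t%:Z + 1) (t%:Z + 1 + i%:Z) w)).
    by apply: le_trans (ler_normD _ _) _; rewrite lerD2l; exact: ler_norm_sum.
  rewrite EintD// Eint_sum; last by move=> t; exact: intg_norm.
  rewrite -[leRHS]addr0; apply: lerD.
    by apply: le_trans (Lam_err iid me es e4 em Psum mv vser i n0) _; rewrite g0 !mulr0.
  by apply: sumr_le0 => t _; exact: W0.
have z : (\int[P]_(x in setT) `|(Lam eps mu v i n x)%:E| = 0)%E.
  have := intg_fin (intg_norm iL) => /= E; rewrite -[LHS]/(\int[P]_x (`|Lam eps mu v i n x|)%:E)%E E; congr EFin.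
  by apply/eqP; rewrite eq_le L0 Eint_ge0.
have := (ae_eq_integral_abs P measurableT (measurable_int _ iL)).1 z.
by apply: aeS => w /(_ I) /= [].
Qed.

End LinearProcessMoments.

Lemma measurable_invr (R : realType) : measurable_fun setT (fun x : R => x^-1).
Proof.
have -> : [set: R] = [set 0] `|` ~` [set 0] by rewrite setUv.
apply/measurable_funU => //; first exact: measurableC.
split; first exact: measurable_fun_set1.
apply: open_continuous_measurable_fun; first by apply: closed_openC; exact: closed_eq.
by move=> x; rewrite inE/= => /eqP x0; exact: inv_continuous.
Qed.

(** * Ratios with a converging denominator *)

Section Slutsky.
Context {R : realType} {d : measure_display} {Om : measurableType d} (P : probability Om R).
Context (S T L : nat -> Om -> R) (c KT KL : R).
Context (mS : forall n, measurable_fun setT (S n)) (iT : forall n, intg P (T n)) (iL : forall n, intg P (L n)).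
(** [S] is [T] times [c / L] away from zeros of [L]. Integrability is assumed of [T] and [L] only,
    as the ratio may have no moments. *)
Context (c0 : 0 < c) (ST : forall n w, L n w != 0 -> S n w * L n w = T n w * c).
Context (bT : forall n, (0 < n)%N -> Eint P (fun w => `|T n w|) <= KT).
Context (bL : forall n, (0 < n)%N -> Eint P (fun w => `|L n w - c|) <= KL / Num.sqrt n%:R).

Lemma slutsky_dist n w (de : R) : 0 < de -> de <= 1 / 2 -> `|L n w - c| <= de * c ->
  `|S n w - T n w| <= 2 * de * `|T n w|.
Proof.
move=> d0 d1 h; have h1 : c / 2 <= L n w.
  move: h; rewrite ler_norml => /andP[h _].
  have : de * c <= 1 / 2 * c by rewrite ler_wpM2r// ltW.
  lra.
have L0 : 0 < L n w by apply: lt_le_trans h1; rewrite divr_gt0.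
have -> : S n w = T n w * c / L n w by rewrite -ST ?gt_eqF// mulfK ?gt_eqF.
have -> : T n w * c / L n w - T n w = - ((L n w - c) / L n w * T n w) by field; rewrite gt_eqF.
rewrite normrN normrM ler_wpM2r// normrM normfV [X in _ / X]gtr0_norm// ler_pdivrMr//.
apply: le_trans h _; nra.
Qed.

(** Where [L] is within [de c] of [c], the Lipschitz bound and [slutsky_dist] apply; elsewhere the
    trivial bound 2 is at most [2 |L - c| / (de c)], as in Markov's inequality. *)
Lemma slutsky_fun (F : R -> R) n (de : R) : (forall x, `|F x| <= 1) -> (forall x y, `|F x - F y| <= `|x - y|) ->
  (forall X : Om -> R, measurable_fun setT X -> measurable_fun setT (fun w => F (X w))) ->
  0 < de -> de <= 1 / 2 -> (0 < n)%N ->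
  `|Eint P (fun w => F (S n w)) - Eint P (fun w => F (T n w))| <= 2 * de * KT + 2 / (de * c) * (KL / Num.sqrt n%:R).
Proof.
move=> F1 Fl mF d0 d1 n0.
have i1 : intg P (fun w => F (S n w)) by apply: intg_bounded (mF _ (mS n)) (fun w => F1 (S n w)).
have i2 : intg P (fun w => F (T n w)) by apply: intg_bounded (mF _ (intgmf (iT n))) (fun w => F1 (T n w)).
have i3 := intg_norm (iT n).
have i4 : intg P (fun w => `|L n w - c|) by apply: intg_norm; apply: intgB => //; exact: intg_cst.
have dc : 0 < de * c by rewrite mulr_gt0.
rewrite -EintB//; apply: le_trans (Eint_norm (intgB i1 i2)) _.
apply: (@le_trans _ _ (Eint P (fun w => 2 * de * `|T n w| + 2 / (de * c) * `|L n w - c|))).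
  apply: Eint_le; [by apply: intg_norm; exact: intgB|by apply: intgD; exact: intgZ|move=> w].
  have [h|h] := leP `|L n w - c| (de * c).
    apply: le_trans (Fl _ _) _; apply: le_trans (slutsky_dist d0 d1 h) _.
    by rewrite lerDl mulr_ge0// divr_ge0// ltW.
  apply: (@le_trans _ _ 2).
    by apply: le_trans (ler_normB _ _) _; rewrite [2](_ : _ = 1 + 1)//; exact: lerD.
  apply: ler_wpDl; first by rewrite !mulr_ge0// ltW.
  by rewrite mulrAC ler_pdivlMr// ler_wpM2l// ltW.
rewrite EintD ?EintZ//; [|exact: intgZ..].
apply: lerD; first by rewrite ler_wpM2l ?bT// mulr_ge0// ltW.
by rewrite ler_wpM2l ?bL// divr_ge0// ltW.
Qed.

Lemma near_inv_sqrt (k e : R) : 0 < e -> \forall n \near \oo, (0 < n)%N /\ k / Num.sqrt n%:R <= e.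
Proof.
move=> e0; have e3 : 0 < e / (`|k| + 1) by rewrite divr_gt0// ltr_wpDl.
have [K _ hK] := near_invn 1 (exprn_gt0 2 e3).
exists (maxn K 1) => // n /=; rewrite geq_max => /andP[Kn n0]; split=> //.
have := hK n Kn; rewrite div1r => h1.
have h2 : (Num.sqrt n%:R)^-1 <= e / (`|k| + 1).
  rewrite -ler_sqr ?nnegrE ?invr_ge0 ?sqrtr_ge0 ?(ltW e3)//.
  by rewrite exprVn sqr_sqrtr.
apply: (@le_trans _ _ (`|k| * (e / (`|k| + 1)))).
  apply: (@le_trans _ _ (`|k| * (Num.sqrt n%:R)^-1)); last by rewrite ler_wpM2l.
  by rewrite ler_wpM2r ?invr_ge0 ?sqrtr_ge0// ler_norm.
rewrite mulrA ler_pdivrMr ?ltr_wpDl//.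
have := normr_ge0 k; move: `|k| => x x0; nra.
Qed.

Lemma slutsky (F : R -> R) (l : R) : (forall x, `|F x| <= 1) -> (forall x y, `|F x - F y| <= `|x - y|) ->
  (forall X : Om -> R, measurable_fun setT X -> measurable_fun setT (fun w => F (X w))) ->
  (fun n => Eint P (fun w => F (T n w))) @ \oo --> l -> (fun n => Eint P (fun w => F (S n w))) @ \oo --> l.
Proof.
move=> F1 Fl mF hl; apply: cvgn_approx => e e0.
exists (fun n => Eint P (fun w => F (T n w))), l; split=> //; first by rewrite subrr normr0 ltW.
have KT0 : 0 <= KT by apply: le_trans (bT (isT : (0 < 1)%N)); apply: Eint_ge0.
(* The cap [1 / 2] keeps [L] away from 0; the second bound spends half of [e] on the term with
   [KT]. *)
pose de := Num.min (1 / 2) (e / (4 * (KT + 1))).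
have d0 : 0 < de by rewrite lt_min divr_gt0// divr_gt0// mulr_gt0// ltr_wpDl.
have d1 : de <= 1 / 2 by rewrite ge_min lexx.
have d2 : 2 * de * KT <= e / 2.
  apply: (@le_trans _ _ (2 * (e / (4 * (KT + 1))) * KT)).
    by rewrite ler_wpM2r// ler_wpM2l// ge_min lexx orbT.
  rewrite (_ : _ * KT = e / 2 * KT / (KT + 1)); last by field; rewrite gt_eqF// ltr_wpDl.
  rewrite ler_pdivrMr ?ltr_wpDl// ler_wpM2l ?divr_ge0 ?(ltW e0)//; lra.
have e2 : 0 < e / 2 by rewrite divr_gt0.
apply: filterS (near_inv_sqrt (2 / (de * c) * KL) e2) => n [n0 hn].
apply: le_trans (slutsky_fun F1 Fl mF d0 d1 n0) _.
by rewrite [leRHS](_ : _ = e / 2 + e / 2); [apply: lerD => //; rewrite mulrA|field].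
Qed.

(** Tails of the ratio are controlled through [T] and [L]: when [L >= c / 2] a large [S] forces
    [|T|] above [K / 2], and both events are bounded by first moments. *)
Lemma slutsky_tight (e : R) : 0 < e -> exists K, \forall n \near \oo, tailE P (S n) K <= e.
Proof.
move=> e0; have KT0 : 0 <= KT by apply: le_trans (bT (isT : (0 < 1)%N)); apply: Eint_ge0.
have k0 : 0 < 4 * (KT + 1) / e by rewrite divr_gt0// mulr_gt0// ltr_wpDl.
have e2 : 0 < e / 2 by rewrite divr_gt0.
have h12 : 0 < 1 / 2 :> R by rewrite divr_gt0.
exists (4 * (KT + 1) / e); set K := _ / e.
apply: filterS (near_inv_sqrt (2 / c * KL) e2) => n [n0 hn].
have i3 := intg_norm (iT n).
have i4 : intg P (fun w => `|L n w - c|) by apply: intg_norm; apply: intgB => //; exact: intg_cst.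
apply: (@le_trans _ _ (Eint P (fun w => 2 / K * `|T n w| + 2 / c * `|L n w - c|))).
  apply: Eint_le; [exact: intg_tail|by apply: intgD; exact: intgZ|move=> w].
  have p1 : 0 <= 2 / K * `|T n w| by rewrite mulr_ge0// divr_ge0// ltW.
  have p2 : 0 <= 2 / c * `|L n w - c| by rewrite mulr_ge0// divr_ge0// ltW.
  rewrite indicE; have [|_] := boolP (w \in _); last by rewrite addr_ge0.
  rewrite inE/= => hS; have [h|h] := leP `|L n w - c| (1 / 2 * c).
    have h2 := slutsky_dist h12 (lexx _) h; apply: ler_wpDr => //.
    have h3 : `|S n w| <= 2 * `|T n w|.
      have := ler_normD (S n w - T n w) (T n w); rewrite subrK; lra.
    by rewrite mulrAC ler_pdivlMr// mul1r; apply: le_trans (ltW hS) h3.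
  apply: ler_wpDl => //; rewrite mulrAC ler_pdivlMr//; lra.
rewrite EintD ?EintZ//; [|exact: intgZ..].
rewrite [e](_ : _ = e / 2 + e / 2); last by field.
apply: lerD.
  apply: (@le_trans _ _ (2 / K * KT)); first by rewrite ler_wpM2l ?bT// divr_ge0// ltW.
  rewrite /K (_ : _ * KT = e / 2 * KT / (KT + 1)); last by field; rewrite !gt_eqF// ltr_wpDl.
  rewrite ler_pdivrMr ?ltr_wpDl// ler_wpM2l ?divr_ge0 ?(ltW e0)//; lra.
by apply: le_trans hn; rewrite -[leRHS]mulrA ler_wpM2l ?bL// divr_ge0// ltW.
Qed.

End Slutsky.

(** * Convergence to a possibly degenerate Gaussian vector *)

Section GaussianLimit.
Context {R : realType} {d : measure_display} {Om : measurableType d} (P : probability Om R) (h : nat).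
Local Notation vec := 'cV[R]_h.

Lemma conv_dist_gauss_cf (X X' : nat -> Om -> vec) (S : 'M[R]_h) :
  S^T = S -> (forall a : vec, 0 <= (a^T *m S *m a) 0 0) -> (forall n, mvec (X' n)) ->
  (forall a : vec, (fun n => cosE P (fun w => (a^T *m X' n w) 0 0)) @ \oo --> expR (- ((a^T *m S *m a) 0 0 / 2)) /\
     (fun n => sinE P (fun w => (a^T *m X' n w) 0 0)) @ \oo --> 0) ->
  (forall i e, 0 < e -> exists K, \forall n \near \oo, tailE P (fun w => X' n w i 0) K <= e) ->
  (forall n, {ae P, forall w, X n w = X' n w}) -> conv_dist_gauss P X S.
Proof.
move=> sS pS mX cX tX XX; have [d' [Om' [P' [Y [mY cY]]]]] := gauss_vec_exists sS pS.
exists d', Om', P', Y; split; first by split=> // a; exact: cY.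
move=> g gc [M gM].
have hX : (fun n => Eint P (fun w => g (X' n w))) @ \oo --> Eint P' (fun w => g (Y w)).
  by apply: (cf_cvg_dist mX mY _ _ tX gc gM) => a; [rewrite (cY a).1|rewrite (cY a).2]; have [] := cX a.
rewrite (_ : (fun n => Ex P (fun w => g (X n w))) = (fun n => Eint P (fun w => g (X' n w))))//.
apply/funext => n; apply: (@eq_Eint_ae _ _ _ P (fun w => g (X n w)) (fun w => g (X' n w))).
by apply: aeS (XX n) => w ->.
Qed.

Lemma degenerate_clt (X : nat -> Om -> vec) (Dz : 'M[R]_(h, h.+1)) Vm : Dz = 0 -> (forall n, {ae P, forall w, X n w = 0}) ->
  conv_dist_gauss P X (Dz *m Vm *m Dz^T).
Proof.
move=> -> XX; rewrite !mul0mx.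
have E0 (a : vec) : (a^T *m (0 : 'M[R]_h) *m a) 0 0 = 0 by rewrite mulmx0 mul0mx mxE.
have E1 (a : vec) : (fun w : Om => (a^T *m (0 : vec)) 0 0) = (fun=> 0) by apply/funext => w; rewrite mulmx0 mxE.
apply: (conv_dist_gauss_cf (X' := fun _ _ => 0)) => //.
- by rewrite trmx0.
- by move=> a; rewrite E0.
- by move=> n i; exact: measurable_cst.
- move=> a; rewrite E0 E1 mul0r oppr0 expR0 /cosE /sinE sin0 cos0 !Eint_cst; split; exact: cvg_cst.
move=> i e0 e00; exists 1; apply: nearW => n.
rewrite /tailE (_ : \1__ = (fun=> 0)) ?Eint_cst ?(ltW e00)//.
apply/funext => w; rewrite indicE; case: (boolP (w \in _)) => //.
by rewrite inE/= mxE normr0 ltr10.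
Qed.

End GaussianLimit.

(** * The delta method for autocorrelations *)

Section LinearProcessRatio.
Context {R : realType} {d : measure_display} {Om : measurableType d} (P : probability Om R)
  (eps : int -> Om -> R -> R) (iid : iid_proc P eps).
Local Notation RR := (measurableTypeR R).
Local Notation path := (int -> R -> R).
Local Notation smp := (sample eps).
Context (mu : probability RR R) (e : path -> int -> R -> R).
Context (me : forall (S : set int) t, S t -> measurable_fun setT (fun z : XS S * RR => e z.1 t z.2)).
Context (es : forall k x t u, e (shiftp k x) t u = e x (t + k) u).
Local Notation Pm := (P \x mu)%E.
Local Notation ep := (ep eps e).
Context (e4 : L2 Pm (fun z => ep 0 z ^+ 2)).
Context (em : {ae mu, forall u, Eint P (fun w => e (smp w) 0 u) = 0}).
Context (psi : nat -> R) (Psum : exists M : R, forall N, \sum_(n < N) `|psi n| <= M).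
Context (v : path -> int -> R -> R)
  (mv : forall t, measurable_fun setT (fun z : XS setT * RR => v z.1 t z.2)).
Context (vser : forall t, {ae mu, forall u, {ae P, forall w,
   (fun N : nat => \sum_(i < N) psi i * e (smp w) (t - i%:Z) u) @ \oo --> v (smp w) t u}}).
Local Notation g := (gam P eps mu e).
Local Notation k1 := (kap1 P eps mu e).
Local Notation k2 := (kap2 P eps mu e).
Local Notation RZ := (RZ psi).
Local Notation Lam := (Lam eps mu v).
Context (h : nat).
Local Notation vec := 'cV[R]_h.
Local Notation Vm := (Vmat psi h k1 k2).

(** A limit of variances of truncated sums. Through [quad_Vmat] this is the positivity required for
    a Gaussian vector with the limiting covariance to exist. *)
Lemma sigZ_ge0 al : 0 <= sigZ psi h al k1 k2.
Proof.
apply: (ler_cvg_to (cvg_cst 0) (@sigT_cvg R psi Psum h al k1 k2)); apply: nearW => N.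
by rewrite -(Ms_var iid me es e4 em psi h al N 0); exact: nrm2_ge0.
Qed.

Lemma Vmat_sym : Vm^T = Vm.
Proof.
apply/matrixP => i j; rewrite [LHS]mxE !Vmat_entry//; congr (_ + _).
  by rewrite [X in _ * X]mulrC.
congr (_ * _); congr (_ + _).
  by congr zsum; apply/funext => x; rewrite mulrC.
have l1 : zl1 (fun x => RZ (j%:Z - x) * RZ (i%:Z + x)).
  apply: zl1M; first by have [] := zl1_reflshift j%:Z (zl1_RZ Psum).
  have [r1 _] := zsum_shift i%:Z (zl1_RZ Psum).
  by apply: (zl1_le _ r1) => x; rewrite addrC.
have [_ <-] := zsum_refl l1.
by congr zsum; apply/funext => x; rewrite mulrC opprK.
Qed.

Lemma quad_Vmat (Dm : 'M[R]_(h, h.+1)) (a : vec) :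
  (a^T *m (Dm *m Vm *m Dm^T) *m a) 0 0 = sigZ psi h (fun j => (a^T *m Dm) 0 (inord j)) k1 k2.
Proof.
rewrite sigZ_Vmat//.
have -> : a^T *m (Dm *m Vm *m Dm^T) *m a = (a^T *m Dm) *m Vm *m (a^T *m Dm)^T.
  by rewrite trmx_mul trmxK !mulmxA.
move: (a^T *m Dm) => b; rewrite mxE exchange_big/=; apply: eq_bigr => j _.
rewrite mxE mulr_suml; apply: eq_bigr => i _; rewrite !inord_val mulrAC; congr (_ * _ * _); exact: mxE.
Qed.

Local Notation c i := (g * RZ i%:Z).
Definition Xvec (n : nat) (w : Om) : vec :=
  \col_(i < h) (Num.sqrt n%:R * (Lam i.+1 n w / Lam 0 n w - c i.+1 / c 0%N)).
Local Notation Dm := (Dmat h (fun i => c i / c 0%N) (c 0%N)).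

Lemma measurable_Xvec n : mvec (Xvec n).
Proof.
move=> i; have mL j : measurable_fun setT (Lam j n) := intgmf (Lam_intg iid me es e4 em Psum mv vser j n).
rewrite (_ : (fun w => _) = (fun w => Num.sqrt n%:R * (Lam i.+1 n w / Lam 0 n w - c i.+1 / c 0%N))); last first.
  by apply/funext => w; rewrite mxE.
apply: measurable_funM => //; apply: measurable_funB => //; apply: measurable_funM => //.
exact: measurableT_comp (@measurable_invr R) (mL _).
Qed.

(** Row [i] of the matrix is the gradient of the ratio [x_(i+1) / x_0] at the limiting
    autocovariances. *)
Lemma Dmat_comb (x : nat -> R) (i : 'I_h) : \sum_(j < h.+1) Dm i j * x j = (x i.+1 - c i.+1 / c 0%N * x 0%N) / c 0%N.
Proof.
rewrite big_ord_recl !mxE/= (bigD1 i)//= !mxE/= /bump/= add1n eqxx big1 => [|j ji].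
  by rewrite mul1r addr0; ring.
by rewrite !mxE/= /bump/= add1n eqSS val_eqE (negPf ji) !mul0r.
Qed.

(** For a ratio the linearisation is exact once the left side is multiplied by the random
    denominator and the right side by its limit, so no Taylor remainder appears. *)
Lemma Xvec_linear (a : vec) n w : 0 < c 0%N -> Lam 0 n w != 0 ->
  (a^T *m Xvec n w) 0 0 * Lam 0 n w =
  Xn P eps mu e psi v h (fun j => (a^T *m Dm) 0 (inord j)) n w * c 0%N.
Proof.
move=> c0 L0; have c0' : c 0%N != 0 by rewrite gt_eqF.
rewrite mxE /Xn.
have -> : \sum_(j < h.+1) (a^T *m Dm) 0 (inord j) * Dev P eps mu e psi v j n w =
   \sum_(i < h) a i 0 * \sum_(j < h.+1) Dm i j * Dev P eps mu e psi v j n w.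
  under eq_bigr => j _ do rewrite inord_val mxE mulr_suml.
  rewrite exchange_big; apply: eq_bigr => i _; rewrite mulr_sumr; apply: eq_bigr => j _.
  by rewrite mxE mulrA.
rewrite !mulr_suml; apply: eq_bigr => i _.
rewrite (Dmat_comb (fun j => Dev P eps mu e psi v j n w)) !mxE /Dev.
move: c0' L0; move: (c 0%N) (c i.+1) (Lam 0 n w) (Lam i.+1 n w) => a0 a1 b0 b1 c0' L0.
by field; rewrite L0 c0'.
Qed.

Lemma Xn_bounded al : exists K : R, forall n, (0 < n)%N -> Eint P (fun w => `|Xn P eps mu e psi v h al n w|) <= K.
Proof.
have /choice[K hK] := Dev_bounded iid me es e4 em Psum mv vser.
have iD i n := Dev_intg iid me es e4 em Psum mv vser i n.
exists (\sum_(i < h.+1) `|al i| * K i) => n np.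
apply: (@le_trans _ _ (Eint P (fun w => \sum_(i < h.+1) `|al i| * `|Dev P eps mu e psi v i n w|))).
  apply: Eint_le.
  - apply: intg_norm; exact: (Xn_intg iid me es e4 em Psum mv vser).
  - by apply: intg_sum => i; apply: intgZ; exact: intg_norm.
  move=> w; apply: le_trans (ler_norm_sum _ _ _) _.
  by apply: ler_sum => i _; rewrite normrM.
rewrite Eint_sum; last by move=> i; apply: intgZ; exact: intg_norm.
by apply: ler_sum => i _; rewrite EintZ ?ler_wpM2l ?hK//; exact: intg_norm.
Qed.

Lemma Lam0_bounded : exists K : R, forall n, (0 < n)%N -> Eint P (fun w => `|Lam 0 n w - c 0%N|) <= K / Num.sqrt n%:R.
Proof.
have [K hK] := Dev_bounded iid me es e4 em Psum mv vser 0.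
have iD n := Lam_intg iid me es e4 em Psum mv vser 0 n.
exists K => n np; have sp : 0 < Num.sqrt n%:R :> R by rewrite sqrtr_gt0 ltr0n.
rewrite ler_pdivlMr// mulrC -EintZ; last by apply: intg_norm; apply: intgB => //; exact: intg_cst.
apply: le_trans (hK n np); rewrite le_eqVlt; apply/orP; left; apply/eqP; congr Eint; apply/funext => w.
by rewrite /Dev normrM gtr0_norm.
Qed.

Lemma ratio_clt (X : nat -> Om -> vec) : 0 < c 0%N -> (forall n, {ae P, forall w, X n w = Xvec n w}) ->
  conv_dist_gauss P X (Dm *m Vm *m Dm^T).
Proof.
move=> c0 XX; pose al (a : vec) j := (a^T *m Dm) 0 (inord j).
have [KL hKL] := Lam0_bounded.
have iL n := Lam_intg iid me es e4 em Psum mv vser 0 n.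
have iT a n : intg P (Xn P eps mu e psi v h (al a) n) by exact: (Xn_intg iid me es e4 em Psum mv vser).
have mS (a : vec) n : measurable_fun setT (fun w => (a^T *m Xvec n w) 0 0).
  rewrite (_ : (fun w => _) = (fun w => \sum_i a i 0 * Xvec n w i 0)).
    by apply: measurable_sum => i; apply: measurable_funM => //; exact: measurable_Xvec.
  by apply/funext => w; rewrite mxE; apply: eq_bigr => i _; rewrite mxE.
have ST a n w : Lam 0 n w != 0 -> (a^T *m Xvec n w) 0 0 * Lam 0 n w = Xn P eps mu e psi v h (al a) n w * c 0%N.
  exact: Xvec_linear.
apply: (conv_dist_gauss_cf (X' := Xvec)) => //.
- by rewrite !trmx_mul trmxK Vmat_sym mulmxA.
- by move=> a; rewrite quad_Vmat; exact: sigZ_ge0.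
- exact: measurable_Xvec.
- move=> a; rewrite quad_Vmat; have [K hK] := Xn_bounded (al a).
  have [c1 c2] := Xn_clt iid me es e4 em Psum mv vser h (al a).
  split.
    apply: (slutsky (mS a) (iT a) iL c0 (ST a) hK hKL (F := cos)) c1 => //; [exact: cos_max|exact: cos_lip|].
    by move=> Z; exact: measurable_cos'.
  apply: (slutsky (mS a) (iT a) iL c0 (ST a) hK hKL (F := sin)) c2 => //; [exact: sin_max|exact: sin_lip|].
  by move=> Z; exact: measurable_sin'.
move=> i e0 e00; have [K hK] := Xn_bounded (al (delta_mx i 0)).
have [K' hK'] := slutsky_tight (mS (delta_mx i 0)) (iT (delta_mx i 0)) iL c0 (ST (delta_mx i 0)) hK hKL e00.
exists K'; apply: filterS hK' => n; rewrite (_ : (fun w => (_ *m _) 0 0) = (fun w => Xvec n w i 0))//.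
by apply/funext => w; rewrite trmx_delta -rowE mxE.
Qed.

End LinearProcessRatio.

(** * The Wasserstein autoregressive model *)

Lemma Eint_mul_shift {R : realType} {d} {T : measurableType d} (P : probability T R) (X Y : T -> R) (u : R) :
  L2 P X -> L2 P Y -> Eint P X = 0 -> Eint P Y = 0 ->
  Eint P (fun w => (X w + u) * (Y w + u)) - u * u = Eint P (fun w => X w * Y w).
Proof.
move=> lX lY X0 Y0; have iX := L2_intg lX; have iY := L2_intg lY; have iXY := L2M lX lY.
rewrite (_ : (fun w => _) = (fun w => X w * Y w + (u * Y w + (u * X w + u * u)))); last by apply/funext => w; ring.
have i3 : intg P (fun w => u * X w + u * u) by apply: intgD; [exact: intgZ|exact: intg_cst].
rewrite EintD//; last by apply: intgD => //; exact: intgZ.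
rewrite EintD//; last exact: intgZ.
rewrite EintD; [|exact: intgZ|exact: intg_cst].
by rewrite (EintZ u iX) (EintZ u iY) X0 Y0 Eint_cst !mulr0 !add0r addrK.
Qed.

Section WassersteinModel.
Context {R : realType} {d : measure_display} {Om : measurableType d} (P : probability Om R)
  (f0 : R -> R) (p : nat) (beta psi : nat -> R) (eps V f : int -> Om -> R -> R).
Context (hf0 : is_density f0) (iD : is_interval (dens_support f0)).
Context (noroot : forall z : R[i], `|z| <= 1 -> ~~ root (ar_poly p beta) z).
Context (psiP : is_inv_series p beta psi) (iid : iid_proc P eps).
Context (mean0 : forall t u, dens_support f0 u -> (\int[P]_w (eps t w u)%:E = 0)%E).
Context (VS : forall t u, dens_support f0 u ->
     {ae P, forall w, (fun N : nat => \sum_(i < N) psi i * eps (t - i%:Z) w u) @ \oo --> V t w u}).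
Context (VD : forall t, {ae P, forall w, forall u, dens_support f0 u ->
       derivable (V t w) u 1 /\ -1 < derive1 (V t w) u}).
Context (M4 : (weighted_moment P f0 (eps 0%R) 4 < +oo)%E).
Context (hf : forall t, {ae P, forall w, exp_density f0 (V t w) (f t w)}).
Local Notation RR := (measurableTypeR R).
Local Notation leb := (@lebesgue_measure R).
Local Notation D := (dens_support f0).
Local Notation Q0 := (quantile_of f0).
Local Notation mu := (dprob hf0).
Local Notation smp := (sample eps).
Local Notation u0 := (Q0 (1 / 2)).
Local Notation e := (ecan u0).
Local Notation v := (vcan u0 psi).
Local Notation Pm := (P \x mu)%E.
Local Notation g := (gam P eps mu e).
Local Notation k1 := (kap1 P eps mu e).
Local Notation k2 := (kap2 P eps mu e).
Local Notation RZ := (RZ psi).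
Local Notation Lam := (Lam eps mu v).

(** The rounding grid is based at the median of [f0]: its base has to lie in the support. *)
Lemma support_base : D u0.
Proof. by apply: support_quantile => //; apply/andP; split; lra. Qed.
Local Notation D0 := support_base.

Lemma derivable_V t : {ae P, forall w, forall u, D u -> derivable (V t w) u 1}.
Proof. by apply: aeS (VD t) => w h u /h []. Qed.
Local Notation good := (canonical_good iD D0 psiP VS derivable_V).

Lemma dprob_support : {ae mu, forall u, D u}.
Proof. by apply: aeS (dprob_quantile_ae hf0) => u [h <-]; exact: support_quantile. Qed.

Lemma ecan_measurable (S : set int) t : S t -> measurable_fun setT (fun z : XS S * RR => e z.1 t z.2).
Proof. exact: measurable_ecan. Qed.

Lemma ecan_shift k x t u : e (shiftp k x) t u = e x (t + k) u.
Proof. by []. Qed.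

(** Assumption (A4) integrates moments taken at fixed points; Tonelli reduces the joint fourth
    moment to such sections, where the version equals [eps] almost surely. *)
Lemma ecan_sqr_L2 : L2 Pm (fun z => ep eps e 0 z ^+ 2).
Proof.
have mep : measurable_fun setT (ep eps e 0) by exact: (measurable_ep iid ecan_measurable).
split; first exact: measurable_funX.
have me4 : measurable_fun setT (fun z => (((ep eps e 0 z ^+ 2) ^+ 2)%:E)).
  by apply/measurable_EFinP; apply: measurable_funX; exact: measurable_funX.
apply/integrableP; split; first exact: me4.
have -> : (\int[Pm]_x `|((ep eps e 0 x ^+ 2) ^+ 2)%:E| = \int[Pm]_x ((ep eps e 0 x ^+ 2) ^+ 2)%:E)%E.
  by apply: eq_integral => z _; rewrite gee0_abs// lee_fin sqr_ge0.
rewrite (fubini_tonelli2 (fun z => ((ep eps e 0 z ^+ 2) ^+ 2)%:E)) => [|//|z]; last by rewrite lee_fin sqr_ge0.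
rewrite dprob_integral; last first.
  by apply: measurable_fun_fubini_tonelli_G => // z; rewrite lee_fin sqr_ge0.
apply: le_lt_trans M4; rewrite le_eqVlt; apply/orP; left; apply/eqP.
apply: (@eq_integral _ RR R leb setT) => u _.
have [Du|nD] := pselect (D u); last by rewrite (density_off_support hf0 nD) !mule0.
congr (_ * _)%E; rewrite /fubini_G; apply: eq_integral_negligible.
apply: negligibleS (ecan_eps iD D0 psiP VS derivable_V 0 Du) => w /= h h2; apply: h.
by rewrite /ep/= h2 -exprM.
Qed.

Lemma ecan_mean0 : {ae mu, forall u, Eint P (fun w => e (smp w) 0 u) = 0}.
Proof.
apply: aeS dprob_support => u Du.
rewrite (eq_Eint_ae (ecan_eps iD D0 psiP VS derivable_V 0 Du)).
by rewrite /Eint/Rintegral mean0.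
Qed.

Lemma psi_summable : exists M : R, forall N, \sum_(n < N) `|psi n| <= M.
Proof. exact: inv_series_summable noroot psiP. Qed.

Lemma vcan_measurable t : measurable_fun setT (fun z : XS setT * RR => v z.1 t z.2).
Proof. exact: measurable_vcan. Qed.

Lemma vcan_series_ae t : {ae mu, forall u, {ae P, forall w,
   (fun N : nat => \sum_(i < N) psi i * e (smp w) (t - i%:Z) u) @ \oo --> v (smp w) t u}}.
Proof. by apply: aeS dprob_support => u Du; exact: (vcan_series iD D0 psiP VS derivable_V t Du). Qed.

Definition good_path (w : Om) : Prop := forall t,
  exp_density f0 (V t w) (f t w) /\
  (forall u, D u -> derivable (V t w) u 1 /\ -1 < derive1 (V t w) u) /\
  (forall u, D u -> v (smp w) t u = V t w u).

Lemma good_path_ae : {ae P, forall w, good_path w}.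
Proof.
have h1 : {ae P, forall w, forall t, exp_density f0 (V t w) (f t w)} by exact: ae_countable.
have h2 : {ae P, forall w, forall t u, D u -> derivable (V t w) u 1 /\ -1 < derive1 (V t w) u}.
  by apply: (ae_countable (Q := fun w t => forall u, _)).
apply: aeS3 h1 h2 good => w a1 a2 a3 t; split; [exact: a1|split; first exact: a2].
by move=> u Du; exact: (a3 t u Du).1.
Qed.

Lemma good_quantile w t s : good_path w -> 0 < s < 1 -> quantile_of (f t w) s = v (smp w) t (Q0 s) + Q0 s.
Proof.
move=> /(_ t) [a1 [a2 a3]] hs.
rewrite (transport_quantile hf0 iD a2 a1 hs) a3//; exact: support_quantile.
Qed.

Lemma autocov_Lam w n i : good_path w -> (0 < n)%N ->
  LInt (fun u => etahat f n w i u * fhat f n w u) = Lam i n w.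
Proof.
move=> gw n0; rewrite autocov_uniform//; last by move=> t; have [[]] := gw t.
have mL : measurable_fun [set: RR] (fun u => LamF eps v i n (w, u)).
  exact: (measurable_section1 w (intgmf (LamF_intg iid ecan_measurable ecan_shift ecan_sqr_L2 ecan_mean0 psi_summable vcan_measurable vcan_series_ae i n))).
apply: etrans (esym (dprob_Eint_quantile hf0 mL)).
apply: eq_Eint_ae; apply: aeS (@unif01_ae R) => s hs.
have nz : (n%:R : R) != 0 by rewrite pnatr_eq0 -lt0n.
have qv t := good_quantile t gw hs.
have -> : Qbar f n w s = vbar v n (smp w) (Q0 s) + Q0 s.
  rewrite /Qbar /vbar; under eq_bigr => t _ do rewrite qv.
  by rewrite big_split/= sumr_const_nat subn1/= -[Q0 s *+ n]mulr_natl mulrDr mulKf.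
rewrite /LamF; congr (_ * _); apply: eq_bigr => t _; rewrite !qv; congr (_ * _); rewrite /vv/=; ring.
Qed.

(** At almost every [u] one has [Q0 (F0 u) = u], so [T_t u] is almost surely [v + u] with [v]
    centred; the added constant drops out of the covariance. *)
Lemma etaC_Eint (i : nat) : {ae mu, forall u, etaC P f0 f i u = Eint P (fun w => v (smp w) 0 u * v (smp w) i%:Z u)}.
Proof.
have hE t := vv_section_mean iid ecan_measurable ecan_shift ecan_sqr_L2 ecan_mean0 psi_summable vcan_measurable vcan_series_ae t.
have hL t := L2_section2 (vv_L2 iid ecan_measurable ecan_shift ecan_sqr_L2 ecan_mean0 psi_summable vcan_measurable vcan_series_ae t).
have h1 : {ae mu, forall u, forall t : int, Eint P (fun w => v (smp w) t u) = 0 /\ L2 P (fun w => v (smp w) t u)}.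
  by apply: ae_countable => t; apply: aeS2 (hE t) (hL t) => u a b; split.
apply: aeS2 h1 (dprob_quantile_ae hf0) => u hu [hs qF].
have T t : {ae P, forall w, Tmap f0 (f t w) u = v (smp w) t u + u}.
  by apply: aeS good_path_ae => w gw; rewrite /Tmap (good_quantile t gw hs) qF.
have cu := intg_cst P u.
have E1 t : Eint P (fun w => Tmap f0 (f t w) u) = u.
  by rewrite (eq_Eint_ae (T t)) EintD// ?(hu t).1 ?Eint_cst ?add0r//; exact: L2_intg (hu t).2.
transitivity (Eint P (fun w => Tmap f0 (f 0 w) u * Tmap f0 (f i%:Z w) u) -
  Eint P (fun w => Tmap f0 (f 0 w) u) * Eint P (fun w => Tmap f0 (f i%:Z w) u)); first by [].
rewrite !E1; apply: etrans (Eint_mul_shift u (hu 0).2 (hu i%:Z).2 (hu 0).1 (hu i%:Z).1).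
congr (_ - _); apply: eq_Eint_ae; apply: aeS2 (T 0) (T i%:Z) => w hT hT'.
by rewrite hT hT'.
Qed.

Lemma LInt_etaC (i : nat) : LInt (fun u => etaC P f0 f i u * f0 u) = g * RZ i%:Z.
Proof.
have iv := vv_prod_intg iid ecan_measurable ecan_shift ecan_sqr_L2 ecan_mean0 psi_summable vcan_measurable vcan_series_ae 0 i%:Z.
have [j1 j2] := Eint_fubini2 iv; have [j3 j4] := Eint_fubini1 iv.
rewrite (LInt_density_ae (etaC_Eint i)); last exact: (intgmf j1).
by rewrite -(EW iid ecan_measurable ecan_shift ecan_sqr_L2 ecan_mean0 psi_summable vcan_measurable vcan_series_ae i) -[RHS]/(Eint P (fun w => Eint mu (fun u => vv eps v 0 (w, u) * vv eps v i%:Z (w, u)))) j4 -j2.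
Qed.

Lemma Cov2_Ceps u u' : D u -> D u' -> Ceps P (eps 0) u u' = Cov2 P eps e (u, u').
Proof.
move=> Du Du'; rewrite /Ceps /Cov /Ex !mean0//= mulr0 subr0; apply: eq_Eint_ae.
by apply: aeS2 (ecan_eps iD D0 psiP VS derivable_V 0 Du) (ecan_eps iD D0 psiP VS derivable_V 0 Du') => w /= -> ->.
Qed.

Lemma K1_kap1 : K1 P f0 (eps 0) = k1.
Proof.
rewrite /kap1 -(dprob_prod_Eint hf0); last exact: (intgmf (Cov2_sqr_intg iid ecan_measurable ecan_shift ecan_sqr_L2)).
rewrite /K1; congr fine; apply: eq_integral => z _; congr EFin.
have [Du|nD] := pselect (D z.1); last by rewrite (density_off_support hf0 nD) !(mulr0, mul0r).
have [Du'|nD] := pselect (D z.2); last by rewrite (density_off_support hf0 nD) !(mulr0, mul0r).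
by rewrite Cov2_Ceps//; case: z {Du Du'}.
Qed.

Lemma K2_kap2 : K2 P f0 (eps 0) = k2.
Proof.
have [ig _] := gam_Cov2 iid ecan_measurable ecan_shift ecan_sqr_L2.
rewrite /kap2 -(dprob_prod_Eint hf0); last first.
  apply: intgmf; apply: intgB; last exact: (intg_prodM ig ig).1.
  by apply: intgB; [exact: (Mom4_intg iid ecan_measurable ecan_shift ecan_sqr_L2)|apply: intgZ; exact: (Cov2_sqr_intg iid ecan_measurable ecan_shift ecan_sqr_L2)].
rewrite /K2; congr fine; apply: eq_integral => z _; congr EFin.
have [Du|nD] := pselect (D z.1); last by rewrite (density_off_support hf0 nD) !(mulr0, mul0r).
have [Du'|nD] := pselect (D z.2); last by rewrite (density_off_support hf0 nD) !(mulr0, mul0r).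
have M : Ex P (fun w => (eps 0 w z.1) ^+ 2 * (eps 0 w z.2) ^+ 2) = Mom4 P eps e z; last first.
  by rewrite M !Cov2_Ceps//; case: z {Du Du' M}.
apply: eq_Eint_ae.
by apply: aeS2 (ecan_eps iD D0 psiP VS derivable_V 0 Du) (ecan_eps iD D0 psiP VS derivable_V 0 Du') => w /= -> ->.
Qed.

Lemma psi0 : psi 0%N = 1.
Proof. by have := psiP 0; rewrite big_ord1 /ar_coef eqxx mul1r. Qed.

Lemma RZ0_gt0 : 0 < RZ 0.
Proof.
have l1 := zcorr_term 0 (zl1_psiZ psi_summable) (zl1_psiZ psi_summable).
apply: (@lt_le_trans _ _ (zpart 0 (fun k => psiZ psi k * psiZ psi (k + 0)))).
  by rewrite /zpart big_ord1/= psi0 mulr1.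
by apply: zpart_le_zsum => // k; rewrite addr0 -expr2 sqr_ge0.
Qed.

Context (h : nat).

Lemma rhohat_clt : conv_dist_gauss P
    (fun (n : nat) (w : Om) =>
       \col_(i < h) (Num.sqrt n%:R * (rhohat f n w i.+1 - rho P f0 f i.+1)))
    (let c := LInt (fun u => etaC P f0 f 0 u * f0 u) in
     let Dm := Dmat h (rho P f0 f) c in
     let Vm := Vmat psi h (K1 P f0 (eps 0)) (K2 P f0 (eps 0)) in
     Dm *m Vm *m Dm^T).
Proof.
rewrite /= K1_kap1 K2_kap2 LInt_etaC.
have rhoE : rho P f0 f = fun i => (g * RZ i%:Z) / (g * RZ 0%N%:Z).
  by apply/funext => i; congr (_ / _); exact: LInt_etaC.
have E n : {ae P, forall w, \col_(i < h) (Num.sqrt n%:R * (rhohat f n w i.+1 - rho P f0 f i.+1)) =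
    Xvec P eps mu e psi v h n w}.
  (* For [n = 0] the factor [sqrt 0] makes both vectors zero; the passage to [Lam] needs a positive
     sample size. *)
  case: n => [|n]; first by apply: aeW => w; apply/matrixP => i j; rewrite !mxE sqrtr0 !mul0r.
  apply: aeS good_path_ae => w gw; apply/matrixP => i j; rewrite !mxE rhoE /rhohat.
  by rewrite !autocov_Lam.
rewrite rhoE in E *.
have g0 := gam_ge0 iid ecan_measurable ecan_shift ecan_sqr_L2 ecan_mean0.
have [gp|gn] := ltP 0 g.
  by apply: (ratio_clt iid ecan_measurable ecan_shift ecan_sqr_L2 ecan_mean0 psi_summable vcan_measurable vcan_series_ae _ E); exact: mulr_gt0 gp RZ0_gt0.
(* All entries of the matrix [D] are divided by [c = 0] and hence vanish, so the limit to reach is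
   the point mass at 0. *)
have gE : g = 0 by apply/eqP; rewrite eq_le gn g0.
apply: degenerate_clt.
  by apply/matrixP => i j; rewrite !mxE gE !mul0r invr0 mulr0.
case=> [|n].
  by apply: aeW => w; apply/matrixP => i j; rewrite !mxE sqrtr0 !mul0r.
have h1 : {ae P, forall w, forall j : nat, Lam j n.+1 w = 0}.
  by apply: ae_countable => j; exact: (Lam_degenerate iid ecan_measurable ecan_shift ecan_sqr_L2 ecan_mean0 psi_summable vcan_measurable vcan_series_ae).
apply: aeS2 (E n.+1) h1 => w -> L0; apply/matrixP => i j; rewrite !mxE !L0 gE !mul0r.
by rewrite subr0 mulr0.
Qed.

End WassersteinModel.

Theorem theorem5 (R : realType) (d : measure_display) (Omega : measurableType d)
  (P : probability Omega R)
  (f0 : R -> R) (p : nat) (beta : nat -> R) (psi : nat -> R)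
  (eps : int -> Omega -> R -> R) (V : int -> Omega -> R -> R)
  (f : int -> Omega -> R -> R) (h : nat) :
  (* f_oplus: density with finite second moment, support D_oplus an interval *)
  is_density f0 -> finite_second_moment f0 -> is_interval (dens_support f0) ->
  (* (A1') *)
  (forall z : R[i], `|z| <= 1 -> ~~ root (ar_poly p beta) z) ->
  is_inv_series p beta psi ->
  (* eps_t i.i.d. elements of the tangent space *)
  iid_proc P eps ->
  (forall t, {ae P, forall w, in_tangent f0 (eps t w)}) ->
  (* (A2) *)
  (forall t u, dens_support f0 u -> (\int[P]_w (eps t w u)%:E = 0)%E) ->
  (weighted_moment P f0 (eps 0%R) 2 < +oo)%E ->
  (* V_t = sum_{i >= 0} psi_i eps_{t-i} *)
  (forall t u, dens_support f0 u ->
     {ae P, forall w, (fun N : nat => \sum_(i < N) psi i * eps (t - i%:Z) w u)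
                        @ \oo --> V t w u}) ->
  (* (A3) *)
  (forall t, {ae P, forall w, forall u, dens_support f0 u ->
       derivable (V t w) u 1 /\ -1 < derive1 (V t w) u}) ->
  (* (A4) *)
  (weighted_moment P f0 (eps 0%R) 4 < +oo)%E ->
  (* f_t is the density of Exp_{f_oplus}(V_t) *)
  (forall t, {ae P, forall w, exp_density f0 (V t w) (f t w)}) ->
  (0 < h)%N ->
  conv_dist_gauss P
    (fun (n : nat) (w : Omega) =>
       \col_(i < h) (Num.sqrt n%:R * (rhohat f n w i.+1 - rho P f0 f i.+1)))
    (let c := LInt (fun u => etaC P f0 f 0 u * f0 u) in
     let Dm := Dmat h (rho P f0 f) c in
     let Vm := Vmat psi h (K1 P f0 (eps 0)) (K2 P f0 (eps 0)) in
     Dm *m Vm *m Dm^T).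
Proof.
move=> hf0 _ iD noroot psiP iid _ mean0 _ VS VD M4 hf _.
exact: (rhohat_clt hf0 iD noroot psiP iid mean0 VS VD M4 hf h).
Qed.
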